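(* Let $T\in\mathcal{T}_{>0}$, and let $g\in G$ be such that $T=g\cdot T_0$, $g\cdot B_+\in\mathcal{B}_{>0}$, $g\cdot B_-\in\mathcal{B}_{<0}$, and $g=g_1g_2$ with $g_1\in U_-^{>0}$ and $g_2\in U_+^{<0}$. For $p>0$ set $(T_0)_{>0}^{(p)}=\{t\in (T_0)_{>0}\mid \alpha_i(t)>p \text{ for all } i\in I\}$. Then: (i) $T\cap G_{>0}\subseteq g\cdot (T_0)_{>0}^{(1)}$; (ii) there exists $p>0$ such that $g\cdot (T_0)_{>0}^{(p)}\subseteq T\cap G_{>0}$.
   Context: $G$ is a semisimple, simply connected algebraic group split over $\mathbb{R}$, identified with its complex points. Fix a pinning: an $\mathbb{R}$-split maximal torus $T_0$, Borel subgroups $B_+,B_-$ with $B_+\cap B_-=T_0$, unipotent radicals $U_+,U_-$, simple roots $\alpha_i$ ($i\in I$), and homomorphisms $\phi_i:\mathrm{SL}_2(\mathbb{C})\to G$ such that $x_i(t)=\phi_i\left(\begin{smallmatrix}1&t\\0&1\end{smallmatrix}\right)$ and $y_i(t)=\phi_i\left(\begin{smallmatrix}1&0\\t&1\end{smallmatrix}\right)$ parametrize the root subgroups of $\alpha_i$ and $-\alpha_i$; let $\alpha_i^\vee(t)=\phi_i(\mathrm{diag}(t,t^{-1}))$. Write $g\cdot S=gSg^{-1}$. Let $U_+^{>0}=\{x_{i_1}(t_1)\cdots x_{i_l}(t_l)\mid t_j>0\}$ for a reduced expression $w_0=s_{i_1}\cdots s_{i_l}$ of the longest Weyl group element, and $U_-^{>0}$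 similarly with $y_i$; let $(T_0)_{>0}$ be the monoid generated by $\alpha_i^\vee(t)$, $t>0$; $G_{>0}=U_-^{>0}(T_0)_{>0}U_+^{>0}$. Set $U_\pm^{<0}=(U_\pm^{>0})^{-1}$. $\mathcal{B}_{>0}=\{u\cdot B_+\mid u\in U_-^{>0}\}$ and $\mathcal{B}_{<0}=\{u\cdot B_+\mid u\in U_-^{<0}\}$ (sets of Borel subgroups). $\mathcal{T}_{>0}=\{B\cap B'\mid B\in\mathcal{B}_{>0},B'\in\mathcal{B}_{<0}\}$, each such intersection being a maximal torus of $G$. *)

(* Defs.v *)
From mathcomp Require Import all_boot all_order all_algebra.
From mathcomp Require Import classical_sets reals complex mpoly.

Set Implicit Arguments.
Unset Strict Implicit.
Unset Printing Implicit Defensive.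

Import Order.TTheory GRing.Theory Num.Theory.
Local Open Scope ring_scope.
Local Open Scope complex_scope.
Local Open Scope classical_set_scope.

(* Linear algebraic groups are represented by their complex points, as Zariski
   closed subgroups of GL_n(C).  "Over k" means that the polynomials involved
   have coefficients in k; only k = setT (that is, C) and k = realpts R are
   used.  The R-structure of a group over R is the one given by the real
   polynomials vanishing on it, and in characteristic 0 a closed set is defined
   over R as soon as it is the zero set of real polynomials. *)

Section AlgebraicGroups.
Variable R : realType.
Local Notation C := R[i].

Definition realpts : set C := range (fun x : R => x%:C).

Definition GL (n : nat) : set 'M[C]_n := [set A | A \in unitmx].

Definition coeffs_in (k : set C) (m : nat) (p : {mpoly C[m]}) : Prop :=
  forall u : 'X_{1..m}, k p@_u.

Definition mxeval (n : nat) (p : {mpoly C[n * n]}) (A : 'M[C]_n) : C :=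
  p.@[fun j => mxvec A 0 j].

Definition zclosed (k : set C) (n : nat) (S : set 'M[C]_n) : Prop :=
  exists P : set {mpoly C[n * n]}, (forall p, P p -> coeffs_in k p) /\
    S = [set A | GL A /\ forall p, P p -> mxeval p A = 0].

Definition zconnected (n : nat) (S : set 'M[C]_n) : Prop :=
  ~ exists F1 F2 : set 'M[C]_n,
      [/\ zclosed setT F1 /\ zclosed setT F2, S `<=` F1 `|` F2,
          S `&` F1 `&` F2 = set0, S `&` F1 !=set0 & S `&` F2 !=set0].

Definition submonoid (n : nat) (H : set 'M[C]_n) : Prop :=
  H 1%:M /\ forall A B, H A -> H B -> H (A *m B).

Definition subgroup (n : nat) (H : set 'M[C]_n) : Prop :=
  [/\ H `<=` @GL n, submonoid H & forall A, H A -> H (invmx A)].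

Definition alg_group (k : set C) (n : nat) (H : set 'M[C]_n) : Prop :=
  zclosed k H /\ subgroup H.

Definition conjby (n : nat) (g A : 'M[C]_n) : 'M[C]_n := g *m A *m invmx g.

Definition conjset (n : nat) (g : 'M[C]_n) (S : set 'M[C]_n) : set 'M[C]_n :=
  conjby g @` S.

Definition regular (k : set C) (n : nat) (H : set 'M[C]_n) (f : 'M[C]_n -> C) :=
  exists (p : {mpoly C[n * n]}) (N : nat), coeffs_in k p /\
    forall A, H A -> f A = mxeval p A / \det A ^+ N.

(* Functions on H are represented by functions on all matrices; only their
   values on H matter. *)
Definition morphism (k : set C) (n m : nat) (H : set 'M[C]_n)
    (K : set 'M[C]_m) (f : 'M[C]_n -> 'M[C]_m) : Prop :=
  [/\ forall A, H A -> K (f A),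
      forall A B, H A -> H B -> f (A *m B) = f A *m f B
    & forall i j, regular k H (fun A => f A i j)].

Definition isomorphism (k : set C) (n m : nat) (H : set 'M[C]_n)
    (K : set 'M[C]_m) (f : 'M[C]_n -> 'M[C]_m) : Prop :=
  morphism k H K f /\
  exists f' : 'M[C]_m -> 'M[C]_n,
    [/\ morphism k K H f', forall A, H A -> f' (f A) = A
      & forall B, K B -> f (f' B) = B].

Definition commutators (n : nat) (H : set 'M[C]_n) : set 'M[C]_n :=
  [set X | exists A B,
     [/\ H A, H B & X = A *m B *m invmx A *m invmx B]].

Definition derived (n : nat) (H : set 'M[C]_n) : set 'M[C]_n :=
  smallest (@subgroup n) (commutators H).

Definition solvable (n : nat) (H : set 'M[C]_n) : Prop :=
  exists k : nat, iter k (@derived n) H = [set 1%:M].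

Definition normal_in (n : nat) (N G : set 'M[C]_n) : Prop :=
  N `<=` G /\ forall g A, G g -> N A -> N (conjby g A).

Definition semisimple (n : nat) (G : set 'M[C]_n) : Prop :=
  zconnected G /\
  forall N : set 'M[C]_n, alg_group setT N -> zconnected N -> solvable N ->
    normal_in N G -> N = [set 1%:M].

Definition borel_type (n : nat) (G B : set 'M[C]_n) : Prop :=
  [/\ alg_group setT B, zconnected B, solvable B & B `<=` G].

Definition borel (n : nat) (G B : set 'M[C]_n) : Prop :=
  borel_type G B /\ forall B', borel_type G B' -> B `<=` B' -> B' = B.

(* A copy of (C^* )^d in GL_d(C). *)
Definition diag_torus (d : nat) : set 'M[C]_d :=
  [set A | GL A /\ is_diag_mx A].

(* For k = setT, a torus; for k = realpts, an R-split torus. *)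
Definition split_torus (k : set C) (n : nat) (T : set 'M[C]_n) : Prop :=
  alg_group k T /\ exists d f, isomorphism k (@diag_torus d) T f.

Definition maximal_torus (n : nat) (G T : set 'M[C]_n) : Prop :=
  [/\ split_torus setT T, T `<=` G
    & forall T', split_torus setT T' -> T' `<=` G -> T `<=` T' -> T' = T].

Definition character (n : nat) (T : set 'M[C]_n) (a : 'M[C]_n -> C) : Prop :=
  morphism setT T (@GL 1) (fun t => (a t)%:M).

Definition SL2 : set 'M[C]_2 := [set A | \det A = 1].
Definition upper (a : C) : 'M[C]_2 := 1%:M + a *: delta_mx 0 1.
Definition lower (a : C) : 'M[C]_2 := 1%:M + a *: delta_mx 1 0.
Definition diag2 (a : C) : 'M[C]_2 :=
  a *: delta_mx 0 0 + a^-1 *: delta_mx 1 1.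
Definition weyl2 : 'M[C]_2 := delta_mx 0 1 - delta_mx 1 0.

(* x is an isomorphism from the additive group, realized as the group of
   matrices [upper a], onto a closed subgroup of G, on which T acts through a.
   When a is a root, that subgroup is the root subgroup U_a. *)
Definition root_param (n : nat) (G T : set 'M[C]_n) (a : 'M[C]_n -> C)
    (x : C -> 'M[C]_n) : Prop :=
  [/\ alg_group setT (range x), range x `<=` G,
      isomorphism setT (range upper) (range x) (fun A => x (A 0 1))
    & forall t c, T t -> conjby t (x c) = x (a t * c)].

(* Roots of (G, T) whose root subgroup is contained in B. *)
Definition root_in (n : nat) (G T B : set 'M[C]_n) (a : 'M[C]_n -> C) : Prop :=
  [/\ character T a, exists t, T t /\ a t != 1
    & exists x, root_param G T a x /\ range x `<=` B].

(* The a i form a base of the root system of (G, T) whose positive roots are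
   the roots in B.  Characters are written multiplicatively. *)
Definition simple_roots (n : nat) (G T B : set 'M[C]_n) (I : finType)
    (a : I -> 'M[C]_n -> C) : Prop :=
  [/\ forall i, root_in G T B (a i),
      forall m : I -> int,
        (forall t, T t -> \prod_i a i t ^ m i = 1) -> forall i, m i = 0
    & forall b, root_in G T B b -> exists m : I -> nat,
        forall t, T t -> b t = \prod_i a i t ^+ m i].

Record pinning (n : nat) (G : set 'M[C]_n) (I : finType) := Pinning {
  T0 : set 'M[C]_n;
  Bplus : set 'M[C]_n;
  Bminus : set 'M[C]_n;
  alpha : I -> 'M[C]_n -> C;
  phi : I -> 'M[C]_2 -> 'M[C]_n;
  T0_split : split_torus realpts T0;
  T0_max : maximal_torus G T0;
  Bplus_borel : borel G Bplus;
  Bminus_borel : borel G Bminus;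
  Bplus_Bminus : Bplus `&` Bminus = T0;
  alpha_simple : simple_roots G T0 Bplus alpha;
  phi_morphism : forall i, morphism realpts SL2 G (phi i);
  phi_upper : forall i,
    root_param G T0 (alpha i) (fun c => phi i (upper c));
  phi_lower : forall i,
    root_param G T0 (fun t => (alpha i t)^-1) (fun c => phi i (lower c)) }.

Section Pinned.
Variables (n : nat) (G : set 'M[C]_n) (I : finType) (P : pinning G I).

Definition xroot (i : I) (c : C) : 'M[C]_n := phi P i (upper c).
Definition yroot (i : I) (c : C) : 'M[C]_n := phi P i (lower c).
Definition coroot (i : I) (c : C) : 'M[C]_n := phi P i (diag2 c).

(* The cocharacter lattice of T0 is generated by the coroots; dually, every
   weight is a character of T0. *)
Definition simply_connected : Prop :=
  forall f : 'M[C]_1 -> 'M[C]_n, morphism setT (@GL 1) (T0 P) f ->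
    exists m : I -> int, forall c : C, c != 0 ->
      f c%:M = \big[mulmx/1%:M]_i coroot i (c ^ m i).

(* An element of the Weyl group N_G(T0)/T0 is represented by any of its
   representatives; the simple reflection s_i is the class of
   phi_i [[0, 1], [-1, 0]]. *)
Definition weyl_rep (w : seq I) : 'M[C]_n :=
  \big[mulmx/1%:M]_(i <- w) phi P i weyl2.

Definition same_weyl (w w' : seq I) : Prop :=
  T0 P (invmx (weyl_rep w) *m weyl_rep w').

Definition reduced (w : seq I) : Prop :=
  forall w', same_weyl w w' -> (size w <= size w')%N.

Definition reduced_longest (w : seq I) : Prop :=
  reduced w /\ forall w', reduced w' -> (size w' <= size w)%N.

Definition positive_products (x : I -> C -> 'M[C]_n) (w : seq I) :
    set 'M[C]_n :=
  [set u | exists t : seq R,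
     [/\ size t = size w, all (fun s => 0 < s) t
       & u = \big[mulmx/1%:M]_(p <- zip w t) x p.1 (p.2)%:C]].

(* w is the chosen reduced expression of the longest element. *)
Variable w : seq I.

Definition Uplus_pos : set 'M[C]_n := positive_products xroot w.
Definition Uminus_pos : set 'M[C]_n := positive_products yroot w.
Definition Uplus_neg : set 'M[C]_n := (@invmx _ n) @` Uplus_pos.
Definition Uminus_neg : set 'M[C]_n := (@invmx _ n) @` Uminus_pos.

Definition T0_pos : set 'M[C]_n :=
  smallest (@submonoid n)
    [set A | exists (i : I) (t : R), 0 < t /\ A = coroot i t%:C].

Definition G_pos : set 'M[C]_n :=
  [set A | exists u t v,
     [/\ Uminus_pos u, T0_pos t, Uplus_pos v & A = u *m t *m v]].

Definition Borel_pos : set (set 'M[C]_n) :=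
  (fun u => conjset u (Bplus P)) @` Uminus_pos.
Definition Borel_neg : set (set 'M[C]_n) :=
  (fun u => conjset u (Bplus P)) @` Uminus_neg.

Definition Torus_pos : set (set 'M[C]_n) :=
  [set T | exists B B', [/\ Borel_pos B, Borel_neg B' & T = B `&` B']].

(* In the order of R[i], p%:C < z means that z is real and greater than p. *)
Definition T0_pos_gt (p : R) : set 'M[C]_n :=
  [set t | T0_pos t /\ forall i, p%:C < alpha P i t].

End Pinned.
End AlgebraicGroups.

(* Main.v *)
(* Let X_w denote the set of products x_{i_1}(a_1) ... x_{i_l}(a_l), a_k > 0, along
   the word w, and write g2^{-1} = h in X_w.

   (i) If g t g^{-1} = u t' v with u, v positive, then v can be moved past g1, since
   x_i(a) y_i(b) is a product y_i(b') alpha_i^vee(1 + a b) x_i(a') with positive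
   parameters, and uniqueness of the factorization in U_- T_0 U_+ gives that t is in
   (T_0)_{>0} and h = (t^{-1} h t) x with x in X_w.  Comparing the images in the
   abelianization of U_+ gives h_i = h_i / alpha_i(t) + x_i, hence alpha_i(t) > 1.

   (ii) Let g.B_- = u0.B_+ with u0 in U_-^{<0}.  The Bruhat decomposition
   u0 = v^{-1} t w_r m, with w_r the reversed word, and v g1 = g1' t' z (z in U_+ is
   positive along w_r) give z = h: both T_0 and its conjugate by z h^{-1} are
   contained in w_r B_+ w_r^{-1}.  So v g1 = g1' t' h, and h is positive along both w and
   w_r; this implies that the element v of X_{w_r} is also in X_w.  Thus
     g t g^{-1} = g1 (t t'^{-1}) ((t t'^{-1})^{-1} h^{-1} (t t'^{-1})) g1'^{-1} v,
   where the third factor is close to 1 when the alpha_i(t) are large.  Moving it to the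
   right of g1'^{-1} leaves g1 (y close to 1) (element of (T_0)_{>0}) (x close to 1) v,
   and X_w is stable under multiplication by elements of U_+(R) close to 1.

   Both the last claim and the passage from w_r to w replace the braid relations by
   analysis: the logarithmic derivatives of the product map of a longest word span
   Lie(U_+) at positive parameters, so that paths in U_+ lift to parameters as long as the
   latter stay in a compact set, and parameters cannot tend to 0 because the limit would
   lie in a smaller Bruhat cell. *)
Require Import Defs.
From HB Require Import structures.
From mathcomp Require Import all_boot all_order all_algebra.
From mathcomp Require Import ring lra zify.
From mathcomp Require Import boolp classical_sets reals complex mpoly.

Set Implicit Arguments.
Unset Strict Implicit.
Unset Printing Implicit Defensive.

Import Order.TTheory GRing.Theory Num.Theory.
Local Open Scope ring_scope.
Local Open Scope classical_set_scope.

(** * Polynomial functions and curves of matrices *)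

(** The hypotheses provide no root system, Lie algebra or theory of Weyl groups: only T_0, Borel
    subgroups defined by maximality, and the maps phi_i. What is needed of this theory is recovered
    from limits of m(c) A m(c)^-1 as c tends to 0, for cocharacters m of T_0. These limits are
    algebraic: the curve is a Laurent polynomial in c, the limit exists when no negative power
    occurs, and an element with limits along both m and m^-1 is fixed by m.

    Two facts require global arguments on Borel subgroups: elements of B_+ have limits along
    dominant cocharacters, which uses Lie-Kolchin, and e_i commutes with f_j for i different from j,
    which uses the maximality of B_+. The rest depends only on the record [pdata], whose shape is
    invariant under the exchange of the two signs, so that every statement about U_+ yields one
    about U_-. Cocharacters dual to the simple roots are available only up to a multiple q, which is
    harmless for limits. The length of a word is the dimension of an intersection of Lie algebras,
    which replaces the counting of roots. *)

Section PolynomialCurves.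
Variable R : realType.
Local Notation C := R[i].

(** Positive integers are the convenient test points: integer powers of a group element stay in the
    group, and polynomial identities then extend them to complex exponents. *)
Lemma poly_nat0 (p : {poly C}) : (forall k : nat, p.[k.+1%:R] = 0) -> p = 0.
Proof.
move=> p0; apply/eqP/negPn/negP => pn0.
have := max_poly_roots pn0 (rs := [seq (k.+1%:R : C) | k <- iota 0 (size p)]).
rewrite size_map size_iota ltnn => H; suff: false by []; apply: H.
  by apply/allP => _ /mapP [k _ ->]; rewrite /root p0.
rewrite map_inj_uniq ?iota_uniq // => a b /eqP.
by rewrite eqr_nat => /eqP [].
Qed.

Lemma poly_neq0_eq0 (p : {poly C}) :
  (forall c, c != 0 -> p.[c] = 0) -> p = 0.
Proof. by move=> p0; apply: poly_nat0 => k; apply: p0; rewrite pnatr_eq0. Qed.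

Lemma poly_neq0_inj (p q : {poly C}) :
  (forall c, c != 0 -> p.[c] = q.[c]) -> p = q.
Proof.
move=> pq; apply/eqP; rewrite -subr_eq0; apply/eqP/poly_neq0_eq0 => c c0.
by rewrite hornerD hornerN pq // subrr.
Qed.

Definition ev m n (Q : 'M[{poly C}]_(m, n)) (c : C) : 'M[C]_(m, n) :=
  map_mx (horner_eval c) Q.

Definition cf m n (k : nat) (Q : 'M[{poly C}]_(m, n)) : 'M[C]_(m, n) :=
  map_mx (coefp k) Q.

Definition cst m n (A : 'M[C]_(m, n)) : 'M[{poly C}]_(m, n) := map_mx polyC A.

Lemma evE m n (Q : 'M[{poly C}]_(m, n)) c i j : ev Q c i j = (Q i j).[c].
Proof. by rewrite mxE. Qed.

Lemma cfE m n (Q : 'M[{poly C}]_(m, n)) k i j : cf k Q i j = (Q i j)`_k.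
Proof. by rewrite mxE. Qed.

Lemma ev_cst m n (A : 'M[C]_(m, n)) c : ev (cst A) c = A.
Proof. by apply/matrixP => i j; rewrite evE mxE hornerC. Qed.

Lemma evM m n p (P : 'M[{poly C}]_(m, n)) (Q : 'M_(n, p)) c :
  ev (P *m Q) c = ev P c *m ev Q c.
Proof. exact: map_mxM. Qed.

Lemma evD m n (P Q : 'M[{poly C}]_(m, n)) c : ev (P + Q) c = ev P c + ev Q c.
Proof. exact: map_mxD. Qed.

Lemma evN m n (P : 'M[{poly C}]_(m, n)) c : ev (- P) c = - ev P c.
Proof. exact: map_mxN. Qed.

Lemma evB m n (P Q : 'M[{poly C}]_(m, n)) c : ev (P - Q) c = ev P c - ev Q c.
Proof. exact: map_mxB. Qed.

Lemma evZ m n p (P : 'M[{poly C}]_(m, n)) c : ev (p *: P) c = p.[c] *: ev P c.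
Proof. exact: map_mxZ. Qed.

Lemma ev_sum m n I (r : seq I) (P : pred I) (Q : I -> 'M[{poly C}]_(m, n)) c :
  ev (\sum_(i <- r | P i) Q i) c = \sum_(i <- r | P i) ev (Q i) c.
Proof. exact: (raddf_sum (map_mx (horner_eval c))). Qed.

Lemma ev1 n c : ev (1%:M : 'M_n) c = 1%:M.
Proof. exact: map_mx1. Qed.

Lemma ev_inj m n (P Q : 'M[{poly C}]_(m, n)) :
  (forall c, c != 0 -> ev P c = ev Q c) -> P = Q.
Proof.
move=> PQ; apply/matrixP => i j; apply: poly_neq0_inj => c c0.
by rewrite -!evE PQ.
Qed.

Definition deg m n (Q : 'M[{poly C}]_(m, n)) : nat :=
  \max_i \max_j size (Q i j).

Lemma size_deg m n (Q : 'M[{poly C}]_(m, n)) i j : (size (Q i j) <= deg Q)%N.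
Proof.
apply: leq_trans (leq_bigmax (i : 'I_m)).
exact: (leq_bigmax (F := fun j => size (Q i j))).
Qed.

Lemma ev_coef m n (Q : 'M[{poly C}]_(m, n)) (N : nat) c : (deg Q <= N)%N ->
  ev Q c = \sum_(k < N) c ^+ k *: cf k Q.
Proof.
move=> QN; apply/matrixP => i j; rewrite evE summxE.
rewrite (horner_coef_wide c (leq_trans (size_deg Q i j) QN)).
by apply: eq_bigr => k _; rewrite !mxE mulrC.
Qed.

Lemma cf_deg m n (Q : 'M[{poly C}]_(m, n)) k : (deg Q <= k)%N -> cf k Q = 0.
Proof.
move=> Qk; apply/matrixP => i j; rewrite !mxE /=.
by apply: nth_default; apply: leq_trans (size_deg Q i j) Qk.
Qed.

Lemma ev0 m n (Q : 'M[{poly C}]_(m, n)) : ev Q 0 = cf 0 Q.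
Proof. by apply/matrixP => i j; rewrite !mxE /= /horner_eval horner_coef0. Qed.

Definition mkpm m n (N : nat) (F : nat -> 'M[C]_(m, n)) : 'M[{poly C}]_(m, n) :=
  \matrix_(i, j) \poly_(k < N) F k i j.

Lemma cf_mkpm m n N (F : nat -> 'M[C]_(m, n)) k :
  cf k (mkpm N F) = if (k < N)%N then F k else 0.
Proof.
by apply/matrixP => i j; rewrite !mxE /= coef_poly; case: ifP; rewrite ?mxE.
Qed.

Lemma ev_mkpm m n N (F : nat -> 'M[C]_(m, n)) c :
  ev (mkpm N F) c = \sum_(k < N) c ^+ k *: F k.
Proof.
apply/matrixP => i j; rewrite !mxE summxE /= /horner_eval horner_poly.
by apply: eq_bigr => k _; rewrite mxE mulrC.
Qed.

(** The linear map X - [projv V X] has kernel V. Applied to the coefficients of Q it gives a curve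
    that vanishes for all c <> 0, so all its coefficients vanish. *)
Lemma ev_vs m n (V : {vspace 'M[C]_(m, n)}) (Q : 'M[{poly C}]_(m, n)) k :
  (forall c, c != 0 -> ev Q c \in V) -> cf k Q \in V.
Proof.
move=> QV; set L : 'M[C]_(m, n) -> 'M[C]_(m, n) := fun X => X - projv V X.
have LV X : (X \in V) = (L X == 0).
  rewrite subr_eq0; apply/idP/eqP => [XV|->]; last exact: memv_proj.
  by rewrite projv_id.
pose N := (deg Q + k.+1)%N.
suff E : mkpm N (fun k => L (cf k Q)) = 0.
  rewrite LV; apply/eqP; move: (congr1 (cf k) E); rewrite cf_mkpm.
  rewrite /N ltn_addl // => ->; apply/matrixP => i j.
  by rewrite !mxE /= coef0.
apply: ev_inj => c c0; rewrite ev_mkpm.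
have -> : ev 0 c = 0 :> 'M[C]_(m, n) by apply/matrixP => i j; rewrite !mxE /= /horner_eval horner0.
have := QV c c0; rewrite LV /L (@ev_coef _ _ _ N) ?leq_addr // => /eqP {2}<-.
rewrite linear_sum -sumrB; apply: eq_bigr => a _.
by rewrite linearZ /= -scalerBr.
Qed.

Lemma ev_vs0 m n (V : {vspace 'M[C]_(m, n)}) (Q : 'M[{poly C}]_(m, n)) :
  (forall c, c != 0 -> ev Q c \in V) -> ev Q 0 \in V.
Proof. by move=> QV; rewrite ev0; apply: ev_vs. Qed.

End PolynomialCurves.

Section PolynomialFunctions.
Variable R : realType.
Local Notation C := R[i].
Variable n : nat.
Implicit Types (A : 'M[C]_n) (F : 'M[C]_n -> C).

Definition polyfun F := exists p : {mpoly C[n * n]}, forall A, F A = mxeval p A.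

Lemma polyfun_eq F F' : (forall A, F A = F' A) -> polyfun F -> polyfun F'.
Proof. by move=> FF' [p Fp]; exists p => A; rewrite -FF'. Qed.

Lemma polyfun_cst c : polyfun (fun=> c).
Proof. by exists c%:MP => A; rewrite /mxeval mevalC. Qed.

Lemma polyfunD F F' : polyfun F -> polyfun F' -> polyfun (fun A => F A + F' A).
Proof.
by move=> [p Fp] [q Fq]; exists (p + q) => A; rewrite /mxeval mevalD Fp Fq.
Qed.

Lemma polyfunM F F' : polyfun F -> polyfun F' -> polyfun (fun A => F A * F' A).
Proof.
by move=> [p Fp] [q Fq]; exists (p * q) => A; rewrite /mxeval mevalM Fp Fq.
Qed.

Lemma polyfunN F : polyfun F -> polyfun (fun A => - F A).
Proof.
move=> HF; apply: polyfun_eq (polyfunM (polyfun_cst (-1)) HF) => A.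
by rewrite mulN1r.
Qed.

Lemma polyfunB F F' : polyfun F -> polyfun F' -> polyfun (fun A => F A - F' A).
Proof. by move=> HF HF'; apply: polyfunD => //; apply: polyfunN. Qed.

Lemma polyfun_sum I (r : seq I) (P : pred I) (F : I -> 'M[C]_n -> C) :
  (forall i, P i -> polyfun (F i)) -> polyfun (fun A => \sum_(i <- r | P i) F i A).
Proof.
move=> HF; elim: r => [|i r IH].
  by apply: polyfun_eq (polyfun_cst 0) => A; rewrite big_nil.
apply: (@polyfun_eq (fun A => (if P i then F i A else 0) +
                              \sum_(i <- r | P i) F i A)).
  by move=> A; rewrite big_cons; case: (P i); rewrite ?add0r.
apply: polyfunD => //; case: (boolP (P i)) => Pi; first exact: HF.
exact: polyfun_cst.
Qed.

Lemma polyfun_prod I (r : seq I) (P : pred I) (F : I -> 'M[C]_n -> C) :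
  (forall i, P i -> polyfun (F i)) -> polyfun (fun A => \prod_(i <- r | P i) F i A).
Proof.
move=> HF; elim: r => [|i r IH].
  by apply: polyfun_eq (polyfun_cst 1) => A; rewrite big_nil.
apply: (@polyfun_eq (fun A => (if P i then F i A else 1) *
                              \prod_(i <- r | P i) F i A)).
  by move=> A; rewrite big_cons; case: (P i); rewrite ?mul1r.
apply: polyfunM => //; case: (boolP (P i)) => Pi; first exact: HF.
exact: polyfun_cst.
Qed.

Lemma polyfunX F k : polyfun F -> polyfun (fun A => F A ^+ k).
Proof.
move=> HF; apply: polyfun_eq (@polyfun_prod _ (index_iota 0 k) xpredT (fun=> F) _) => //.
by move=> A; rewrite prodr_const_nat subn0.
Qed.

Lemma polyfun_entry i j : polyfun (fun A => A i j).
Proof. by exists 'X_(mxvec_index i j) => A; rewrite /mxeval mevalXU mxvecE. Qed.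

Lemma polyfun_det : polyfun (fun A => \det A).
Proof.
apply: polyfun_sum => s _; apply: polyfunM; first exact: polyfun_cst.
by apply: polyfun_prod => i _; apply: polyfun_entry.
Qed.

Definition polymap m (F : 'M[C]_n -> 'M[C]_m) :=
  forall i j, polyfun (fun A => F A i j).

Lemma polymap_eq m (F F' : 'M[C]_n -> 'M[C]_m) :
  (forall A, F A = F' A) -> polymap F -> polymap F'.
Proof. by move=> FF' HF i j; apply: polyfun_eq (HF i j) => A; rewrite FF'. Qed.

Lemma polymap_id : polymap id.
Proof. exact: polyfun_entry. Qed.

Lemma polymap_cst m (B : 'M[C]_m) : polymap (fun=> B).
Proof. by move=> i j; apply: polyfun_cst. Qed.

Lemma polymapM m (F F' : 'M[C]_n -> 'M[C]_m) :
  polymap F -> polymap F' -> polymap (fun A => F A *m F' A).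
Proof.
move=> HF HF' i j.
apply: (@polyfun_eq (fun A => \sum_k F A i k * F' A k j)).
  by move=> A; rewrite mxE.
by apply: polyfun_sum => k _; apply: polyfunM.
Qed.

Lemma polymapD m (F F' : 'M[C]_n -> 'M[C]_m) :
  polymap F -> polymap F' -> polymap (fun A => F A + F' A).
Proof.
move=> HF HF' i j; apply: (polyfun_eq _ (polyfunD (HF i j) (HF' i j))) => A.
by rewrite mxE.
Qed.

Lemma polymapZ m (f : 'M[C]_n -> C) (F : 'M[C]_n -> 'M[C]_m) :
  polyfun f -> polymap F -> polymap (fun A => f A *: F A).
Proof.
move=> Hf HF i j; apply: (polyfun_eq _ (polyfunM Hf (HF i j))) => A.
by rewrite mxE.
Qed.

Lemma polymap_sum m I (r : seq I) (P : pred I) (F : I -> 'M[C]_n -> 'M[C]_m) :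
  (forall i, P i -> polymap (F i)) -> polymap (fun A => \sum_(i <- r | P i) F i A).
Proof.
move=> HF i j; apply: (@polyfun_eq (fun A => \sum_(k <- r | P k) F k A i j)).
  by move=> A; rewrite summxE.
by apply: polyfun_sum => k Pk; apply: HF.
Qed.

Lemma polyfun_detmap m (F : 'M[C]_n -> 'M[C]_m) :
  polymap F -> polyfun (fun A => \det (F A)).
Proof.
move=> HF; apply: polyfun_sum => s _; apply: polyfunM; first exact: polyfun_cst.
by apply: polyfun_prod => i _; apply: HF.
Qed.

Lemma polymap_adj : polymap (fun A => \adj A).
Proof.
move=> i j; apply: (@polyfun_eq (fun A => cofactor A j i)).
  by move=> A; rewrite mxE.
apply: polyfunM; first exact: polyfun_cst.
apply: polyfun_detmap => k l.
apply: (@polyfun_eq (fun A => A (lift j k) (lift i l))).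
  by move=> A; rewrite !mxE.
exact: polyfun_entry.
Qed.

Lemma polyfun_comp m (p : {mpoly C[m * m]}) (F : 'M[C]_n -> 'M[C]_m) :
  polymap F -> polyfun (fun A => mxeval p (F A)).
Proof.
move=> HF; apply: (@polyfun_eq (fun A => \sum_(u <- msupp p)
   p@_u * \prod_k mxvec (F A) 0 k ^+ u k)).
  by move=> A; rewrite /mxeval mevalE.
apply: polyfun_sum => u _; apply: polyfunM; first exact: polyfun_cst.
apply: polyfun_prod => k _; apply: polyfunX.
by case/mxvec_indexP: k => i j; apply: polyfun_eq (HF i j) => A; rewrite mxvecE.
Qed.

(** Denominators are cleared by homogenization: each monomial of p is multiplied by the power of d A
    that completes its degree to the maximal degree N. *)
Lemma polyfun_ratio m (p : {mpoly C[m * m]}) (d : 'M[C]_n -> C)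
    (F : 'M[C]_n -> 'M[C]_m) : polyfun d -> polymap F ->
  exists2 f, polyfun f &
    forall A, d A != 0 -> (f A = 0 <-> mxeval p ((d A)^-1 *: F A) = 0).
Proof.
move=> Hd HF; pose N := \max_(u <- msupp p) mdeg u.
exists (fun A => \sum_(u <- msupp p)
   p@_u * (d A ^+ (N - mdeg u) * \prod_k mxvec (F A) 0 k ^+ u k)).
  apply: polyfun_sum => u _; apply: polyfunM; first exact: polyfun_cst.
  apply: polyfunM; first exact: polyfunX.
  apply: polyfun_prod => k _; apply: polyfunX.
  by case/mxvec_indexP: k => i j; apply: polyfun_eq (HF i j) => A; rewrite mxvecE.
move=> A d0.
suff -> : \sum_(u <- msupp p)
   p@_u * (d A ^+ (N - mdeg u) * \prod_k mxvec (F A) 0 k ^+ u k) =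
   d A ^+ N * mxeval p ((d A)^-1 *: F A).
  split=> [/eqP|->]; last by rewrite mulr0.
  by rewrite mulf_eq0 expf_eq0 (negPf d0) andbF /= => /eqP.
rewrite /mxeval mevalE big_distrr /= big_seq [RHS]big_seq; apply: eq_bigr => u pu.
rewrite [RHS]mulrCA; congr (_ * _).
have uN : (mdeg u <= N)%N by rewrite /N (big_rem u) //= leq_maxl.
rewrite [in RHS](eq_bigr (fun k => (d A)^-1 ^+ u k * mxvec (F A) 0 k ^+ u k)); last first.
  by case/mxvec_indexP => i j _; rewrite !mxvecE mxE exprMn.
rewrite big_split /= mulrA; congr (_ * _).
rewrite prodrXr -mdegE -{2}(subnK uN) exprD -mulrA -exprMn divff //.
by rewrite expr1n mulr1.
Qed.

Lemma zclosed_polyfun J (F : J -> 'M[C]_n -> C) :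
  (forall j, polyfun (F j)) ->
  zclosed setT [set A | GL A /\ forall j, F j A = 0].
Proof.
move=> HF; exists [set p | exists j, forall A, F j A = mxeval p A]; split.
  by move=> p _ u.
apply/seteqP; split=> A /= [GA FA]; split=> //.
  by move=> p [j <-].
by move=> j; have [p Hp] := HF j; rewrite Hp; apply: FA; exists j.
Qed.

Lemma zclosed_setT k (S : set 'M[C]_n) : zclosed k S -> zclosed setT S.
Proof. by move=> [P [_ ->]]; exists P; split. Qed.

(** This makes preimages closed under maps that involve an inverse: F is then built with the
    adjugate and d is the determinant. *)
Lemma zclosed_preim m k (S : set 'M[C]_m) (d : 'M[C]_n -> C)
    (F : 'M[C]_n -> 'M[C]_m) : polyfun d -> polymap F -> zclosed k S ->
  (forall A, GL A -> d A != 0) -> (forall A, GL A -> GL ((d A)^-1 *: F A)) ->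
  zclosed setT [set A | GL A /\ S ((d A)^-1 *: F A)].
Proof.
move=> Hd HF [P [_ ->]] d0 GF.
have H (p : {mpoly C[m * m]}) : exists f, polyfun f /\
    forall A, d A != 0 -> (f A = 0 <-> mxeval p ((d A)^-1 *: F A) = 0).
  by have [f] := polyfun_ratio p Hd HF; exists f.
have [f Hf] := choice H.
have := @zclosed_polyfun {p | P p} (fun p => f (sval p)).
have -> : [set A | GL A /\ [set B | GL B /\ forall p, P p -> mxeval p B = 0]
      ((d A)^-1 *: F A)] = [set A | GL A /\ forall p : {p | P p}, f (sval p) A = 0].
  apply/seteqP; split=> A /=.
    by move=> [GA [_ FA]]; split=> // -[p Pp] /=; apply/(proj2 (Hf p)); [exact: d0|exact: FA].
  move=> [GA FA]; split=> //; split=> [|p Pp]; first exact: GF.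
  by apply/(proj2 (Hf p)); [exact: d0|exact: (FA (exist _ p Pp))].
by apply=> p; case: (Hf (sval p)).
Qed.

Lemma mxeval_ev (p : {mpoly C[n * n]}) (Q : 'M[{poly C}]_n) :
  exists q : {poly C}, forall c, mxeval p (ev Q c) = q.[c].
Proof.
exists (\sum_(u <- msupp p) (p@_u)%:P * \prod_k mxvec Q 0 k ^+ u k) => c.
rewrite /mxeval mevalE horner_sum; apply: eq_bigr => u _.
rewrite hornerM hornerC horner_prod; congr (_ * _); apply: eq_bigr => k _.
by rewrite horner_exp; case/mxvec_indexP: k => i j; rewrite !mxvecE evE.
Qed.

(** An equation of S is a polynomial in c along the curve, with infinitely many zeros. The main use
    is at c = 0, where it says that S contains limits. *)
Lemma zclosed_curve k (S : set 'M[C]_n) (Q : 'M[{poly C}]_n) :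
  zclosed k S -> (forall j : nat, S (ev Q j.+1%:R)) ->
  forall c, GL (ev Q c) -> S (ev Q c).
Proof.
move=> [P [_ ->]] SQ c Gc; split=> // p Pp.
have [q Hq] := mxeval_ev p Q; rewrite Hq.
suff -> : q = 0 by rewrite horner0.
by apply: poly_nat0 => j; rewrite -Hq; case: (SQ j) => _; apply.
Qed.

(** The affine line is irreducible: an equation of F1 failing at b and an equation of F2 failing at
    a would give two nonzero polynomials with product zero. *)
Lemma connected_curve (S F1 F2 : set 'M[C]_n) (Q : 'M[{poly C}]_n) :
  zclosed setT F1 -> zclosed setT F2 -> S `<=` F1 `|` F2 ->
  S `&` F1 `&` F2 = set0 -> (forall c, S (ev Q c)) ->
  forall a b, F1 (ev Q a) -> F1 (ev Q b).
Proof.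
move=> [P1 [_ E1]] [P2 [_ E2]] SF dis SQ a b Fa.
have GQ c : GL (ev Q c).
  by case: (SF _ (SQ c)); rewrite ?E1 ?E2; case.
case: (SF _ (SQ b)) => // Fb.
have : ~ F2 (ev Q a).
  move=> F2a; suff: set0 (ev Q a) by [].
  by rewrite -dis; split=> //; split.
case: (EM (F1 (ev Q b))) => // nFb nFa; exfalso.
have [q1 [H1 n1]] : exists q1 : {poly C}, (forall c, F1 (ev Q c) -> q1.[c] = 0) /\ q1 != 0.
  have [p [Pp np]] : exists p, P1 p /\ mxeval p (ev Q b) <> 0.
    apply: contrapT => H; apply: nFb; rewrite E1; split=> // p Pp.
    by apply: contrapT => np; apply: H; exists p.
  have [q Hq] := mxeval_ev p Q; exists q; split.
    by move=> c; rewrite E1 => -[_ /(_ _ Pp)]; rewrite Hq.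
  by apply/eqP => q0; apply: np; rewrite Hq q0 horner0.
have [q2 [H2 n2]] : exists q2 : {poly C}, (forall c, F2 (ev Q c) -> q2.[c] = 0) /\ q2 != 0.
  have [p [Pp np]] : exists p, P2 p /\ mxeval p (ev Q a) <> 0.
    apply: contrapT => H; apply: nFa; rewrite E2; split=> // p Pp.
    by apply: contrapT => np; apply: H; exists p.
  have [q Hq] := mxeval_ev p Q; exists q; split.
    by move=> c; rewrite E2 => -[_ /(_ _ Pp)]; rewrite Hq.
  by apply/eqP => q0; apply: np; rewrite Hq q0 horner0.
have : q1 * q2 = 0.
  apply: poly_nat0 => j; rewrite hornerM; case: (SF _ (SQ j.+1%:R)) => [/H1 ->|/H2 ->].
    by rewrite mul0r.
  by rewrite mulr0.
by move/eqP; rewrite mulf_eq0 (negPf n1) (negPf n2).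
Qed.

End PolynomialFunctions.

(** The exponential series of c N, truncated at K and seen as a polynomial in c. It is the
    exponential as soon as N^K = 0, so one large K serves several nilpotent matrices. *)
HB.lock Definition expq (R : realType) (n : nat) (K : nat) (N : 'M[R[i]]_n) :
    'M[{poly R[i]}]_n :=
  mkpm K (fun k => (k`!%:R)^-1 *: N ^+ k).

Section OneParameterGroups.
Variable R : realType.
Local Notation C := R[i].
Variable n : nat.
Implicit Types (A N : 'M[C]_n) (P Q : 'M[{poly C}]_n).

Lemma ev_inj_nat P Q :
  (forall k : nat, ev P k.+1%:R = ev Q k.+1%:R) -> P = Q.
Proof.
move=> PQ; apply/matrixP => i j; apply/eqP; rewrite -subr_eq0; apply/eqP.
by apply: poly_nat0 => k; rewrite hornerD hornerN -!evE PQ subrr.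
Qed.

Definition shiftq (a : C) Q : 'M[{poly C}]_n :=
  map_mx (fun p => p \Po ('X + a%:P)) Q.

Definition dq Q : 'M[{poly C}]_n := map_mx (@deriv C) Q.

Lemma ev_shiftq a Q c : ev (shiftq a Q) c = ev Q (c + a).
Proof.
by apply/matrixP => i j; rewrite !evE mxE horner_comp hornerD hornerX hornerC.
Qed.

Lemma cf_dq k Q : cf k (dq Q) = k.+1%:R *: cf k.+1 Q.
Proof. by apply/matrixP => i j; rewrite !mxE /= coef_deriv mulr_natl. Qed.

Lemma cfM_cst k Q A : cf k (Q *m cst A) = cf k Q *m A.
Proof.
apply/matrixP => i j; rewrite !mxE /= coef_sum; apply: eq_bigr => l _.
by rewrite !mxE /= coefMC.
Qed.

Lemma cst_cfM k Q A : cf k (cst A *m Q) = A *m cf k Q.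
Proof.
apply/matrixP => i j; rewrite !mxE /= coef_sum; apply: eq_bigr => l _.
by rewrite !mxE /= coefCM.
Qed.

Lemma dqM P Q : dq (P *m Q) = dq P *m Q + P *m dq Q.
Proof.
apply/matrixP => i j; rewrite !mxE /= linear_sum /= -big_split /=.
by apply: eq_bigr => k _; rewrite derivM !mxE.
Qed.

Lemma dq_cst A : dq (cst A) = 0.
Proof. by apply/matrixP => i j; rewrite !mxE derivC. Qed.

Lemma dqB P Q : dq (P - Q) = dq P - dq Q.
Proof. by apply/matrixP => i j; rewrite !mxE derivB. Qed.

Lemma dq_shiftq a Q : dq (shiftq a Q) = shiftq a (dq Q).
Proof.
apply/matrixP => i j; rewrite !mxE deriv_comp derivD derivX derivC addr0 mulr1.
by [].
Qed.

Lemma shiftqM a P Q : shiftq a (P *m Q) = shiftq a P *m shiftq a Q.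
Proof. by apply: ev_inj => c _; rewrite evM !ev_shiftq evM. Qed.

Lemma shiftq_cst a A : shiftq a (cst A) = cst A.
Proof. by apply: ev_inj => c _; rewrite ev_shiftq !ev_cst. Qed.

Lemma cf_inj P Q : (forall k, cf k P = cf k Q) -> P = Q.
Proof.
move=> PQ; apply/matrixP => i j; apply/polyP => k.
by have := congr1 (fun M : 'M_n => M i j) (PQ k); rewrite !cfE.
Qed.

(** Uniqueness for a linear differential equation, read on coefficients: the one of order k + 1 is a
    multiple of the one of order k times N. *)
Lemma dq_eq0 P N : dq P = P *m cst N -> ev P 0 = 0 -> P = 0.
Proof.
move=> dP P0; apply: cf_inj => k.
have -> : cf k (0 : 'M[{poly C}]_n) = 0.
  by apply/matrixP => i j; rewrite !mxE /= coef0.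
elim: k => [|k IH]; first by rewrite -ev0.
have := cf_dq k P; rewrite dP cfM_cst IH mul0mx => /esym/eqP.
by rewrite scaler_eq0 pnatr_eq0 => /orP [//|/eqP].
Qed.

Lemma dq_expq K N : N ^+ K = 0 -> dq (expq K N) = expq K N *m cst N.
Proof.
move=> NK; apply: cf_inj => k; rewrite cf_dq cfM_cst expq.unlock !cf_mkpm.
have facS : k.+1%:R * (k.+1`!%:R)^-1 = (k`!%:R)^-1 :> C.
  by rewrite factS natrM invfM mulrA mulfV ?mul1r // pnatr_eq0.
case: (ltnP k.+1 K) => kK.
  by rewrite (ltnW kK) scalerA facS exprSr -scalemxAl.
rewrite scaler0; case: (ltnP k K) => kK'; last by rewrite mul0mx.
rewrite -scalemxAl; have -> : N ^+ k *m N = N ^+ k.+1 by rewrite exprSr.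
suff -> : N ^+ k.+1 = 0 by rewrite scaler0.
have -> : k.+1 = K by apply/eqP; rewrite eqn_leq kK kK'.
exact: NK.
Qed.

Lemma expq0 K N : N ^+ K = 0 -> ev (expq K N) 0 = 1%:M.
Proof.
rewrite ev0 expq.unlock cf_mkpm; case: K => [|K] NK /=; first by rewrite -NK.
by rewrite fact0 invr1 scale1r.
Qed.

Lemma expqD K N a b : N ^+ K = 0 ->
  ev (expq K N) (a + b) = ev (expq K N) a *m ev (expq K N) b.
Proof.
move=> NK; set E := expq K N; pose P := shiftq a E - cst (ev E a) *m E.
suff P0 : P = 0.
  apply/eqP; rewrite -subr_eq0; have := congr1 (fun M => ev M b) P0.
  rewrite evB ev_shiftq evM ev_cst [b + a]addrC => ->.
  by apply/eqP/matrixP => i j; rewrite !mxE /horner_eval horner0.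
apply: (@dq_eq0 _ N).
  rewrite dqB dq_shiftq dqM dq_cst mul0mx add0r dq_expq // shiftqM shiftq_cst.
  by rewrite mulmxBl mulmxA.
by rewrite evB ev_shiftq add0r evM ev_cst expq0 // mulmx1 subrr.
Qed.

(** Differentiating the group law gives Q' = Q N with N = Q'(0), so the coefficients of Q are N^k /
    k!. They vanish from the degree of Q on, hence N is nilpotent. *)
Lemma one_param_exp Q : ev Q 0 = 1%:M ->
  (forall a b, ev Q (a + b) = ev Q a *m ev Q b) ->
  exists K N, N ^+ K = 0 /\ forall c, ev Q c = ev (expq K N) c.
Proof.
move=> Q0 QD; pose N := cf 1 Q.
have dQ : dq Q = Q *m cst N.
  apply: ev_inj => a _.
  have E : shiftq a Q = cst (ev Q a) *m Q.
    by apply: ev_inj => c _; rewrite ev_shiftq evM ev_cst addrC QD.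
  have := congr1 (cf 0) (congr1 dq E).
  rewrite dq_shiftq -ev0 ev_shiftq add0r => ->.
  by rewrite dqM dq_cst mul0mx add0r cst_cfM cf_dq scale1r evM ev_cst.
have cQ k : cf k Q = (k`!%:R)^-1 *: N ^+ k.
  elim: k => [|k IH]; first by rewrite -ev0 Q0 fact0 invr1 scale1r expr0.
  have := cf_dq k Q; rewrite dQ cfM_cst IH => E.
  have k0 : k.+1%:R != 0 :> C by rewrite pnatr_eq0.
  rewrite -[cf k.+1 Q](scalerK k0) -E factS natrM invfM -scalerA; congr (_ *: _).
  by rewrite exprSr -scalemxAl.
exists (deg Q), N; split.
  have := cQ (deg Q); rewrite cf_deg // => /esym/eqP.
  by rewrite scaler_eq0 invr_eq0 pnatr_eq0 eqn0Ngt fact_gt0 /= => /eqP.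
move=> c; rewrite (@ev_coef _ _ _ _ (deg Q)) // expq.unlock ev_mkpm.
by apply: eq_bigr => k _; rewrite cQ.
Qed.

(** The two arguments are extended from positive integers to all scalars one after the other, each
    time by an equality of polynomials. *)
Lemma one_param_nat Q :
  (forall a b : nat, ev Q (a.+1%:R + b.+1%:R) = ev Q a.+1%:R *m ev Q b.+1%:R) ->
  forall a b, ev Q (a + b) = ev Q a *m ev Q b.
Proof.
move=> QD.
have E1 (b : nat) : shiftq b.+1%:R Q = Q *m cst (ev Q b.+1%:R).
  by apply: ev_inj_nat => a; rewrite ev_shiftq QD evM ev_cst.
have E2 (a : C) : shiftq a Q = cst (ev Q a) *m Q.
  apply: ev_inj_nat => b; rewrite ev_shiftq addrC -ev_shiftq E1.
  by rewrite !evM !ev_cst.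
by move=> a b; rewrite addrC -ev_shiftq E2 evM ev_cst.
Qed.

Definition binq (r : nat) : {poly C} :=
  (r`!%:R)^-1 *: \prod_(a < r) ('X - (a%:R)%:P).

Lemma binq_nat r (k : nat) : (binq r).[k%:R] = ('C(k, r))%:R.
Proof.
rewrite hornerZ horner_prod.
have -> : \prod_(a < r) ('X - (a%:R)%:P).[k%:R] = (k ^_ r)%:R :> C.
  elim: r => [|r IH]; first by rewrite big_ord0 ffactn0.
  rewrite big_ord_recr /= IH hornerD hornerX hornerN hornerC ffactnSr natrM.
  case: (leqP r k) => rk; first by rewrite natrB.
  by rewrite ffact_small // !mul0r.
have f0 : r`!%:R != 0 :> C by rewrite pnatr_eq0 -lt0n fact_gt0.
by rewrite -bin_ffact natrM mulrC mulfK.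
Qed.

(** The binomial series of A = 1 + W with W nilpotent: the polynomial in c that interpolates the
    powers of A. Together with [one_param_exp] it stands in for the logarithm of a unipotent
    matrix. *)
Definition powq (K : nat) A : 'M[{poly C}]_n :=
  \sum_(r < K) binq r *: cst ((A - 1%:M) ^+ r).

Lemma powq_nat K A (k : nat) : (A - 1%:M) ^+ K = 0 -> ev (powq K A) k%:R = A ^+ k.
Proof.
move=> AK; rewrite ev_sum.
rewrite (eq_bigr (fun r : 'I_K => (A - 1%:M) ^+ r *+ 'C(k, r))); last first.
  by move=> r _; rewrite evZ ev_cst binq_nat scaler_nat.
set W := A - 1%:M; have -> : A = W + 1 by rewrite /W subrK.
have WK r : (K <= r)%N -> W ^+ r = 0.
  by move=> Kr; rewrite -(subnK Kr) exprD AK mulr0.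
rewrite exprD1n.
pose F r := W ^+ r *+ 'C(k, r).
rewrite -!(big_mkord xpredT F).
have E (M M' : nat) : (M <= M')%N -> (forall r, (M <= r)%N -> F r = 0) ->
    \sum_(0 <= r < M) F r = \sum_(0 <= r < M') F r.
  move=> MM' F0; rewrite [RHS](big_cat_nat (n := M)) //=.
  by rewrite [X in _ + X]big_nat_cond [X in _ + X]big1 ?addr0 // => r /andP [/andP [/F0]].
rewrite (E K (K + k.+1)%N) ?leq_addr //; last first.
  by move=> r Kr; rewrite /F WK // mul0rn.
rewrite (E k.+1 (K + k.+1)%N) ?leq_addl // => r kr.
by rewrite /F bin_small // mulr0n.
Qed.

Lemma powqD K A a b : (A - 1%:M) ^+ K = 0 ->
  ev (powq K A) (a + b) = ev (powq K A) a *m ev (powq K A) b.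
Proof.
move=> AK; apply: one_param_nat => {a b} a b.
by rewrite -natrD !powq_nat // exprD.
Qed.

Lemma powq0 K A : (A - 1%:M) ^+ K = 0 -> ev (powq K A) 0 = 1%:M.
Proof. by move=> AK; rewrite (powq_nat 0 AK) expr0. Qed.

Lemma one_param_GL Q : ev Q 0 = 1%:M ->
  (forall a b, ev Q (a + b) = ev Q a *m ev Q b) -> forall c, GL (ev Q c).
Proof.
move=> Q0 QD c; suff : ev Q c *m ev Q (- c) = 1%:M by case/mulmx1_unit.
by rewrite -QD subrr.
Qed.

Lemma powq_closed k (S : set 'M[C]_n) K A c : zclosed k S -> submonoid S ->
  S A -> (A - 1%:M) ^+ K = 0 -> S (ev (powq K A) c).
Proof.
move=> Scl [S1 SM] SA AK; apply: (zclosed_curve Scl); last first.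
  by apply: one_param_GL; [exact: powq0|move=> a b; exact: powqD].
move=> j; rewrite powq_nat //; elim: (j.+1) => [|r IH]; first by rewrite expr0.
by rewrite exprS; apply: SM.
Qed.

Lemma one_param_inv Q c : ev Q 0 = 1%:M ->
  (forall a b, ev Q (a + b) = ev Q a *m ev Q b) ->
  invmx (ev Q c) = ev Q (- c).
Proof.
move=> Q0 QD; have G := one_param_GL Q0 QD c.
by rewrite -[RHS]mul1mx -(mulVmx G) -mulmxA -QD subrr Q0 mulmx1.
Qed.

End OneParameterGroups.

(** * Cocharacters and split tori *)

Section Laurent.
Variable R : realType.
Local Notation C := R[i].

(** F is a Laurent polynomial on the nonzero complex numbers; its value at 0 is irrelevant. *)
Definition laur (F : C -> C) :=
  exists (K : nat) (Q : {poly C}), forall c, c != 0 -> c ^+ K * F c = Q.[c].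

Lemma laur_eq F F' : (forall c, c != 0 -> F c = F' c) -> laur F -> laur F'.
Proof. by move=> FF' [K [Q FQ]]; exists K, Q => c c0; rewrite -FF' // FQ. Qed.

Lemma laur_cst a : laur (fun=> a).
Proof. by exists 0%N, a%:P => c _; rewrite expr0 mul1r hornerC. Qed.

Lemma laurD F F' : laur F -> laur F' -> laur (fun c => F c + F' c).
Proof.
move=> [K [Q FQ]] [K' [Q' FQ']]; exists (K + K')%N, ('X^K' * Q + 'X^K * Q').
move=> c c0; rewrite hornerD !hornerM !hornerXn -FQ // -FQ' // exprD.
by rewrite mulrDr !mulrA [c ^+ K' * _]mulrC.
Qed.

Lemma laurM F F' : laur F -> laur F' -> laur (fun c => F c * F' c).
Proof.
move=> [K [Q FQ]] [K' [Q' FQ']]; exists (K + K')%N, (Q * Q').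
by move=> c c0; rewrite hornerM -FQ // -FQ' // exprD mulrACA.
Qed.

Lemma laur_sum I (r : seq I) (P : pred I) (F : I -> C -> C) :
  (forall i, laur (F i)) -> laur (fun c => \sum_(i <- r | P i) F i c).
Proof.
move=> HF; elim: r => [|i r IH].
  by apply: laur_eq (laur_cst 0) => c _; rewrite big_nil.
apply: (@laur_eq (fun c => (if P i then F i c else 0) +
                            \sum_(i <- r | P i) F i c)).
  by move=> c _; rewrite big_cons; case: (P i); rewrite ?add0r.
by apply: laurD => //; case: (P i); [exact: HF|exact: laur_cst].
Qed.

Lemma laur_prod I (r : seq I) (P : pred I) (F : I -> C -> C) :
  (forall i, laur (F i)) -> laur (fun c => \prod_(i <- r | P i) F i c).
Proof.
move=> HF; elim: r => [|i r IH].
  by apply: laur_eq (laur_cst 1) => c _; rewrite big_nil.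
apply: (@laur_eq (fun c => (if P i then F i c else 1) *
                            \prod_(i <- r | P i) F i c)).
  by move=> c _; rewrite big_cons; case: (P i); rewrite ?mul1r.
by apply: laurM => //; case: (P i); [exact: HF|exact: laur_cst].
Qed.

Lemma laurX F k : laur F -> laur (fun c => F c ^+ k).
Proof.
move=> HF; apply: laur_eq (@laur_prod _ (index_iota 0 k) xpredT (fun=> F) _) => //.
by move=> c _; rewrite prodr_const_nat subn0.
Qed.

Lemma laur_expz (k : int) : laur (fun c => c ^ k).
Proof.
case: k => k; first by exists 0%N, 'X^k => c _; rewrite expr0 mul1r hornerXn.
exists k.+1, 1 => c c0; rewrite hornerC NegzE -exprnN mulfV //.
by rewrite expf_neq0.
Qed.

Lemma laurV F : laur F -> laur (fun c => F c^-1).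
Proof.
move=> [K [Q FQ]].
apply: (@laur_eq (fun c => c ^ K%:Z * \sum_(k < size Q) Q`_k * c ^ (- (k : nat)%:Z))).
  move=> c c0; have c0' : c^-1 != 0 by rewrite invr_eq0.
  have -> : \sum_(k < size Q) Q`_k * c ^ (- (k : nat)%:Z) = Q.[c^-1].
    by rewrite horner_coef; apply: eq_bigr => k _; rewrite -exprz_inv.
  by rewrite -FQ // exprVn mulrA -exprnP mulfV ?mul1r // expf_neq0.
apply: laurM; first exact: laur_expz.
by apply: laur_sum => k; apply: laurM; [exact: laur_cst|exact: laur_expz].
Qed.

Lemma laur_mxeval n (p : {mpoly C[n * n]}) (M : C -> 'M[C]_n) :
  (forall i j, laur (fun c => M c i j)) -> laur (fun c => mxeval p (M c)).
Proof.
move=> HM; apply: (@laur_eq (fun c => \sum_(u <- msupp p)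
   p@_u * \prod_k mxvec (M c) 0 k ^+ u k)).
  by move=> c _; rewrite /mxeval mevalE.
apply: laur_sum => u; apply: laurM; first exact: laur_cst.
apply: laur_prod => k; apply: laurX; case/mxvec_indexP: k => i j.
by apply: laur_eq (HM i j) => c _; rewrite mxvecE.
Qed.

Lemma laur_det n (M : C -> 'M[C]_n) :
  (forall i j, laur (fun c => M c i j)) -> laur (fun c => \det (M c)).
Proof.
move=> HM; apply: laur_sum => s; apply: laurM; first exact: laur_cst.
by apply: laur_prod => i; apply: HM.
Qed.

Lemma laur_mx n (M : C -> 'M[C]_n) : (forall i j, laur (fun c => M c i j)) ->
  exists (K : nat) (Q : 'M[{poly C}]_n), forall c, c != 0 ->
    c ^+ K *: M c = ev Q c.
Proof.
move=> HM.
have H (ij : 'I_n * 'I_n) : exists kq : nat * {poly C}, forall c, c != 0 ->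
    c ^+ kq.1 * M c ij.1 ij.2 = kq.2.[c].
  by have [K [Q HQ]] := HM ij.1 ij.2; exists (K, Q).
have [KQ HKQ] := choice H.
pose K := \max_ij (KQ ij).1.
exists K, (\matrix_(i, j) ('X^(K - (KQ (i, j)).1) * (KQ (i, j)).2)) => c c0.
apply/matrixP => i j; rewrite !mxE /horner_eval hornerM hornerXn -HKQ //=.
by rewrite mulrA -exprD subnK //; apply: (leq_bigmax (i, j)).
Qed.

(** With c^K F(c) = Q(c), the identity Q(dc) = Q(d) Q(c) yields Q(d) = d^(deg Q) on leading
    coefficients. *)
Lemma laur_mult (F : C -> C) : laur F -> F 1 != 0 ->
  (forall c d, c != 0 -> d != 0 -> F (c * d) = F c * F d) ->
  exists k : int, forall c, c != 0 -> F c = c ^ k.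
Proof.
move=> [K [Q FQ]] F1 FM.
have QM c d : c != 0 -> d != 0 -> Q.[d * c] = Q.[d] * Q.[c].
  by move=> c0 d0; rewrite -!FQ ?mulf_neq0 // exprMn FM // mulrACA.
have Q0 : Q != 0.
  apply/eqP => Q0; have := FQ 1 (oner_neq0 _); rewrite Q0 horner0 expr1n mul1r.
  by move=> /eqP; rewrite (negPf F1).
have L0 : Q`_(size Q).-1 != 0 by rewrite -lead_coefE lead_coef_eq0.
exists ((size Q).-1%:Z - K%:Z) => d d0.
have E : Q \Po (d *: 'X) = Q.[d] *: Q.
  apply: poly_neq0_inj => c c0; rewrite horner_comp !hornerZ hornerX.
  exact: QM.
have := congr1 (fun p : {poly C} => p`_(size Q).-1) E.
rewrite coefZ.
have -> : (Q \Po (d *: 'X))`_(size Q).-1 = d ^+ (size Q).-1 * Q`_(size Q).-1.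
  rewrite comp_polyE coef_sum.
  have sz : ((size Q).-1 < size Q)%N by rewrite prednK // size_poly_gt0.
  rewrite (bigD1 (Ordinal sz)) //= big1 ?addr0 => [|k kn].
    by rewrite coefZ exprZn coefZ coefXn eqxx mulr1 mulrC.
  rewrite coefZ exprZn coefZ coefXn.
  have -> : ((size Q).-1 == k)%N = false.
    by apply/eqP => E'; case/eqP: kn; apply: val_inj.
  by rewrite !mulr0.
move=> /(mulIf L0) Qd; rewrite expfzDr // -exprnN -exprnP Qd -FQ //.
by rewrite mulrC mulKf // expf_neq0.
Qed.

End Laurent.

Section Cocharacters.
Variables (R : realType) (n : nat).
Local Notation C := R[i].
Implicit Types (m : C -> 'M[C]_n) (T : set 'M[C]_n).

Definition cochar T m :=
  [/\ forall c, c != 0 -> T (m c),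
      forall c d, c != 0 -> d != 0 -> m (c * d) = m c *m m d
    & forall i j, laur (fun c => m c i j)].

Lemma laur_mxM m m' : (forall i j, laur (fun c => m c i j)) ->
  (forall i j, laur (fun c => m' c i j)) ->
  forall i j, laur (fun c => (m c *m m' c) i j).
Proof.
move=> Hm Hm' i j; apply: (@laur_eq _ (fun c => \sum_k m c i k * m' c k j)).
  by move=> c _; rewrite mxE.
by apply: laur_sum => k; apply: laurM.
Qed.

Lemma cochar1 T m : T `<=` @GL R n -> cochar T m -> m 1 = 1%:M.
Proof.
move=> TG [mT mM _]; have U := TG _ (mT 1 (oner_neq0 _)).
have := mM 1 1 (oner_neq0 _) (oner_neq0 _); rewrite mulr1.
by move/(congr1 (mulmx (invmx (m 1)))); rewrite mulKmx // mulVmx.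
Qed.

Lemma cochar_inv T m c : T `<=` @GL R n -> cochar T m -> c != 0 ->
  invmx (m c) = m c^-1.
Proof.
move=> TG cm c0; have [mT mM _] := cm; have U := TG _ (mT c c0).
rewrite -[RHS](mulKmx U) -mM ?invr_eq0 // mulfV // (cochar1 TG cm).
by rewrite mulmx1.
Qed.

Lemma cocharV T m : cochar T m -> cochar T (fun c => m c^-1).
Proof.
move=> [mT mM mL]; split.
- by move=> c c0; apply: mT; rewrite invr_eq0.
- by move=> c d c0 d0; rewrite invfM mM // invr_eq0.
by move=> i j; apply: laurV (mL i j).
Qed.

Lemma cocharM T m m' : submonoid T -> (forall A B, T A -> T B -> A *m B = B *m A) ->
  cochar T m -> cochar T m' -> cochar T (fun c => m c *m m' c).
Proof.
move=> [_ TM] Tc [mT mM mL] [mT' mM' mL']; split.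
- by move=> c c0; apply: TM; [apply: mT|apply: mT'].
- move=> c d c0 d0; rewrite mM // mM' // -!mulmxA; congr (_ *m _).
  by rewrite !mulmxA; congr (_ *m _); apply: Tc; [apply: mT|apply: mT'].
exact: laur_mxM.
Qed.

(** A character is a polynomial divided by a power of the determinant. Along m the determinant is
    itself a power of c, so the quotient is a multiplicative Laurent polynomial. *)
Lemma cochar_char T (a : 'M[C]_n -> C) m : T `<=` @GL R n -> cochar T m ->
  character T a -> exists k : int, forall c, c != 0 -> a (m c) = c ^ k.
Proof.
move=> TG cm [aG aM aR]; have [mT mM mL] := cm.
have aM' A B : T A -> T B -> a (A *m B) = a A * a B.
  move=> TA TB; have := aM A B TA TB; rewrite -scalar_mxM.
  by move/matrixP/(_ 0 0); rewrite !mxE eqxx !mulr1n.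
have a0 A : T A -> a A != 0.
  move=> TA; have := aG A TA; rewrite /GL /= unitmxE det_scalar1.
  by rewrite unitfE.
have det0 c : c != 0 -> \det (m c) != 0.
  by move=> c0; rewrite -unitfE -unitmxE; apply: TG; apply: mT.
have [k dk] : exists k : int, forall c, c != 0 -> \det (m c) = c ^ k.
  apply: laur_mult; first exact: laur_det.
    by apply: det0; rewrite oner_neq0.
  by move=> c d c0 d0; rewrite mM // det_mulmx.
have [p [N [_ Hp]]] := aR 0 0.
apply: laur_mult.
- apply: (@laur_eq _ (fun c => mxeval p (m c) * c ^ (k * - N%:Z))).
    move=> c c0; have := Hp _ (mT c c0); rewrite mxE eqxx mulr1n => ->.
    by rewrite dk // -exprz_exp -exprnN.
  by apply: laurM; [exact: laur_mxeval|exact: laur_expz].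
- by apply/a0/mT; rewrite oner_neq0.
by move=> c d c0 d0; rewrite mM // aM' //; apply: mT.
Qed.

End Cocharacters.

Section RegularFunctions.
Variables (R : realType) (n : nat) (H : set 'M[R[i]]_n).
Local Notation C := R[i].
Hypothesis HG : H `<=` @GL R n.

Let det0 A : H A -> \det A != 0.
Proof. by move=> /HG; rewrite /GL /= unitmxE unitfE. Qed.

Lemma regular_eq f f' : (forall A, H A -> f A = f' A) ->
  regular setT H f -> regular setT H f'.
Proof. by move=> ff' [p [N [s E]]]; exists p, N; split=> // A HA; rewrite -ff' // E. Qed.

Lemma regularP f : regular setT H f <->
  exists2 F : 'M[C]_n -> C, polyfun F &
    exists N : nat, forall A, H A -> f A = F A / \det A ^+ N.
Proof.
split=> [[p [N [_ E]]]|[F [p Fp] [N E]]].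
  by exists (mxeval p); [exists p|exists N].
by exists p, N; split=> [|A HA]; [|rewrite -Fp E].
Qed.

Lemma regular_poly F : polyfun F -> regular setT H F.
Proof.
by move=> HF; apply/regularP; exists F => //; exists 0%N => A _; rewrite expr0 divr1.
Qed.

Lemma regularM f f' : regular setT H f -> regular setT H f' ->
  regular setT H (fun A => f A * f' A).
Proof.
move=> /regularP [F HF [N E]] /regularP [F' HF' [N' E']]; apply/regularP.
exists (fun A => F A * F' A); first exact: polyfunM.
by exists (N + N')%N => A HA; rewrite E // E' // exprD invfM mulrACA.
Qed.

Lemma regularD f f' : regular setT H f -> regular setT H f' ->
  regular setT H (fun A => f A + f' A).
Proof.
move=> /regularP [F HF [N E]] /regularP [F' HF' [N' E']]; apply/regularP.
exists (fun A => F A * \det A ^+ N' + F' A * \det A ^+ N).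
  by apply: polyfunD; apply: polyfunM => //; apply: polyfunX; apply: polyfun_det.
exists (N + N')%N => A HA; rewrite E // E' // exprD.
have d0 k : \det A ^+ k != 0 by rewrite expf_neq0 // det0.
by rewrite addf_div // d0.
Qed.

Lemma regular_sum I (r : seq I) (P : pred I) (f : I -> 'M[C]_n -> C) :
  (forall i, regular setT H (f i)) ->
  regular setT H (fun A => \sum_(i <- r | P i) f i A).
Proof.
move=> Hf; elim: r => [|i r IH].
  by apply: (regular_eq _ (regular_poly (polyfun_cst n 0))) => A _; rewrite big_nil.
apply: (@regular_eq (fun A => (if P i then f i A else 0) +
                               \sum_(i <- r | P i) f i A)).
  by move=> A _; rewrite big_cons; case: (P i); rewrite ?add0r.
by apply: regularD => //; case: (P i) => //; apply/regular_poly/polyfun_cst.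
Qed.

Lemma regular_prod I (r : seq I) (P : pred I) (f : I -> 'M[C]_n -> C) :
  (forall i, regular setT H (f i)) ->
  regular setT H (fun A => \prod_(i <- r | P i) f i A).
Proof.
move=> Hf; elim: r => [|i r IH].
  by apply: (regular_eq _ (regular_poly (polyfun_cst n 1))) => A _; rewrite big_nil.
apply: (@regular_eq (fun A => (if P i then f i A else 1) *
                               \prod_(i <- r | P i) f i A)).
  by move=> A _; rewrite big_cons; case: (P i); rewrite ?mul1r.
by apply: regularM => //; case: (P i) => //; apply/regular_poly/polyfun_cst.
Qed.

Lemma regular_expz f (k : int) : regular setT H f ->
  regular setT H (fun A => (f A)^-1) -> regular setT H (fun A => f A ^ k).
Proof.
move=> Hf Hf'; case: k => k.
  apply: (regular_eq _ (@regular_prod _ (index_iota 0 k) xpredT (fun=> f) _)) => //.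
  by move=> A _; rewrite prodr_const_nat subn0.
apply: (regular_eq _ (@regular_prod _ (index_iota 0 k.+1) xpredT (fun _ A => (f A)^-1) _)) => //.
by move=> A _; rewrite prodr_const_nat subn0 NegzE -exprnN exprVn.
Qed.

Lemma regular_mul m (f g : 'M[C]_n -> 'M[C]_m) :
  (forall i j, regular setT H (fun A => f A i j)) ->
  (forall i j, regular setT H (fun A => g A i j)) ->
  forall i j, regular setT H (fun A => (f A *m g A) i j).
Proof.
move=> Hf Hg i j; apply: (@regular_eq (fun A => \sum_k f A i k * g A k j)).
  by move=> A _; rewrite mxE.
by apply: regular_sum => k; apply: regularM.
Qed.

End RegularFunctions.

(* Locked: unification would otherwise compare monomials by unfolding the
   powers and the multiplication of complex numbers. *)
HB.lock Definition mono (F : fieldType) m k (z : 'I_m -> F)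
    (L : 'M[int]_(m, k)) (a : 'I_k) : F :=
  \prod_b z b ^ L b a.

(** * Simultaneous diagonalization of commuting cocharacters *)

Section ImageTorus.
Variable R : realType.
Local Notation C := R[i].

Lemma idempotent_diagonalizable n (E : 'M[C]_n) : E *m E = E ->
  exists2 P : 'M_n, P \in unitmx & similar_diag P E.
Proof.
case: n E => [|n] E EE.
  by exists 1%:M; rewrite ?unitmx1 //; apply/is_diag_mxP => -[].
apply/diagonalizableP; exists [:: 0; 1]; first by rewrite /= inE eq_sym oner_neq0.
apply: mxminpoly_min; rewrite big_cons big_seq1 subr0 rmorphM rmorphB /=.
by rewrite !horner_mx_X horner_mx_C -mulmxE mulmxBr mulmxE mulr1 -mulmxE EE subrr.
Qed.

Lemma mono_neq0 m k (z : 'I_m -> C) (L : 'M[int]_(m, k)) a :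
  (forall b, z b != 0) -> mono z L a != 0.
Proof. by rewrite mono.unlock => z0; apply/prodf_neq0 => b _; rewrite expfz_neq0. Qed.

Lemma expfz_sum (x : C) (J : Type) (r : seq J) (F : J -> int) : x != 0 ->
  x ^ (\sum_(j <- r) F j) = \prod_(j <- r) x ^ F j.
Proof.
move=> x0; elim: r => [|j r IH]; first by rewrite !big_nil expr0z.
by rewrite !big_cons expfzDr // IH.
Qed.

Lemma expfz_prod (J : Type) (r : seq J) (F : J -> C) (k : int) :
  (\prod_(j <- r) F j) ^ k = \prod_(j <- r) F j ^ k.
Proof.
elim: r => [|j r IH]; first by rewrite !big_nil exp1rz.
by rewrite !big_cons expfzMl IH.
Qed.

Lemma mono_comp m k l (z : 'I_m -> C) (L : 'M[int]_(m, k)) (M : 'M[int]_(k, l)) a :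
  (forall b, z b != 0) -> mono (mono z L) M a = mono z (L *m M) a.
Proof.
move=> z0; rewrite mono.unlock.
under eq_bigr => b _ do rewrite expfz_prod.
rewrite exchange_big /=; apply: eq_bigr => b _; rewrite mxE expfz_sum //.
by apply: eq_bigr => j _; rewrite exprz_exp.
Qed.

Lemma mono1 m (z : 'I_m -> C) a : mono z 1%:M a = z a.
Proof.
rewrite mono.unlock (bigD1 a) //= mxE eqxx expr1z big1 ?mulr1 // => b /negPf ba.
by rewrite mxE ba expr0z.
Qed.

Lemma monoM m k (z y : 'I_m -> C) (L : 'M[int]_(m, k)) a :
  mono (fun b => z b * y b) L a = mono z L a * mono y L a.
Proof. by rewrite mono.unlock -big_split; apply: eq_bigr => b _; rewrite expfzMl. Qed.

Lemma eq_mono m k (z y : 'I_m -> C) (L : 'M[int]_(m, k)) a : z =1 y ->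
  mono z L a = mono y L a.
Proof. by rewrite mono.unlock => zy; apply: eq_bigr => b _; rewrite zy. Qed.

Definition dg d (z : 'I_d -> C) : 'M[C]_d := diag_mx (\row_a z a).

Lemma dgE d (z : 'I_d -> C) i j : dg z i j = z i *+ (i == j).
Proof. by rewrite !mxE; case: eqP => [->|]. Qed.

Lemma dgM d (z y : 'I_d -> C) : dg z *m dg y = dg (fun a => z a * y a).
Proof.
rewrite mulmx_diag; congr diag_mx; apply/matrixP => i j.
by rewrite !mxE.
Qed.

Lemma dg_mulE d (X Y : 'M[C]_d) a : X = dg (fun a => X a a) ->
  Y = dg (fun a => Y a a) -> (X *m Y) a a = X a a * Y a a.
Proof.
move: (fun a => X a a) (fun a => Y a a) => x y -> ->.
by rewrite dgM !dgE eqxx.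
Qed.

Lemma scale_comm d (X Y : 'M[C]_d) x y : X *m Y = Y *m X ->
  (x *: X) *m (y *: Y) = (y *: Y) *m (x *: X).
Proof.
move=> XY; rewrite -scalemxAl -scalemxAr XY -[RHS]scalemxAl -scalemxAr.
by rewrite !scalerA mulrC.
Qed.

Lemma dg_GL d (z : 'I_d -> C) : (forall a, z a != 0) -> diag_torus (dg z).
Proof.
move=> z0; split; last exact: diag_mx_is_diag.
rewrite /GL /= unitmxE det_diag unitfE; apply/prodf_neq0 => a _.
by rewrite mxE.
Qed.

Lemma dg1 d : dg (fun=> 1) = 1%:M :> 'M[C]_d.
Proof. by apply/matrixP => i j; rewrite dgE !mxE. Qed.

Lemma eq_dg d (z y : 'I_d -> C) : z =1 y -> dg z = dg y.
Proof. by move=> zy; apply/matrixP => i j; rewrite !dgE zy. Qed.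

Lemma diag_torusP d (A : 'M[C]_d) : diag_torus A ->
  A = dg (fun a => A a a) /\ forall a, A a a != 0.
Proof.
move=> [GA /diag_mxP [v Av]]; split.
  by apply/matrixP => i j; rewrite dgE Av !mxE eqxx mulr1n; case: eqP => [->|].
move=> a; move: GA; rewrite /GL /= Av unitmxE det_diag unitfE.
by move/prodf_neq0/(_ a isT); rewrite mxE eqxx mulr1n.
Qed.

Lemma diag_torus_subgroup d : subgroup (@diag_torus R d).
Proof.
split; first by move=> A [].
- split; first by rewrite -dg1; apply: dg_GL => a; rewrite oner_neq0.
  move=> A B /diag_torusP [EA A0] /diag_torusP [EB B0]; rewrite EA EB dgM.
  by apply: dg_GL => a; rewrite mulf_neq0.
move=> A /diag_torusP [EA A0]; rewrite {}EA.
have E : dg (fun a => A a a) *m dg (fun a => (A a a)^-1) = 1%:M.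
  by rewrite dgM -dg1; apply: eq_dg => a; rewrite mulfV.
have [U _] := mulmx1_unit E.
rewrite -[invmx _]mulmx1 -E mulKmx //.
by apply: dg_GL => a; rewrite invr_eq0.
Qed.

(** The coefficients of a cocharacter, as a Laurent polynomial, are the projections onto its weight
    spaces. Those of commuting cocharacters commute, so they are diagonalized together. *)
Lemma cochar_codiag m n (mu : 'I_m -> C -> 'M[C]_n) :
  (forall b, cochar (@GL R n) (mu b)) ->
  (forall b b' c c', c != 0 -> c' != 0 ->
     mu b c *m mu b' c' = mu b' c' *m mu b c) ->
  exists P : 'M[C]_n, P \in unitmx /\ exists M : 'M[int]_(m, n),
    forall b c, c != 0 -> P *m mu b c *m invmx P = dg (fun a => c ^ M b a).
Proof.
move=> cmu comm.
have H b : exists KQ : nat * 'M[{poly C}]_n, forall c, c != 0 ->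
    c ^+ KQ.1 *: mu b c = ev KQ.2 c.
  by have [_ _ /laur_mx [K [Q HQ]]] := cmu b; exists (K, Q).
have [KQ HKQ] := choice H; pose Q b := (KQ b).2.
have QD b c d : c != 0 -> d != 0 -> ev (Q b) (c * d) = ev (Q b) c *m ev (Q b) d.
  move=> c0 d0; have [_ mM _] := cmu b.
  rewrite -!HKQ ?mulf_neq0 // mM // -scalemxAl -scalemxAr scalerA.
  by rewrite exprMn.
have mkE b c : ev (Q b) c = \sum_(k < deg (Q b)) c ^+ k *: cf k (Q b).
  exact: ev_coef.
(* Coefficient of c^k in Q(cd) = Q(c) Q(d). *)
have QE b d k : d != 0 -> d ^+ k *: cf k (Q b) = cf k (Q b) *m ev (Q b) d.
  move=> d0; rewrite -cfM_cst.
  have -> : Q b *m cst (ev (Q b) d) = mkpm (deg (Q b)) (fun k => d ^+ k *: cf k (Q b)).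
    apply: ev_inj => c c0; rewrite evM ev_cst -QD // mkE ev_mkpm.
    by apply: eq_bigr => l _; rewrite scalerA exprMn.
  rewrite cf_mkpm; case: ltnP => // kQ; by rewrite cf_deg // scaler0.
(* Coefficient of d^l in the preceding identity: the coefficients of Q are orthogonal
   idempotents. *)
have QQ b k l : cf k (Q b) *m cf l (Q b) = if k == l then cf k (Q b) else 0.
  rewrite -cst_cfM.
  have -> : cst (cf k (Q b)) *m Q b =
      mkpm k.+1 (fun j => if j == k then cf k (Q b) else 0).
    apply: ev_inj => d d0; rewrite evM ev_cst -QE // ev_mkpm big_ord_recr /= eqxx.
    rewrite big1 ?add0r // => j _; case: eqP => [E|]; last by rewrite scaler0.
    by have := ltn_ord j; rewrite E ltnn.
  rewrite cf_mkpm ltnS eq_sym; case: eqP => [->|]; first by rewrite leqnn.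
  by case: ifP.
have Qcomm b b' k l : cf k (Q b) *m cf l (Q b') = cf l (Q b') *m cf k (Q b).
  have E1 c : c != 0 -> cst (ev (Q b) c) *m Q b' = Q b' *m cst (ev (Q b) c).
    move=> c0; apply: ev_inj => c' c0'; rewrite 2!evM ev_cst.
    rewrite -(HKQ b c c0) -(HKQ b' c' c0').
    by rewrite scale_comm // comm.
  have E2 : Q b *m cst (cf l (Q b')) = cst (cf l (Q b')) *m Q b.
    apply: ev_inj => c c0; rewrite !evM !ev_cst.
    by have := congr1 (cf l) (E1 c c0); rewrite cst_cfM cfM_cst.
  by have := congr1 (cf k) E2; rewrite cst_cfM cfM_cst.
pose fs := flatten [seq [seq cf k (Q b) | k <- iota 0 (deg (Q b))] | b <- enum 'I_m].
have fsP f : f \in fs -> exists b k, f = cf k (Q b).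
  by case/flattenP => s /mapP [b _ ->] /mapP [k _ ->]; exists b, k.
have [P UP dP] : exists2 P : 'M_n, P \in unitmx & all [pred A | similar_diag P A] fs.
  apply/codiagonalizableP; split.
    move=> f g /fsP [b [k ->]] /fsP [b' [l ->]]; exact: Qcomm.
  move=> f /fsP [b [k ->]]; apply: idempotent_diagonalizable.
  by rewrite QQ eqxx.
have offd b c i j : c != 0 -> i != j -> (P *m mu b c *m invmx P) i j = 0.
  move=> c0 ij; apply/eqP.
  have : c ^+ (KQ b).1 * (P *m mu b c *m invmx P) i j = 0.
    have -> : c ^+ (KQ b).1 * (P *m mu b c *m invmx P) i j =
        (P *m (c ^+ (KQ b).1 *: mu b c) *m invmx P) i j.
      by rewrite -scalemxAr -scalemxAl [RHS]mxE.
    rewrite HKQ // mkE mulmx_sumr mulmx_suml summxE big1 // => k _.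
    have kin : cf k (Q b) \in fs.
      apply/flattenP; exists [seq cf k (Q b) | k <- iota 0 (deg (Q b))].
        by apply/mapP; exists b; rewrite ?mem_enum.
      by apply/mapP; exists (k : nat); rewrite ?mem_iota /=.
    have := allP dP _ kin => /(similar_diagP _ UP)/(_ i j ij).
    by move=> E0; rewrite -scalemxAr -scalemxAl [LHS]mxE E0 mulr0.
  by move/eqP; rewrite mulf_eq0 expf_eq0 (negPf c0) andbF.
have Dg b c : c != 0 -> P *m mu b c *m invmx P =
    dg (fun a => (P *m mu b c *m invmx P) a a).
  move=> c0; apply/matrixP => i j; rewrite dgE; case: eqP => [->|/eqP] //.
  exact: offd.
have chi b a : exists k : int, forall c, c != 0 ->
    (P *m mu b c *m invmx P) a a = c ^ k.
  have [mT mM mL] := cmu b.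
  apply: laur_mult.
  - apply: laur_mxM.
      by apply: laur_mxM => // i j; apply: laur_cst.
    by move=> i j; apply: laur_cst.
  - have := cochar1 (fun A h => h) (cmu b) => ->.
    by rewrite mulmx1 mulmxV // mxE eqxx oner_neq0.
  move=> c d c0 d0; rewrite mM //.
  have -> : P *m (mu b c *m mu b d) *m invmx P =
     (P *m mu b c *m invmx P) *m (P *m mu b d *m invmx P).
    by rewrite !mulmxA mulmxKV // .
  by apply: dg_mulE; apply: Dg.
have chi' (ba : 'I_m * 'I_n) : exists k : int, forall c, c != 0 ->
    (P *m mu ba.1 c *m invmx P) ba.2 ba.2 = c ^ k by exact: chi.
have [M HM] := choice chi'.
exists P; split=> //; exists (\matrix_(b, a) M (b, a)) => b c c0.
by rewrite Dg //; apply: eq_dg => a; rewrite mxE -(HM (b, a)).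
Qed.

End ImageTorus.

Lemma mulmxij (R : pzSemiRingType) m n p (A : 'M[R]_(m, n)) (B : 'M_(n, p)) i j :
  (A *m B) i j = \sum_k A i k * B k j.
Proof. exact: mxE. Qed.

Lemma invmxE (R : comUnitRingType) n (A : 'M[R]_n) : A \in unitmx ->
  invmx A = (\det A)^-1 *: \adj A.
Proof. by rewrite /invmx => ->. Qed.

(* Unification would otherwise unfold products of matrices when it fails. *)
Local Opaque mulmx invmx.

(** * Tori parametrized by a direct summand of the lattice of exponents *)

Section StandardTorus.
Variables (R : realType) (n r : nat).
Local Notation C := R[i].
Variables (P : 'M[C]_n) (L : 'M[int]_(r, n)) (S : 'M[int]_(n, r)).
Hypotheses (UP : P \in unitmx) (LS : L *m S = 1%:M).

(** In the basis P the diagonal entries are the monomials in z with exponents L. Since L S = 1, the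
    monomials with exponents S recover z from the diagonal. *)
Definition std_elt (z : 'I_r -> C) : 'M[C]_n :=
  invmx P *m dg (mono z L) *m P.

Definition std_torus : set 'M[C]_n :=
  [set A | exists z, (forall j, z j != 0) /\ A = std_elt z].

Let pd (A : 'M[C]_n) a := (P *m A *m invmx P) a a.

Lemma std_conj z : P *m std_elt z *m invmx P = dg (mono z L).
Proof. by rewrite /std_elt !mulmxA mulmxV // mul1mx mulmxK. Qed.

Lemma conj_eq z y : z =1 y ->
  invmx P *m dg z *m P = invmx P *m dg y *m P.
Proof. by move=> /eq_dg ->. Qed.

Lemma std_eltM z y : std_elt z *m std_elt y = std_elt (fun j => z j * y j).
Proof.
rewrite /std_elt !mulmxA (mulmxK UP) -[X in X *m P]mulmxA dgM.
by apply: conj_eq => a; rewrite monoM.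
Qed.

Lemma std_elt1 : std_elt (fun=> 1) = 1%:M.
Proof.
rewrite /std_elt (_ : dg _ = 1%:M) ?mulmx1 ?mulVmx //.
by rewrite -dg1; apply: eq_dg => a; rewrite mono.unlock; apply: big1 => b _; apply: exp1rz.
Qed.

Lemma std_elt_eq z y : z =1 y -> std_elt z = std_elt y.
Proof. by move=> zy; apply: conj_eq => a; apply: eq_mono. Qed.

Lemma std_eltV z : (forall j, z j != 0) ->
  std_elt z \in unitmx /\ invmx (std_elt z) = std_elt (fun j => (z j)^-1).
Proof.
move=> z0; have E : std_elt z *m std_elt (fun j => (z j)^-1) = 1%:M.
  by rewrite std_eltM -std_elt1; apply: std_elt_eq => j; rewrite mulfV.
have [U _] := mulmx1_unit E; split=> //.
by rewrite -[invmx _]mulmx1 -E mulKmx.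
Qed.

Lemma std_diag z : (forall j, z j != 0) ->
  [/\ P *m std_elt z *m invmx P = dg (pd (std_elt z)),
      (forall a, pd (std_elt z) a != 0),
      mono (pd (std_elt z)) S =1 z
    & forall a, pd (std_elt z) a = mono z L a].
Proof.
move=> z0; have E a : pd (std_elt z) a = mono z L a.
  by rewrite /pd std_conj dgE eqxx.
split=> //.
- by rewrite std_conj; apply: eq_dg => a; rewrite E.
- by move=> a; rewrite E mono_neq0.
by move=> j; rewrite (eq_mono _ _ E) mono_comp // LS mono1.
Qed.

Lemma std_torus_subgroup : subgroup std_torus.
Proof.
split.
- by move=> A [z [z0 ->]]; have [] := std_eltV z0.
- split; first by exists (fun=> 1); rewrite std_elt1; split=> // j; rewrite oner_neq0.
  move=> A B [z [z0 ->]] [y [y0 ->]]; exists (fun j => z j * y j).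
  by rewrite std_eltM; split=> // j; rewrite mulf_neq0.
move=> A [z [z0 ->]]; exists (fun j => (z j)^-1).
by have [_ ->] := std_eltV z0; split=> // j; rewrite invr_eq0.
Qed.

Lemma pd_poly a b : polyfun (fun A => (P *m A *m invmx P) a b).
Proof.
have H : polymap (fun A : 'M[C]_n => P *m A *m invmx P).
  apply: polymapM; last exact: polymap_cst.
  by apply: polymapM; [exact: polymap_cst|exact: polymap_id].
exact: H.
Qed.

Lemma std_torus_closed : zclosed setT std_torus.
Proof.
(* A diagonal matrix lies in the torus exactly when the monomials with exponents X fix its diagonal;
   its parameters are then the monomials with exponents S. Negative exponents are moved to the other
   side to obtain polynomial equations. *)
pose X := S *m L.
pose pos (k : int) := if k is Posz p then p else 0%N.
pose F (q : 'I_n * 'I_n + 'I_n) (A : 'M[C]_n) := match q with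
  | inl (a, b) => if a == b then 0 else (P *m A *m invmx P) a b
  | inr a => pd A a * \prod_b pd A b ^+ pos (- X b a) - \prod_b pd A b ^+ pos (X b a)
  end.
have -> : std_torus = [set A | GL A /\ forall q, F q A = 0].
  apply/seteqP; split=> A /=.
    move=> [z [z0 ->]]; have [UA _] := std_eltV z0; split=> //.
    have [E d0 Ez Ed] := std_diag z0.
    move=> [[a b]|a] /=.
      by case: eqP => // /eqP /negPf ab; rewrite E dgE ab.
    apply/eqP; rewrite subr_eq0; apply/eqP.
    have {1}-> : pd (std_elt z) a = mono (pd (std_elt z)) X a.
      by rewrite /X -mono_comp // (eq_mono _ _ Ez) Ed.
    rewrite mono.unlock -big_split; apply: eq_bigr => b _ /=.
    case: (X b a) => k /=; last by rewrite NegzE -exprnN mulVf // expf_neq0.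
    by case: k => [|k] //=; rewrite mulr1.
  move=> [GA FA].
  have E : P *m A *m invmx P = dg (pd A).
    apply/matrixP => a b; rewrite dgE; case: eqP => [->//|/eqP/negPf ab].
    by have := FA (inl (a, b)); rewrite /= ab.
  have GB : GL (dg (pd A)) by rewrite -E /GL /= !unitmx_mul UP unitmx_inv UP andbT.
  have d0 a : pd A a != 0.
    have [] := @diag_torusP _ _ (dg (pd A)); first by split=> //; apply: diag_mx_is_diag.
    by move=> _ /(_ a); rewrite dgE eqxx.
  exists (mono (pd A) S); split; first by move=> j; apply: mono_neq0.
  rewrite /std_elt; rewrite -[LHS](mulKmx UP) -[in LHS](mulmxKV UP (P *m A)) E.
  rewrite !mulmxA; apply: conj_eq => a.
  rewrite mono_comp // -/X; have /= /eqP := FA (inr a).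
  rewrite subr_eq0 => /eqP H.
  apply: (@mulIf _ (\prod_b pd A b ^+ pos (- X b a))).
    by apply/prodf_neq0 => b _; rewrite expf_neq0.
  rewrite H mono.unlock -big_split; apply: eq_bigr => b _ /=.
  case: (X b a) => k /=; last by rewrite NegzE -exprnN mulVf // expf_neq0.
  by case: k => [|k] //=; rewrite mulr1.
apply: zclosed_polyfun => -[[a b]|a] /=.
  by rewrite /F; case: (a == b); [exact: polyfun_cst|exact: pd_poly].
apply: polyfunB.
  apply: polyfunM; first exact: pd_poly.
  by apply: polyfun_prod => b _; apply: polyfunX; apply: pd_poly.
by apply: polyfun_prod => b _; apply: polyfunX; apply: pd_poly.
Qed.

Lemma std_torus_split : split_torus setT std_torus.
Proof.
have HG : std_torus `<=` @GL R n by case: std_torus_subgroup.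
split; first by split; [exact: std_torus_closed|exact: std_torus_subgroup].
have DG : @diag_torus R r `<=` @GL R r by move=> A [].
have dreg : forall j, regular setT (@diag_torus R r) (fun B => (B j j)^-1).
  move=> j; apply/regularP; exists (fun B => \prod_(i | i != j) B i i).
    by apply: polyfun_prod => i _; apply: polyfun_entry.
  exists 1%N => A /diag_torusP [EA A0]; rewrite expr1.
  have -> : \det A = \prod_i A i i.
    rewrite {1}EA det_diag; apply: eq_bigr => i _; by rewrite mxE.
  rewrite [X in _ / X](bigD1 j) //= invfM mulrCA mulfV ?mulr1 //.
  exact/prodf_neq0.
have areg a : regular setT std_torus (fun A => (pd A a)^-1).
  apply/regularP; exists (fun A => \prod_(b | b != a) pd A b).
    by apply: polyfun_prod => i _; apply: pd_poly.
  exists 1%N => A [z [z0 ->]]; rewrite expr1.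
  have [E d0 _ _] := std_diag z0.
  have -> : \det (std_elt z) = \prod_b pd (std_elt z) b.
    have : \det (P *m std_elt z *m invmx P) = \det (std_elt z).
      by rewrite !det_mulmx mulrAC det_inv divff ?mul1r // -unitfE -unitmxE.
    rewrite E det_diag => <-; apply: eq_bigr => b _; by rewrite mxE.
  rewrite [X in _ / X](bigD1 a) //= invfM mulrCA mulfV ?mulr1 //.
  exact/prodf_neq0.
exists r, (fun B => std_elt (fun j => B j j)); split.
  split.
  - move=> B /diag_torusP [_ B0]; by exists (fun j => B j j).
  - move=> A B /diag_torusP [EA A0] /diag_torusP [EB B0]; rewrite std_eltM.
    by apply: std_elt_eq => j; apply: dg_mulE.
  apply: regular_mul => //; first apply: regular_mul => //.
  - by move=> i j; apply/regular_poly/polyfun_cst.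
  - move=> i j; case: (eqVneq i j) => [->|/negPf ij].
      apply: (@regular_eq _ _ _ (fun B => mono (fun j => B j j) L j)).
        by move=> B _; rewrite dgE eqxx.
      rewrite mono.unlock; apply: regular_prod => // k; apply: regular_expz => //.
      exact/regular_poly/polyfun_entry.
    apply: (@regular_eq _ _ _ (fun=> 0)); last exact/regular_poly/polyfun_cst.
    by move=> B _; rewrite dgE ij.
  by move=> i j; apply/regular_poly/polyfun_cst.
exists (fun A => dg (mono (pd A) S)); split.
- split.
  + move=> A [z [z0 ->]]; have [_ d0 _ _] := std_diag z0.
    by apply: dg_GL => j; apply: mono_neq0.
  + move=> A B [z [z0 EA]] [y [y0 EB]]; rewrite {}EA {}EB dgM std_eltM.
    have zy0 j : z j * y j != 0 by rewrite mulf_neq0.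
    have [_ _ Ez _] := std_diag z0; have [_ _ Ey _] := std_diag y0.
    have [_ _ Ezy _] := std_diag zy0.
    rewrite (eq_dg Ezy); apply: eq_dg => j.
    exact: (esym (f_equal2 *%R (Ez j) (Ey j))).
  move=> i j; case: (eqVneq i j) => [->|/negPf ij].
    apply: (@regular_eq _ _ _ (fun A => mono (pd A) S j)).
      by move=> B _; rewrite dgE eqxx.
    rewrite mono.unlock; apply: regular_prod => // k; apply: regular_expz => //.
    exact/regular_poly/pd_poly.
  apply: (@regular_eq _ _ _ (fun=> 0)); last exact/regular_poly/polyfun_cst.
  by move=> B _; rewrite dgE ij.
- move=> B /diag_torusP [EB B0]; have [_ _ Ez _] := std_diag B0.
  by rewrite [RHS]EB; apply: eq_dg => j; rewrite Ez.
move=> B [z [z0 ->]]; have [_ _ Ez _] := std_diag z0.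
by apply: std_elt_eq => j; rewrite dgE eqxx Ez.
Qed.

End StandardTorus.

Section ProductTorus.
Variable R : realType.
Local Notation C := R[i].

Lemma expz_root (x : C) (k : int) : x != 0 -> k != 0 ->
  exists2 y : C, y != 0 & y ^ k = x.
Proof.
move=> x0 k0.
have H (p : nat) (x' : C) : x' != 0 -> (0 < p)%N -> exists2 y : C, y != 0 & y ^+ p = x'.
  move=> x0' p0; exists (p.-root x'); last exact: rootCK.
  by rewrite rootC_eq0.
case: k k0 => k k0.
  have k1 : (0 < k)%N by rewrite lt0n.
  by have [y y0 yk] := H k x x0 k1; exists y.
have [|y y0 yk] := H k.+1 x^-1 _ isT; first by rewrite invr_eq0.
by exists y => //; rewrite NegzE -exprnN yk invrK.
Qed.

(** Let M = L D N be the Smith form of the matrix of exponents. The invertible L only changes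
    parameters, and a nonzero elementary divisor acts by a surjective power map on nonzero complex
    numbers. Thus the image is the standard torus given by the rows of N with nonzero divisor, and
    the inverse of N provides the matrix S. *)
Lemma product_split_torus m n (mu : 'I_m -> C -> 'M[C]_n) :
  (forall b, cochar (@GL R n) (mu b)) ->
  (forall b b' c c', c != 0 -> c' != 0 ->
     mu b c *m mu b' c' = mu b' c' *m mu b c) ->
  split_torus setT [set A | exists z : 'I_m -> C,
    (forall b, z b != 0) /\ A = \big[mulmx/1%:M]_b mu b (z b)].
Proof.
move=> cmu comm; have [P [UP [M HM]]] := cochar_codiag cmu comm.
have [L UL [N UN [d _ EM]]] := int_Smith_normal_form M.
pose D : 'M[int]_(m, n) := \matrix_(i, j) (d`_i *+ (i == j :> nat)).
pose J := [pred a : 'I_n | (a < m)%N && (d`_a != 0)].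
pose L' : 'M[int]_(#|J|, n) := \matrix_(j, a) N (enum_val j) a.
pose S' : 'M[int]_(n, #|J|) := \matrix_(a, j) invmx N a (enum_val j).
have LS : L' *m S' = 1%:M.
  apply/matrixP => i j; rewrite mulmxij.
  have := congr1 (fun X : 'M_n => X (enum_val i) (enum_val j)) (mulmxV UN).
  rewrite mulmxij !mxE (inj_eq enum_val_inj) => <-; apply: eq_bigr => k _.
  by rewrite !mxE.
have := std_torus_split UP LS; congr split_torus.
have prodE (z : 'I_m -> C) : (forall b, z b != 0) ->
    \big[mulmx/1%:M]_b mu b (z b) = invmx P *m dg (mono z M) *m P.
  move=> z0; set X := \big[_/_]_b _.
  suff <- : P *m X *m invmx P = dg (mono z M) by rewrite !mulmxA mulVmx // mul1mx mulmxKV.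
  rewrite (@big_morph _ _ (fun X => P *m X *m invmx P) 1%:M (@mulmx _ n n n)); last first.
  - by rewrite mulmx1 mulmxV.
  - by move=> A B; rewrite !mulmxA mulmxKV.
  transitivity (\big[mulmx/1%:M]_b dg (fun a => z b ^ M b a)).
    by apply: eq_bigr => b _; rewrite HM.
  rewrite mono.unlock; elim: (index_enum _) => [|b s IH].
    by rewrite big_nil -dg1; apply: eq_dg => a; rewrite big_nil.
  by rewrite big_cons IH dgM; apply: eq_dg => a; rewrite big_cons.
have monoJ (z : 'I_n -> C) a : (forall b, b \notin J -> z b = 1) ->
    mono z N a = mono (fun j : 'I_#|J| => z (enum_val j)) L' a.
  move=> z1; rewrite mono.unlock (bigID (mem J)) /= [X in _ * X]big1 ?mulr1; last first.
    by move=> b /z1 ->; rewrite exp1rz.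
  by rewrite big_enum_val /=; apply: eq_bigr => j _; rewrite mxE.
have monoD (y : 'I_m -> C) (a : 'I_n) :
    mono y D a = if insub (a : nat) is Some b then y b ^ d`_a else 1.
  rewrite mono.unlock; case: insubP => [b _ ba|am].
    rewrite (bigD1 b) //= mxE ba eqxx mulr1n big1 ?mulr1 // => b' b'b.
    rewrite mxE -ba (_ : (b' == b :> nat) = false) ?mulr0n ?expr0z //.
    exact: negbTE.
  rewrite big1 // => b _; rewrite mxE (_ : (b == a :> nat) = false) ?mulr0n ?expr0z //.
  by apply/negbTE/eqP => ba; rewrite -ba ltn_ord in am.
apply/seteqP; split=> A /=.
  move=> [z [z0 ->]].
  pose zt (a : 'I_n) : C := \prod_(j | enum_val j == a) z j.
  have ztJ j : zt (enum_val j) = z j.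
    rewrite /zt (bigD1 j) //= big1 ?mulr1 // => k /andP [/eqP /enum_val_inj -> ].
    by rewrite eqxx.
  have zt1 b : b \notin J -> zt b = 1.
    move=> bJ; rewrite /zt big1 // => j /eqP jb; move: bJ.
    by rewrite -jb enum_valP.
  have zt0 b : zt b != 0 by apply/prodf_neq0.
  have H (b : 'I_m) : exists y : C, y != 0 /\
      (forall a : 'I_n, a = b :> nat -> a \in J -> y ^ d`_a = zt a).
    case: (ltnP b n) => [bn|nb]; last first.
      exists 1; split; first exact: oner_neq0.
      by move=> a ab; have := ltn_ord a; rewrite ab ltnNge nb.
    case: (boolP (Ordinal bn \in J)) => bJ.
      have := bJ; rewrite inE /= => /andP [_ db].
      have [y y0 Ey] := expz_root (zt0 (Ordinal bn)) db.
      exists y; split=> // a ab _; have -> : a = Ordinal bn by apply: val_inj.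
      exact: Ey.
    exists 1; split; first exact: oner_neq0.
    move=> a ab; have -> : a = Ordinal bn by apply: val_inj.
    by rewrite (negPf bJ).
  have [y Hy] := choice H.
  exists (mono y (invmx L)); have y0 b : y b != 0 by case: (Hy b).
  split; first by move=> b; apply: mono_neq0.
  rewrite prodE => [|b]; last exact: mono_neq0.
  apply: conj_eq => a.
  rewrite mono_comp // EM mulmxA mulmxA mulVmx // mul1mx -mono_comp //.
  rewrite -(eq_mono _ _ (fun j => ztJ j)) -monoJ //; apply: eq_mono => b.
  rewrite monoD; case: insubP => [b' _ bb'|bm].
    case: (boolP (b \in J)) => bJ; first by have [_ ->] := Hy b'.
    rewrite zt1 //; move: bJ; rewrite inE negb_and -bb' ltn_ord /= negbK => /eqP ->.
    by rewrite expr0z.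
  by rewrite zt1 // inE (negPf bm).
move=> [z [z0 ->]]; rewrite prodE //.
pose y := mono z L; have y0 b : y b != 0 by apply: mono_neq0.
exists (fun j : 'I_#|J| => mono y D (enum_val j)); split.
  by move=> j; apply: mono_neq0.
apply: conj_eq => a.
rewrite EM -mono_comp // -(eq_mono _ _ (fun b => mono_comp L D b z0)) -/y.
rewrite -monoJ // => b bJ; rewrite monoD; case: insubP => // b' _ bb'.
by move: bJ; rewrite inE negb_and -bb' ltn_ord /= negbK => /eqP ->; rewrite expr0z.
Qed.

End ProductTorus.

Section SplitTori.
Variables (R : realType) (n : nat).
Local Notation C := R[i].
Implicit Types (T G : set 'M[C]_n).

Lemma laur_pow (F : C -> C) (k : int) : laur F -> laur (fun c => F (c ^ k)).
Proof.
move=> [K [Q FQ]].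
apply: (@laur_eq _ (fun c => c ^ (- (k * K%:Z)) *
    \sum_(j < size Q) Q`_j * c ^ (k * j%:Z))).
  move=> c c0; have ck : c ^ k != 0 by rewrite expfz_neq0.
  have -> : \sum_(j < size Q) Q`_j * c ^ (k * j%:Z) = Q.[c ^ k].
    by rewrite horner_coef; apply: eq_bigr => j _; rewrite -exprz_exp -exprnP.
  rewrite -FQ // mulrA -invr_expz -exprz_exp -exprnP mulVf ?mul1r //.
  by rewrite expf_neq0.
apply: laurM; first exact: laur_expz.
by apply: laur_sum => j; apply: laurM; [exact: laur_cst|exact: laur_expz].
Qed.

Lemma cochar_pow T m (k : int) : cochar T m -> cochar T (fun c => m (c ^ k)).
Proof.
move=> [mT mM mL]; split.
- by move=> c c0; apply: mT; rewrite expfz_neq0.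
- by move=> c d c0 d0; rewrite expfzMl mM // expfz_neq0.
by move=> i j; apply: (laur_pow k (mL i j)).
Qed.

Lemma cochar_cst1 T : T 1%:M -> cochar T (fun=> 1%:M).
Proof. by move=> T1; split=> // [c d _ _|i j]; [rewrite mulmx1|exact: laur_cst]. Qed.

Lemma cochar_prod T (J : Type) (r : seq J) (m : J -> C -> 'M[C]_n) :
  submonoid T -> (forall A B, T A -> T B -> A *m B = B *m A) ->
  (forall a, cochar T (m a)) ->
  cochar T (fun c => \big[mulmx/1%:M]_(a <- r) m a c).
Proof.
move=> mT Tc cm; elim: r => [|a r [H1 H2 H3]].
  have [H1 H2 H3] := cochar_cst1 (proj1 mT); split.
  - by move=> c c0; rewrite big_nil; apply: H1 c0.
  - by move=> c d c0 d0; rewrite !big_nil; apply: H2 c0 d0.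
  by move=> i j; apply: laur_eq (H3 i j) => c _; rewrite big_nil.
have [H1' H2' H3'] := cocharM mT Tc (cm a) (And3 H1 H2 H3).
split.
- by move=> c c0; rewrite big_cons; apply: H1'.
- by move=> c d c0 d0; rewrite !big_cons; apply: H2'.
by move=> i j; apply: laur_eq (H3' i j) => c _; rewrite big_cons.
Qed.

Definition torus_coords T d (ep : 'I_d -> C -> 'M[C]_n) :=
  [/\ subgroup T, forall A B, T A -> T B -> A *m B = B *m A,
      forall a, cochar T (ep a)
    & forall t, T t -> exists z : 'I_d -> C,
        (forall a, z a != 0) /\ t = \big[mulmx/1%:M]_a ep a (z a)].

Lemma split_torus_coords k T : split_torus k T ->
  exists d (ep : 'I_d -> C -> 'M[C]_n), torus_coords T ep.
Proof.
move=> [[Tcl Tsub] [d [f [[fT fM fR] [f' [[fT' fM' fR'] ff' f'f]]]]]].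
pose co (a : 'I_d) (c : C) := dg (fun b => if b == a then c else 1).
have co0 a c : c != 0 -> diag_torus (co a c).
  by move=> c0; apply: dg_GL => b; case: ifP; rewrite ?oner_neq0.
have coM a c e : co a (c * e) = co a c *m co a e.
  by rewrite dgM; apply: eq_dg => b; case: ifP; rewrite ?mulr1.
have DT := @diag_torus_subgroup R d; have [DG [D1 DM] DV] := DT.
have Tc A B : T A -> T B -> A *m B = B *m A.
  move=> TA TB; rewrite -(f'f A TA) -(f'f B TB) -!fM; try exact: fT'.
  congr f; have [-> _] := diag_torusP (fT' A TA); have [-> _] := diag_torusP (fT' B TB).
  by rewrite !dgM; apply: eq_dg => a; rewrite mulrC.
have [TG [T1 TM] TV] := Tsub.
exists d, (fun a c => f (co a c)); split=> //.
  move=> a; split.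
  - by move=> c c0; apply: fT; apply: co0.
  - by move=> c e c0 e0; rewrite coM fM //; apply: co0.
  have coL i j : laur (fun c => co a c i j).
    apply: (@laur_eq _ (fun c => if i == j then (if i == a then c else 1) else 0)).
      by move=> c _; rewrite dgE; case: (i == j).
    case: (i == j); last exact: laur_cst.
    case: (i == a); last exact: laur_cst.
    exact: (laur_expz R 1).
  have det0 c : c != 0 -> \det (co a c) != 0.
    by move=> c0; rewrite -unitfE -unitmxE; apply: DG; apply: co0.
  have [e de] : exists k : int, forall c, c != 0 -> \det (co a c) = c ^ k.
    apply: laur_mult; first exact: laur_det.
      by apply: det0; rewrite oner_neq0.
    by move=> c e c0 e0; rewrite coM det_mulmx.
  move=> i j; have [p [N [_ Hp]]] := fR i j.
  apply: (@laur_eq _ (fun c => mxeval p (co a c) * c ^ (e * - N%:Z))).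
    by move=> c c0; rewrite Hp ?de -?exprz_exp -?exprnN //; apply: co0.
  by apply: laurM; [exact: laur_mxeval|exact: laur_expz].
have f1 : f 1%:M = 1%:M.
  have := fM 1%:M 1%:M D1 D1; rewrite mulmx1 => E.
  have U := TG _ (fT _ D1).
  by have := congr1 (mulmx (invmx (f 1%:M))) E; rewrite mulKmx // mulVmx.
move=> t Tt; have [Et t0] := diag_torusP (fT' t Tt).
exists (fun a => f' t a a); split=> //.
rewrite -[LHS](f'f t Tt) {1}Et.
have prodE (r : seq 'I_d) (y : 'I_d -> C) : (forall a, y a != 0) -> uniq r ->
    \big[mulmx/1%:M]_(a <- r) f (co a (y a)) =
    f (dg (fun a => if a \in r then y a else 1)).
  move=> y0; elim: r => [|a r IH] /=.
    by move=> _; rewrite big_nil -{1}f1 -dg1.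
  move=> /andP [ar ur]; rewrite big_cons IH // -fM; last first.
  - by apply: dg_GL => b; case: ifP; rewrite ?oner_neq0.
  - exact: co0.
  congr f; rewrite dgM; apply: eq_dg => b; rewrite in_cons.
  case: eqP => [->|_] /=; last by rewrite mul1r.
  by rewrite (negPf ar) mulr1.
rewrite prodE ?index_enum_uniq //; congr f; apply: eq_dg => a.
by rewrite mem_index_enum.
Qed.

Lemma character_prod T (a : 'M[C]_n -> C) (J : Type) (r : seq J) (m : J -> 'M[C]_n) :
  subgroup T -> character T a -> (forall j, T (m j)) ->
  a (\big[mulmx/1%:M]_(j <- r) m j) = \prod_(j <- r) a (m j).
Proof.
move=> [TG [T1 TM] TV] [aG aM aR] mT.
have aM' A B : T A -> T B -> a (A *m B) = a A * a B.
  move=> TA TB; have := aM A B TA TB; rewrite -scalar_mxM.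
  by move/matrixP/(_ 0 0); rewrite !mxE eqxx !mulr1n.
have a0 A : T A -> a A != 0.
  move=> TA; have := aG A TA; rewrite /GL /= unitmxE det_scalar1.
  by rewrite unitfE.
have a1 : a 1%:M = 1.
  apply: (mulfI (a0 _ T1)); by rewrite -aM' // mulmx1 mulr1.
suff [_ ->] : T (\big[mulmx/1%:M]_(j <- r) m j) /\
   a (\big[mulmx/1%:M]_(j <- r) m j) = \prod_(j <- r) a (m j) by [].
elim: r => [|j r [IH1 IH2]]; first by rewrite !big_nil.
by rewrite !big_cons aM' // IH2; split=> //; apply: TM.
Qed.

Lemma denominators p q (A : 'M[rat]_(p, q)) :
  exists (k : nat) (B : 'M[int]_(p, q)), (0 < k)%N /\ k%:R *: A = map_mx intr B.
Proof.
pose D := \prod_ij `|denq (A ij.1 ij.2)|%N.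
have D0 : (0 < D)%N by apply: prodn_gt0 => ij; rewrite absz_gt0 denq_neq0.
pose B (i : 'I_p) (j : 'I_q) :=
  numq (A i j) * (\prod_(kl | kl != (i, j)) `|denq (A kl.1 kl.2)|%N)%N%:Z.
exists D, (\matrix_(i, j) B i j); split=> //.
apply/matrixP => i j; rewrite !mxE /B /D (bigD1 (i, j)) //=.
set E := (\prod_(kl | _) _)%N; rewrite natrM rmorphM /= -[X in _ * X = _]divq_num_den mulrAC.
have -> : (`|denq (A i j)|%N)%:R = (denq (A i j))%:~R :> rat.
  by rewrite -[in RHS](gez0_abs (denq_ge0 _)).
by rewrite [_ / _]mulrC mulVKf // intr_eq0 denq_neq0.
Qed.

(** The exponents of the characters a_i along the cocharacters [ep b] form a matrix with independent
    rows over the rationals, because an integral relation between rows is a multiplicative relation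
    between the a_i. A rational right inverse, multiplied by a common denominator q, gives the
    exponents of the [mu j]. *)
Lemma fundamental_cochars T d (ep : 'I_d -> C -> 'M[C]_n) (I : finType)
    (a : I -> 'M[C]_n -> C) : torus_coords T ep ->
  (forall i, character T (a i)) ->
  (forall m : I -> int,
     (forall t, T t -> \prod_i a i t ^ m i = 1) -> forall i, m i = 0) ->
  exists q : nat, (0 < q)%N /\ exists mu : I -> C -> 'M[C]_n,
    forall j, cochar T (mu j) /\
      forall i c, c != 0 -> a i (mu j c) = c ^+ (if i == j then q else 0).
Proof.
move=> [sT Tc cep tT] ca ind; have [TG mT TV] := sT.
have H (ib : I * 'I_d) : exists k : int, forall c, c != 0 ->
    a ib.1 (ep ib.2 c) = c ^ k.
  exact: (cochar_char TG (cep ib.2) (ca ib.1)).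
have [A HA] := choice H.
pose M : 'M[rat]_(#|I|, d) := \matrix_(i, b) (A (enum_val i, b))%:~R.
have Mfree : row_free M.
  apply/negPn/negP; rewrite -kermx_eq0 => /rowV0Pn [v /sub_kermxP vM v0].
  have [k [B [k0 kB]]] := denominators v.
  have m0 : forall i, B 0 (enum_rank i) = 0.
    apply: (ind (fun i => B 0 (enum_rank i))) => t Tt.
    have [z [z0 ->]] := tT t Tt.
    under eq_bigr => i _.
      rewrite (character_prod _ sT (ca i)); last by move=> b; case: (cep b) => H' _ _; apply: H'.
      rewrite expfz_prod; over.
    rewrite exchange_big big1 //= => b _.
    under eq_bigr => i _ do rewrite (HA (i, b)) // exprz_exp.
    rewrite -expfz_sum //.
    suff -> : \sum_i A (i, b) * B 0 (enum_rank i) = 0 by rewrite expr0z.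
    apply/eqP; rewrite -(intr_eq0 rat) rmorph_sum /=.
    have : (k%:R *: v *m M) 0 b = 0 by rewrite -scalemxAl vM scaler0 mxE.
    rewrite kB mulmxij => /eqP; congr (_ == 0).
    rewrite (reindex_omap (enum_val (A := I)) (fun i => Some (enum_rank i))) /=; last first.
      by move=> i _; rewrite enum_rankK.
    apply: congr_big => // [i|i _]; first by rewrite enum_valK eqxx.
    by rewrite !mxE enum_valK rmorphM mulrC.
  case/eqP: v0; apply/rowP => i; apply/eqP.
  have k1 : k%:R != 0 :> rat by rewrite pnatr_eq0 -lt0n.
  rewrite mxE -(inj_eq (mulfI k1)) mulr0.
  have := congr1 (fun X : 'rV_#|I| => X 0 i) kB; rewrite !mxE => ->.
  by have := m0 (enum_val i); rewrite enum_valK => ->.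
have [N MN] := row_freeP Mfree.
have [q [B [q0 qB]]] := denominators N.
exists q; split=> //.
exists (fun j c => \big[mulmx/1%:M]_b ep b (c ^ B b (enum_rank j))) => j.
split; first by apply: cochar_prod => // b; apply: cochar_pow.
move=> i c c0; rewrite (character_prod _ sT (ca i)); last first.
  by move=> b; case: (cep b) => H' _ _; apply: H'; rewrite expfz_neq0.
under eq_bigr => b _ do rewrite (HA (i, b)) ?expfz_neq0 // exprz_exp.
rewrite -expfz_sum //.
suff -> : \sum_b B b (enum_rank j) * A (i, b) = (if i == j then q else 0%N) by [].
apply/eqP; rewrite -(eqr_int rat) rmorph_sum /=.
have : (M *m (q%:R *: N)) (enum_rank i) (enum_rank j) = (q%:R *: 1%:M : 'M_#|I|) (enum_rank i) (enum_rank j).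
  by rewrite -scalemxAr MN.
rewrite qB mulmxij !mxE (inj_eq enum_rank_inj) => E.
have -> : ((if i == j then q else 0%N)%:Z)%:~R = q%:R * (i == j)%:R :> rat.
  by case: eqP => _; rewrite ?mulr1 ?mulr0.
apply/eqP; rewrite -E; apply: eq_bigr => b _.
by rewrite !mxE enum_rankK rmorphM mulrC.
Qed.

(** The products of T with the image of m form a split torus of G containing T, which is T by
    maximality. This places the coroots in T_0. *)
Lemma cochar_in_max_torus G T (m : C -> 'M[C]_n) :
  subgroup G -> maximal_torus G T -> cochar G m ->
  (forall c t, c != 0 -> T t -> m c *m t = t *m m c) ->
  forall c, c != 0 -> T (m c).
Proof.
move=> [GG [G1 GM] _] [Tst TsubG Tmax] cm mTc c c0.
have [d [ep [sT Tc cep tT]]] := split_torus_coords Tst.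
have [TG [T1 TM] TV] := sT.
pose mu (b : 'I_d.+1) := if unlift ord0 b is Some a then ep a else m.
have mu0 : mu ord0 = m by rewrite /mu unlift_none.
have muS a : mu (lift ord0 a) = ep a by rewrite /mu liftK.
have cGL (H : set 'M[C]_n) m' : H `<=` @GL R n -> cochar H m' -> cochar (@GL R n) m'.
  by move=> HG [H1 H2 H3]; split=> // e e0; apply: HG; apply: H1.
have cmu b : cochar (@GL R n) (mu b).
  rewrite /mu; case: (unlift ord0 b) => [a|]; first exact: (cGL T).
  exact: (cGL G).
have mep a e : e != 0 -> T (ep a e) by move=> e0; case: (cep a) => H _ _; apply: H.
have comm b b' e e' : e != 0 -> e' != 0 ->
   mu b e *m mu b' e' = mu b' e' *m mu b e.
  move=> e0 e0'; rewrite /mu.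
  case: (unlift ord0 b) => [a|]; case: (unlift ord0 b') => [a'|].
  - by apply: Tc; apply: mep.
  - by rewrite -mTc //; apply: mep.
  - by apply: mTc => //; apply: mep.
  by have [_ mM _] := cm; rewrite -!mM // mulrC.
set T' := [set A | exists z : 'I_d.+1 -> C,
    (forall b, z b != 0) /\ A = \big[mulmx/1%:M]_b mu b (z b)].
have prodG z : (forall b, z b != 0) -> \big[mulmx/1%:M]_b mu b (z b) =
    m (z ord0) *m \big[mulmx/1%:M]_a ep a (z (lift ord0 a)).
  move=> z0; rewrite big_ord_recl mu0; congr (_ *m _).
  by apply: eq_bigr => a _; rewrite muS.
have prodT (z : 'I_d -> C) : (forall b, z b != 0) -> T (\big[mulmx/1%:M]_a ep a (z a)).
  by move=> z0; apply: big_ind => // a _; apply: mep.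
have [mG mM _] := cm.
have <- : T' = T.
  apply: Tmax; first exact: product_split_torus.
    move=> A [z [z0 ->]]; rewrite prodG //; apply: GM; first exact: mG.
    by apply: TsubG; apply: prodT => a.
  move=> t /tT [z [z0 ->]].
  exists (fun b => if unlift ord0 b is Some a then z a else 1); split.
    by move=> b; case: (unlift ord0 b) => [a|]; rewrite ?oner_neq0.
  rewrite prodG; last by move=> b; case: (unlift ord0 b) => [a|]; rewrite ?oner_neq0.
  rewrite unlift_none (cochar1 GG cm) mul1mx.
  by apply: eq_bigr => a _; rewrite liftK.
exists (fun b => if unlift ord0 b is Some a then 1 else c); split.
  by move=> b; case: (unlift ord0 b) => [a|]; rewrite ?oner_neq0.
rewrite prodG; last by move=> b; case: (unlift ord0 b) => [a|]; rewrite ?oner_neq0.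
rewrite unlift_none (_ : \big[mulmx/1%:M]_a _ = 1%:M) ?mulmx1 //.
apply: (big_ind (fun A => A = 1%:M)) => // [A B -> ->|a _]; first by rewrite mulmx1.
by rewrite liftK (cochar1 TG (cep a)).
Qed.

End SplitTori.

(** Among the subspaces inside Q, one of maximal dimension contains every vector of Q, since
    otherwise that vector could be added. *)
Lemma vspace_of (K : fieldType) (vT : vectType K) (Q : vT -> Prop) :
  Q 0 -> (forall a u v, Q u -> Q v -> Q (a *: u + v)) ->
  exists U : {vspace vT}, forall v, v \in U <-> Q v.
Proof.
move=> Q0 Qlin.
pose P d := `[< exists U : {vspace vT}, \dim U = d /\ forall v, v \in U -> Q v >].
have exP : exists d, P d.
  exists 0%N; apply/asboolP; exists 0%VS; rewrite dimv0; split=> // v.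
  by rewrite memv0 => /eqP ->.
have bP d : P d -> (d <= \dim {:vT})%N.
  by move=> /asboolP [U [<- _]]; apply/dimvS/subvf.
case: (ex_maxnP exP bP) => d /asboolP [U [Ud UQ]] dmax.
exists U => v; split; first exact: UQ.
move=> Qv; apply/negPn/negP => vU.
have : P (\dim (U + <[v]>)%VS).
  apply/asboolP; exists (U + <[v]>)%VS; split=> // u /memv_addP [u1 u1U [u2]].
  by move=> /vlineP [a ->] ->; rewrite addrC; apply: Qlin => //; apply: UQ.
move/dmax; rewrite -Ud => D.
have /eqP E : U == (U + <[v]>)%VS by rewrite eqEdim addvSl.
by case/negP: vU; rewrite E; apply: (subvP (addvSr U _)); apply: memv_line.
Qed.

(** * The Lie-Kolchin theorem *)

Section LieKolchin.
Variable R : realType.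
Local Notation C := R[i].

(** The split characteristic polynomial of M kills v by Cayley-Hamilton. Applying its linear factors
    one by one, the last nonzero vector is an eigenvector, and it has not left U. *)
Lemma eigenvector_in m (U : {vspace 'rV[C]_m}) (M : 'M[C]_m) (v : 'rV[C]_m) :
  v \in U -> v != 0 -> (forall u, u \in U -> u *m M \in U) ->
  exists (u : 'rV[C]_m) (x : C), [/\ u \in U, u != 0 & u *m M = x *: u].
Proof.
move=> vU v0 UM; case: m => [|m] in U M v vU v0 UM *.
  by case/eqP: v0; apply/rowP => -[].
have [s Es] := closed_field_poly_normal (char_poly M).
have CH : horner_mx M (char_poly M) = 0 := Cayley_Hamilton M.
move: CH; rewrite Es linearZ /= (monicP (char_poly_monic M)) scale1r => CH.
have : v *m horner_mx M (\prod_(z <- s) ('X - z%:P)) = 0 by rewrite CH mulmx0.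
elim: s v vU v0 {Es CH} => [|z s IH] v vU v0.
  by rewrite big_nil rmorph1 mulmx1 => /eqP; rewrite (negPf v0).
rewrite big_cons rmorphM /= rmorphB /= horner_mx_X horner_mx_C -mulmxE mulmxA.
case: (eqVneq (v *m (M - z%:M)) 0) => [E _|vM0].
  exists v, z; split=> //; apply/eqP; rewrite -subr_eq0 -mul_mx_scalar -mulmxBr.
  exact/eqP.
apply: IH => //; rewrite mulmxBr mul_mx_scalar.
by apply: memvB; [exact: UM|exact: memvZ].
Qed.

Definition polyrep n m (H : set 'M[C]_n) (rho : 'M[C]_n -> 'M[C]_m) :=
  [/\ polymap rho, rho 1%:M = 1%:M
    & forall A B, H A -> H B -> rho (A *m B) = rho A *m rho B].

Lemma polyrep_unit n m (H : set 'M[C]_n) (rho : 'M[C]_n -> 'M[C]_m) A :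
  subgroup H -> polyrep H rho -> H A -> rho A \in unitmx.
Proof.
move=> [HG _ HV] [_ r1 rM] HA.
have : rho A *m rho (invmx A) = 1%:M by rewrite -rM ?mulmxV //; [exact: HG|exact: HV].
by case/mulmx1_unit.
Qed.

(* A connected group cannot move an eigenvector of M to another of the
   finitely many eigenvalues of M. *)
Lemma constant_eigenvalue n m (H : set 'M[C]_n) (rho : 'M[C]_n -> 'M[C]_m)
    (M : 'M[C]_m) (w : 'rV[C]_m) (x : C) :
  subgroup H -> zconnected H -> polyrep H rho -> w != 0 ->
  (forall Y, H Y -> exists c, w *m rho Y *m M = c *: (w *m rho Y)) ->
  w *m M = x *: w ->
  forall Y, H Y -> w *m rho Y *m M = x *: (w *m rho Y).
Proof.
move=> sH cH rH w0 wY wM Y HY; have [HG [H1 _] _] := sH; have [rP r1 rM] := rH.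
case: m => [|m] in rho M w rH w0 wY wM rP r1 rM *.
  by case/eqP: w0; apply/rowP => -[].
have [s Es] := closed_field_poly_normal (char_poly M).
pose t := [seq c <- s | c != x].
(* The vectors w rho(Z) are eigenvectors of M, and N kills such a vector exactly when its eigenvalue
   is not x. This makes [F1] and [F2] complementary closed conditions on H. *)
pose N := \big[mulmx/1%:M]_(c <- t) (M - c%:M).
have uN u c : u *m M = c *: u -> u *m N = (\prod_(d <- t) (c - d)) *: u.
  move=> uM; rewrite /N; elim: (t) => [|d t' IH].
    by rewrite !big_nil mulmx1 scale1r.
  rewrite !big_cons mulmxA mulmxBr uM mul_mx_scalar -scalerBl -scalemxAl IH.
  by rewrite scalerA.
have wr0 Z : H Z -> w *m rho Z != 0.
  move=> HZ; apply/eqP => E; case/eqP: w0.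
  by rewrite -(mulmxK (polyrep_unit sH rH HZ) w) E mul0mx.
have ptm (B : 'M[C]_m.+1) (b : 'I_m.+1) (d : C) :
    polyfun (fun A => (w *m rho A *m B - d *: (w *m rho A)) 0 b).
  apply: (@polyfun_eq _ _ (fun A => \sum_k (\sum_l w 0 l * rho A l k) * B k b -
      d * (\sum_l w 0 l * rho A l b))).
    move=> A; have sub (A' B' : 'rV[C]_m.+1) :
      (A' - d *: B') 0 b = A' 0 b - d * B' 0 b by rewrite !mxE.
    rewrite sub 2!mulmxij; congr (_ - _); apply: eq_bigr => k _.
    by rewrite mulmxij.
  apply: polyfunB; last first.
    apply: polyfunM; first exact: polyfun_cst.
    by apply: polyfun_sum => l _; apply: polyfunM; [exact: polyfun_cst|exact: rP].
  apply: polyfun_sum => k _; apply: polyfunM; last exact: polyfun_cst.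
  by apply: polyfun_sum => l _; apply: polyfunM; [exact: polyfun_cst|exact: rP].
pose F1 := [set A | GL A /\ forall b, (w *m rho A *m M - x *: (w *m rho A)) 0 b = 0].
pose F2 := [set A | GL A /\ forall b, (w *m rho A *m N - 0 *: (w *m rho A)) 0 b = 0].
have F1P Z : H Z -> F1 Z <-> w *m rho Z *m M = x *: (w *m rho Z).
  move=> HZ; split=> [[_ E]|E]; last by split=> [|b]; [exact: HG|rewrite E subrr mxE].
  by apply/eqP; rewrite -subr_eq0; apply/eqP/rowP => b; rewrite E mxE.
have F2P Z : H Z -> F2 Z <-> w *m rho Z *m N = 0.
  move=> HZ; split=> [[_ E]|E].
    by apply/rowP => b; have := E b; rewrite scale0r subr0 => ->; rewrite mxE.
  by split=> [|b]; [exact: HG|rewrite E scale0r subr0 mxE].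
have eigs Z c : H Z -> w *m rho Z *m M = c *: (w *m rho Z) -> c \in s.
  move=> HZ E; have : eigenvalue M c.
    by apply/eigenvalueP; exists (w *m rho Z) => //; apply: wr0.
  rewrite eigenvalue_root_char Es rootZ; last first.
    by rewrite (monicP (char_poly_monic M)) oner_neq0.
  by rewrite root_prod_XsubC.
apply/(F1P Y HY); apply: contrapT => nF1.
have cover Z : H Z -> F1 Z \/ F2 Z.
  move=> HZ; have [c Ec] := wY Z HZ; case: (eqVneq c x) => cx.
    by left; apply/F1P => //; rewrite -cx.
  right; apply/F2P => //; rewrite (uN _ _ _ Ec).
  suff -> : \prod_(d <- t) (c - d) = 0 by rewrite scale0r.
  apply/eqP; rewrite prodf_seq_eq0; apply/hasP; exists c; last by rewrite subrr eqxx.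
  by rewrite mem_filter cx (eigs Z).
apply: cH; exists F1, F2; split.
- by split; apply: zclosed_polyfun => b; apply: ptm.
- by move=> Z /cover.
- apply/seteqP; split=> // Z [[HZ /(F1P Z HZ) E1] /(F2P Z HZ)].
  rewrite (uN _ _ _ E1) => /eqP; rewrite scaler_eq0 (negPf (wr0 _ HZ)) orbF.
  rewrite prodf_seq_eq0 => /hasP [c]; rewrite mem_filter => /andP [cx _] /=.
  by rewrite subr_eq0 eq_sym (negPf cx).
- by exists 1%:M; split=> //; apply/F1P => //; rewrite r1 mulmx1.
by exists Y; split=> //; case: (cover Y HY).
Qed.

Lemma derived_sub n (H : set 'M[C]_n) : subgroup H -> derived H `<=` H.
Proof.
move=> sH A; apply; split=> // X [B [D [HB HD ->]]].
have [_ [_ HM] HV] := sH.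
exact: (HM _ _ (HM _ _ (HM _ _ HB HD) (HV _ HB)) (HV _ HD)).
Qed.

Lemma derived_subgroup n (H : set 'M[C]_n) : subgroup H -> subgroup (derived H).
Proof.
move=> sH; split.
- by move=> A /(derived_sub sH); case: sH => HG _ _; apply: HG.
- split; first by move=> S [[_ [S1 _] _] _].
  by move=> A B HA HB S SS; have [[_ [_ SM] _] _] := SS; apply: SM; [exact: HA|exact: HB].
by move=> A HA S SS; have [[_ _ SV] _] := SS; apply: SV; apply: HA.
Qed.

Lemma derived_comm n (H : set 'M[C]_n) A B : H A -> H B ->
  derived H (A *m B *m invmx A *m invmx B).
Proof. by move=> HA HB S [_]; apply; exists A, B. Qed.

Lemma derived_ind n (H S : set 'M[C]_n) : subgroup H -> S 1%:M ->
  (forall A B, derived H A -> derived H B -> S A -> S B -> S (A *m B)) ->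
  (forall A, derived H A -> S A -> S (invmx A)) ->
  (forall A B, H A -> H B -> S (A *m B *m invmx A *m invmx B)) ->
  derived H `<=` S.
Proof.
move=> sH S1 SM SV Sc A dA.
suff [] : (derived H `&` S) A by [].
have [dG [d1 dM] dV] := derived_subgroup sH.
apply: dA; split.
  split.
  - by move=> B [/dG].
  - split; first by split.
    by move=> B D [dB SB] [dD SD]; split; [exact: dM|exact: SM].
  by move=> B [dB SB]; split; [exact: dV|exact: SV].
by move=> _ [B [D [HB HD ->]]]; split; [exact: derived_comm|exact: Sc].
Qed.

Lemma derived_normal n (H : set 'M[C]_n) A B : subgroup H ->
  derived H A -> H B -> derived H (B *m A *m invmx B).
Proof.
move=> sH dA HB; have [dG [_ dM] _] := derived_subgroup sH.
have HA := derived_sub sH dA.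
have -> : B *m A *m invmx B = (B *m A *m invmx B *m invmx A) *m A.
  by rewrite mulmxKV //; apply: dG.
by apply: dM => //; apply: derived_comm.
Qed.

(** For fixed X and A, the map sending B to X [A, B] takes 1 to X and maps the connected group H
    into its derived group. So the parts of a separation are stable under right multiplication by
    commutators. *)
Lemma derived_connected n (H : set 'M[C]_n) :
  subgroup H -> zconnected H -> zconnected (derived H).
Proof.
move=> sH cH [F1 [F2 [[cF1 cF2] cov dis ne1 ne2]]].
have [HG [H1 HM] HV] := sH; have [dG [d1 dM] dV] := derived_subgroup sH.
have step (E1 E2 : set 'M[C]_n) X A B : zclosed setT E1 -> zclosed setT E2 ->
    derived H `<=` E1 `|` E2 -> derived H `&` E1 `&` E2 = set0 ->
    derived H X -> E1 X -> H A -> H B ->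
    E1 (X *m (A *m B *m invmx A *m invmx B)).
  move=> cE1 cE2 cv ds dX E1X HA HB; apply: contrapT => nE.
  (* The adjugate in place of the inverse of Y keeps [Phi] polynomial; the determinant is divided
     out in [PhiE]. *)
  pose Phi (Y : 'M[C]_n) := X *m A *m Y *m invmx A *m \adj Y.
  have PhiE Y : GL Y -> (\det Y)^-1 *: Phi Y = X *m (A *m Y *m invmx A *m invmx Y).
    by move=> GY; rewrite [invmx Y]invmxE // /Phi -!scalemxAr !mulmxA.
  have polyPhi : polymap Phi.
    do 2?[apply: polymapM; last exact: polymap_adj || exact: polymap_cst].
    by apply: polymapM; [exact: polymap_cst|exact: polymap_id].
  have d0 Y : GL Y -> \det Y != 0 by rewrite /GL /= unitmxE unitfE.
  have GPhi Y : GL Y -> GL ((\det Y)^-1 *: Phi Y).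
    move=> GY; rewrite PhiE // /GL /= !unitmx_mul (dG X dX) (HG A HA) GY.
    by rewrite !unitmx_inv (HG A HA) GY.
  have pre E : zclosed setT E ->
      zclosed setT [set Y | GL Y /\ E ((\det Y)^-1 *: Phi Y)].
    by move=> cE; apply: (zclosed_preim (polyfun_det R n) polyPhi cE).
  have dY Y : H Y -> derived H ((\det Y)^-1 *: Phi Y).
    by move=> HY; rewrite PhiE; [apply: dM => //; apply: derived_comm|exact: HG].
  apply: cH; exists [set Y | GL Y /\ E1 ((\det Y)^-1 *: Phi Y)],
                     [set Y | GL Y /\ E2 ((\det Y)^-1 *: Phi Y)]; split.
  - by split; apply: pre.
  - move=> Y HY; have GY := HG Y HY.
    by case: (cv _ (dY Y HY)) => E; [left|right].
  - apply/seteqP; split=> // Y [[HY [_ e1]] [_ e2]] /=.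
    by rewrite -[False]/(set0 ((\det Y)^-1 *: Phi Y)) -ds; split=> //; split=> //; apply: dY.
  - exists 1%:M; split=> //; split; first exact: HG.
    rewrite PhiE; last exact: HG.
    by rewrite mulmx1 mulmxV ?mul1mx; [rewrite invmx1 mulmx1|exact: HG].
  exists B; split=> //; split; first exact: HG.
  have := cv _ (dY B HB); rewrite PhiE; last exact: HG.
  by case.
have inv E1 E2 : zclosed setT E1 -> zclosed setT E2 ->
    derived H `<=` E1 `|` E2 -> derived H `&` E1 `&` E2 = set0 ->
    E1 1%:M -> derived H `<=` E1.
  move=> cE1 cE2 cv ds E11.
  have cv' : derived H `<=` E2 `|` E1 by move=> Y /cv [|]; [right|left].
  have ds' : derived H `&` E2 `&` E1 = set0.
    by rewrite -setIA [E2 `&` _]setIC setIA.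
  (* An equivalence rather than an implication, so that the induction over the derived subgroup
     passes through inverses. *)
  have both X Z : derived H X -> derived H Z -> (E1 X <-> E1 (X *m Z)).
    move=> dX dZ; move: Z dZ X dX.
    apply: (derived_ind sH) => //=.
    - by move=> X _; rewrite mulmx1.
    - move=> A B dA dB EA EB X dX; rewrite mulmxA.
      by apply: (iff_trans (EA X dX)); apply: EB; apply: dM.
    - move=> A dA EA X dX; have U : A \in unitmx by apply: dG.
      have := EA (X *m invmx A) (dM _ _ dX (dV _ dA)); rewrite mulmxKV //.
      by move=> E; split=> /E.
    move=> A B HA HB X dX; split=> [E|E]; first exact: (step E1 E2).
    case: (cv X dX) => // E2X; exfalso.
    have E2' := step E2 E1 X A B cE2 cE1 cv' ds' dX E2X HA HB.
    have dXY : derived H (X *m (A *m B *m invmx A *m invmx B)).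
      by apply: dM => //; apply: derived_comm.
    by rewrite -[False]/(set0 (X *m (A *m B *m invmx A *m invmx B))) -ds; split=> //; split.
  by move=> Z dZ; have [E _] := both _ _ d1 dZ; rewrite mul1mx in E; apply: E.
have cov' : derived H `<=` F2 `|` F1 by move=> Y /cov [|]; [right|left].
have dis' : derived H `&` F2 `&` F1 = set0.
  by rewrite -setIA [F2 `&` _]setIC setIA.
have bad Y : derived H Y -> F1 Y -> F2 Y -> False.
  move=> dY f1 f2; suff : set0 Y by [].
  by rewrite -dis; split=> //; split.
case: (cov 1%:M d1) => f1.
  have := inv F1 F2 cF1 cF2 cov dis f1 => S.
  by have [Y [dY f2]] := ne2; apply: (bad Y) => //; apply: S.
have := inv F2 F1 cF2 cF1 cov' dis' f1 => S.
by have [Y [dY f1']] := ne1; apply: (bad Y) => //; apply: S.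
Qed.

Lemma polyrep_sub n m (H K : set 'M[C]_n) (rho : 'M[C]_n -> 'M[C]_m) :
  K `<=` H -> polyrep H rho -> polyrep K rho.
Proof. by move=> KH [h1 h2 h3]; split=> // A B /KH HA /KH HB; apply: h3. Qed.

(** Induction on the derived length. The derived group has a common eigenvector, of weight chi;
    connectedness of H makes chi invariant under conjugation, so the weight space W is stable under
    H. On W commutators act by scalars, and connectedness forces these scalars to be 1, so H acts on
    W by commuting operators. *)
Theorem lie_kolchin_eigenvector n k (H : set 'M[C]_n) m
    (rho : 'M[C]_n -> 'M[C]_m) :
  subgroup H -> zconnected H -> iter k (@derived R n) H = [set 1%:M] ->
  polyrep H rho -> (0 < m)%N ->
  exists v : 'rV[C]_m, v != 0 /\ forall A, H A -> exists c, v *m rho A = c *: v.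
Proof.
move=> sH cH Hk rH m0; have [w w0] : exists w : 'rV[C]_m, w != 0.
  exists (const_mx 1); apply/eqP => /rowP /(_ (Ordinal m0)); rewrite !mxE => /eqP.
  by rewrite oner_eq0.
elim: k H sH cH Hk rH => [|k IH] H sH cH Hk rH.
  exists w; split=> // A; rewrite (_ : H = [set 1%:M]) => // -> .
  by exists 1; case: rH => _ -> _; rewrite mulmx1 scale1r.
have sD := derived_subgroup sH; have cD := derived_connected sH cH.
have DH := derived_sub sH.
have [|v [v0 vD]] := IH _ sD cD _ (polyrep_sub DH rH); first by rewrite -iterSr.
have [HG [H1 HM] HV] := sH; have [rP r1 rM] := rH.
have vD' A : exists c, derived H A -> v *m rho A = c *: v.
  case: (EM (derived H A)) => dA; last by exists 0.
  by have [c E] := vD A dA; exists c.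
have [chi Echi] := choice vD'.
have chi_conj A B : derived H A -> H B -> chi (B *m A *m invmx B) = chi A.
  move=> dA HB.
  have conjE Y : H Y -> v *m rho Y *m rho A = chi (Y *m A *m invmx Y) *: (v *m rho Y).
    move=> HY; rewrite -mulmxA -rM //; last exact: DH.
    have -> : Y *m A = (Y *m A *m invmx Y) *m Y by rewrite mulmxKV //; apply: HG.
    have dY := derived_normal sH dA HY.
    rewrite rM //; last exact: DH.
    by rewrite mulmxA (Echi _ dY) -scalemxAl mulmxKV //; apply: HG.
  have := @constant_eigenvalue _ _ _ _ (rho A) v (chi A) sH cH rH v0 _ (Echi _ dA) B HB.
  rewrite conjE // => /(_ _)/eqP; rewrite -subr_eq0 -scalerBl scaler_eq0.
  have /negPf -> : v *m rho B != 0.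
    apply/eqP => E; case/eqP: v0.
    by rewrite -(mulmxK (polyrep_unit sH rH HB) v) E mul0mx.
  rewrite orbF subr_eq0 => E; apply/eqP/E => Y HY; exists (chi (Y *m A *m invmx Y)).
  exact: conjE.
have [W HW] : exists W : {vspace 'rV[C]_m}, forall u, u \in W <->
    forall A, derived H A -> u *m rho A = chi A *: u.
  apply: vspace_of; first by move=> A _; rewrite mul0mx scaler0.
  move=> a u u' Hu Hu' A dA; rewrite mulmxDl -scalemxAl Hu // Hu' //.
  by rewrite scalerDr !scalerA mulrC.
have vW : v \in W by apply/HW => A; apply: Echi.
have WH u Y : u \in W -> H Y -> u *m rho Y \in W.
  move=> /HW uW HY; apply/HW => A dA.
  rewrite -mulmxA -rM //; last exact: DH.
  have -> : Y *m A = (Y *m A *m invmx Y) *m Y by rewrite mulmxKV //; apply: HG.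
  have dY := derived_normal sH dA HY.
  rewrite rM //; last exact: DH.
  by rewrite mulmxA uW // -scalemxAl chi_conj.
have swap X Y u : H X -> H Y -> u \in W ->
    u *m rho X *m rho Y = chi (X *m Y *m invmx X *m invmx Y) *: (u *m rho Y *m rho X).
  move=> HX HY /HW uW; have dc := derived_comm HX HY.
  have E : X *m Y = (X *m Y *m invmx X *m invmx Y) *m (Y *m X).
    by rewrite !mulmxA mulmxKV ?mulmxKV //; apply: HG.
  rewrite -mulmxA -rM // {1}E rM //; [|exact: DH|exact: HM].
  by rewrite mulmxA (uW _ dc) -scalemxAl (rM _ _ HY HX) mulmxA.
(* If u is an eigenvector of rho(X) in W, so is each u rho(Z), with the eigenvalue divided by chi of
   the commutator; by [constant_eigenvalue] this eigenvalue does not depend on Z. *)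
have chi1 X Y : H X -> H Y -> chi (X *m Y *m invmx X *m invmx Y) = 1.
  move=> HX HY.
  have [u [x [uW u0 ux]]] := eigenvector_in vW v0 (fun u uW => WH u X uW HX).
  have x0 : x != 0.
    apply/eqP => E; move: ux; rewrite E scale0r => E'; case/eqP: u0.
    by rewrite -(mulmxK (polyrep_unit sH rH HX) u) E' mul0mx.
  have chi0 Z : H Z -> chi (X *m Z *m invmx X *m invmx Z) != 0.
    move=> HZ; apply/eqP => E; have := swap X Z u HX HZ uW; rewrite E scale0r => E'.
    case/eqP: u0; rewrite -(mulmxK (polyrep_unit sH rH HX) u).
    by rewrite -(mulmxK (polyrep_unit sH rH HZ) (u *m rho X)) E' !mul0mx.
  have eigY Z : H Z -> u *m rho Z *m rho X =
      ((chi (X *m Z *m invmx X *m invmx Z))^-1 * x) *: (u *m rho Z).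
    move=> HZ; have S := swap X Z u HX HZ uW; rewrite ux -scalemxAl in S.
    by rewrite -scalerA S scalerA mulVf ?scale1r //; apply: chi0.
  have E := @constant_eigenvalue _ _ _ _ (rho X) u x sH cH rH u0
    (fun Z HZ => ex_intro _ _ (eigY Z HZ)) ux Y HY.
  move: E; rewrite eigY // => /eqP; rewrite -subr_eq0 -scalerBl scaler_eq0.
  have /negPf -> : u *m rho Y != 0.
    apply/eqP => E; case/eqP: u0.
    by rewrite -(mulmxK (polyrep_unit sH rH HY) u) E mul0mx.
  rewrite orbF subr_eq0 -[X in _ == X]mul1r (inj_eq (mulIf x0)).
  by rewrite invr_eq1 => /eqP.
(* A nonzero stable subspace of W of minimal dimension consists of common
   eigenvectors, since the operators commute on W. *)
pose good (U : {vspace 'rV[C]_m}) := [/\ (U <= W)%VS, U != 0%VS &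
  forall u Y, u \in U -> H Y -> u *m rho Y \in U].
pose Pd d := `[< exists U, good U /\ \dim U = d >].
have exP : exists d, Pd d.
  exists (\dim W); apply/asboolP; exists W; split=> //; split=> //.
  by apply/eqP => W0; move: vW; rewrite W0 memv0 (negPf v0).
case: (ex_minnP exP) => d /asboolP [U [[UW U0 UH] Ud]] dmin.
exists (vpick U); rewrite vpick0; split=> // X HX.
have [u [x [uU u0 ux]]] := eigenvector_in (memv_pick U)
  (etrans (congr1 negb (vpick0 U)) U0) (fun u uU => UH u X uU HX).
have [U' HU'] : exists U' : {vspace 'rV[C]_m}, forall z, z \in U' <->
    z \in U /\ z *m rho X = x *: z.
  apply: vspace_of; first by rewrite mem0v mul0mx scaler0.
  move=> a z z' [zU zx] [zU' zx']; split; first by apply: memvD => //; apply: memvZ.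
  by rewrite mulmxDl -scalemxAl zx zx' scalerDr !scalerA mulrC.
have U'U : (U' <= U)%VS by apply/subvP => z /HU' [].
have g' : good U'.
  split; first exact: subv_trans UW.
    apply/eqP => E; have : u \in U' by apply/HU'.
    by rewrite E memv0 (negPf u0).
  move=> z Y /HU' [zU zx] HY; apply/HU'; split; first exact: UH.
  have zW := subvP UW _ zU.
  have E := swap X Y z HX HY zW; rewrite (chi1 X Y HX HY) scale1r in E.
  by rewrite -E zx -scalemxAl.
have : (d <= \dim U')%N by apply: dmin; apply/asboolP; exists U'.
rewrite -Ud => dU; have [_ E] := dimv_leqif_sup U'U.
have /HU' [_ E'] : vpick U \in U'.
  apply: (subvP _ _ (memv_pick U)); rewrite -E eqn_leq dU andbT.
  exact: dimvS.
by exists x.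
Qed.

Lemma mx11_commutator (b d b' d' : 'M[C]_1) :
  b *m b' = 1%:M -> d *m d' = 1%:M -> b *m d *m b' *m d' = 1%:M.
Proof.
have comm (X Y : 'M[C]_1) : X *m Y = Y *m X by rewrite [X]mx11_scalar scalar_mxC.
by move=> bb' dd'; rewrite (comm b d) -(mulmxA d b b') bb' mulmx1.
Qed.

Lemma derived_hom1 n (H : set 'M[C]_n) (f : 'M[C]_n -> 'M[C]_1) : subgroup H ->
  f 1%:M = 1%:M -> (forall A B, H A -> H B -> f (A *m B) = f A *m f B) ->
  forall A, derived H A -> f A = 1%:M.
Proof.
move=> sH f1 fM; have [HG [H1 HM] HV] := sH; have DH := derived_sub sH.
have fV B : H B -> f B *m f (invmx B) = 1%:M.
  by move=> HB; rewrite -fM ?mulmxV ?f1 //; [exact: HG|exact: HV].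
apply: (derived_ind sH) => //=.
- by move=> B D dB dD EB ED; rewrite (fM _ _ (DH _ dB) (DH _ dD)) EB ED mulmx1.
- by move=> B dB EB; have := fV B (DH B dB); rewrite EB mul1mx.
move=> B D HB HD; have [HB' HD'] := (HV _ HB, HV _ HD).
rewrite (fM _ _ _ HD'); last by apply: (HM) => //; apply: (HM).
rewrite (fM _ _ (HM _ _ HB HD) HB') (fM _ _ HB HD).
exact: mx11_commutator (fV B HB) (fV D HD).
Qed.

(** A common eigenvector, taken as first basis vector, makes rho block triangular. The corner block
    is a character, trivial on the derived group, and the induction on the dimension applies to the
    other diagonal block. *)
Theorem lie_kolchin n k (H : set 'M[C]_n) m (rho : 'M[C]_n -> 'M[C]_m) :
  subgroup H -> zconnected H -> iter k (@derived R n) H = [set 1%:M] ->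
  polyrep H rho -> forall A, derived H A -> (rho A - 1%:M) ^+ m = 0.
Proof.
move=> sH cH Hk; have [HG [H1 HM] HV] := sH.
have sD := derived_subgroup sH; have DH := derived_sub sH.
elim: m rho => [|m IH] rho rH A dA; first by apply/matrixP => -[].
have [v [v0 vA]] := lie_kolchin_eigenvector sH cH Hk rH isT.
have [rP r1 rM] := rH.
pose e0 : 'M[C]_(1, 1 + m) := row_mx 1%:M 0.
have rk0 : \rank e0 = 1%N.
  rewrite rank_rV; case: eqP => // /rowP /(_ (lshift m 0)).
  by rewrite /e0 row_mxEl !mxE => /eqP; rewrite oner_eq0.
have e0v : e0 *m col_mx v (0 : 'M_(m, 1 + m)) = v.
  by rewrite mul_row_col mul1mx mul0mx addr0.
have [|P UP] := @complete_unitmx _ _ _ e0 (col_mx v 0).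
  by rewrite e0v rk0; apply/eqP; rewrite rank_rV v0.
rewrite e0v => Pv.
pose sig (A : 'M[C]_n) : 'M[C]_(1 + m) := P *m rho A *m invmx P.
have sigM B D : H B -> H D -> sig (B *m D) = sig B *m sig D.
  by move=> HB HD; rewrite /sig rM // !mulmxA mulmxKV.
have sig1 : sig 1%:M = 1%:M by rewrite /sig r1 mulmx1 mulmxV.
have sigB B : H B -> sig B = block_mx (ulsubmx (sig B)) 0 (dlsubmx (sig B)) (drsubmx (sig B)).
  move=> HB; rewrite -[LHS]submxK; congr block_mx.
  have [c Ec] := vA B HB.
  have : e0 *m sig B = c *: e0.
    by rewrite /sig !mulmxA -Pv Ec -scalemxAl Pv mulmxK.
  rewrite -[sig B]submxK /e0 mul_row_block !mul1mx !mul0mx !addr0.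
  rewrite scale_row_mx scaler0 => /eq_row_mx [_ ->].
  by rewrite block_mxKur.
have sigP : polymap sig.
  by apply: polymapM; [apply: polymapM => //|]; apply: polymap_cst.
pose rho' (A : 'M[C]_n) : 'M[C]_m := drsubmx (sig A).
have rH' : polyrep H rho'.
  split.
  - move=> i j; apply: (polyfun_eq _ (sigP (rshift 1 i) (rshift 1 j))) => B.
    by rewrite !mxE.
  - by rewrite /rho' sig1 -[1%:M]submxK block_mxKdr; apply/matrixP => i j; rewrite !mxE (inj_eq (@rshift_inj _ _)).
  move=> B D HB HD; rewrite /rho' sigM // {1}(sigB B HB) {1}(sigB D HD).
  by rewrite mulmx_block block_mxKdr mulmx0 add0r.
have ul1 : ulsubmx (sig A) = 1%:M.
  have ulM B D : H B -> H D -> ulsubmx (sig (B *m D)) = ulsubmx (sig B) *m ulsubmx (sig D).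
    move=> HB HD; rewrite sigM // {1}(sigB B HB) {1}(sigB D HD).
    by rewrite mulmx_block block_mxKul mul0mx addr0.
  have u1 : ulsubmx (sig 1%:M) = 1%:M by rewrite sig1 scalar_mx_block block_mxKul.
  exact: (derived_hom1 sH u1 ulM dA).
have N0 := IH rho' rH' A dA.
have HA := DH A dA.
have Es : sig A - 1%:M = block_mx 0 0 (dlsubmx (sig A)) (rho' A - 1%:M).
  rewrite {1}(sigB A HA) ul1 scalar_mx_block opp_block_mx add_block_mx.
  by rewrite subrr !oppr0 !addr0.
(* The lower left block involves one power less of the diagonal block, whence one more power in
   total. *)
have pw k' : (sig A - 1%:M) ^+ k'.+1 =
    block_mx 0 0 ((rho' A - 1%:M) ^+ k' *m dlsubmx (sig A)) ((rho' A - 1%:M) ^+ k'.+1).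
  elim: k' => [|k' IH']; first by rewrite !expr1 expr0 mul1mx.
  rewrite exprS IH' Es -mulmxE mulmx_block !mul0mx !mulmx0 !add0r.
  have EX j (X : 'M[C]_m) : X *m X ^+ j = X ^+ j.+1 by rewrite exprS.
  by rewrite mulmxA !EX.
have : (sig A - 1%:M) ^+ m.+1 = 0.
  by rewrite pw exprS N0 mulr0 mul0mx block_mx0.
have -> : sig A - 1%:M = P *m (rho A - 1%:M) *m invmx P.
  by rewrite mulmxBr mulmxBl mulmx1 mulmxV.
have -> k' : (P *m (rho A - 1%:M) *m invmx P) ^+ k' = P *m (rho A - 1%:M) ^+ k' *m invmx P.
  elim: k' => [|k' IH']; first by rewrite !expr0 mulmx1 mulmxV.
  by rewrite exprS IH' -mulmxE exprS -mulmxE !mulmxA mulmxKV.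
move=> E; have := congr1 (fun X => invmx P *m X *m P) E.
by rewrite mulmx0 mul0mx !mulmxA mulVmx // mul1mx mulmxKV.
Qed.

End LieKolchin.

(** * Limits under cocharacters and Borel subgroups *)

Section Conjugation.
Variables (R : realType) (n : nat).
Local Notation C := R[i].
Implicit Types (A B g h t X Y N : 'M[C]_n) (m : C -> 'M[C]_n).

Lemma invmxM g h : g \in unitmx -> h \in unitmx ->
  invmx (g *m h) = invmx h *m invmx g.
Proof.
move=> Ug Uh; have E : (g *m h) *m (invmx h *m invmx g) = 1%:M.
  by rewrite mulmxA mulmxK // mulmxV.
have [U _] := mulmx1_unit E.
by rewrite -[LHS]mulmx1 -E mulKmx.
Qed.

Fact conjby_linear g : linear (conjby g : 'M[C]_n -> 'M[C]_n).
Proof. by move=> a A B; rewrite /conjby mulmxDr mulmxDl -scalemxAr -scalemxAl. Qed.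

HB.instance Definition _ g :=
  GRing.isLinear.Build C 'M[C]_n 'M[C]_n *:%R (conjby g) (conjby_linear g).

Lemma conjbyD g A B : conjby g (A + B) = conjby g A + conjby g B.
Proof. exact: linearD. Qed.

Lemma conjbyB g A B : conjby g (A - B) = conjby g A - conjby g B.
Proof. exact: linearB. Qed.

Lemma conjbyZ g a A : conjby g (a *: A) = a *: conjby g A.
Proof. by rewrite /conjby -scalemxAr -scalemxAl. Qed.

Lemma mxscaleX (K : comNzRingType) p (a : K) (A : 'M[K]_p) k :
  (a *: A) ^+ k = a ^+ k *: A ^+ k.
Proof.
elim: k => [|k IH]; first by rewrite !expr0 scale1r.
by rewrite !exprS IH -!mulmxE -scalemxAl -scalemxAr scalerA.
Qed.

Lemma ev_expq K N c : ev (expq K N) c = \sum_(k < K) c ^+ k *: ((k`!%:R)^-1 *: N ^+ k).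
Proof. by rewrite expq.unlock ev_mkpm. Qed.

Lemma conjbyM g A B : g \in unitmx ->
  conjby g (A *m B) = conjby g A *m conjby g B.
Proof. by move=> Ug; rewrite /conjby !mulmxA mulmxKV. Qed.

Lemma conjby_comp g h A : g \in unitmx -> h \in unitmx ->
  conjby (g *m h) A = conjby g (conjby h A).
Proof. by move=> Ug Uh; rewrite /conjby invmxM // !mulmxA. Qed.

Lemma conjby1 g : g \in unitmx -> conjby g 1%:M = 1%:M.
Proof. by move=> Ug; rewrite /conjby mulmx1 mulmxV. Qed.

Lemma conj1by A : conjby 1%:M A = A.
Proof. by rewrite /conjby invmx1 mulmx1 mul1mx. Qed.

Lemma conjbyK g A : g \in unitmx -> conjby (invmx g) (conjby g A) = A.
Proof. by move=> Ug; rewrite -conjby_comp ?unitmx_inv // mulVmx // conj1by. Qed.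

Lemma conjbyVK g A : g \in unitmx -> conjby g (conjby (invmx g) A) = A.
Proof. by move=> Ug; rewrite -conjby_comp ?unitmx_inv // mulmxV // conj1by. Qed.

Lemma conjby_eq0 g A : g \in unitmx -> (conjby g A == 0) = (A == 0).
Proof.
move=> Ug; apply/eqP/eqP => [E|->]; last by rewrite linear0.
by rewrite -(conjbyK A Ug) E linear0.
Qed.

Lemma conjbyX g A k : g \in unitmx -> conjby g (A ^+ k) = conjby g A ^+ k.
Proof.
move=> Ug; elim: k => [|k IH]; first by rewrite !expr0 conjby1.
by rewrite !exprS conjbyM // IH.
Qed.

Lemma conjby_unit g A : g \in unitmx -> A \in unitmx -> conjby g A \in unitmx.
Proof. by move=> Ug UA; rewrite /conjby !unitmx_mul unitmx_inv Ug UA. Qed.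

Lemma conjbyV g A : g \in unitmx -> A \in unitmx ->
  invmx (conjby g A) = conjby g (invmx A).
Proof.
move=> Ug UA; rewrite /conjby invmxM ?unitmx_mul ?unitmx_inv ?Ug //.
by rewrite invmxK invmxM // mulmxA.
Qed.

Lemma conjby_exp g K N c : g \in unitmx ->
  conjby g (ev (expq K N) c) = ev (expq K (conjby g N)) c.
Proof.
move=> Ug.
rewrite (ev_expq K N).
rewrite (ev_expq K (conjby g N)).
rewrite linear_sum.
apply: eq_bigr => k _.
by rewrite [LHS]conjbyZ conjbyZ conjbyX.
Qed.

Lemma expq_scale K N a c : ev (expq K (a *: N)) c = ev (expq K N) (a * c).
Proof.
rewrite (ev_expq K N).
rewrite (ev_expq K (a *: N)).
apply: eq_bigr => k _.
by rewrite mxscaleX exprMn 3!scalerA -mulrA [_ * a ^+ k]mulrC mulrA [c ^+ k * _]mulrC.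
Qed.

Lemma evX (Q : 'M[{poly C}]_n) k c : ev (Q ^+ k) c = ev Q c ^+ k.
Proof.
elim: k => [|k IH]; first by rewrite !expr0 ev1.
by rewrite !exprS evM IH.
Qed.

Definition compq (p : {poly C}) (Q : 'M[{poly C}]_n) : 'M[{poly C}]_n :=
  map_mx (fun r => r \Po p) Q.

Lemma ev_compq p Q c : ev (compq p Q) c = ev Q p.[c].
Proof. by apply/matrixP => i j; rewrite !evE mxE horner_comp. Qed.

Definition scaleq (d : C) (Q : 'M[{poly C}]_n) : 'M[{poly C}]_n := compq (d *: 'X) Q.

Lemma ev_scaleq d Q c : ev (scaleq d Q) c = ev Q (d * c).
Proof. by rewrite ev_compq hornerZ hornerX. Qed.

(** No negative power of c occurs in m(c) A m(c)^-1; the constant term of this curve is then its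
    limit at c = 0. For m dominant and regular, [pol m] plays the role of membership in B_+, and for
    its inverse that of membership in B_-. *)
Definition pol m A := exists Q, forall c, c != 0 -> conjby (m c) A = ev Q c.

Definition lim m A B :=
  exists2 Q, forall c, c != 0 -> conjby (m c) A = ev Q c & ev Q 0 = B.

Lemma lim_pol m A B : lim m A B -> pol m A.
Proof. by move=> [Q HQ _]; exists Q. Qed.

Lemma pol_lim m A : pol m A -> exists B, lim m A B.
Proof. by move=> [Q HQ]; exists (ev Q 0), Q. Qed.

Lemma lim_uniq m A B B' : lim m A B -> lim m A B' -> B = B'.
Proof.
move=> [Q HQ <-] [Q' HQ' <-]; congr ev.
by apply: ev_inj => c c0; rewrite -HQ // HQ'.
Qed.

Section OneCochar.
Variable m : C -> 'M[C]_n.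
Hypothesis cm : cochar (@GL R n) m.

Let um c : c != 0 -> m c \in unitmx.
Proof. by move=> c0; have [H _ _] := cm; apply: (H c c0). Qed.

Let mM c d : c != 0 -> d != 0 -> m (c * d) = m c *m m d.
Proof. by have [_ H _] := cm; apply: H. Qed.

Lemma limM A A' B B' : lim m A B -> lim m A' B' -> lim m (A *m A') (B *m B').
Proof.
move=> [Q HQ <-] [Q' HQ' <-]; exists (Q *m Q'); last by rewrite evM.
by move=> c c0; rewrite conjbyM ?um // HQ // HQ' // evM.
Qed.

Lemma limD a A A' B B' : lim m A B -> lim m A' B' -> lim m (a *: A + A') (a *: B + B').
Proof.
move=> [Q HQ <-] [Q' HQ' <-].
exists (a%:P *: Q + Q'); last by rewrite evD evZ hornerC.
by move=> c c0; rewrite conjby_linear HQ // HQ' // evD evZ hornerC.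
Qed.

Lemma lim0 : lim m 0 0.
Proof.
have E c : ev (0 : 'M_n) c = 0.
  by apply/matrixP => i j; rewrite !mxE /horner_eval horner0.
by exists 0 => // c c0; rewrite linear0 E.
Qed.

Lemma lim1 : lim m 1%:M 1%:M.
Proof. by exists 1%:M; rewrite ?ev1 // => c c0; rewrite ev1 conjby1 ?um. Qed.

Lemma lim_conj A B c : c != 0 -> lim m A B -> lim m (conjby (m c) A) B.
Proof.
move=> c0 [Q HQ <-]; exists (scaleq c Q); last by rewrite ev_scaleq mulr0.
move=> d d0; rewrite -conjby_comp ?um // -mM // HQ ?mulf_neq0 //.
by rewrite ev_scaleq mulrC.
Qed.

Lemma lim_det A B : lim m A B -> \det B = \det A.
Proof.
move=> [Q HQ <-].
have Edet c : \det (ev Q c) = (\det Q).[c] by exact: (det_map_mx (horner_eval c)).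
suff /(congr1 (fun p => p.[0])) : \det Q = (\det A)%:P by rewrite Edet hornerC.
apply: poly_neq0_inj => c c0; rewrite -Edet -HQ // hornerC.
by rewrite !det_mulmx mulrAC det_inv divff ?mul1r // -unitfE -unitmxE um.
Qed.

Lemma lim_unit A B : lim m A B -> A \in unitmx -> B \in unitmx.
Proof. by move=> /lim_det E; rewrite !unitmxE E. Qed.

(** The determinant is constant along the curve, so the inverse is a fixed multiple of the adjugate,
    which is polynomial. *)
Lemma limV A B : lim m A B -> A \in unitmx -> lim m (invmx A) (invmx B).
Proof.
move=> AB UA; have UB := lim_unit AB UA; have dA := lim_det AB.
have [Q HQ QB] := AB; have d0 : \det A != 0 by rewrite -unitfE -unitmxE.
have evadj c : ev (\adj Q) c = \adj (ev Q c) by exact: (map_mx_adj (horner_eval c)).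
have detc c : c != 0 -> \det (conjby (m c) A) = \det A.
  move=> c0; rewrite !det_mulmx mulrAC det_inv divff ?mul1r //.
  by rewrite -unitfE -unitmxE um.
exists (((\det A)^-1)%:P *: \adj Q).
  move=> c c0; rewrite evZ hornerC evadj -HQ // -(detc c c0) -invmxE ?conjbyV ?um //.
  by rewrite conjby_unit ?um.
by rewrite evZ hornerC evadj QB -dA -invmxE.
Qed.

(** K and D do not depend on A, and the coefficients are polynomial in A. Hence the existence of a
    limit, and its membership in a closed set, are polynomial conditions on A. *)
Lemma conj_poly : exists (K D : nat) (L : 'M[C]_n -> 'M[{poly C}]_n),
  [/\ forall A c, c != 0 -> c ^+ K *: conjby (m c) A = ev (L A) c,
      forall k, polymap (fun A => cf k (L A))
    & forall A k, (D <= k)%N -> cf k (L A) = 0].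
Proof.
have [_ _ mL] := cm; have [K1 [M1 H1]] := laur_mx mL.
have [_ _ mL'] := cocharV cm; have [K2 [M2 H2]] := laur_mx mL'.
have cfL k A i j : cf k (M1 *m cst A *m M2) i j =
    \sum_b (\sum_a (M1 i a * M2 b j)`_k * A a b).
  rewrite cfE mulmxij coef_sum; apply: eq_bigr => b _.
  rewrite mulmxij big_distrl coef_sum; apply: eq_bigr => a _ /=.
  by rewrite !mxE mulrAC coefMC.
exists (K1 + K2)%N, (deg M1 + deg M2)%N, (fun A => M1 *m cst A *m M2); split.
- move=> A c c0; rewrite !evM ev_cst -H1 // -H2 // /conjby (cochar_inv _ cm c0) //.
  by rewrite -!scalemxAl -scalemxAr scalerA exprD.
- move=> k i j; apply: (polyfun_eq (fun A => esym (cfL k A i j))).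
  apply: polyfun_sum => b _; apply: polyfun_sum => a _.
  by apply: polyfunM; [exact: polyfun_cst|exact: polyfun_entry].
move=> A k Dk; apply/matrixP => i j; rewrite cfL mxE big1 // => b _; rewrite big1 // => a _.
rewrite nth_default ?mul0r //; apply: leq_trans Dk.
apply: leq_trans (size_polyMleq _ _) _.
by apply: leq_trans (leq_pred _) _; apply: leq_add; apply: size_deg.
Qed.

Lemma polP (K : nat) (L : 'M[C]_n -> 'M[{poly C}]_n) A B :
  (forall A c, c != 0 -> c ^+ K *: conjby (m c) A = ev (L A) c) ->
  lim m A B <-> (forall k, (k < K)%N -> cf k (L A) = 0) /\ cf K (L A) = B.
Proof.
move=> HL; split=> [[Q HQ QB]|[Lk LB]].
  have E : L A = 'X^K *: Q.
    by apply: ev_inj => c c0; rewrite -HL // evZ hornerXn HQ.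
  split=> [k kK|]; apply/matrixP => i j; rewrite E !mxE /= coefXnM.
    by rewrite kK.
  by rewrite ltnn subnn -QB ev0 cfE.
exists (mkpm (deg (L A)) (fun k => cf (k + K) (L A))).
  move=> c c0; apply: (scalerI (_ : c ^+ K != 0)); first by rewrite expf_neq0.
  rewrite HL // ev_mkpm (@ev_coef _ _ _ _ (K + deg (L A))) ?leq_addl //.
  rewrite big_split_ord /= big1 ?add0r; last by move=> k _; rewrite Lk // scaler0.
  rewrite scaler_sumr; apply: eq_bigr => k _.
  by rewrite scalerA exprD [(k + K)%N]addnC.
rewrite ev0 cf_mkpm add0n; case: ltnP => // D0.
by rewrite -LB cf_deg // (leq_trans D0).
Qed.

(** If the curve of A is divisible by c, that of A^D is divisible by c^D, whereas no conjugation
    curve has exponents beyond the uniform bound D - K. *)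
Lemma lim0_nilpotent : exists K, forall A, lim m A 0 -> A ^+ K = 0.
Proof.
have [K [D [L [HL _ HD]]]] := conj_poly.
exists D => A [Q HQ Q0].
have [Q' EQ] : exists Q', Q = 'X *: Q'.
  exists (mkpm (deg Q) (fun k => cf k.+1 Q)); apply: cf_inj => k.
  case: k => [|k].
    by rewrite -[LHS]ev0 Q0; apply/matrixP => i j; rewrite !mxE /= coefXM.
  apply/matrixP => i j; rewrite !mxE /= coefXM /= coef_poly cfE.
  case: ltnP => // kD; apply: nth_default; apply: leq_trans (size_deg Q i j) _.
  exact: leq_trans kD _.
have E : L (A ^+ D) = 'X^(K + D) *: Q' ^+ D.
  apply: ev_inj => c c0; rewrite -HL // conjbyX ?um // HQ // EQ !evZ.
  by rewrite hornerX hornerXn mxscaleX scalerA -exprD evX.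
have L0 : L (A ^+ D) = 0.
  apply: cf_inj => k; have -> : cf k (0 : 'M[{poly C}]_n) = 0.
    by apply/matrixP => i j; rewrite !mxE /= coef0.
  case: (leqP D k) => Dk; first exact: HD.
  by rewrite E; apply/matrixP => i j; rewrite !mxE /= coefXnM ltn_addl.
have := HL (A ^+ D) 1 (oner_neq0 _).
rewrite L0 expr1n scale1r (cochar1 _ cm) // conj1by => ->.
by apply/matrixP => i j; rewrite !mxE /horner_eval horner0.
Qed.

(** The term of lowest order of the conjugation curve, here [ev Q 0], is a weight vector of m, of
    weight that order. *)
Lemma lead A : A != 0 -> exists (k : int) (Q : 'M[{poly C}]_n),
  [/\ forall c, c != 0 -> conjby (m c) A = c ^ k *: ev Q c, ev Q 0 != 0
    & forall c, c != 0 -> conjby (m c) (ev Q 0) = c ^ k *: ev Q 0].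
Proof.
move=> A0; have [K [D [L [HL _ _]]]] := conj_poly.
have L0 : L A != 0.
  apply/eqP => E; case/eqP: A0.
  have := HL A 1 (oner_neq0 _).
  rewrite E expr1n scale1r (cochar1 _ cm) // conj1by => ->.
  by apply/matrixP => i j; rewrite !mxE /horner_eval horner0.
have exk : exists k, cf k (L A) != 0.
  apply: contrapT => H; case/eqP: L0; apply: cf_inj => k.
  have -> : cf k (0 : 'M[{poly C}]_n) = 0.
    by apply/matrixP => i j; rewrite !mxE /= coef0.
  by apply/eqP/negPn/negP => H'; apply: H; exists k.
case: (ex_minnP exk) => v Lv vmin.
pose Q := mkpm (deg (L A)) (fun k => cf (k + v) (L A)).
have EL : L A = 'X^v *: Q.
  apply: cf_inj => k; apply/matrixP => i j; rewrite !mxE /= coefXnM !coef_poly.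
  case: ltnP => kv.
    have -> : (L A i j)`_k = cf k (L A) i j by rewrite cfE.
    suff /eqP -> : cf k (L A) == 0 by rewrite mxE.
    by apply/negPn/negP => /vmin; rewrite leqNgt kv.
  case: ltnP => kD; first by rewrite cfE subnK.
  by apply: nth_default; apply: leq_trans (size_deg _ i j) (leq_trans kD (leq_subr _ _)).
have Hk c : c != 0 -> conjby (m c) A = c ^ (v%:Z - K%:Z) *: ev Q c.
  move=> c0; apply: (scalerI (_ : c ^+ K != 0)); first by rewrite expf_neq0.
  rewrite HL // EL evZ hornerXn scalerA expfzDr // -exprnN -exprnP.
  by rewrite mulrCA mulfV ?mulr1 // expf_neq0.
exists (v%:Z - K%:Z), Q; split=> //.
  rewrite ev0 cf_mkpm add0n; case: ltnP => // D0.
  by case/eqP: Lv; rewrite cf_deg // (leq_trans D0).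
move=> c c0; have E : cst (m c) *m Q *m cst (invmx (m c)) = (c ^ (v%:Z - K%:Z))%:P *: scaleq c Q.
  apply: ev_inj => d d0; rewrite !evM !ev_cst evZ hornerC ev_scaleq.
  apply: (scalerI (_ : d ^ (v%:Z - K%:Z) != 0)); first by rewrite expfz_neq0.
  rewrite -[m c *m _ *m _]/(conjby (m c) (ev Q d)) -conjbyZ -Hk //.
  rewrite -conjby_comp ?um // -mM //.
  by rewrite Hk ?mulf_neq0 // scalerA expfzMl [_ * d ^ _]mulrC.
have := congr1 (fun M => ev M 0) E.
by rewrite !evM !ev_cst evZ hornerC ev_scaleq mulr0.
Qed.

End OneCochar.
End Conjugation.

(** * Root subgroups from nilpotent weight vectors *)

Section RootSubgroups.
Variables (R : realType) (n : nat).
Local Notation C := R[i].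
Implicit Types (A B g h t X Y N : 'M[C]_n) (m : C -> 'M[C]_n).

Lemma exp_GL K N c : N ^+ K = 0 -> GL (ev (expq K N) c).
Proof. by move=> NK; apply: one_param_GL => [|a b]; [exact: expq0|exact: expqD]. Qed.

Lemma exp_inv K N c : N ^+ K = 0 -> invmx (ev (expq K N) c) = ev (expq K N) (- c).
Proof. by move=> NK; apply: one_param_inv => [|a b]; [exact: expq0|exact: expqD]. Qed.

Lemma curve_near1 (Q : 'M[{poly C}]_n) : ev Q 0 = 1%:M ->
  exists2 Q', Q = 1%:M + 'X *: Q' & ev Q' 0 = cf 1 Q.
Proof.
move=> Q1; exists (mkpm (deg Q).+1 (fun k => cf k.+1 Q)).
  apply/eqP; rewrite -subr_eq0 opprD addrA subr_eq0; apply/eqP.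
  apply: cf_inj => k; apply/matrixP => i j.
  case: k => [|k].
    rewrite -[LHS]/((cf 0 (Q - 1%:M)) i j) -ev0 evB ev1 Q1 subrr !mxE /= coefXM.
    by [].
  rewrite !mxE /= coefXM /= coef_poly !mxE.
  rewrite coefB coefMn coef1 (_ : k.+1 == 0%N = false) // mul0rn subr0.
  case: ltnP => // kD; apply: nth_default; apply: leq_trans (size_deg Q i j) _.
  by rewrite ltnW // ltnW.
by rewrite ev0 cf_mkpm.
Qed.

Lemma cf1_expq K N : (1 < K)%N -> cf 1 (expq K N) = N.
Proof.
by move=> K1; rewrite expq.unlock cf_mkpm K1 (_ : 1`! = 1%N) // invr1 scale1r expr1.
Qed.

Lemma expq_le K K' N : N ^+ K = 0 -> (K <= K')%N -> expq K' N = expq K N.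
Proof.
move=> NK KK'; apply: cf_inj => k; rewrite !expq.unlock !cf_mkpm.
case: (ltnP k K) => kK; first by rewrite (leq_trans kK KK').
by case: ltnP => // _; rewrite -(subnK kK) exprD NK -mulmxE mulmx0 scaler0.
Qed.

Lemma exp_curve (Q : 'M[{poly C}]_n) K s : exists E : 'M[{poly C}]_n,
  forall c, ev E c = ev (expq K (ev Q c)) s.
Proof.
exists (\sum_(k < K) (s ^+ k * (k`!%:R)^-1)%:P *: Q ^+ k) => c.
rewrite ev_expq ev_sum; apply: eq_bigr => k _.
by rewrite evZ hornerC evX scalerA.
Qed.

Lemma nilpotent_curve (Q : 'M[{poly C}]_n) K :
  (forall c, c != 0 -> ev Q c ^+ K = 0) -> forall c, ev Q c ^+ K = 0.
Proof.
move=> QK c; rewrite -evX; have -> : Q ^+ K = 0.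
  apply: ev_inj => d d0; rewrite evX QK //.
  by apply/matrixP => i j; rewrite !mxE /horner_eval horner0.
by apply/matrixP => i j; rewrite !mxE /horner_eval horner0.
Qed.

(* The coordinate of exp (c Y) is extracted by interpolation between the
   distinct eigenvalues of the conjugation by g on the powers of Y. *)
Lemma exp_coordinate K Y g (a : C) : g \in unitmx -> Y ^+ K = 0 -> Y != 0 ->
  conjby g Y = a *: Y -> (forall j, j != 1%N -> a ^+ j != a) ->
  exists2 l : 'M[C]_n -> C, polyfun l & forall c, l (ev (expq K Y) c) = c.
Proof.
move=> Ug YK Y0 gY aj.
pose F (j : nat) A := (a - a ^+ j)^-1 *: (conjby g A - a ^+ j *: A).
have Flin j b A B : F j (b *: A + B) = b *: F j A + F j B.
  rewrite /F conjby_linear scalerA mulrC -scalerA -scalerDr.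
  congr (_ *: _); rewrite scalerDr opprD scalerBr !scalerA addrACA.
  by rewrite [_ * b]mulrC.
have FY j i : F j (Y ^+ i) = ((a ^+ i - a ^+ j) / (a - a ^+ j)) *: Y ^+ i.
  by rewrite /F conjbyX // gY mxscaleX -scalerBl scalerA mulrC.
have Fpol j (f : 'M[C]_n -> 'M[C]_n) : polymap f -> polymap (fun A => F j (f A)).
  move=> pf; apply: polymapZ; first exact: polyfun_cst.
  apply: polymapD.
    apply: polymapM; last exact: polymap_cst.
    by apply: polymapM; [exact: polymap_cst|].
  apply: (@polymap_eq _ _ _ (fun A => (- a ^+ j) *: f A)).
    by move=> A; rewrite scaleNr.
  by apply: polymapZ => //; apply: polyfun_cst.
pose Phi := foldr (fun j f => fun A => F j (f A)) id [seq j <- iota 0 K | j != 1%N].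
have PhiP : polymap Phi.
  by rewrite /Phi; elim: [seq _ <- _ | _] => [|j s IH] /=; [exact: polymap_id|exact: Fpol].
have Philin b A B : Phi (b *: A + B) = b *: Phi A + Phi B.
  by rewrite /Phi; elim: [seq _ <- _ | _] => [//|j s IH] /=; rewrite IH Flin.
have Phi0 : Phi 0 = 0.
  by have := Philin (-1) 0 0; rewrite scaler0 addr0 scaleN1r addNr.
have PhiY i : (i < K)%N -> Phi (Y ^+ i) = if i == 1%N then Y else 0.
  move=> iK; have PhiE s : foldr (fun j f => fun A => F j (f A)) id s (Y ^+ i) =
      (\prod_(j <- s) ((a ^+ i - a ^+ j) / (a - a ^+ j))) *: Y ^+ i.
    elim: s => [|j s IH] /=; first by rewrite big_nil scale1r.
    have F0 : F j 0 = 0 by rewrite /F linear0 scaler0 subr0 scaler0.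
    have FZ b A : F j (b *: A) = b *: F j A.
      by have := Flin j b A 0; rewrite F0 !addr0.
    by rewrite IH big_cons FZ FY scalerA mulrC.
  rewrite /Phi PhiE; case: eqP => [->|/eqP i1].
    rewrite big_seq big1 ?scale1r ?expr1 // => j.
    rewrite mem_filter => /andP [/aj aj' _].
    by rewrite divff // subr_eq0 eq_sym.
  rewrite (_ : \prod_(j <- _) _ = 0) ?scale0r //.
  apply/eqP; rewrite prodf_seq_eq0; apply/hasP; exists i.
    by rewrite mem_filter i1 mem_iota.
  by rewrite subrr mul0r eqxx.
have PhiE c : Phi (ev (expq K Y) c) = c *: Y.
  have K1 : (1 < K)%N.
    case: K YK {Phi PhiP Philin Phi0 PhiY} => [|[|//]].
      by move=> E; case/eqP: Y0; rewrite -[Y]mulmx1 -[1%:M]/(Y ^+ 0) E mulmx0.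
    by rewrite expr1 => E; case/eqP: Y0.
  rewrite ev_expq.
  have Phisum r (G : nat -> 'M[C]_n) : Phi (\sum_(k <- r) G k) = \sum_(k <- r) Phi (G k).
    elim: r => [|k r IH]; first by rewrite !big_nil.
    by rewrite !big_cons -[G k]scale1r Philin !scale1r IH.
  pose G k := c ^+ k *: ((k`!%:R)^-1 *: Y ^+ k).
  rewrite -(big_mkord xpredT G) Phisum big_mkord (bigD1 (Ordinal K1)) //= big1.
    have := Philin c (Y ^+ 1) 0; rewrite Phi0 !addr0 PhiY // => <-.
    by rewrite /G (_ : 1`! = 1%N) // invr1 scale1r expr1.
  move=> k k1; have PhiZ b A : Phi (b *: A) = b *: Phi A.
    by have := Philin b A 0; rewrite Phi0 !addr0.
  rewrite /G !PhiZ PhiY ?ltn_ord //; case: eqP => [E|]; last by rewrite !scaler0.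
  by case/eqP: k1; apply: val_inj.
have [i [j Yij]] : exists i j, Y i j != 0.
  apply: contrapT => H; case/eqP: Y0; apply/matrixP => i j; rewrite mxE.
  by apply/eqP/negPn/negP => H'; apply: H; exists i, j.
exists (fun A => Phi A i j * (Y i j)^-1).
  by apply: polyfunM; [exact: PhiP|exact: polyfun_cst].
by move=> c; rewrite PhiE mxE mulfK.
Qed.

Lemma upper01 (a : C) : (upper a) 0 1 = a.
Proof. by rewrite !mxE /= mulr1 add0r. Qed.

Lemma upperD (a b : C) : upper a *m upper b = upper (a + b).
Proof.
apply/matrixP => i j; rewrite mulmxij !big_ord_recl big_ord0 !mxE /=.
case: i => [[|[|]]] //= ?; case: j => [[|[|]]] //= ?;
  by rewrite /= ?(mulr0, mulr1, mul0r, mul1r, addr0, add0r) // addrC.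
Qed.

(** The polynomial coordinate l of [exp_coordinate] serves twice: the subgroup is closed, being
    defined by A = exp(l(A) Y), and l gives the inverse isomorphism. *)
Lemma root_param_exp (G T : set 'M[C]_n) K Y g (a : C) (chi : 'M[C]_n -> C) :
  g \in unitmx -> Y ^+ K = 0 -> Y != 0 ->
  conjby g Y = a *: Y -> (forall j, j != 1%N -> a ^+ j != a) ->
  (forall c, G (ev (expq K Y) c)) -> T `<=` @GL R n ->
  (forall t, T t -> conjby t Y = chi t *: Y) ->
  root_param G T chi (fun c => ev (expq K Y) c).
Proof.
move=> Ug YK Y0 gY aj YG TG Tchi.
have [l lP lE] := exp_coordinate Ug YK Y0 gY aj.
have xP : polymap (fun A => ev (expq K Y) (l A)).
  apply: (@polymap_eq _ _ _ (fun A => \sum_(k < K) l A ^+ k *: ((k`!%:R)^-1 *: Y ^+ k))).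
    by move=> A; rewrite ev_expq.
  apply: polymap_sum => k _; apply: polymapZ; first exact: polyfunX.
  exact: polymap_cst.
split.
- split.
    have -> : range (fun c => ev (expq K Y) c) = [set A | GL A /\
        forall ij : 'I_n * 'I_n, A ij.1 ij.2 - ev (expq K Y) (l A) ij.1 ij.2 = 0].
      apply/seteqP; split=> A /=.
        by move=> [c _ <-]; split=> [|ij]; [exact: exp_GL|rewrite lE subrr].
      move=> [GA EA]; exists (l A) => //; apply/matrixP => i j; apply/eqP.
      by rewrite eq_sym -subr_eq0; apply/eqP; apply: (EA (i, j)).
    apply: zclosed_polyfun => ij; apply: polyfunB; last exact: xP.
    exact: polyfun_entry.
  split.
  - by move=> A [c _ <-]; apply: exp_GL.
  - split; first by exists 0 => //; apply: expq0.
    by move=> A B [c _ <-] [d _ <-]; exists (c + d) => //; apply: expqD.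
  by move=> A [c _ <-]; exists (- c) => //; rewrite exp_inv.
- by move=> A [c _ <-].
- split.
    split.
    + by move=> A [c _ <-]; exists ((upper c) 0 1).
    + by move=> A B [c _ <-] [d _ <-]; rewrite upperD !upper01 expqD.
    move=> i j; apply: regular_poly.
    apply: (@polyfun_eq _ _ (fun A : 'M[C]_2 => \sum_(k < K) A 0 1 ^+ k * ((k`!%:R)^-1 *: Y ^+ k) i j)).
      by move=> A; rewrite ev_expq summxE; apply: eq_bigr => k _; rewrite [RHS]mxE.
    apply: polyfun_sum => k _; apply: polyfunM; last exact: polyfun_cst.
    by apply: polyfunX; apply: polyfun_entry.
  exists (fun A => upper (l A)); split.
  + split.
    * by move=> A [c _ <-]; exists (l (ev (expq K Y) c)).
    * by move=> A B [c _ <-] [d _ <-]; rewrite -expqD // !lE upperD.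
    move=> i j; apply: regular_poly.
    apply: (@polyfun_eq _ _ (fun A => (1%:M : 'M[C]_2) i j + l A * (delta_mx 0 1 : 'M[C]_2) i j)).
      by move=> A; rewrite !mxE.
    apply: polyfunD; first exact: polyfun_cst.
    by apply: polyfunM => //; apply: polyfun_cst.
  + by move=> A [c _ <-]; rewrite upper01 lE.
  by move=> A [c _ <-]; rewrite lE upper01.
by move=> t c Tt; rewrite conjby_exp ?Tchi ?expq_scale //; apply: TG.
Qed.

(** Since 2 is not a root of unity, conjugation by the value of a cocharacter at 2 separates the
    powers of a vector of nonzero weight. *)
Lemma int_pow_neq (k : int) (j : nat) : k != 0 -> j != 1%N ->
  ((2 : C) ^ k) ^+ j != 2 ^ k.
Proof.
move=> k0 j1; apply/eqP => E.
have two0 : (2 : C) != 0 by rewrite pnatr_eq0.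
have : (2 : C) ^ (k * (j%:Z - 1)) = 1.
  rewrite mulrBr mulr1 expfzDr // -exprz_exp -exprnP E -invr_expz divff //.
  by rewrite expfz_neq0.
move/eqP; rewrite pexprz_eq1 ?ler0n // mulf_eq0 (negPf k0) /= subr_eq0.
case/orP => [/eqP [j1']|]; first by case/eqP: j1.
by rewrite -[1]/(1%:R) eqr_nat.
Qed.

Lemma root_in_exp (G T B : set 'M[C]_n) d (ep : 'I_d -> C -> 'M[C]_n)
    (a : 'M[C]_n -> C) (mu : C -> 'M[C]_n) K Y (k : int) :
  torus_coords T ep -> B `<=` G -> (forall c, B (ev (expq K Y) c)) ->
  Y ^+ K = 0 -> Y != 0 -> cochar T mu -> k != 0 ->
  (forall c, c != 0 -> conjby (mu c) Y = c ^ k *: Y) ->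
  (forall t, T t -> conjby t Y = a t *: Y) -> root_in G T B a.
Proof.
move=> [sT Tc cep tT] BG YB YK Y0 [muT muM _] k0 muY aY.
have [TG [T1 TM] TV] := sT; have two0 : (2 : C) != 0 by rewrite pnatr_eq0.
have [i [j Yij]] : exists i j, Y i j != 0.
  apply: contrapT => H; case/eqP: Y0; apply/matrixP => i j; rewrite mxE.
  by apply/eqP/negPn/negP => H'; apply: H; exists i, j.
have aE t : T t -> a t = conjby t Y i j / Y i j.
  by move=> Tt; rewrite aY // mxE mulfK.
have aM A D : T A -> T D -> a (A *m D) = a A * a D.
  move=> TA TD; apply: (mulIf Yij).
  have := congr1 (fun M : 'M_n => M i j) (aY _ (TM _ _ TA TD)).
  rewrite conjby_comp ?(TG _ TA) ?(TG _ TD) // (aY D TD) conjbyZ (aY A TA) scalerA.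
  by rewrite !mxE mulrC => <-; rewrite mulrC [a D * _]mulrC.
have a0 t : T t -> a t != 0.
  move=> Tt; apply/eqP => E; have := aY t Tt; rewrite E scale0r => /eqP.
  by rewrite conjby_eq0 ?(negPf Y0) //; apply: TG.
split.
- split.
  + by move=> t Tt; rewrite /GL /= unitmxE det_scalar1 unitfE a0.
  + by move=> A D TA TD; rewrite aM // scalar_mxM.
  move=> i' j'; apply: (@regular_eq _ _ _ (fun t => (t *m Y *m \adj t) i j / Y i j * (\det t)^-1)).
    move=> t Tt; rewrite !ord1 [RHS]mxE eqxx mulr1n aE // /conjby invmxE ?TG //.
    rewrite -scalemxAr; have -> (c : C) (M : 'M[C]_n) : (c *: M) i j = c * M i j.
      by rewrite mxE.
    by rewrite -[RHS]mulrA [RHS]mulrC.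
  apply: regularM => //.
    apply: regular_poly; apply: polyfunM; last exact: polyfun_cst.
    have H : polymap (fun t : 'M[C]_n => t *m Y *m \adj t).
      apply: polymapM; last exact: polymap_adj.
      by apply: polymapM; [exact: polymap_id|exact: polymap_cst].
    exact: H.
  apply/regularP; exists (fun=> 1); first exact: polyfun_cst.
  by exists 1%N => A _; rewrite expr1 mul1r.
- exists (mu 2); split; first exact: muT.
  apply/eqP => E; have := aY _ (muT 2 two0); rewrite E muY // scale1r => /eqP.
  rewrite -subr_eq0 -[X in _ - X]scale1r -scalerBl scaler_eq0 (negPf Y0) orbF.
  by rewrite subr_eq0 pexprz_eq1 ?ler0n // (negPf k0) -[1]/(1%:R) eqr_nat.
exists (fun c => ev (expq K Y) c); split; last by move=> A [c _ <-].
apply: (@root_param_exp _ _ _ _ (mu 2) (2 ^ k)) => //.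
- by apply: TG; apply: muT.
- exact: muY.
- by move=> l l1; apply: int_pow_neq.
by move=> c; apply: BG.
Qed.

(** Up to rescaling the parameter, exp(s Q(c)) is a conjugate of an element of the one-parameter
    group of X by an element of T, so it lies in B for c <> 0; closedness of B gives c = 0. *)
Lemma lead_exp (T B : set 'M[C]_n) k0 (mu : C -> 'M[C]_n) K X :
  T `<=` @GL R n -> T `<=` B -> zclosed k0 B -> subgroup B -> cochar T mu ->
  X ^+ K = 0 -> X != 0 -> (forall c, B (ev (expq K X) c)) ->
  exists (k : int) Y (Q : 'M[{poly C}]_n),
    [/\ Y ^+ K = 0, Y != 0, forall c, B (ev (expq K Y) c),
        forall c, c != 0 -> conjby (mu c) Y = c ^ k *: Y
      & (forall c, c != 0 -> conjby (mu c) X = c ^ k *: ev Q c) /\ ev Q 0 = Y].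
Proof.
move=> TG TB Bcl [BG [_ BM] BV] cmu XK X0 XB.
have cmu' : cochar (@GL R n) mu.
  by have [H1 H2 H3] := cmu; split=> // c c0; apply: TG; apply: H1.
have [muT _ _] := cmu.
have [k [Q [HQ Q0 EQ]]] := lead cmu' X0.
have QK : forall c, ev Q c ^+ K = 0.
  apply: nilpotent_curve => c c0.
  have -> : ev Q c = c ^ (- k) *: conjby (mu c) X.
    by rewrite HQ // scalerA -expfzDr // addNr expr0z scale1r.
  by rewrite mxscaleX -conjbyX ?XK ?linear0 ?scaler0 //; apply: TG; apply: muT.
exists k, (ev Q 0), Q; split=> // s.
have [E HE] := exp_curve Q K s; rewrite -HE; apply: (zclosed_curve Bcl).
  move=> j; rewrite HE; set c : C := j.+1%:R.
  have c0 : c != 0 by rewrite pnatr_eq0.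
  have -> : ev Q c = c ^ (- k) *: conjby (mu c) X.
    by rewrite HQ // scalerA -expfzDr // addNr expr0z scale1r.
  have Tm := muT c c0; rewrite expq_scale -conjby_exp; last exact: TG.
  apply: (BM); last by apply: BV; apply: TB.
  by apply: (BM) => //; apply: TB.
by rewrite HE; apply: exp_GL.
Qed.

Lemma commuting_lead mu X (Q : 'M[{poly C}]_n) Y (k : int) t (a : C) :
  t \in unitmx -> (forall c, c != 0 -> mu c *m t = t *m mu c) ->
  (forall c, c != 0 -> mu c \in unitmx) ->
  (forall c, c != 0 -> conjby (mu c) X = c ^ k *: ev Q c) -> ev Q 0 = Y ->
  conjby t X = a *: X -> conjby t Y = a *: Y.
Proof.
move=> Ut mut Um HQ <- tX.
have E : cst t *m Q *m cst (invmx t) = a%:P *: Q.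
  apply: ev_inj => c c0; rewrite !evM !ev_cst evZ hornerC.
  apply: (scalerI (_ : c ^ k != 0)); first by rewrite expfz_neq0.
  rewrite -[t *m _ *m _]/(conjby t (ev Q c)) -conjbyZ -HQ //.
  rewrite -(conjby_comp _ Ut (Um c c0)) -(mut c c0) (conjby_comp _ (Um c c0) Ut) tX conjbyZ (HQ c c0).
  by rewrite !scalerA mulrC.
by have := congr1 (fun M => ev M 0) E; rewrite !evM !ev_cst evZ hornerC.
Qed.

(** Taking leading terms along the coordinate cocharacters of T, one after the other, turns X into a
    weight vector of T. Each step keeps the weights obtained before, in particular the one of mu,
    because T is commutative. *)
Lemma root_of_weight (G T B : set 'M[C]_n) k0 d (ep : 'I_d -> C -> 'M[C]_n)
    (mu : C -> 'M[C]_n) K X (k : int) :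
  torus_coords T ep -> B `<=` G -> T `<=` B -> zclosed k0 B -> subgroup B ->
  cochar T mu -> X ^+ K = 0 -> X != 0 -> (forall c, B (ev (expq K X) c)) ->
  k != 0 -> (forall c, c != 0 -> conjby (mu c) X = c ^ k *: X) ->
  exists2 a, root_in G T B a & forall c, c != 0 -> a (mu c) = c ^ k.
Proof.
move=> tc BG TB Bcl sB cmu XK X0 XB k0' muX; have [sT Tc cep tT] := tc.
have [TG [T1 TM] TV] := sT; have [muT muM _] := cmu.
have [Y [YK Y0 YB muY Yw]] : exists Y, [/\ Y ^+ K = 0, Y != 0,
    forall c, B (ev (expq K Y) c), forall c, c != 0 -> conjby (mu c) Y = c ^ k *: Y
    & forall b, exists kb : int, forall c, c != 0 -> conjby (ep b c) Y = c ^ kb *: Y].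
  suff H (s : seq 'I_d) : exists Y, [/\ Y ^+ K = 0, Y != 0,
      forall c, B (ev (expq K Y) c), forall c, c != 0 -> conjby (mu c) Y = c ^ k *: Y
      & forall b, b \in s -> exists kb : int, forall c, c != 0 ->
          conjby (ep b c) Y = c ^ kb *: Y].
    have [Y [h1 h2 h3 h4 h5]] := H (enum 'I_d); exists Y; split=> // b.
    by apply: h5; rewrite mem_enum.
  elim: s => [|b s [Y [YK Y0 YB muY Yw]]]; first by exists X.
  have [kb [Z [Q [ZK Z0 ZB epZ [HQ QZ]]]]] := lead_exp TG TB Bcl sB (cep b) YK Y0 YB.
  have epT b' c : c != 0 -> T (ep b' c) by move=> c0; case: (cep b') => H _ _; apply: H.
  have cl t a : T t -> conjby t Y = a *: Y -> conjby t Z = a *: Z.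
    move=> Tt tY; apply: (commuting_lead (TG _ Tt) _ _ HQ QZ tY).
      by move=> c c0; apply: Tc => //; apply: epT.
    by move=> c c0; apply: TG; apply: epT.
  exists Z; split=> //.
    by move=> c c0; apply: cl; [exact: muT|exact: muY].
  move=> b'; rewrite in_cons => /orP [/eqP ->|/Yw [kb' H]].
    by exists kb.
  by exists kb' => c c0; apply: cl; [exact: epT|exact: H].
have H t : exists x : C, T t -> conjby t Y = x *: Y.
  case: (EM (T t)) => Tt; last by exists 0.
  have [z [z0 ->]] := tT t Tt.
  suff [x [_ Ex]] : exists x, T (\big[mulmx/1%:M]_a ep a (z a)) /\
      conjby (\big[mulmx/1%:M]_a ep a (z a)) Y = x *: Y by exists x.
  elim: (index_enum _) => [|b s [x [Ts IH]]].
    by exists 1; rewrite big_nil conj1by scale1r.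
  have epT : T (ep b (z b)) by case: (cep b) => H _ _; apply: H.
  have [kb Ekb] := Yw b; exists (x * z b ^ kb); rewrite big_cons.
  split; first exact: TM.
  by rewrite conjby_comp ?IH ?conjbyZ ?Ekb ?scalerA //; apply: TG.
have [a Ha] := choice H; exists a.
  exact: (root_in_exp tc BG YB YK Y0 cmu k0' muY Ha).
move=> c c0; have := Ha _ (muT c c0); rewrite muY // => /eqP.
rewrite -subr_eq0 -scalerBl scaler_eq0 (negPf Y0) orbF subr_eq0 => /eqP ->.
by [].
Qed.

End RootSubgroups.

(** * Borel subgroups and dominant cocharacters *)

Section Borel.
Variables (R : realType) (n : nat) (G T B : set 'M[R[i]]_n) (I : finType).
Local Notation C := R[i].
Variable a : I -> 'M[C]_n -> C.
Hypotheses (Gcl : zclosed setT G) (sG : subgroup G) (bB : borel G B)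
  (TB : T `<=` B) (spl : split_torus setT T) (aS : simple_roots G T B a).

Let Bcl : zclosed setT B. Proof. by case: bB => [[[]]]. Qed.
Let sB : subgroup B. Proof. by case: bB => [[[]]]. Qed.
Let BG : B `<=` G. Proof. by case: bB => [[]]. Qed.
Let TGL : T `<=` @GL R n.
Proof. by move=> t /TB; case: sB => H _ _; apply: H. Qed.

Definition dominant (mu : C -> 'M[C]_n) := cochar T mu /\
  exists k : I -> nat, forall i c, c != 0 -> a i (mu c) = c ^+ k i.

Let cGL mu : cochar T mu -> cochar (@GL R n) mu.
Proof. by move=> [H1 H2 H3]; split=> // c c0; apply: TGL; apply: H1. Qed.

Lemma dominant_root mu (k : int) (b : 'M[C]_n -> C) : dominant mu ->
  root_in G T B b -> (forall c, c != 0 -> b (mu c) = c ^ k) -> 0 <= k.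
Proof.
move=> [cmu [l Hl]] rb bk; have [_ _ aN] := aS; have [m bm] := aN b rb.
have two0 : (2 : C) != 0 by rewrite pnatr_eq0.
have [muT _ _] := cmu; have := bm _ (muT 2 two0).
rewrite bk // (eq_bigr (fun i => 2 ^+ (l i * m i))); last first.
  by move=> i _; rewrite Hl // exprM.
have -> : \prod_i (2 : C) ^+ (l i * m i) = 2 ^+ (\sum_i l i * m i).
  by rewrite expr_sum.
move=> E; rewrite leNgt; apply/negP => k0.
have : (2 : C) ^ (k - (\sum_i l i * m i)%N%:Z) = 1.
  by rewrite expfzDr // E exprnP -expfzDr // subrr expr0z.
move/eqP; rewrite pexprz_eq1 ?ler0n // -[1]/(1%:R) eqr_nat orbF subr_eq0 => /eqP E'.
by move: k0; rewrite E' ltNge.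
Qed.

(** By Lie-Kolchin A is unipotent, hence an exponential inside B. A negative leading exponent of its
    logarithm would produce a root of B on which mu is negative, against [dominant_root]. *)
Lemma unipotent_pol mu A : dominant mu -> derived B A -> pol mu A.
Proof.
move=> dmu dA; have [cmu _] := dmu; have [[_ cB [k Bk] _] _] := bB.
have An : (A - 1%:M) ^+ n = 0.
  have rid : polyrep B id by split=> //; apply: polymap_id.
  exact: (lie_kolchin sB cB Bk rid dA).
have [BGL sm BV] := sB.
have BA := derived_sub sB dA.
have [K [N [NK EN]]] := one_param_exp (powq0 An) (fun x y => powqD x y An).
have NB c : B (ev (expq K N) c) by rewrite -EN; apply: powq_closed Bcl sm BA An.
have A1 : A = ev (expq K N) 1.
  by rewrite -EN -[1]/(1%:R) powq_nat // expr1.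
case: (eqVneq N 0) => [N0|N0].
  exists 1%:M => c c0; rewrite ev1 A1 N0.
  rewrite -(scale0r (0 : 'M[C]_n)) expq_scale mul0r expq0 ?conjby1 //.
    by case: (cGL cmu) => H _ _; apply: H.
  by rewrite -[X in X ^+ K]N0.
have [d [ep tc]] := split_torus_coords spl.
have [k' [Y [Q [YK Y0 YB muY [HQ QY]]]]] := lead_exp TGL TB Bcl sB cmu NK N0 NB.
have k0 : 0 <= k'.
  case: (eqVneq k' 0) => [->//|k0].
  have [b rb bk] := root_of_weight tc BG TB Bcl sB cmu YK Y0 YB k0 muY.
  exact: (dominant_root dmu rb bk).
have [p Ep] : exists p : nat, k' = p by case: k' k0 {HQ muY} => p // _; exists p.
have [E HE] := exp_curve ('X^p *: Q) K 1.
exists E => c c0; rewrite HE evZ hornerXn A1 conjby_exp; last first.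
  by case: (cGL cmu) => H _ _; apply: H.
by rewrite HQ // Ep.
Qed.

(** Suppose that the curve of A starts at c^k with k < 0 and leading term Q_0. The commutator of
    mu(2) and A is unipotent and has a unipotent limit, which multiplies Q_0 by 2^k; this is
    impossible for k nonzero. *)
Lemma borel_pol mu A : dominant mu -> B A -> pol mu A.
Proof.
move=> dmu BA; have [cmu _] := dmu; have cmu' := cGL cmu.
have [BGL [B1 BM] BV] := sB; have two0 : (2 : C) != 0 by rewrite pnatr_eq0.
have [muT muM _] := cmu; have um c : c != 0 -> mu c \in unitmx.
  by move=> c0; case: cmu' => H _ _; apply: H.
have UA : A \in unitmx by apply: BGL.
case: (eqVneq A 0) => [E|A0]; first by exists 0 => c c0; rewrite E linear0 [RHS]map_mx0.
have [k [Q [HQ Q0 EQ]]] := lead cmu' A0.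
case: k HQ EQ => p HQ EQ.
  by exists ('X^p *: Q) => c c0; rewrite HQ // evZ hornerXn.
exfalso; set k := Negz p in HQ EQ.
pose q := mu 2 *m A *m invmx (mu 2) *m invmx A.
have dq' : derived B q by apply: derived_comm => //; apply: TB; apply: muT.
have [Pq HP] := unipotent_pol dmu dq'.
have Pn c : (ev Pq c - 1%:M) ^+ n = 0.
  have qn : (q - 1%:M) ^+ n = 0.
    have [[_ cB [l Bl] _] _] := bB.
    have rid : polyrep B id by split=> //; apply: polymap_id.
    exact: (lie_kolchin sB cB Bl rid dq').
  have := @nilpotent_curve _ _ (Pq - 1%:M) n _ c; rewrite evB ev1; apply.
  move=> e e0; rewrite evB ev1 -HP; last exact: e0.
  have := conjbyB (mu e) q 1%:M.
  by rewrite (conjby1 (um e e0)) => <-; rewrite -conjbyX ?um // qn linear0.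
have EP : Pq *m Q = (2 ^ k)%:P *: scaleq 2 Q.
  apply: ev_inj => c c0; rewrite evM evZ hornerC ev_scaleq.
  apply: (scalerI (_ : c ^ k != 0)); first by rewrite expfz_neq0.
  rewrite scalemxAr -HQ // -HP // -conjbyM ?um // scalerA -expfzMl [c * 2]mulrC.
  rewrite -HQ ?mulf_neq0 // [2 * c]mulrC.
  rewrite muM //.
  rewrite conjby_comp; [|exact: um..].
  by rewrite /q mulmxKV.
have E0 : (ev Pq 0 - 1%:M) *m ev Q 0 = (2 ^ k - 1) *: ev Q 0.
  have := congr1 (fun M => ev M 0) EP; rewrite evM evZ hornerC ev_scaleq mulr0 => E.
  by rewrite mulmxBl E mul1mx scalerBl scale1r.
have Ej j : (ev Pq 0 - 1%:M) ^+ j *m ev Q 0 = (2 ^ k - 1) ^+ j *: ev Q 0.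
  elim: j => [|j IH]; first by rewrite !expr0 mul1mx scale1r.
  by rewrite exprSr -mulmxE -mulmxA E0 -scalemxAr IH scalerA exprS.
have := Ej n; rewrite Pn mul0mx => /esym/eqP.
rewrite scaler_eq0 (negPf Q0) orbF expf_eq0 subr_eq0 => /andP [_].
by rewrite pexprz_eq1 ?ler0n // -[1]/(1%:R) eqr_nat.
Qed.

Lemma borel_lim mu A L : dominant mu -> B A -> lim mu A L -> B L.
Proof.
move=> [cmu _] BA AL; have [BGL [B1 BM] BV] := sB; have [muT _ _] := cmu.
have UL : L \in unitmx by apply: (lim_unit (cGL cmu) AL); apply: BGL.
have [Q HQ QL] := AL; rewrite -QL; apply: (zclosed_curve Bcl); last by rewrite QL.
move=> j; rewrite -HQ ?pnatr_eq0 //.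
have Tm : T (mu j.+1%:R) by apply: muT; rewrite pnatr_eq0.
by apply: (BM); [apply: (BM) => //; apply: TB|apply: BV; apply: TB].
Qed.

Lemma commutator_near1 (A D : 'M[C]_n) :
  (1%:M + A) *m (1%:M + D) - (1%:M + D) *m (1%:M + A) = A *m D - D *m A.
Proof.
rewrite !mulmxDl !mulmxDr !mul1mx !mulmx1 !addrA [1%:M + D + A]addrAC.
by rewrite opprD addrACA subrr add0r.
Qed.

(* The elements of G which flow into B form a connected solvable closed group
   containing B, hence equal to B. *)
Lemma borel_contracted mu A L : dominant mu -> G A -> lim mu A L -> B L -> B A.
Proof.
move=> dmu; have [cmu _] := dmu; have cmu' := cGL cmu.
have [BGL [B1 BM] BV] := sB; have [GGL [G1 GM] GV] := sG.
have [muT muM _] := cmu; have [[_ cB [k0 Bk] _] Bmax] := bB.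
have um c : c != 0 -> mu c \in unitmx by move=> c0; case: cmu' => H _ _; apply: H.
pose B' := [set A | G A /\ exists2 L, lim mu A L & B L].
suff EB : B' = B by move=> GA AL BL; rewrite -EB; split=> //; exists L.
move=> {A L}.
have BB' : B `<=` B'.
  move=> D BD; split; first exact: BG.
  by have [L' DL] := pol_lim (borel_pol dmu BD); exists L' => //; apply: borel_lim DL.
have [K [D [Lp [HL polL LD]]]] := conj_poly cmu'.
(* By [polP], a limit exists when the coefficients of order below K vanish, and it is then the
   coefficient of order K: both are polynomial conditions. *)
have cl : zclosed setT B'.
  have [PB [_ EB]] := Bcl; have [PG [_ EG]] := Gcl.
  pose F (q : {p | PG p} + 'I_K * ('I_n * 'I_n) + {p | PB p}) (A : 'M[C]_n) :=
    match q with
    | inl (inl p) => mxeval (sval p) A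
    | inl (inr (k, ij)) => cf k (Lp A) ij.1 ij.2
    | inr p => mxeval (sval p) (cf K (Lp A))
    end.
  have -> : B' = [set A | GL A /\ forall q, F q A = 0].
    apply/seteqP; split=> X /=.
      move=> [GX [L XL BL]]; split; first exact: GGL.
      have /(polP X L HL) [X0 XL'] := XL.
      move=> [[[p Pp]|[k ij]]|[p Pp]] /=.
      - by move: GX; rewrite EG => -[_]; apply.
      - by rewrite X0 // mxE.
      by rewrite XL'; move: BL; rewrite EB => -[_]; apply.
    move=> [GX XF]; have XL : lim mu X (cf K (Lp X)).
      apply/(polP _ _ HL); split=> // k kK; apply/matrixP => i j; rewrite [RHS]mxE.
      exact: (XF (inl (inr (Ordinal kK, (i, j))))).
    split; first by rewrite EG; split=> // p Pp; apply: (XF (inl (inl (exist _ p Pp)))).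
    exists (cf K (Lp X)) => //; rewrite EB; split; first exact: (lim_unit cmu' XL).
    by move=> p Pp; apply: (XF (inr (exist _ p Pp))).
  apply: zclosed_polyfun => -[[[p Pp]|[k ij]]|[p Pp]] /=.
  - by exists p.
  - exact: polL.
  by apply: polyfun_comp => i j; apply: polL.
have sB' : subgroup B'.
  split.
  - by move=> X [/GGL].
  - split; first by split=> //; exists 1%:M => //; apply: lim1.
    move=> X Y [GX [L XL BL]] [GY [M YM BM']]; split; first exact: GM.
    by exists (L *m M); [exact: limM|exact: BM].
  move=> X [GX [L XL BL]]; split; first exact: GV.
  by exists (invmx L); [apply: limV => //; apply: GGL|exact: BV].
apply: Bmax => //; split=> //; last by move=> X [].
(* Each element of B' is joined to its limit, a point of B, by a polynomial curve inside B', so a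
   separation of B' would separate B. *)
- move=> [F1 [F2 [[c1 c2] cov dis ne1 ne2]]].
  have curve X E1 E2 : zclosed setT E1 -> zclosed setT E2 -> B' `<=` E1 `|` E2 ->
      B' `&` E1 `&` E2 = set0 -> B' X -> E1 X -> exists2 L, B L & E1 L.
    move=> ce1 ce2 cv ds [GX [L XL BL]] E1X; exists L => //.
    have [Q HQ QL] := XL; rewrite -QL.
    apply: (connected_curve ce1 ce2 cv ds _ (a := 1)); last first.
      by rewrite -HQ ?oner_neq0 // (cochar1 TGL cmu) conj1by.
    move=> c; case: (eqVneq c 0) => [->|c0]; first by rewrite QL; apply: BB'.
    rewrite -HQ //; split.
      have Gm : G (mu c) by apply: BG; apply: TB; apply: muT.
      by apply: (GM); [apply: (GM)|apply: GV].
    by exists L => //; apply: lim_conj.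
  apply: cB; exists F1, F2; split=> //.
  - by move=> X /BB' /cov.
  - by rewrite -subset0 -dis => X [[/BB' h1 h2] h3].
  - by have [X [BX F1X]] := ne1; have [L ? ?] := curve X F1 F2 c1 c2 cov dis BX F1X; exists L.
  have cov' : B' `<=` F2 `|` F1 by move=> X /cov [|]; [right|left].
  have dis' : B' `&` F2 `&` F1 = set0 by rewrite -setIA [F2 `&` _]setIC setIA.
  by have [X [BX F2X]] := ne2; have [L ? ?] := curve X F2 F1 c2 c1 cov' dis' BX F2X; exists L.
have sder H j : subgroup H -> subgroup (iter j (@derived R n) H).
  by move=> sH; elim: j => //= j IH; apply: derived_subgroup.
have subB' j : iter j (@derived R n) B' `<=` B'.
  by elim: j => //= j IH X /(derived_sub (sder _ j sB')) /IH.
(* Limits are compatible with products and inverses, so the derived series of B' flows into that of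
   B, and after k0 steps into 1. *)
have derL j X L : iter j (@derived R n) B' X -> lim mu X L ->
    iter j (@derived R n) B L.
  elim: j X L => [|j IH] X L /=.
    by move=> [_ [L' XL' BL']] XL; rewrite (lim_uniq XL XL').
  have sH := sder _ j sB'; have sH' := sder _ j sB.
  have [_ [d1 dM] dV] := derived_subgroup sH'.
  have un Y : iter j (@derived R n) B' Y -> Y \in unitmx.
    by case: sH => H _ _; apply: H.
  move=> dX; move: X dX L; apply: (derived_ind sH) => //=.
  - by move=> L /(lim_uniq (lim1 cmu')) <-.
  - move=> X Y dX dY HX HY L XYL.
    have [_ [L1 XL1 _]] := subB' j.+1 _ dX; have [_ [L2 YL2 _]] := subB' j.+1 _ dY.
    by rewrite -(lim_uniq (limM cmu' XL1 YL2) XYL); apply: dM; [exact: HX|exact: HY].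
  - move=> X dX HX L XL.
    have [_ [L1 XL1 _]] := subB' j.+1 _ dX.
    have UX := un _ (derived_sub sH dX).
    by rewrite -(lim_uniq (limV cmu' XL1 UX) XL); apply: dV; apply: HX.
  move=> X Y HX HY L XL.
  have [_ [L1 XL1 _]] := subB' j _ HX; have [_ [L2 YL2 _]] := subB' j _ HY.
  have E := limM cmu' (limM cmu' (limM cmu' XL1 YL2) (limV cmu' XL1 (un _ HX)))
    (limV cmu' YL2 (un _ HY)).
  rewrite -(lim_uniq E XL); apply: derived_comm.
    exact: (IH X).
  exact: (IH Y).
(* Elements whose curve is 1 modulo c^j. Each further commutator gains at least one order, because
   [X, Y] - 1 contains the factor XY - YX; once the order exceeds the uniform degree bound D, only 1
   remains. *)
pose U j := [set X | exists Q : 'M[{poly C}]_n, forall c, c != 0 ->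
  conjby (mu c) X = 1%:M + c ^+ j *: ev Q c].
have derU j : iter (j + k0) (@derived R n) B' `<=` U j.+1.
  elim: j => [|j IH].
    move=> X dX; have [_ [L XL _]] := subB' _ _ dX.
    have := derL _ _ _ dX XL; rewrite Bk => L1; move: XL; rewrite L1 => -[Q HQ Q1].
    have [Q' EQ _] := curve_near1 Q1.
    by exists Q' => c c0; rewrite HQ // EQ evD ev1 evZ hornerX expr1.
  move=> X /=; have sH := sder _ (j + k0)%N sB'.
  have cU X' Q' c : conjby (mu c) X' = 1%:M + c ^+ j.+1 *: ev Q' c ->
      conjby (mu c) X' - 1%:M = c ^+ j.+1 *: ev Q' c.
    by move=> ->; rewrite addrAC subrr add0r.
  have un Y : iter (j + k0) (@derived R n) B' Y -> Y \in unitmx.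
    by case: sH => H _ _; apply: H.
  have polB Y : iter (j + k0) (@derived R n) B' Y -> pol mu Y.
    by move=> /subB' [_ [L YL _]]; apply: lim_pol YL.
  have polB1 Y : derived (iter (j + k0) (@derived R n) B') Y -> pol mu Y.
    by move=> /(derived_sub sH); apply: polB.
  have invB Y : iter (j + k0) (@derived R n) B' Y -> pol mu (invmx Y).
    by case: sH => _ _ H /H; apply: polB.
  move: X; apply: (derived_ind sH) => /=.
  - exists 0 => c c0; rewrite conjby1 ?um //.
    by rewrite (_ : ev 0 c = 0) ?scaler0 ?addr0 // [LHS]map_mx0.
  - move=> X Y dX dY [Q1 H1] [Q2 H2]; exists (Q1 + Q2 + 'X^(j.+2) *: (Q1 *m Q2)) => c c0.
    rewrite conjbyM ?um // H1 // H2 // mulmxDl mul1mx mulmxDr mulmx1 2!evD evZ evM.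
    rewrite hornerXn -scalemxAl -scalemxAr -addrA !scalerDr; congr (_ + _).
    rewrite addrCA addrA; congr (_ + _).
  - move=> X dX [Q1 H1]; have [P HP] := invB _ (derived_sub sH dX).
    have UX := un _ (derived_sub sH dX).
    exists (- (P *m Q1)) => c c0; rewrite evN evM -HP //.
    have E : conjby (mu c) (invmx X) *m conjby (mu c) X = 1%:M.
      by rewrite -conjbyM ?um // mulVmx // conjby1 ?um.
    rewrite H1 // mulmxDr mulmx1 in E.
    by rewrite scalerN -E scalemxAr addrK.
  move=> X Y dX dY; have [Q1 H1] := IH _ dX; have [Q2 H2] := IH _ dY.
  have [P1 HP1] := invB _ dX; have [P2 HP2] := invB _ dY.
  have [UX UY] := (un _ dX, un _ dY).
  exists ('X^j *: ((Q1 *m Q2 - Q2 *m Q1) *m P1 *m P2)) => c c0.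
  have -> : X *m Y *m invmx X *m invmx Y =
      1%:M + (X *m Y - Y *m X) *m invmx X *m invmx Y.
    rewrite !mulmxBl (mulmxK UX) (mulmxV UY) addrCA subrr addr0.
    by [].
  rewrite conjbyD conjby1; last exact: um.
  congr (_ + _).
  rewrite [LHS]conjbyM; last exact: um.
  rewrite [X in X *m _]conjbyM; last exact: um.
  rewrite conjbyB [conjby _ (X *m Y)]conjbyM; last exact: um.
  rewrite [conjby _ (Y *m X)]conjbyM; last exact: um.
  rewrite (HP1 c c0) (HP2 c c0) (H1 c c0) (H2 c c0).
  rewrite evZ hornerXn !evM evB !evM scalerA -exprD.
  rewrite !scalemxAl; congr (_ *m _ *m _).
  rewrite commutator_near1 -!scalemxAl -!scalemxAr !scalerA -!exprD.
  by rewrite -scalerBr addSnnS addnC.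
have Uend : U (D + 1)%N `<=` [set 1%:M].
  move=> X [Q HQ] /=.
  have E : Lp X = 'X^K *: 1%:M + 'X^(K + (D + 1)) *: Q.
    apply: ev_inj => c c0; rewrite -HL // HQ // evD !evZ !hornerXn ev1.
    by rewrite scalerDr scalerA -exprD.
  have Q0 : Q = 0.
    apply: cf_inj => k; have -> : cf k (0 : 'M[{poly C}]_n) = 0 by rewrite [LHS]map_mx0.
    have := LD X (K + (D + 1) + k)%N; rewrite E.
    have -> : cf (K + (D + 1) + k) ('X^K *: 1%:M + 'X^(K + (D + 1)) *: Q) = cf k Q.
      apply/matrixP => i j; rewrite !mxE /= coefD !coefXnM.
      rewrite [(_ < K + (D + 1))%N]ltnNge leq_addr /= addKn.
      rewrite [(_ < K)%N]ltnNge -addnA leq_addr /= addKn coefMn coef1.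
      by rewrite addnAC addn1 /= mul0rn add0r.
    by apply; rewrite addnAC -addnA addnA addnC -!addnA leq_addr.
  have := HQ 1 (oner_neq0 _).
  rewrite (cochar1 TGL cmu) conj1by Q0 [ev 0 1]map_mx0 scaler0 addr0.
  by [].
exists (D + k0)%N; apply/seteqP; split=> X.
  by move=> /derU; rewrite -addn1 => /Uend.
by move=> /= ->; case: (sder _ (D + k0)%N sB') => _ [].
Qed.

End Borel.

(** * Commutators of opposite root subgroups *)

Section Brackets.
Variables (R : realType) (n : nat).
Local Notation C := R[i].
Implicit Types (A B X Y Z g : 'M[C]_n).

Definition br A B := A *m B - B *m A.

Lemma brN A B : br B A = - br A B.
Proof. by rewrite /br opprB. Qed.

Lemma br_linear A : linear (br A).
Proof.
move=> a X Y; rewrite /br mulmxDr mulmxDl -scalemxAl -scalemxAr scalerBr.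
by rewrite opprD addrACA.
Qed.

Lemma brDr A X Y : br A (X + Y) = br A X + br A Y.
Proof. by have := br_linear A 1 X Y; rewrite !scale1r. Qed.

Lemma br0 A : br A 0 = 0.
Proof. by rewrite /br mulmx0 mul0mx subrr. Qed.

Lemma br0l A : br 0 A = 0.
Proof. by rewrite brN br0 oppr0. Qed.

Lemma brZr A a X : br A (a *: X) = a *: br A X.
Proof. by have := br_linear A a X 0; rewrite br0 !addr0. Qed.

Lemma brDl A X Y : br (X + Y) A = br X A + br Y A.
Proof. by rewrite !(brN A) brDr opprD. Qed.

Lemma brZl A a X : br (a *: X) A = a *: br X A.
Proof. by rewrite !(brN A) brZr scalerN. Qed.

Lemma br_jacobi A B X : br A (br B X) = br (br A B) X + br B (br A X).
Proof.
rewrite /br !mulmxBr !mulmxBl !mulmxA.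
have H (V : zmodType) (p r s u v w : V) :
    p - r - (s - u) = p - v - (w - u) + (v - s - (r - w)).
  rewrite [RHS]addrACA [p - v + (v - s)]addrA subrK [- (w - u)]opprB.
  rewrite [- (r - w)]opprB [u - w + _]addrA subrK opprB.
  by rewrite [RHS]addrACA [LHS]addrACA [- r - s]addrC.
exact: H.
Qed.

(** The commutator of x and y is 1 + (xy - yx) x^-1 y^-1, and both x - 1 and y - 1 are divisible by
    s. *)
Lemma exp_commutator K e f : e ^+ K = 0 -> f ^+ K = 0 -> (1 < K)%N ->
  exists V : 'M[{poly C}]_n, ev V 0 = br e f /\ forall s,
    ev (expq K e) s *m ev (expq K f) s *m ev (expq K e) (- s) *m ev (expq K f) (- s) =
    1%:M + s ^+ 2 *: ev V s.
Proof.
move=> eK fK K1; set ex := expq K e; set fx := expq K f.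
have [e1 Ee e10] := curve_near1 (expq0 eK).
have [f1 Ef f10] := curve_near1 (expq0 fK).
rewrite cf1_expq // in e10; rewrite cf1_expq // in f10.
exists ((e1 *m f1 - f1 *m e1) *m scaleq (-1) ex *m scaleq (-1) fx); split.
  by rewrite !evM !ev_scaleq mulr0 (expq0 eK) (expq0 fK) !mulmx1 evB !evM e10 f10.
move=> s; rewrite !evM !ev_scaleq !mulN1r -(exp_inv s eK) -(exp_inv s fK).
have Ue : ev ex s \in unitmx by apply: exp_GL.
have Uf : ev fx s \in unitmx by apply: exp_GL.
have -> : ev ex s *m ev fx s *m invmx (ev ex s) *m invmx (ev fx s) = 1%:M +
    (ev ex s *m ev fx s - ev fx s *m ev ex s) *m invmx (ev ex s) *m invmx (ev fx s).
  by rewrite !mulmxBl (mulmxK Ue) (mulmxV Uf) addrCA subrr addr0.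
congr (_ + _); rewrite !scalemxAl; congr (_ *m _ *m _).
rewrite evB /ex /fx Ee Ef [ev (1%:M + _) s]evD [ev (1%:M + 'X *: f1) s]evD !ev1 !evZ.
rewrite hornerX commutator_near1 !evM.
by rewrite -!scalemxAl -!scalemxAr !scalerA scalerBr.
Qed.

End Brackets.

Section SimpleRoots.
Variables (R : realType) (n : nat) (G T B : set 'M[R[i]]_n) (I : finType).
Local Notation C := R[i].
Variable a : I -> 'M[C]_n -> C.
Hypotheses (Gcl : zclosed setT G) (sG : subgroup G) (bB : borel G B)
  (TB : T `<=` B) (spl : split_torus setT T) (aS : simple_roots G T B a).

Let TG : T `<=` G. Proof. by case: bB => [[_ _ _ H] _] t /TB /H. Qed.
Let GGL : G `<=` @GL R n. Proof. by case: sG. Qed.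
Let TGL : T `<=` @GL R n. Proof. by move=> t /TG /GGL. Qed.

(** The matrices [upper c] have determinant 1, so a regular function of them is polynomial in c, and
    a polynomial one-parameter group is an exponential. *)
Lemma root_param_expq (b : 'M[C]_n -> C) (x : C -> 'M[C]_n) : root_param G T b x ->
  exists K e, [/\ e ^+ K = 0, e != 0, forall c, x c = ev (expq K e) c
    & forall t, T t -> conjby t e = b t *: e].
Proof.
move=> [[_ sx] xG [[_ xM xr] [x' [_ x'x _]]] xT].
have UGL : range (@upper R) `<=` @GL R 2.
  move=> _ [c _ <-]; have E : upper c *m upper (- c) = 1%:M.
    by rewrite upperD subrr /upper scale0r addr0.
  by have [] := mulmx1_unit E.
have up c : (\det (upper c) : C) = 1.
  have ut : is_trig_mx (upper c)^T.
    by apply/is_trig_mxP => -[[|[|]]] // ? [[|[|]]] // ? _; rewrite !mxE /= mulr0 addr0.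
  by rewrite -det_tr (det_trig ut) !big_ord_recl big_ord0 !mxE /= mulr0 !addr0 !mulr1.
have [Q HQ] : exists Q, forall c, x c = ev Q c.
  have H i j : exists q : {poly C}, forall c, x c i j = q.[c].
    have [p [N [_ Hp]]] := xr i j.
    have [q Hq] := mxeval_ev p (1%:M + 'X *: cst (delta_mx 0 1)).
    exists q => c; have := Hp (upper c); rewrite upper01 up expr1n divr1 => -> //.
    by rewrite -Hq evD ev1 evZ hornerX ev_cst.
  have [q Hq] := choice (fun ij => H ij.1 ij.2).
  exists (\matrix_(i, j) q (i, j)) => c; apply/matrixP => i j.
  by rewrite evE mxE -Hq.
have xD c d : x (c + d) = x c *m x d.
  by have := xM (upper c) (upper d); rewrite upperD !upper01; apply.
have x0 : x 0 = 1%:M.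
  have E := xD 0 0; rewrite addr0 in E.
  have U : x 0 \in unitmx by apply: GGL; apply: xG; exists 0.
  by rewrite -[LHS](mulKmx U) -E mulVmx.
have [K [e [eK eE]]] : exists K e, e ^+ K = 0 /\ forall c, ev Q c = ev (expq K e) c.
  by apply: one_param_exp => [|c d]; rewrite -!HQ ?x0.
have xE c : x c = ev (expq K e) c by rewrite HQ.
have e0 : e != 0.
  apply/eqP => E; have x1 : x 1 = x 0.
    by rewrite !xE E -(scale0r (0 : 'M[C]_n)) !expq_scale !mul0r.
  have := congr1 x' x1; rewrite -[X in x' (x X)](upper01 1) -[X in _ = x' (x X)](upper01 0).
  rewrite !x'x; [|by exists 0|by exists 1].
  move/matrixP/(_ 0 1); rewrite !upper01; move/eqP.
  by rewrite oner_eq0.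
have K1 : (1 < K)%N.
  case: K eK {eE xE} => [|[|//]]; last by rewrite expr1 => E; case/eqP: e0.
  by move=> E; case/eqP: e0; rewrite -[e]mulmx1 -[1%:M]/(e ^+ 0) E mulmx0.
exists K, e; split=> // t Tt.
have E : expq K (conjby t e) = expq K (b t *: e).
  apply: ev_inj => c _; rewrite -conjby_exp; last exact: TGL.
  by rewrite expq_scale -xE xT // xE.
by have := congr1 (cf 1) E; rewrite !cf1_expq.
Qed.

(** Such an equality is a relation between the simple roots in which a_j has exponent m_j + 1 >
    0. *)
Lemma char_mul_neq1 i j (m : I -> nat) : i != j ->
  ~ (forall t, T t -> a i t * (a j t)^-1 = \prod_k a k t ^+ m k).
Proof.
move=> ij H; have [ar aind _] := aS.
have a0 k t : T t -> a k t != 0.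
  move=> Tt; have [[H1 _ _] _ _] := ar k.
  have := H1 t Tt; rewrite /GL /= unitmxE det_scalar1 unitfE.
  by [].
pose e k : int := (m k)%:Z + (k == j)%:Z - (k == i)%:Z.
have /(_ j) : forall k, e k = 0.
  apply: aind => t Tt.
  under eq_bigr => k _ do rewrite /e !expfzDr ?a0 // -exprnP.
  rewrite 2!big_split /= -H //.
  rewrite (bigD1 j) //= eqxx expr1z big1 => [|k kj]; last by rewrite (negPf kj) expr0z.
  rewrite (bigD1 i) //= eqxx big1 => [|k ki]; last by rewrite (negPf ki) oppr0 expr0z.
  by rewrite !mulr1 mulfVK ?a0 // -[_ ^ (-1)]/(_^-1) divff ?a0.
by rewrite /e eqxx eq_sym (negPf ij) subr0 -PoszD addn1.
Qed.

(* The commutator of x_i and y_j has leading term s^2 [e_i, f_j]; if this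
   bracket were not zero, it would generate a root subgroup of weight
   alpha_i - alpha_j in B. *)
Lemma simple_root_commute (q : nat) (mu : I -> C -> 'M[C]_n) i j K e f :
  (0 < q)%N -> (forall k, cochar T (mu k)) ->
  (forall k l c, c != 0 -> a l (mu k c) = c ^+ (if l == k then q else 0)) ->
  i != j -> e ^+ K = 0 -> f ^+ K = 0 -> (1 < K)%N ->
  (forall c, G (ev (expq K e) c)) -> (forall c, G (ev (expq K f) c)) ->
  (forall t, T t -> conjby t e = a i t *: e) ->
  (forall t, T t -> conjby t f = (a j t)^-1 *: f) -> e *m f = f *m e.
Proof.
move=> q0 cmu amu ij eK fK K1 eG fG eT fT.
have [d [ep tc]] := split_torus_coords spl; have [sT Tc _ _] := tc.
have [_ sTm TV] := sT; have [_ [G1 GM] GV] := sG.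
pose ex := expq K e; pose fx := expq K f.
have [V [V0 Vs]] := exp_commutator eK fK K1.
pose U s := ev ex s *m ev fx s *m ev ex (- s) *m ev fx (- s).
have {}Vs s : U s = 1%:M + s ^+ 2 *: ev V s by exact: Vs.
have GU s : G (U s)   by apply: (GM) (fG _); apply: (GM) (eG _); apply: (GM).
(* Under [nu], e and f both have weight q, so U(s) is conjugated to U(c^q s) and contracted to 1. By
   [lim0_nilpotent] U(s) is therefore unipotent. *)
pose nu c := mu i c *m mu j c^-1.
have cnu : cochar T nu by apply: cocharM => //; apply: cocharV.
have cnu' : cochar (@GL R n) nu.
  by have [H1 H2 H3] := cnu; split=> // c c0; apply: TGL; apply: H1.
have [muT _ _] := cmu i; have [mujT _ _] := cmu j.
have anu c : c != 0 -> a i (nu c) = c ^+ q /\ a j (nu c) = c ^- q.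
  move=> c0; have c0' : c^-1 != 0 by rewrite invr_eq0.
  have [ar _ _] := aS.
  have aM k t t' : T t -> T t' -> a k (t *m t') = a k t * a k t'.
    move=> Tt Tt'; have [[_ H _] _ _] := ar k.
    have := H t t' Tt Tt' => /matrixP /(_ 0 0); rewrite mulmxij big_ord1 !mxE eqxx !mulr1n.
    by [].
  have ji : (j == i) = false by rewrite eq_sym (negPf ij).
  have Ti := muT c c0; have Tj := mujT _ c0'.
  rewrite (aM i _ _ Ti Tj) (aM j _ _ Ti Tj) !(amu _ _ c c0) !(amu _ _ _ c0').
  by rewrite !eqxx ji (negPf ij) !expr0 mulr1 mul1r exprVn.
have nuU c s : c != 0 -> conjby (nu c) (U s) = U (c ^+ q * s).
  move=> c0; have Tn : T (nu c) by case: cnu => H _ _; apply: H.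
  have Un : nu c \in unitmx by apply: TGL.
  have [ai aj] := anu c c0.
  rewrite /U !(conjbyM _ _ Un) !(conjby_exp _ _ _ Un) eT // fT // ai aj invrK.
  by rewrite !expq_scale !mulrN.
have [K0 HK0] := lim0_nilpotent cnu'.
have UK s : (U s - 1%:M) ^+ K0 = 0.
  apply: HK0; exists (('X^q * s%:P) ^+ 2 *: compq ('X^q * s%:P) V).
    move=> c c0; have Un : nu c \in unitmx by case: cnu' => H _ _; apply: H.
    rewrite conjbyB conjby1 // nuU // Vs addrAC subrr add0r evZ ev_compq.
    by rewrite !hornerE.
  by rewrite evZ !hornerE expr0n (gtn_eqF q0) /= !mul0r expr0n /= scale0r.
have VK s : ev V s ^+ K0 = 0.
  apply: nilpotent_curve => c c0; apply: (scalerI (_ : (c ^+ 2) ^+ K0 != 0)).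
    by rewrite !expf_neq0.
  rewrite scaler0 -mxscaleX; have := UK c; rewrite Vs addrAC subrr add0r.
  by [].
pose X := br e f.
have XV : ev V 0 = X by [].
have XK : X ^+ K0 = 0 by rewrite -XV.
have GX z : G (ev (expq K0 X) z).
  (* The value exp(z X) is the limit of U(s)^(z / s^2) as s tends to 0. In the binomial series the
     factors s^2 of U(s) - 1 turn each z / s^2 - b into z - b s^2, which makes the expression
     polynomial in s. *)
  pose E := \sum_(r < K0) ((r`!%:R)^-1%:P * \prod_(b < r) (z%:P - b%:R%:P * 'X^2)) *: V ^+ r.
  have Ez s : ev E s = \sum_(r < K0) ((r`!%:R)^-1 * \prod_(b < r) (z - b%:R * s ^+ 2)) *: ev V s ^+ r.
    rewrite ev_sum; apply: eq_bigr => r _; rewrite evZ evX hornerM hornerC horner_prod.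
    by congr ((_ * _) *: _); apply: eq_bigr => b _; rewrite !hornerE.
  have E0 : ev E 0 = ev (expq K0 X) z.
    rewrite Ez ev_expq; apply: eq_bigr => r _; rewrite XV scalerA.
    rewrite (eq_bigr (fun=> z)) => [|b _]; last by rewrite expr0n /= mulr0 subr0.
    by rewrite prodr_const card_ord mulrC.
  rewrite -E0; apply: (zclosed_curve Gcl); last by rewrite E0; apply: exp_GL.
  move=> k; set s : C := k.+1%:R; have s0 : s != 0 by rewrite pnatr_eq0.
  have -> : ev E s = ev (powq K0 (U s)) (z / s ^+ 2).
    rewrite Ez /powq ev_sum; apply: eq_bigr => r _.
    rewrite evZ ev_cst Vs addrAC subrr add0r mxscaleX scalerA /binq hornerZ horner_prod.
    rewrite -mulrA; congr ((_ * _) *: _).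
    have -> : (s ^+ 2) ^+ r = \prod_(b < r) (s ^+ 2) by rewrite prodr_const card_ord.
    rewrite -big_split /=; apply: eq_bigr => b _.
    by rewrite hornerD hornerX hornerN hornerC mulrBl mulfVK // expf_neq0.
  exact: (powq_closed _ Gcl _ (GU s) (UK s)).
apply/eqP; rewrite -subr_eq0 -[_ - _]/X; apply/negPn/negP => X0.
have XT t : T t -> conjby t X = (a i t / a j t) *: X.
  move=> Tt; have Ut := TGL Tt; rewrite /X conjbyB !(conjbyM _ _ Ut) eT // fT //.
  by rewrite -!scalemxAl -!scalemxAr !scalerA scalerBr [(a j t)^-1 * _]mulrC.
have dmu : dominant T a (mu i).
  by split; [exact: cmu|exists (fun l => if l == i then q else 0%N) => l c c0; apply: amu].
have muX c : c != 0 -> conjby (mu i c) X = c ^+ q *: X.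
  move=> c0; rewrite (XT _ (muT c c0)) !(amu _ _ _ c0) eqxx eq_sym (negPf ij).
  by rewrite expr0 divr1.
(* For [mu i] the vector X has weight q > 0, since a_j is trivial on [mu i]; so exp(z X) is
   contracted to 1, an element of B. *)
have XB z : B (ev (expq K0 X) z).
  apply: (borel_contracted Gcl sG bB TB spl aS dmu (GX z) (L := 1%:M)).
    have [E HE] := exp_curve ('X *: cst X) K0 z.
    exists (compq 'X^q E) => [c c0|].
      rewrite conjby_exp; last by apply: TGL; apply: muT.
      by rewrite muX // ev_compq HE evZ ev_cst !hornerXn hornerX.
    rewrite ev_compq hornerXn expr0n (gtn_eqF q0) HE evZ hornerX scale0r.
    by rewrite -(scale0r X) expq_scale mul0r expq0.
  by case: bB => [[[_ [_ [H _] _]]]].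
have ri : root_in G T B (fun t => a i t * (a j t)^-1).
  have BG : B `<=` G by case: bB => [[]].
  apply: (root_in_exp tc BG XB XK X0 (cmu i) (k := q%:Z)) => //.
  by case: q q0 {amu anu nuU dmu muX}.
have [_ _ aN] := aS; have [m Hm] := aN _ ri.
exact: (char_mul_neq1 ij Hm).
Qed.

End SimpleRoots.

(** * Pinnings *)

Section SL2Identities.
Variable R : realType.
Local Notation C := R[i].

Definition mx2 (a b c d : C) : 'M[C]_2 :=
  \matrix_(i, j) (if i == 0 then if j == 0 then a else b else if j == 0 then c else d).

Lemma mx2P (A : 'M[C]_2) : A = mx2 (A 0 0) (A 0 1) (A 1 0) (A 1 1).
Proof.
apply/matrixP => -[[|[|]]] // pi [[|[|]]] // pj; rewrite mxE /=;
  by congr (A _ _); apply: val_inj.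
Qed.

Lemma mx2M a b c d a' b' c' d' : mx2 a b c d *m mx2 a' b' c' d' =
  mx2 (a * a' + b * c') (a * b' + b * d') (c * a' + d * c') (c * b' + d * d').
Proof.
by rewrite [LHS]mx2P !mulmxij !big_ord_recl !big_ord0 !mxE /= !addr0.
Qed.

Lemma det_mx2 a b c d : \det (mx2 a b c d) = a * d - b * c.
Proof.
rewrite (expand_det_row _ 0) !big_ord_recl big_ord0 /cofactor !det_mx11 !mxE /=.
by rewrite expr0 expr1 mul1r mulN1r mulrN addr0.
Qed.

Lemma upperE (a : C) : upper a = mx2 1 a 0 1.
Proof. by rewrite [LHS]mx2P !mxE /= !(mulr0, mulr1, addr0, add0r). Qed.

Lemma lowerE (a : C) : lower a = mx2 1 0 a 1.
Proof. by rewrite [LHS]mx2P !mxE /= !(mulr0, mulr1, addr0, add0r). Qed.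

Lemma diag2E (a : C) : diag2 a = mx2 a 0 0 a^-1.
Proof. by rewrite [LHS]mx2P !mxE /= !(mulr0, mulr1, addr0, add0r). Qed.

Lemma weyl2E : weyl2 R = mx2 0 1 (-1) 0.
Proof. by rewrite [LHS]mx2P !mxE /= !(subr0, sub0r). Qed.

Lemma mx2_1 : 1%:M = mx2 1 0 0 1.
Proof. by rewrite [LHS]mx2P !mxE. Qed.

Lemma SL2_upper a : SL2 (upper a : 'M[C]_2).
Proof. by rewrite /SL2 /= upperE det_mx2 mulr1 mulr0 subr0. Qed.

Lemma SL2_lower a : SL2 (lower a : 'M[C]_2).
Proof. by rewrite /SL2 /= lowerE det_mx2 mulr1 mul0r subr0. Qed.

Lemma SL2_diag2 a : a != 0 -> SL2 (diag2 a : 'M[C]_2).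
Proof. by move=> a0; rewrite /SL2 /= diag2E det_mx2 divff // mulr0 subr0. Qed.

Lemma SL2_weyl2 : SL2 (weyl2 R).
Proof. by rewrite /SL2 /= weyl2E det_mx2 mulr0 mulrN1 sub0r opprK. Qed.

Lemma SL2M (A B : 'M[C]_2) : SL2 A -> SL2 B -> SL2 (A *m B).
Proof. by rewrite /SL2 /= det_mulmx => -> ->; rewrite mulr1. Qed.

Lemma SL2_1 : SL2 (1%:M : 'M[C]_2).
Proof. by rewrite /SL2 /= det1. Qed.

Lemma SL2V (A : 'M[C]_2) : SL2 A -> SL2 (invmx A).
Proof. by rewrite /SL2 /= det_inv => ->; rewrite invr1. Qed.

Lemma SL2_unit (A : 'M[C]_2) : SL2 A -> A \in unitmx.
Proof. by rewrite /SL2 /= unitmxE => ->; rewrite unitr1. Qed.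

Lemma upper0 : upper (0 : C) = 1%:M. Proof. by rewrite upperE mx2_1. Qed.

Lemma diag2M (a b : C) : diag2 a *m diag2 b = diag2 (a * b).
Proof. by rewrite !diag2E mx2M invfM; congr mx2; ring. Qed.

Lemma diag2_1 : diag2 (1 : C) = 1%:M. Proof. by rewrite diag2E mx2_1 invr1. Qed.

Lemma weyl2_factor : weyl2 R = upper 1 *m lower (- 1) *m upper 1.
Proof. by rewrite weyl2E lowerE !upperE !mx2M; congr mx2; ring. Qed.

Lemma diag2_weyl2 (a : C) : a != 0 ->
  diag2 a *m weyl2 R = upper a *m lower (- a^-1) *m upper a.
Proof. by move=> a0; rewrite weyl2E diag2E lowerE !upperE !mx2M; congr mx2; field. Qed.

Lemma upper_bruhat (a : C) : a != 0 ->
  upper a = lower a^-1 *m diag2 a *m weyl2 R *m lower a^-1.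
Proof. by move=> a0; rewrite weyl2E diag2E !lowerE !upperE !mx2M; congr mx2; field. Qed.

Lemma upper_lower (a b : C) : 1 + a * b != 0 -> upper a *m lower b =
  lower (b / (1 + a * b)) *m diag2 (1 + a * b) *m upper (a / (1 + a * b)).
Proof. by move=> ab0; rewrite diag2E !lowerE !upperE !mx2M; congr mx2; field. Qed.

Lemma diag2_upper (c a : C) : c != 0 -> diag2 c *m upper a = upper (c ^+ 2 * a) *m diag2 c.
Proof. by move=> c0; rewrite diag2E !upperE !mx2M; congr mx2; field. Qed.

Lemma weyl2_lower (c : C) : weyl2 R *m lower c = upper (- c) *m weyl2 R.
Proof. by rewrite weyl2E upperE lowerE !mx2M; congr mx2; ring. Qed.

Lemma weyl2_sqr : weyl2 R *m weyl2 R = diag2 (- 1).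
Proof. by rewrite weyl2E diag2E mx2M invrN1; congr mx2; ring. Qed.

Lemma upper_lower_commutator (s : C) (u := 1 + s ^+ 2 + s ^+ 4) : u != 0 ->
  upper s *m lower s *m upper (- s) *m lower (- s) =
  lower (s ^+ 3 / u) *m diag2 u *m upper (- (s ^+ 3 / u)).
Proof.
by move=> u0; rewrite diag2E !lowerE !upperE !mx2M; congr mx2; rewrite /u in u0 *; field.
Qed.

(* The involution exchanging upper and lower triangular matrices and fixing
   weyl2. *)
Definition flip (A : 'M[C]_2) : 'M[C]_2 := (invmx A)^T.

Lemma mx2_tr a b c d : (mx2 a b c d)^T = mx2 a c b d.
Proof. by rewrite [LHS]mx2P !mxE. Qed.

Lemma invmx2 a b c d : a * d - b * c = 1 -> invmx (mx2 a b c d) = mx2 d (- b) (- c) a.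
Proof.
move=> D; have U : mx2 a b c d \in unitmx by apply: SL2_unit; rewrite /SL2 /= det_mx2.
have E : mx2 d (- b) (- c) a *m mx2 a b c d = 1%:M.
  by rewrite mx2M mx2_1; congr mx2; rewrite -?D; ring.
by rewrite -[RHS](mulmxK U) E mul1mx.
Qed.

Lemma flipM (A B : 'M[C]_2) : SL2 A -> SL2 B -> flip (A *m B) = flip A *m flip B.
Proof. by move=> /SL2_unit UA /SL2_unit UB; rewrite /flip invmxM // trmx_mul. Qed.

Lemma flip1 : flip 1%:M = 1%:M.
Proof. by rewrite /flip invmx1 trmx1. Qed.

Lemma SL2_flip A : SL2 A -> SL2 (flip A).
Proof. by move=> /SL2V; rewrite /SL2 /= det_tr. Qed.

Lemma flip_upper a : flip (upper a) = lower (- a).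
Proof. by rewrite /flip upperE lowerE invmx2 ?mx2_tr ?oppr0 //; ring. Qed.

Lemma flip_lower a : flip (lower a) = upper (- a).
Proof. by rewrite /flip upperE lowerE invmx2 ?mx2_tr ?oppr0 //; ring. Qed.

Lemma flip_diag2 a : a != 0 -> flip (diag2 a) = diag2 a^-1.
Proof. by move=> a0; rewrite /flip !diag2E invmx2 ?mx2_tr ?oppr0 ?invrK //; field. Qed.

Lemma flip_weyl2 : flip (weyl2 R) = weyl2 R.
Proof. by rewrite /flip weyl2E invmx2 ?mx2_tr ?opprK //; ring. Qed.

End SL2Identities.

Local Opaque upper lower diag2 weyl2.

(* The part of a pinning that is used below; the last clause provides
   cocharacters dual to the simple roots, up to a factor q. *)
Record pdata (R : realType) (n : nat) (I : finType) (T : set 'M[R[i]]_n)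
    (chi : I -> 'M[R[i]]_n -> R[i]) (ph : I -> 'M[R[i]]_2 -> 'M[R[i]]_n) (K : nat)
    (e f : I -> 'M[R[i]]_n) (mu : I -> R[i] -> 'M[R[i]]_n) (q : nat) : Prop := Pdata {
  pd_sub : subgroup T;
  pd_comm : forall t t', T t -> T t' -> t *m t' = t' *m t;
  pd_chie : forall i t, T t -> conjby t (e i) = chi i t *: e i;
  pd_chif : forall i t, T t -> conjby t (f i) = (chi i t)^-1 *: f i;
  pd_chiM : forall i t t', T t -> T t' -> chi i (t *m t') = chi i t * chi i t';
  pd_e0 : forall i, e i != 0;
  pd_f0 : forall i, f i != 0;
  pd_ph1 : forall i, ph i 1%:M = 1%:M;
  pd_phM : forall i A B, SL2 A -> SL2 B -> ph i (A *m B) = ph i A *m ph i B;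
  pd_eK : forall i, e i ^+ K = 0;
  pd_fK : forall i, f i ^+ K = 0;
  pd_K1 : (1 < K)%N;
  pd_up : forall i c, ph i (upper c) = ev (expq K (e i)) c;
  pd_lo : forall i c, ph i (lower c) = ev (expq K (f i)) c;
  pd_ef : forall i j, i != j -> e i *m f j = f j *m e i;
  pd_cor : forall i c, c != 0 -> T (ph i (diag2 c));
  pd_cork : forall i j, exists k : int, forall c, c != 0 -> chi j (ph i (diag2 c)) = c ^ k;
  pd_q : (0 < q)%N;
  pd_mu : forall j, cochar T (mu j);
  pd_chimu : forall i j c, c != 0 -> chi i (mu j c) = c ^+ (if i == j then q else 0) }.

HB.lock Definition xx (R : realType) n (I : Type) (ph : I -> 'M[R[i]]_2 -> 'M[R[i]]_n) i c :=
  ph i (upper c).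
HB.lock Definition yy (R : realType) n (I : Type) (ph : I -> 'M[R[i]]_2 -> 'M[R[i]]_n) i c :=
  ph i (lower c).
HB.lock Definition cc (R : realType) n (I : Type) (ph : I -> 'M[R[i]]_2 -> 'M[R[i]]_n) i c :=
  ph i (diag2 c).
HB.lock Definition ss (R : realType) n (I : Type) (ph : I -> 'M[R[i]]_2 -> 'M[R[i]]_n) i :=
  ph i (weyl2 R).

Section DualData.
Variables (R : realType) (n : nat) (I : finType) (T : set 'M[R[i]]_n).
Local Notation C := R[i].
Variables (chi : I -> 'M[C]_n -> C) (ph : I -> 'M[C]_2 -> 'M[C]_n) (K : nat).
Variables (e f : I -> 'M[C]_n) (mu : I -> C -> 'M[C]_n) (q : nat).
Hypothesis D : pdata T chi ph K e f mu q.

Lemma oppX p (A : 'M[C]_p) k : A ^+ k = 0 -> (- A) ^+ k = 0.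
Proof. by move=> Ak; rewrite -scaleN1r mxscaleX Ak scaler0. Qed.

Lemma expq_opp (A : 'M[C]_n) c : ev (expq K (- A)) c = ev (expq K A) (- c).
Proof. by rewrite -scaleN1r expq_scale mulN1r. Qed.

(** Composition with [flip] exchanges e_i and -f_i, replaces the roots by their negatives and fixes
    the representatives of the simple reflections. Every lemma on positive root vectors thus has a
    negative version. *)
Lemma dual_pdata : pdata T (fun i t => (chi i t)^-1) (fun i A => ph i (flip A)) K
  (fun i => - f i) (fun i => - e i) (fun j c => mu j c^-1) q.
Proof.
split.
- exact: pd_sub D.
- exact: pd_comm D.
- by move=> i t Tt; rewrite linearN /= (pd_chif D) // scalerN.
- by move=> i t Tt; rewrite linearN /= (pd_chie D) // scalerN invrK.
- by move=> i t t' Tt Tt'; rewrite (pd_chiM D) // invfM.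
- by move=> i; rewrite oppr_eq0 (pd_f0 D).
- by move=> i; rewrite oppr_eq0 (pd_e0 D).
- by move=> i; rewrite flip1 (pd_ph1 D).
- by move=> i A B SA SB; rewrite flipM // (pd_phM D) //; apply: SL2_flip.
- by move=> i; apply: oppX; apply: (pd_fK D).
- by move=> i; apply: oppX; apply: (pd_eK D).
- exact: pd_K1 D.
- by move=> i c; rewrite flip_upper (pd_lo D) expq_opp.
- by move=> i c; rewrite flip_lower (pd_up D) expq_opp.
- by move=> i j ij; rewrite !mulNmx !mulmxN (pd_ef D) // eq_sym.
- by move=> i c c0; rewrite flip_diag2 //; apply: (pd_cor D); rewrite invr_eq0.
- move=> i j; have [k Hk] := pd_cork D i j; exists k => c c0.
  by rewrite flip_diag2 // Hk ?invr_eq0 // expfV invrK.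
- exact: pd_q D.
- by move=> j; apply: cocharV; apply: (pd_mu D).
- by move=> i j c c0; rewrite (pd_chimu D) ?invr_eq0 // exprVn invrK.
Qed.

Lemma dual_xx i c : xx (fun i A => ph i (flip A)) i c = yy ph i (- c).
Proof. by rewrite xx.unlock yy.unlock flip_upper. Qed.

Lemma dual_yy i c : yy (fun i A => ph i (flip A)) i c = xx ph i (- c).
Proof. by rewrite xx.unlock yy.unlock flip_lower. Qed.

Lemma dual_ss i : ss (fun i A => ph i (flip A)) i = ss ph i.
Proof. by rewrite ss.unlock flip_weyl2. Qed.

End DualData.

(** * The Lie algebras generated by the simple root vectors *)

Section GeneratedSpaces.
Variables (R : realType) (n : nat) (I : finType).
Local Notation C := R[i].
Implicit Types (e f : I -> 'M[C]_n) (X Y : 'M[C]_n) (V : {vspace 'M[C]_n}).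

(** The span of the iterated brackets with a generator on the left. That it is a Lie algebra follows
    from the Jacobi identity ([nsp_bracket]). *)
Definition nilspan e X := forall V, (forall i, e i \in V) ->
  (forall j Y, Y \in V -> br (e j) Y \in V) -> X \in V.

Fact nsp_exists e : exists U : {vspace 'M[C]_n}, forall X, X \in U <-> nilspan e X.
Proof.
apply: vspace_of => [V _ _|a X Y HX HY V H1 H2]; first exact: mem0v.
by apply: memvD; [apply: memvZ; apply: HX|apply: HY].
Qed.

End GeneratedSpaces.

(* For the root vectors e_i of a pinning, this is the Lie algebra of U_+. *)
HB.lock Definition nsp (R : realType) n (I : finType) (e : I -> 'M[R[i]]_n) :
    {vspace 'M[R[i]]_n} :=
  projT1 (cid (nsp_exists e)).

Section GeneratedSpaces.
Variables (R : realType) (n : nat) (I : finType).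
Local Notation C := R[i].
Implicit Types (e f : I -> 'M[C]_n) (X Y : 'M[C]_n) (V : {vspace 'M[C]_n}).

Lemma nspP e X : X \in nsp e <-> nilspan e X.
Proof. by rewrite nsp.unlock; apply: (projT2 (cid (nsp_exists e))). Qed.

Lemma nsp_gen e i : e i \in nsp e.
Proof. by apply/nspP => V H _. Qed.

Lemma nsp_br e j X : X \in nsp e -> br (e j) X \in nsp e.
Proof. by move=> /nspP HX; apply/nspP => V H1 H2; apply: (H2); apply: HX. Qed.

Lemma nsp_ind e (Q : 'M[C]_n -> Prop) : Q 0 ->
  (forall a X Y, Q X -> Q Y -> Q (a *: X + Y)) -> (forall i, Q (e i)) ->
  (forall j X, X \in nsp e -> Q X -> Q (br (e j) X)) -> forall X, X \in nsp e -> Q X.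
Proof.
move=> Q0 QL Qe Qb X; have [U HU] := vspace_of Q0 QL.
move=> /nspP /(_ (U :&: nsp e)%VS) H.
have : X \in (U :&: nsp e)%VS.
  apply: H => [i|j Y]; rewrite memv_cap; first by rewrite nsp_gen andbT; apply/HU.
  move=> /andP [/HU YU YN]; rewrite memv_cap nsp_br // andbT; apply/HU.
  exact: Qb.
by rewrite memv_cap => /andP [/HU].
Qed.

Lemma nsp_sub e V : (forall i, e i \in V) ->
  (forall j Y, Y \in V -> br (e j) Y \in V) -> (nsp e <= V)%VS.
Proof. by move=> H1 H2; apply/subvP => X /nspP; apply. Qed.

Lemma nsp_opp e : nsp (fun i => - e i) = nsp e.
Proof.
have H e' e'' : (forall i, e'' i = - e' i) -> (nsp e'' <= nsp e')%VS.
  move=> E; apply: nsp_sub => [i|j Y HY]; rewrite E; first by rewrite memvN nsp_gen.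
  by rewrite -scaleN1r brZl memvZ // nsp_br.
apply/eqP; rewrite eqEsubv; apply/andP; split; apply: H => i //.
by rewrite opprK.
Qed.

Lemma nsp_bracket e X Y : X \in nsp e -> Y \in nsp e -> br X Y \in nsp e.
Proof.
move=> HX; move: X HX Y; apply: nsp_ind.
- by move=> Y _; rewrite brN br0 oppr0 mem0v.
- move=> a X X' HX HX' Y HY; rewrite brDl brZl.
  by apply: memvD; [apply: memvZ; apply: HX|apply: HX'].
- by move=> i Y; apply: nsp_br.
move=> j X XN HX Y HY.
have -> : br (br (e j) X) Y = br (e j) (br X Y) - br X (br (e j) Y).
  by rewrite br_jacobi addrK.
by apply: memvB; [apply: nsp_br; apply: HX|apply: HX; apply: nsp_br].
Qed.

(** For a pinning these brackets are the derivatives of the coroots. *)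
Definition hsp e f : {vspace 'M[C]_n} := <<[seq br (e i) (f i) | i : I]>>%VS.

Lemma hsp_gen e f i : br (e i) (f i) \in hsp e f.
Proof. by apply: memv_span; apply/mapP; exists i; rewrite ?mem_enum. Qed.

Lemma hsp_ind e f (Q : 'M[C]_n -> Prop) : Q 0 ->
  (forall a X Y, Q X -> Q Y -> Q (a *: X + Y)) -> (forall i, Q (br (e i) (f i))) ->
  forall X, X \in hsp e f -> Q X.
Proof.
move=> Q0 QL Qb X; have [U HU] := vspace_of Q0 QL.
suff /subvP H : (hsp e f <= U)%VS by move=> /H /HU.
by apply/span_subvP => _ /mapP [i _ ->]; apply/HU.
Qed.

Lemma hsp_opp e f : hsp (fun i => - f i) (fun i => - e i) = hsp e f.
Proof.
have brNN X Y : br (- Y) (- X) = - br X Y.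
  by rewrite -[- Y]scaleN1r -[- X]scaleN1r brZl brZr scalerA mulrNN mul1r scale1r brN.
apply/eqP; rewrite eqEsubv; apply/andP; split; apply/span_subvP => _ /mapP [i _ ->].
  by rewrite brNN memvN hsp_gen.
by rewrite -memvN -brNN; apply: (hsp_gen (fun i => - f i) (fun i => - e i)).
Qed.

End GeneratedSpaces.

Section CorootWeights.
Variables (R : realType) (n : nat).
Local Notation C := R[i].
Implicit Types (e f X Z : 'M[C]_n).

(** This stands for 1 + s^2 + s^4. What matters is the expansion of its powers, pu^a = 1 + a s^2 +
    O(s^3), and that it does not vanish at the test points. *)
Variable pu : {poly C}.
Hypotheses (pu_nat : forall j : nat, pu.[j.+1%:R] != 0) (pu0 : pu.[0] = 1)
  (pu_exp : forall a, exists2 r : {poly C}, pu ^+ a = 1 + 'X^2 * r & r.[0] = a%:R).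

Let exp_scaled K X : X ^+ K = 0 -> (1 < K)%N -> exists A : 'M[{poly C}]_n, forall s,
  pu.[s] != 0 -> pu.[s] ^+ K *: ev (expq K X) (s ^+ 3 / pu.[s]) =
    pu.[s] ^+ K *: 1%:M + s ^+ 3 *: ev A s.
Proof.
case: K => // K XK K1.
exists (\sum_(k < K) ('X ^+ (3 * k) * pu ^+ (K - k)) *: cst ((k.+1`!%:R)^-1 *: X ^+ k.+1)).
move=> s u0; rewrite ev_expq big_ord_recl scalerDr; congr (_ + _).
  by rewrite !expr0 scale1r fact0 invr1 scale1r.
rewrite ev_sum !scaler_sumr; apply: eq_bigr => k _.
rewrite evZ ev_cst [RHS]scalerA [LHS]scalerA (_ : nat_of_ord (lift ord0 k) = k.+1) //.
congr (_ *: _).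
rewrite hornerM !hornerXn horner_exp expr_div_n.
rewrite {1}(_ : K.+1 = (K - k) + k.+1)%N; last first.
  by rewrite addnS subnK // ltnW.
rewrite exprD mulrACA [X in _ * X]mulrC -mulrA.
rewrite [pu.[s] ^- _ * _]mulVf ?expf_neq0 // mulr1 mulrC mulrA; congr (_ * _).
by rewrite -exprM -exprD mulnS.
Qed.

Let scaled_product (x y : C) (A W B : 'M[C]_n) :
  (x *: 1%:M + y *: A) *m W *m (x *: 1%:M + y *: B) =
  (x * x) *: W + y *: (x *: (W *m B) + x *: (A *m W) + y *: (A *m W *m B)).
Proof.
rewrite [X in X *m _]mulmxDl -!scalemxAl mul1mx mulmxDr -!scalemxAr mulmx1.
rewrite !mulmxDl -!scalemxAl !scalerDr !scalerA -!addrA; congr (_ + _).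
by rewrite addrCA; congr (_ + (_ + _)); rewrite mulrC.
Qed.

(** Write h for the bracket of e and f. To order s^2 the coroot at u = pu(s) is 1 + s^2 h, and the
    weight relation becomes a Z + h Z = b Z + Z h. Multiplication by u^(2K) clears the
    denominators. *)
Lemma coroot_weight_gen K e f (co : C -> 'M[C]_n) Z a b : e ^+ K = 0 -> f ^+ K = 0 ->
  (1 < K)%N -> (forall s, pu.[s] != 0 ->
    ev (expq K e) s *m ev (expq K f) s *m ev (expq K e) (- s) *m ev (expq K f) (- s) =
    ev (expq K f) (s ^+ 3 / pu.[s]) *m co pu.[s] *m ev (expq K e) (- (s ^+ 3 / pu.[s]))) ->
  (forall u, u != 0 -> u ^+ a *: (co u *m Z) = u ^+ b *: (Z *m co u)) ->
  br (br e f) Z = (b%:R - a%:R) *: Z.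
Proof.
move=> eK fK K1 Hc HZ; have [V [V0 HV]] := exp_commutator eK fK K1.
have [A HA] := exp_scaled (oppX fK) K1; have [B HB] := exp_scaled eK K1.
have [ra Ea ra0] := pu_exp a; have [rb Eb rb0] := pu_exp b.
have [W HW] : exists W, forall s, ev W s = 1%:M + s ^+ 2 *: ev V s.
  by exists (1%:M + 'X^2 *: V) => s; rewrite evD ev1 evZ hornerXn.
(* The remainder, divided by s^3, left by the two outer exponentials. *)
pose M := pu ^+ K *: (W *m B) + pu ^+ K *: (A *m W) + 'X^3 *: (A *m W *m B).
have Hco s : pu.[s] != 0 -> pu.[s] ^+ (K + K) *: co pu.[s] =
    pu.[s] ^+ (K + K) *: ev W s + s ^+ 3 *: ev M s.
  move=> u0; set u := pu.[s]; set z := s ^+ 3 / u.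
  have E : ev (expq K (- f)) z *m ev W s *m ev (expq K e) z = co u.
    rewrite HW -HV Hc //; rewrite (expq_opp K f) !mulmxA.
    rewrite -(expqD _ _ fK) addNr (expq0 fK) mul1mx -mulmxA.
    by rewrite -(expqD _ _ eK) addNr (expq0 eK) mulmx1.
  have -> : u ^+ (K + K) *: co u = (u ^+ K *: ev (expq K (- f)) z) *m ev W s *m
      (u ^+ K *: ev (expq K e) z).
    by rewrite -E -!scalemxAl -scalemxAr scalerA -exprD.
  rewrite (HA s u0) (HB s u0) exprD.
  by rewrite /M 2!evD !evZ !evM !horner_exp hornerX scaled_product.
clearbody M.
(* [L] and [N] are the two sides of the weight relation after division by s^2; the remainder [N]
   keeps a factor s, so evaluation at 0 gives the bracket. *)
pose L := pu ^+ (K + K) *: ((ra - rb) *: cst Z + (V *m cst Z - cst Z *m V) +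
   'X^2 *: (ra *: (V *m cst Z) - rb *: (cst Z *m V))).
pose N := 'X *: (pu ^+ b *: (cst Z *m M) - pu ^+ a *: (M *m cst Z)).
have LN : L = N.
  apply: ev_inj_nat => j; set s : C := j.+1%:R; have u0 := pu_nat j; rewrite -/s in u0.
  have s0 : s ^+ 2 != 0 by rewrite expf_neq0 // pnatr_eq0.
  have E : pu.[s] ^+ a *: ((pu.[s] ^+ (K + K) *: co pu.[s]) *m Z) =
      pu.[s] ^+ b *: (Z *m (pu.[s] ^+ (K + K) *: co pu.[s])).
    rewrite -scalemxAl -scalemxAr !scalerA ![_ * pu.[s] ^+ (K + K)]mulrC -!scalerA.
    by rewrite HZ.
  rewrite Hco // HW in E; apply: (scalerI s0).
  have [Ea' Eb'] : pu.[s] ^+ a = 1 + s ^+ 2 * ra.[s] /\ pu.[s] ^+ b = 1 + s ^+ 2 * rb.[s].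
    by rewrite -!horner_exp Ea Eb !(hornerM, hornerD, hornerN, horner_exp, hornerX, hornerC).
  rewrite /L /N !(evZ, evD, evN, evM, ev_cst) !(hornerM, hornerD, hornerN, horner_exp, hornerX).
  rewrite mulmxDl mulmxDr -!scalemxAl -!scalemxAr mulmxDl mulmxDr mul1mx mulmx1 in E.
  rewrite -!scalemxAl -!scalemxAr in E.
  set u := pu.[s] in E Ea' Eb' u0 *.
  set VZ := ev V s *m Z in E *; set ZV := Z *m ev V s in E *.
  set MZ := ev M s *m Z in E *; set ZM := Z *m ev M s in E *.
  set al := u ^+ (K + K) in E *; clearbody VZ ZV MZ ZM al.
  apply/matrixP => k l; move/matrixP/(_ k l): E; rewrite !mxE => E.
  apply/eqP; rewrite -subr_eq0; move/eqP: E; rewrite -subr_eq0 => /eqP E.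
  rewrite -[0]E Ea' Eb'; apply/eqP; ring.
have := congr1 (fun P : 'M[{poly C}]_n => ev P 0) LN; rewrite /L /N !(evZ, evD, evN, evM, ev_cst).
rewrite !(hornerM, hornerD, hornerN, horner_exp, hornerX) V0 ra0 rb0 pu0.
rewrite expr1n scale1r mul0r 2!scale0r addr0 => E.
have -> : br (br e f) Z = br e f *m Z - Z *m br e f by [].
by apply/eqP; rewrite -subr_eq0 -scaleNr opprB addrC E.
Qed.

End CorootWeights.

(* Comparing the coefficients of s^2 in U(s) Z and Z U(s), where U(s) is the
   commutator of x(s) and y(s), which is the coroot at 1 + s^2 + s^4 up to O(s^3). *)
Lemma coroot_weight (R : realType) n K (e f : 'M[R[i]]_n) (co : R[i] -> 'M[R[i]]_n) Z a b :
  e ^+ K = 0 -> f ^+ K = 0 -> (1 < K)%N ->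
  (forall s, let u := 1 + s ^+ 2 + s ^+ 4 in u != 0 ->
    ev (expq K e) s *m ev (expq K f) s *m ev (expq K e) (- s) *m ev (expq K f) (- s) =
    ev (expq K f) (s ^+ 3 / u) *m co u *m ev (expq K e) (- (s ^+ 3 / u))) ->
  (forall u, u != 0 -> u ^+ a *: (co u *m Z) = u ^+ b *: (Z *m co u)) ->
  br (br e f) Z = (b%:R - a%:R) *: Z.
Proof.
move=> eK fK K1 Hc; pose pu : {poly R[i]} := 1 + 'X^2 + 'X^4.
have puE s : pu.[s] = 1 + s ^+ 2 + s ^+ 4 by rewrite /pu !hornerE.
apply: (@coroot_weight_gen _ _ pu _ _ _ K) => //.
- move=> j; rewrite puE (_ : _ + _ = (1 + j.+1 ^ 2 + j.+1 ^ 4)%N%:R) ?pnatr_eq0 //.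
  by rewrite !natrD !natrX.
- by rewrite puE !expr0n /= !addr0.
- elim=> [|k [r Er r0]]; first by exists 0; rewrite ?expr0 ?mulr0 ?addr0 ?horner0.
  exists (r + (1 + 'X^2) * pu ^+ k); last first.
    rewrite Er !hornerE r0 expr0n /= !(mul0r, addr0, mulr1, mul1r).
    by rewrite -[k.+1]addn1 natrD.
  rewrite exprS {1}/pu Er; ring.
by move=> s; rewrite puE; apply: Hc.
Qed.

Section AdjointAction.
Variables (R : realType) (n : nat).
Local Notation C := R[i].
Implicit Types (N X Y L g : 'M[C]_n) (m : C -> 'M[C]_n).

Lemma exp_conj K X Y g : (1 < K)%N -> g \in unitmx ->
  (forall c, conjby g (ev (expq K X) c) = ev (expq K Y) c) -> conjby g X = Y.
Proof.
move=> K1 Ug H; have E : expq K (conjby g X) = expq K Y.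
  by apply: ev_inj => c _; rewrite -conjby_exp.
by have := congr1 (cf 1) E; rewrite !cf1_expq.
Qed.

Lemma cst_expq K N : N ^+ K = 0 -> cst N *m expq K N = expq K N *m cst N.
Proof.
move=> NK; apply: ev_inj => c _; rewrite !evM ev_cst ev_expq.
rewrite mulmx_sumr mulmx_suml; apply: eq_bigr => k _.
by rewrite -!scalemxAl -!scalemxAr; congr (_ *: (_ *: _)); rewrite mulmxE -exprS exprSr.
Qed.

(** The derivative in c of Ad(exp(cN)) Y is Ad(exp(cN)) [N, Y], so by induction all coefficients of
    this curve lie in V. *)
Lemma exp_stable K N (V : {vspace 'M[C]_n}) c X : N ^+ K = 0 ->
  (forall Y, Y \in V -> br N Y \in V) -> X \in V -> conjby (ev (expq K N) c) X \in V.
Proof.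
move=> NK NV; pose P Y := expq K N *m cst Y *m expq K (- N).
have evP Y d : ev (P Y) d = conjby (ev (expq K N) d) Y.
  by rewrite !evM ev_cst expq_opp -exp_inv.
have dP Y : dq (P Y) = P (br N Y).
  rewrite /P dqM dqM dq_cst mulmx0 addr0 (dq_expq NK) (dq_expq (oppX NK)).
  rewrite -(cst_expq (oppX NK)).
  have -> : cst (- N) = - cst N by apply: ev_inj => d _; rewrite evN !ev_cst.
  have -> : cst (br N Y) = cst N *m cst Y - cst Y *m cst N.
    by apply: ev_inj => d _; rewrite evB !evM !ev_cst.
  by rewrite mulNmx mulmxN mulmxBr mulmxBl !mulmxA.
have cP k : forall Y, Y \in V -> cf k (P Y) \in V.
  elim: k => [|k IH] Y YV.
    by rewrite -ev0 evP (expq0 NK) conj1by.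
  have := IH _ (NV _ YV); rewrite -dP cf_dq => H.
  have k0 : (k.+1%:R : C) != 0 by rewrite pnatr_eq0.
  by rewrite -[X in X \in V]scale1r -(mulVf k0) -scalerA memvZ.
move=> XV; rewrite -evP (ev_coef _ (leqnn _)); apply: memv_suml => k _.
by rewrite memvZ // cP.
Qed.

Lemma laurent_constant (Q Q' : 'M[{poly C}]_n) :
  (forall c, c != 0 -> ev Q c = ev Q' c^-1) -> Q = cst (ev Q 0).
Proof.
move=> H; set d := deg Q'.
have E : 'X^d *: Q = mkpm d.+1 (fun k => cf (d - k) Q').
  apply: ev_inj => c c0; rewrite evZ hornerXn H // ev_mkpm (@ev_coef _ _ _ _ d) //.
  rewrite scaler_sumr big_ord_recr /= subnn.
  have -> : \sum_(k < d) c ^+ d *: (c^-1 ^+ k *: cf k Q') =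
      \sum_(k < d) c ^+ k.+1 *: cf (d - k.+1) Q'.
    rewrite (reindex_inj rev_ord_inj) /=; apply: eq_bigr => k _.
    rewrite scalerA; congr (_ *: _); rewrite -{1}(subnKC (ltn_ord k)) exprD exprVn.
    by rewrite mulfK // expf_neq0.
  have := @big_ord_recl _ 0 +%R d (fun k : 'I_d.+1 => c ^+ k *: cf (d - k) Q').
  rewrite big_ord_recr /= subnn => ->.
  by rewrite expr0 scale1r subn0 [in cf d Q']cf_deg // add0r.
apply: cf_inj => k; have := congr1 (cf (d + k)) E.
rewrite cf_mkpm (_ : cf (d + k) ('X^d *: Q) = cf k Q); last first.
  by apply/matrixP => i j; rewrite !mxE /= coefXnM ltnNge leq_addr /= addKn.
case: k => [_|k ->]; first by rewrite ev0; apply/matrixP => i j; rewrite !mxE /= coefC.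
rewrite ltnNge addnS ltnS leq_addr /=.
by apply/matrixP => i j; rewrite !mxE /= coefC.
Qed.

(** The curve is polynomial both in c and in 1/c, hence constant. Uniqueness statements below come
    from this rigidity. *)
Lemma lim_fixed m X L : cochar (@GL R n) m -> lim m X L ->
  pol (fun c => m c^-1) X -> X = L /\ forall c, c != 0 -> conjby (m c) X = X.
Proof.
move=> cm [Q HQ Q0] [Q' HQ'].
have E : Q = cst L.
  rewrite -Q0; apply: (@laurent_constant _ Q') => c c0.
  by rewrite -HQ // -HQ' ?invr_eq0 // invrK.
have XL : X = L.
  by rewrite -[LHS]conj1by -(cochar1 (@subset_refl _ _) cm) HQ ?oner_neq0 // E ev_cst.
by split=> // c c0; rewrite HQ // E ev_cst.
Qed.

Lemma lim_weight m X k : (forall c, c != 0 -> conjby (m c) X = c ^+ k *: X) ->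
  lim m X (if k == 0%N then X else 0).
Proof.
move=> H; exists ('X^k *: cst X) => [c c0|]; rewrite evZ ev_cst hornerXn; first exact: H.
by rewrite expr0n; case: eqP => _; rewrite ?scale1r ?scale0r.
Qed.

Lemma lim_br m X Y L L' : cochar (@GL R n) m -> lim m X L -> lim m Y L' ->
  lim m (br X Y) (br L L').
Proof.
move=> cm XL YL; rewrite /br -[- (Y *m X)]scaleN1r -[- (L' *m L)]scaleN1r ![_ + -1 *: _]addrC.
by apply: limD => //; apply: limM.
Qed.

Lemma conjby_br g X Y : g \in unitmx -> conjby g (br X Y) = br (conjby g X) (conjby g Y).
Proof. by move=> Ug; rewrite /br conjbyB !conjbyM. Qed.

End AdjointAction.

HB.lock Definition wd (R : realType) n (I : Type) (ph : I -> 'M[R[i]]_2 -> 'M[R[i]]_n)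
    (u : seq I) : 'M[R[i]]_n :=
  \big[mulmx/1%:M]_(i <- u) ss ph i.

(** The exponent of alpha_i on this cocharacter is q if P i holds and 0 otherwise. With [predT] it
    contracts all of U_+; with [predC1 j] it commutes with the image of phi_j and contracts the
    other simple root subgroups. *)
Definition cm (R : realType) n (I : finType) (mu : I -> R[i] -> 'M[R[i]]_n)
    (P : pred I) (c : R[i]) : 'M[R[i]]_n :=
  \big[mulmx/1%:M]_(j <- [seq j <- enum I | P j]) mu j c.

(** * Words in the simple reflections *)

Section WeylElements.
Variables (R : realType) (n : nat) (I : finType) (T : set 'M[R[i]]_n).
Local Notation C := R[i].
Variables (chi : I -> 'M[C]_n -> C) (ph : I -> 'M[C]_2 -> 'M[C]_n) (K : nat).
Variables (e f : I -> 'M[C]_n) (mu : I -> C -> 'M[C]_n) (q : nat).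
Hypothesis D : pdata T chi ph K e f mu q.
Local Notation wd := (wd ph).
Local Notation cm := (cm mu).
Implicit Types (A B X Y Z g t : 'M[C]_n) (u v w : seq I).

Lemma pd_unit t : T t -> t \in unitmx.
Proof. by case: (pd_sub D) => H _ _; apply: H. Qed.

Lemma pd_TM t t' : T t -> T t' -> T (t *m t').
Proof. by case: (pd_sub D) => _ [_ H] _; apply: H. Qed.

Lemma pd_TV t : T t -> T (invmx t).
Proof. by case: (pd_sub D) => _ _; apply. Qed.

Lemma pd_T1 : T 1%:M.
Proof. by case: (pd_sub D) => _ []. Qed.

Lemma pd_conjT t t' : T t -> T t' -> conjby t t' = t'.
Proof. by move=> Tt Tt'; rewrite /conjby (pd_comm D Tt Tt') mulmxK ?pd_unit. Qed.

Lemma pd_chi0 i t : T t -> chi i t != 0.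
Proof.
move=> Tt; apply/eqP => E; have := pd_chie D i Tt; rewrite E scale0r => /eqP.
by rewrite conjby_eq0 ?pd_unit // (negPf (pd_e0 D i)).
Qed.

Lemma pd_chi1 i : chi i 1%:M = 1.
Proof.
have := pd_chiM D i pd_T1 pd_T1; rewrite mul1mx => E.
by apply: (mulfI (pd_chi0 i pd_T1)); rewrite mulr1.
Qed.

Lemma ph_unit i (A : 'M[C]_2) : SL2 A -> ph i A \in unitmx.
Proof.
move=> SA; have E : ph i A *m ph i (invmx A) = 1%:M.
  by rewrite -(pd_phM D i SA (SL2V SA)) mulmxV ?SL2_unit // (pd_ph1 D).
by have [] := mulmx1_unit E.
Qed.

Lemma xxE i c : xx ph i c = ev (expq K (e i)) c.
Proof. by rewrite xx.unlock (pd_up D). Qed.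

Lemma yyE i c : yy ph i c = ev (expq K (f i)) c.
Proof. by rewrite yy.unlock (pd_lo D). Qed.

Lemma cc_T i c : c != 0 -> T (cc ph i c).
Proof. by rewrite cc.unlock; apply: (pd_cor D). Qed.

Lemma x_unit i c : xx ph i c \in unitmx.
Proof. by rewrite xx.unlock; apply/ph_unit/SL2_upper. Qed.

Lemma y_unit i c : yy ph i c \in unitmx.
Proof. by rewrite yy.unlock; apply/ph_unit/SL2_lower. Qed.

Lemma s_unit i : ss ph i \in unitmx.
Proof. by rewrite ss.unlock; apply/ph_unit/SL2_weyl2. Qed.

Lemma co_unit i c : c != 0 -> cc ph i c \in unitmx.
Proof. by move=> c0; rewrite cc.unlock; apply/ph_unit/SL2_diag2. Qed.

Lemma x_add i c d : xx ph i c *m xx ph i d = xx ph i (c + d).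
Proof. by rewrite xx.unlock -(pd_phM D i (SL2_upper c) (SL2_upper d)) upperD. Qed.

Lemma x_inv i c : invmx (xx ph i c) = xx ph i (- c).
Proof. by rewrite !xxE (exp_inv _ (pd_eK D i)). Qed.

Lemma y_inv i c : invmx (yy ph i c) = yy ph i (- c).
Proof. by rewrite !yyE (exp_inv _ (pd_fK D i)). Qed.

Lemma conj_x i t c : T t -> conjby t (xx ph i c) = xx ph i (chi i t * c).
Proof.
by move=> Tt; rewrite !xxE conjby_exp ?pd_unit // (pd_chie D) // expq_scale.
Qed.

Lemma conj_y i t c : T t -> conjby t (yy ph i c) = yy ph i ((chi i t)^-1 * c).
Proof.
by move=> Tt; rewrite !yyE conjby_exp ?pd_unit // (pd_chif D) // expq_scale.
Qed.

Lemma exp_conj_x i g X : g \in unitmx -> conjby g (e i) = X ->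
  forall c, conjby g (xx ph i c) = ev (expq K X) c.
Proof. by move=> Ug <- c; rewrite xxE conjby_exp. Qed.

Lemma exp_conj_y i g X : g \in unitmx -> conjby g (f i) = X ->
  forall c, conjby g (yy ph i c) = ev (expq K X) c.
Proof. by move=> Ug <- c; rewrite yyE conjby_exp. Qed.

Lemma weylE i : ss ph i = xx ph i 1 *m yy ph i (- 1) *m xx ph i 1.
Proof.
rewrite ss.unlock xx.unlock yy.unlock; have [Su Sl] := (@SL2_upper R 1, @SL2_lower R (- 1)).
by rewrite weyl2_factor (pd_phM D i (SL2M Su Sl) Su) (pd_phM D i Su Sl).
Qed.

Lemma co_weylE i a : a != 0 -> cc ph i a *m ss ph i =
  xx ph i a *m yy ph i (- a^-1) *m xx ph i a.
Proof.
move=> a0; rewrite cc.unlock ss.unlock xx.unlock yy.unlock; have [Su Sl] := (@SL2_upper R a, @SL2_lower R (- a^-1)).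
have E := congr1 (ph i) (diag2_weyl2 a0).
transitivity (ph i (diag2 a *m weyl2 R)).
  exact: esym (pd_phM D i (SL2_diag2 a0) (SL2_weyl2 R)).
by rewrite E (pd_phM D i (SL2M Su Sl) Su) (pd_phM D i Su Sl).
Qed.

Lemma conj_T_s i t : T t ->
  conjby t (ss ph i) = cc ph i (chi i t) *m ss ph i.
Proof.
move=> Tt; have Ut := pd_unit Tt; rewrite (co_weylE i (pd_chi0 i Tt)).
rewrite weylE (conjbyM _ _ Ut).
rewrite [X in X *m _](conjbyM _ _ Ut).
have Ex := conj_x i 1 Tt; have Ey := conj_y i (- 1) Tt.
rewrite mulr1 in Ex; rewrite mulrN1 in Ey.
rewrite Ex.
rewrite Ey.
by [].
Qed.

Lemma T_s i t : T t -> T (conjby (ss ph i) t).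
Proof.
move=> Tt; have Tt' := pd_TV Tt; have Ut := pd_unit Tt; have Us := s_unit i.
have c0 : chi i (invmx t) != 0 by apply: pd_chi0.
have E := conj_T_s i Tt'; rewrite {1}/conjby invmxK in E.
suff -> : conjby (ss ph i) t = t *m cc ph i (chi i (invmx t)).
  by apply: pd_TM => //; apply: cc_T.
have E2 : ss ph i *m t = t *m (cc ph i (chi i (invmx t)) *m ss ph i).
  by rewrite -E !mulmxA mulmxV // mul1mx.
by rewrite /conjby E2 !mulmxA mulmxK.
Qed.

Lemma s_sqr i : ss ph i *m ss ph i = cc ph i (- 1).
Proof. by rewrite ss.unlock cc.unlock -(pd_phM D i (SL2_weyl2 R) (SL2_weyl2 R)) weyl2_sqr. Qed.

Lemma T_s2 i : T (cc ph i (- 1)).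
Proof. by apply: cc_T; rewrite oppr_eq0 oner_neq0. Qed.

Lemma s_inv i : invmx (ss ph i) = invmx (cc ph i (- 1)) *m ss ph i.
Proof. by rewrite -s_sqr invmxM ?s_unit // mulmxKV ?s_unit. Qed.

Lemma T_sV i t : T t -> T (conjby (invmx (ss ph i)) t).
Proof.
move=> Tt; rewrite s_inv conjby_comp ?s_unit //; last first.
  by rewrite unitmx_inv; apply: pd_unit; apply: T_s2.
by rewrite (pd_conjT (pd_TV (T_s2 i)) (T_s i Tt)); apply: T_s.
Qed.

Lemma wd_nil : wd [::] = 1%:M.
Proof. by rewrite wd.unlock big_nil. Qed.

Lemma wd_cons i u : wd (i :: u) = ss ph i *m wd u.
Proof. by rewrite wd.unlock big_cons. Qed.

Lemma wd_cat u v : wd (u ++ v) = wd u *m wd v.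
Proof.
elim: u => [|i u IH]; first by rewrite wd_nil mul1mx.
by rewrite cat_cons !wd_cons IH mulmxA.
Qed.

Lemma wd_unit u : wd u \in unitmx.
Proof.
elim: u => [|i u IH]; first by rewrite wd_nil unitmx1.
by rewrite wd_cons unitmx_mul s_unit IH.
Qed.

Lemma T_wd u t : T t -> T (conjby (wd u) t).
Proof.
elim: u t => [|i u IH] t Tt; first by rewrite wd_nil conj1by.
by rewrite wd_cons conjby_comp ?s_unit ?wd_unit //; apply/T_s/IH.
Qed.

Lemma T_wdV u t : T t -> T (conjby (invmx (wd u)) t).
Proof.
elim: u t => [|i u IH] t Tt; first by rewrite wd_nil invmx1 conj1by.
rewrite wd_cons invmxM ?s_unit ?wd_unit // conjby_comp ?unitmx_inv ?s_unit ?wd_unit //.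
exact/IH/T_sV.
Qed.

Definition same_class u v := T (invmx (wd u) *m wd v).

Lemma same_classP u v : same_class u v <-> exists2 t, T t & wd v = wd u *m t.
Proof.
split=> [H|[t Tt E]]; last by rewrite /same_class E mulKmx ?wd_unit.
by exists (invmx (wd u) *m wd v) => //; rewrite mulKVmx ?wd_unit.
Qed.

Lemma same_class_l u t v : T t -> wd u = t *m wd v -> same_class u v.
Proof.
move=> Tt E; have Uv := wd_unit v; have Ut := pd_unit Tt.
rewrite /same_class E invmxM // -mulmxA.
have -> : invmx (wd v) *m (invmx t *m wd v) = conjby (invmx (wd v)) (invmx t).
  by rewrite /conjby invmxK mulmxA.
exact/T_wdV/pd_TV.
Qed.

Lemma same_class_sym u v : same_class u v -> same_class v u.
Proof.
move=> /pd_TV; rewrite /same_class invmxM ?unitmx_inv ?wd_unit // invmxK.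
by [].
Qed.

Lemma same_class_cons i u v : same_class u v -> same_class (i :: u) (i :: v).
Proof.
by move=> /same_classP [t Tt E]; apply/same_classP; exists t; rewrite // !wd_cons E mulmxA.
Qed.

(** The squares of the representatives of simple reflections lie in T. *)
Lemma wd_rev u : exists2 t, T t & wd (rev u) = invmx (wd u) *m t.
Proof.
elim: u => [|i u [t Tt E]].
  by exists 1%:M; [exact: pd_T1|rewrite wd_nil invmx1 mulmx1].
have Us := s_unit i; have T2 := T_s2 i; have U2 := pd_unit T2.
exists (conjby (ss ph i) t *m cc ph i (- 1)).
  by apply: pd_TM => //; apply: T_s.
rewrite rev_cons -cats1 wd_cat E !wd_cons wd_nil mulmx1 invmxM ?wd_unit //.
rewrite -!mulmxA; apply: (f_equal2 mulmx (erefl _)).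
by rewrite /conjby -s_sqr !mulmxA mulVmx // mul1mx mulmxKV.
Qed.

Lemma same_class_rev u v : same_class u v -> same_class (rev u) (rev v).
Proof.
move=> /same_classP [t Tt E]; have [tu Tu Eu] := wd_rev u; have [tv Tv Ev] := wd_rev v.
have [Uu Ut] := (wd_unit u, pd_unit Tt).
rewrite /same_class Eu Ev E invmxM // (invmxM _ (pd_unit Tu)) ?unitmx_inv // invmxK.
set wu := wd u in Uu *.
have -> : invmx tu *m wu *m (invmx t *m invmx wu *m tv) = invmx tu *m conjby wu (invmx t) *m tv.
  by rewrite /conjby !mulmxA.
by apply: pd_TM => //; apply: pd_TM; [exact: pd_TV|apply/T_wd/pd_TV].
Qed.

Lemma ph_mul3 i (A1 A2 A3 : 'M[C]_2) : SL2 A1 -> SL2 A2 -> SL2 A3 ->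
  ph i (A1 *m A2 *m A3) = ph i A1 *m ph i A2 *m ph i A3.
Proof. by move=> S1 S2 S3; rewrite (pd_phM D i (SL2M S1 S2) S3) (pd_phM D i S1 S2). Qed.

Lemma ph_mul4 i (A1 A2 A3 A4 : 'M[C]_2) : SL2 A1 -> SL2 A2 -> SL2 A3 -> SL2 A4 ->
  ph i (A1 *m A2 *m A3 *m A4) = ph i A1 *m ph i A2 *m ph i A3 *m ph i A4.
Proof.
by move=> S1 S2 S3 S4; rewrite (pd_phM D i (SL2M (SL2M S1 S2) S3) S4) ph_mul3.
Qed.

Lemma xy_commutator i s : let z := s ^+ 3 / (1 + s ^+ 2 + s ^+ 4) in
  1 + s ^+ 2 + s ^+ 4 != 0 ->
  xx ph i s *m yy ph i s *m xx ph i (- s) *m yy ph i (- s) =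
  yy ph i z *m cc ph i (1 + s ^+ 2 + s ^+ 4) *m xx ph i (- z).
Proof.
move=> z u0; rewrite xx.unlock yy.unlock cc.unlock.
have [Su Sl] := (@SL2_upper R, @SL2_lower R); have Sd := SL2_diag2 u0.
etransitivity; first exact: esym (ph_mul4 i (Su s) (Sl s) (Su (- s)) (Sl (- s))).
have E := congr1 (ph i) (upper_lower_commutator u0).
by etransitivity; [exact: E|exact: (ph_mul3 i (Sl z) Sd (Su (- z)))].
Qed.

Lemma h_weight i Z a b : (forall u : C, u != 0 ->
    u ^+ a *: (cc ph i u *m Z) = u ^+ b *: (Z *m cc ph i u)) ->
  br (br (e i) (f i)) Z = (b%:R - a%:R) *: Z.
Proof.
move=> H; apply: (coroot_weight (pd_eK D i) (pd_fK D i) (pd_K1 D) _ H) => s /= u0.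
by rewrite -!xxE -!yyE; apply: xy_commutator.
Qed.

Lemma cc_e i c : c != 0 -> conjby (cc ph i c) (e i) = c ^+ 2 *: e i.
Proof.
move=> c0; apply: (exp_conj (pd_K1 D) (co_unit i c0)) => d.
rewrite expq_scale -!xxE; have Uc := co_unit i c0.
suff E : cc ph i c *m xx ph i d = xx ph i (c ^+ 2 * d) *m cc ph i c.
  by rewrite /conjby E mulmxK.
rewrite xx.unlock cc.unlock; have [Su Sd] := (@SL2_upper R, SL2_diag2 c0).
etransitivity; first exact: esym (pd_phM D i Sd (Su d)).
have E := congr1 (ph i) (diag2_upper d c0).
by etransitivity; [exact: E|exact: (pd_phM D i (Su _) Sd)].
Qed.

Lemma h_e2 i : br (br (e i) (f i)) (e i) = 2 *: e i.
Proof.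
rewrite (@h_weight i (e i) 0 2) ?subr0 // => u u0; have Uc := co_unit i u0.
by rewrite expr0 scale1r scalemxAl -cc_e // /conjby mulmxKV.
Qed.

Lemma h_e i j : exists l, br (br (e i) (f i)) (e j) = l *: e j.
Proof.
have [k Hk] := pd_cork D i j.
have H (u : C) : u != 0 -> cc ph i u *m e j = u ^ k *: (e j *m cc ph i u).
  move=> u0; have Uc := co_unit i u0; have := pd_chie D j (cc_T i u0).
  rewrite {2}cc.unlock Hk // => E.
  by rewrite scalemxAl -E /conjby mulmxKV.
(* [h_weight] takes natural exponents on both sides, so a negative weight is moved to the left. *)
case: k H {Hk} => k H.
  by exists (k%:R - 0%:R); apply: h_weight => u u0; rewrite H // expr0 scale1r.
exists (0%:R - k.+1%:R); apply: h_weight => u u0; rewrite H // expr0 scale1r scalerA.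
by rewrite NegzE -invr_expz divff ?scale1r // expf_neq0.
Qed.

Lemma cm_cochar P : cochar T (cm P).
Proof.
apply: cochar_prod; first by case: (pd_sub D).
  exact: pd_comm D.
exact: pd_mu D.
Qed.

Lemma cm_GL P : cochar (@GL R n) (cm P).
Proof. by have [H1 H2 H3] := cm_cochar P; split=> // c c0; apply/pd_unit/H1. Qed.

Lemma cm_T P c : c != 0 -> T (cm P c).
Proof. by case: (cm_cochar P) => H _ _; apply: H. Qed.

Lemma chi_cm P i c : c != 0 -> chi i (cm P c) = c ^+ (if P i then q else 0).
Proof.
move=> c0; have muT j : T (mu j c) by case: (pd_mu D j) => H _ _; apply: H.
have -> (r : seq I) : uniq r -> chi i (\big[mulmx/1%:M]_(j <- r) mu j c) =
    c ^+ (if i \in r then q else 0).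
  elim: r => [|j r IH] /=; first by rewrite big_nil pd_chi1.
  move=> /andP [jr ur]; rewrite big_cons (pd_chiM D) //; last first.
    by elim: (r) => [|k r' IH']; rewrite ?big_nil ?big_cons; [apply: pd_T1|apply: pd_TM].
  rewrite (pd_chimu D) // IH // in_cons -exprD; case: eqP => [->|] /=.
    by rewrite (negPf jr) addn0.
  by rewrite add0n.
- by rewrite mem_filter mem_enum andbT.
by rewrite filter_uniq // enum_uniq.
Qed.

Lemma cm_e P i c : c != 0 -> conjby (cm P c) (e i) = c ^+ (if P i then q else 0) *: e i.
Proof. by move=> c0; rewrite (pd_chie D) ?chi_cm //; apply: cm_T. Qed.

Lemma cm_f P i c : c != 0 ->
  conjby (cm P c^-1) (f i) = c ^+ (if P i then q else 0) *: f i.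
Proof.
move=> c0; have c0' : c^-1 != 0 by rewrite invr_eq0.
by rewrite (pd_chif D) ?chi_cm // ?exprVn ?invrK //; apply: cm_T.
Qed.

Lemma q_neq0 : (q == 0%N) = false.
Proof. exact: gtn_eqF (pd_q D). Qed.

Lemma lim_e P i : lim (cm P) (e i) (if P i then 0 else e i).
Proof.
have := @lim_weight _ _ (cm P) (e i) _ (fun c => @cm_e P i c).
by case: (P i); rewrite ?q_neq0.
Qed.

Lemma np_T t X : T t -> X \in nsp e -> conjby t X \in nsp e.
Proof.
move=> Tt; have Ut := pd_unit Tt; move: X; apply: nsp_ind.
- by rewrite linear0 mem0v.
- by move=> a X Y HX HY; rewrite linearP /=; apply: memvD => //; apply: memvZ.
- by move=> i; rewrite (pd_chie D) // memvZ // nsp_gen.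
by move=> j X _ HX; rewrite conjby_br // (pd_chie D) // brZl memvZ // nsp_br.
Qed.

Lemma np_pol P X : X \in nsp e -> pol (cm P) X.
Proof.
move=> HX; suff [L HL] : exists L, lim (cm P) X L by apply: lim_pol HL.
move: X HX; apply: nsp_ind.
- by exists 0; apply: lim0.
- by move=> a X Y [L HL] [L' HL']; exists (a *: L + L'); apply: limD => //; apply: cm_GL.
- by move=> i; eexists; apply: lim_e.
move=> j X _ [L HL]; eexists; apply: lim_br (lim_e P j) HL; exact: cm_GL.
Qed.

Lemma np_lim0 X : X \in nsp e -> lim (cm predT) X 0.
Proof.
have cG := cm_GL predT; move: X; apply: nsp_ind.
- exact: lim0.
- by move=> a X Y HX HY; have := limD a HX HY; rewrite scaler0 addr0.
- by move=> i; apply: lim_e.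
move=> j X _ HX; have := lim_br cG (lim_e predT j) HX.
by rewrite br0.
Qed.

(** The complement of the line of e_j is contracted by [cm mu (predC1 j)]. Brackets with e_j
    preserve the contracted part and kill e_j; brackets with another e_k send everything into the
    contracted part. *)
Lemma np_split j X : X \in nsp e ->
  exists a Y, [/\ X = a *: e j + Y, Y \in nsp e & lim (cm (predC1 j)) Y 0].
Proof.
have cG := cm_GL (predC1 j); move: X; apply: nsp_ind.
- by exists 0, 0; rewrite scale0r addr0 mem0v; split=> //; apply: lim0.
- move=> b X X' [a [Y [-> HY LY]]] [a' [Y' [-> HY' LY']]].
  exists (b * a + a'), (b *: Y + Y'); split.
  + by rewrite scalerDl scalerDr scalerA addrACA.
  + by apply: memvD => //; apply: memvZ.
  by have := limD b LY LY'; rewrite scaler0 addr0.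
- move=> i; case: (eqVneq i j) => [->|ij].
    by exists 1, 0; rewrite scale1r addr0 mem0v; split=> //; apply: lim0.
  exists 0, (e i); rewrite scale0r add0r nsp_gen; split=> //.
  by have := lim_e (predC1 j) i; rewrite /= ij.
move=> k X _ [a [Y [-> HY LY]]]; exists 0, (br (e k) (a *: e j + Y)); split.
- by rewrite scale0r add0r.
- by apply: nsp_br; apply: memvD => //; apply: memvZ; apply: nsp_gen.
rewrite brDr brZr; case: (eqVneq k j) => [->|kj].
  rewrite [br (e j) (e j)]subrr scaler0 add0r.
  have := lim_br cG (lim_e (predC1 j) j) LY; rewrite br0.
  by [].
have Lk : lim (cm (predC1 j)) (e k) 0 by have := lim_e (predC1 j) k; rewrite /= kj.
have := limD a (lim_br cG Lk (lim_e (predC1 j) j)) (lim_br cG Lk LY).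
by rewrite 2!br0l scaler0 addr0.
Qed.

Lemma hs_T X t : X \in hsp e f -> T t -> conjby t X = X.
Proof.
move=> HX Tt; have Ut := pd_unit Tt; move: X HX; apply: hsp_ind.
- by rewrite linear0.
- by move=> a X Y HX HY; rewrite linearP /= HX HY.
move=> i; rewrite conjby_br // (pd_chie D) // (pd_chif D) // brZl brZr scalerA.
by rewrite divff ?scale1r // pd_chi0.
Qed.

Lemma hs_lim X P : X \in hsp e f -> lim (cm P) X X.
Proof.
move=> HX; exists (cst X) => [c c0|]; rewrite ev_cst //.
by rewrite (hs_T HX) //; apply: cm_T.
Qed.

Lemma np_h X H : X \in nsp e -> H \in hsp e f -> br H X \in nsp e.
Proof.
move=> HX; move: H; apply: hsp_ind.
- by rewrite brN br0 oppr0 mem0v.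
- by move=> a H H' H1 H2; rewrite brDl brZl; apply: memvD => //; apply: memvZ.
move=> i; move: X HX; apply: nsp_ind.
- by rewrite br0 mem0v.
- by move=> a X Y HX HY; rewrite brDr brZr; apply: memvD => //; apply: memvZ.
- by move=> j; have [l ->] := h_e i j; rewrite memvZ // nsp_gen.
move=> j X HXn HX; rewrite br_jacobi; apply: memvD; last exact: nsp_br.
by have [l ->] := h_e i j; rewrite brZl memvZ // nsp_br.
Qed.

End WeylElements.

(** * The triangular decomposition of the Lie algebra *)

Section RootDecomposition.
Variables (R : realType) (n : nat) (I : finType) (T : set 'M[R[i]]_n).
Local Notation C := R[i].
Variables (chi : I -> 'M[C]_n -> C) (ph : I -> 'M[C]_2 -> 'M[C]_n) (K : nat).
Variables (e f : I -> 'M[C]_n) (mu : I -> C -> 'M[C]_n) (q : nat).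
Hypothesis D : pdata T chi ph K e f mu q.
Implicit Types (A B X Y Z g t : 'M[C]_n) (u v w : seq I).

Let D' := dual_pdata D.
Local Notation kap := (cm mu predT).
Local Notation nu j := (cm mu (predC1 j)).

Lemma nm_T t X : T t -> X \in nsp f -> conjby t X \in nsp f.
Proof. by rewrite -(nsp_opp f); apply: (np_T D'). Qed.

Lemma nm_pol P X : X \in nsp f -> pol (fun c => cm mu P c^-1) X.
Proof. by rewrite -(nsp_opp f); apply: (np_pol D'). Qed.

Lemma nm_lim0 X : X \in nsp f -> lim (fun c => kap c^-1) X 0.
Proof. by rewrite -(nsp_opp f); apply: (np_lim0 D'). Qed.

Lemma nm_split j X : X \in nsp f ->
  exists a Y, [/\ X = a *: f j + Y, Y \in nsp f & lim (fun c => nu j c^-1) Y 0].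
Proof.
rewrite -(nsp_opp f) => /(np_split D' j) [a [Y [-> HY LY]]].
by exists (- a), Y; rewrite scaleNr scalerN.
Qed.

Lemma nm_h X H : X \in nsp f -> H \in hsp e f -> br H X \in nsp f.
Proof. by rewrite -(nsp_opp f) -(hsp_opp e f); apply: (np_h D'). Qed.

Lemma br_e_hs j X : X \in hsp e f -> br (e j) X \in <[e j]>%VS.
Proof.
move: X; apply: hsp_ind.
- by rewrite br0 mem0v.
- by move=> a X Y HX HY; rewrite brDr brZr; apply: memvD => //; apply: memvZ.
by move=> i; rewrite brN; have [l ->] := h_e D i j; rewrite memvN memvZ // memv_line.
Qed.

Lemma br_f_hs j X : X \in hsp e f -> br X (f j) \in nsp f.
Proof. by move=> HX; apply: nm_h => //; apply: nsp_gen. Qed.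

Lemma br_e_nm j X : X \in nsp f -> br (e j) X \in (nsp f + hsp e f)%VS.
Proof.
have subl Y : Y \in nsp f -> Y \in (nsp f + hsp e f)%VS by move/(subvP (addvSl _ _)).
have subr Y : Y \in hsp e f -> Y \in (nsp f + hsp e f)%VS by move/(subvP (addvSr _ _)).
move: X; apply: nsp_ind.
- by rewrite br0 mem0v.
- by move=> a X Y HX HY; rewrite brDr brZr; apply: memvD => //; apply: memvZ.
- move=> i; case: (eqVneq j i) => [->|ji]; first exact/subr/hsp_gen.
  by rewrite /br (pd_ef D) // subrr mem0v.
move=> i X HX /memv_addP [Y HY [Z HZ E]]; rewrite br_jacobi E; apply: memvD.
  case: (eqVneq j i) => [->|ji]; first by apply/subl/nm_h => //; apply: hsp_gen.
  by rewrite [br (e j) (f i)]/br (pd_ef D) // subrr br0l mem0v.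
rewrite brDr; apply: subl; apply: memvD; first exact: nsp_br.
by rewrite brN memvN br_f_hs.
Qed.

(** The Lie algebra generated by the e_i and f_i. Instead of proving that the sum is direct, the
    components are separated by their limits ([np_cap], [gs_lim0]). *)
Definition gs : {vspace 'M[C]_n} := (nsp f + hsp e f + nsp e)%VS.

Lemma gs_nm X : X \in nsp f -> X \in gs.
Proof. by move=> H; apply: (subvP (addvSl _ _)); apply: (subvP (addvSl _ _)). Qed.

Lemma gs_hs X : X \in hsp e f -> X \in gs.
Proof. by move=> H; apply: (subvP (addvSl _ _)); apply: (subvP (addvSr _ _)). Qed.

Lemma gs_np X : X \in nsp e -> X \in gs.
Proof. by move=> H; apply: (subvP (addvSr _ _)). Qed.

Lemma gs_split X : X \in gs -> exists A H B,
  [/\ X = A + H + B, A \in nsp f, H \in hsp e f & B \in nsp e].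
Proof.
by move=> /memv_addP [_ /memv_addP [A HA [H HH ->]] [B HB ->]]; exists A, H, B.
Qed.

Lemma gs_e j X : X \in gs -> br (e j) X \in gs.
Proof.
move=> /gs_split [A [H [B [-> HA HH HB]]]]; rewrite !brDr; apply: memvD.
  apply: memvD; first exact: (subvP (addvSl _ _) _ (br_e_nm j HA)).
  apply: gs_np; have /vlineP [a ->] := br_e_hs j HH.
  by rewrite memvZ // nsp_gen.
by apply/gs_np/nsp_br.
Qed.

End RootDecomposition.

Lemma gs_opp (R : realType) n (I : finType) (e f : I -> 'M[R[i]]_n) :
  gs (fun i => - f i) (fun i => - e i) = gs e f.
Proof.
by rewrite /gs !nsp_opp hsp_opp addvC addvA [(nsp f + nsp e)%VS]addvC -addvA addvC.
Qed.

Section Dichotomy.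
Variables (R : realType) (n : nat) (I : finType) (T : set 'M[R[i]]_n).
Local Notation C := R[i].
Variables (chi : I -> 'M[C]_n -> C) (ph : I -> 'M[C]_2 -> 'M[C]_n) (K : nat).
Variables (e f : I -> 'M[C]_n) (mu : I -> C -> 'M[C]_n) (q : nat).
Hypothesis D : pdata T chi ph K e f mu q.
Implicit Types (A B X Y Z g t : 'M[C]_n) (u v w : seq I).

Let D' := dual_pdata D.
Local Notation kap := (cm mu predT).
Local Notation nu j := (cm mu (predC1 j)).
Local Notation np := (nsp e).
Local Notation nm := (nsp f).
Local Notation gs := (gs e f).
Local Notation wd := (wd ph).

Lemma gs_f j X : X \in gs -> br (f j) X \in gs.
Proof.
rewrite -gs_opp => /(gs_e D' j); rewrite -[- f j]scaleN1r brZl scaleN1r.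
by rewrite memvN.
Qed.

Lemma gs_T t X : T t -> X \in gs -> conjby t X \in gs.
Proof.
move=> Tt /gs_split [A [H [B [-> HA HH HB]]]]; rewrite 2!conjbyD.
apply: memvD; last by apply/gs_np/(np_T D).
apply: memvD; first by apply/gs_nm/(nm_T D).
by rewrite (hs_T D) //; apply: gs_hs.
Qed.

Lemma gs_xx i c X : X \in gs -> conjby (xx ph i c) X \in gs.
Proof.
by move=> HX; rewrite (xxE D); apply: exp_stable (pd_eK D i) _ HX => Y; apply: gs_e D i Y.
Qed.

Lemma gs_yy i c X : X \in gs -> conjby (yy ph i c) X \in gs.
Proof.
by move=> HX; rewrite (yyE D); apply: exp_stable (pd_fK D i) _ HX => Y; apply: gs_f.
Qed.

Lemma gs_ss i X : X \in gs -> conjby (ss ph i) X \in gs.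
Proof.
have [Ux Uy] := (x_unit D i 1, y_unit D i (- 1)).
move=> HX; rewrite (weylE D) conjby_comp ?unitmx_mul ?Ux ?Uy // conjby_comp //.
by apply/gs_xx/gs_yy/gs_xx.
Qed.

Lemma gs_ssV i X : X \in gs -> conjby (invmx (ss ph i)) X \in gs.
Proof.
have T2 := pd_TV D (T_s2 D i); have U2 := pd_unit D T2.
by move=> HX; rewrite (s_inv D) conjby_comp ?(s_unit D) //; apply/gs_T/gs_ss.
Qed.

Lemma gs_wdV u X : X \in gs -> conjby (invmx (wd u)) X \in gs.
Proof.
elim: u X => [|i u IH] X HX; first by rewrite wd_nil invmx1 conj1by.
have [Us Uw] := (s_unit D i, wd_unit D u).
rewrite wd_cons invmxM // conjby_comp ?unitmx_inv //.
exact/IH/gs_ssV.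
Qed.

Lemma nmh_pol P X : X \in (nm + hsp e f)%VS -> pol (fun c => cm mu P c^-1) X.
Proof.
move=> /memv_addP [A HA [H HH ->]]; have [L HL] := pol_lim (nm_pol D P HA).
have HHl := hs_lim D' P; rewrite hsp_opp in HHl.
by rewrite -[A]scale1r; apply: lim_pol; apply: limD HL (HHl _ HH).
Qed.

Lemma np_cap X : X \in np -> X \in (nm + hsp e f)%VS -> X = 0.
Proof. by move=> /(np_lim0 D) H1 /(nmh_pol predT) H2; case: (lim_fixed (cm_GL D predT) H1 H2). Qed.

Lemma np_nm0 X : X \in np -> X \in nm -> X = 0.
Proof. by move=> H1 H2; apply: np_cap => //; apply: (subvP (addvSl _ _)). Qed.

(** The component of X in [nm + hsp e f] has limit 0 along [kap] and also a limit along its inverse,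
    so it vanishes. *)
Lemma gs_lim0 X : X \in gs -> lim kap X 0 -> X \in np.
Proof.
move=> /gs_split [A [H [B [-> HA HH HB]]]] HL; have cG := cm_GL D predT.
suff -> : A + H = 0 by rewrite add0r.
have L0 : lim kap (A + H) 0.
  have := limD (-1) (np_lim0 D HB) HL; rewrite scaler0 addr0 scaleN1r addrC addrK.
  by [].
have HAH : A + H \in (nm + hsp e f)%VS by rewrite memv_add.
by case: (lim_fixed cG L0 (nmh_pol predT HAH)).
Qed.

End Dichotomy.

HB.lock Definition adv (R : realType) n (g : 'M[R[i]]_n) (V : {vspace 'M[R[i]]_n}) :
    {vspace 'M[R[i]]_n} :=
  (linfun (conjby g) @: V)%VS.

Section Adv.
Variables (R : realType) (n : nat).
Implicit Types (X g h : 'M[R[i]]_n) (V : {vspace 'M[R[i]]_n}).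

Lemma memadv g V X : g \in unitmx -> (X \in adv g V) = (conjby (invmx g) X \in V).
Proof.
rewrite adv.unlock => Ug; apply/memv_imgP/idP => [[Y YV ->]|H].
  by rewrite lfunE /= conjbyK.
by exists (conjby (invmx g) X) => //; rewrite lfunE /= conjbyVK.
Qed.

Lemma dim_adv g V : g \in unitmx -> \dim (adv g V) = \dim V.
Proof.
rewrite adv.unlock => Ug; apply: limg_dim_eq; apply/eqP; rewrite -subv0; apply/subvP => X.
rewrite memv_cap memv_ker lfunE /= conjby_eq0 // => /andP [_ /eqP ->].
exact: mem0v.
Qed.

Lemma conjby_compV g h X : g \in unitmx -> h \in unitmx ->
  conjby (invmx (g *m h)) X = conjby (invmx h) (conjby (invmx g) X).
Proof. by move=> Ug Uh; rewrite invmxM // conjby_comp // unitmx_inv. Qed.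

Lemma conjbyV_conj g h X : g \in unitmx -> h \in unitmx ->
  conjby (conjby (invmx g) h) (conjby (invmx g) X) = conjby (invmx g) (conjby h X).
Proof.
move=> Ug Uh; have Ugv : invmx g \in unitmx by rewrite unitmx_inv.
by rewrite -[RHS]conjby_comp // -conjby_comp ?conjby_unit // /conjby invmxK mulmxK.
Qed.

End Adv.

Section Exchange.
Variables (R : realType) (n : nat) (I : finType) (T : set 'M[R[i]]_n).
Local Notation C := R[i].
Variables (chi : I -> 'M[C]_n -> C) (ph : I -> 'M[C]_2 -> 'M[C]_n) (K : nat).
Variables (e f : I -> 'M[C]_n) (mu : I -> C -> 'M[C]_n) (q : nat).
Hypothesis D : pdata T chi ph K e f mu q.
Implicit Types (A B X Y Z g t : 'M[C]_n) (u v w : seq I).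

Let D' := dual_pdata D.
Local Notation kap := (cm mu predT).
Local Notation nu j := (cm mu (predC1 j)).
Local Notation np := (nsp e).
Local Notation nm := (nsp f).
Local Notation gs := (gs e f).
Local Notation wd := (wd ph).

Lemma gs_lim0V X : X \in gs -> lim (fun c => kap c^-1) X 0 -> X \in nm.
Proof.
by move=> HX HL; rewrite -(nsp_opp f); apply: (gs_lim0 D') => //; rewrite gs_opp.
Qed.

Lemma chi_cochar i m : cochar T m -> exists k : int, forall c, c != 0 -> chi i (m c) = c ^ k.
Proof.
move=> cmm; have [mT mM mL] := cmm; have [_ _ mLV] := cocharV cmm.
have [a [b eab]] : exists a b, e i a b != 0.
  apply: contrapT => H; case/eqP: (pd_e0 D i); apply/matrixP => a b; rewrite mxE.
  by apply/eqP/negPn/negP => H'; apply: H; exists a, b.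
have TGL : T `<=` @GL R n by move=> t; apply: pd_unit D t.
have E c : c != 0 -> chi i (m c) = (m c *m e i *m m c^-1) a b / e i a b.
  move=> c0; have := pd_chie D i (mT c c0).
  rewrite /conjby (cochar_inv TGL cmm) // => ->.
  by rewrite mxE mulfK.
apply: laur_mult.
- apply: (@laur_eq _ (fun c => (m c *m e i *m m c^-1) a b / e i a b)).
    by move=> c c0; rewrite E.
  apply: laurM; last exact: laur_cst.
  apply: laur_mxM => //; apply: laur_mxM => // k l; exact: laur_cst.
- by apply: (pd_chi0 D); apply: mT; apply: oner_neq0.
by move=> c d c0 d0; rewrite mM // (pd_chiM D) //; apply: mT.
Qed.

Lemma wd_weight u i : exists k : int, forall c, c != 0 ->
  conjby (kap c) (conjby (invmx (wd u)) (e i)) = c ^ k *: conjby (invmx (wd u)) (e i) /\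
  conjby (kap c) (conjby (invmx (wd u)) (f i)) = c ^ (- k) *: conjby (invmx (wd u)) (f i).
Proof.
have Uw := wd_unit D u; have Uwv : invmx (wd u) \in unitmx by rewrite unitmx_inv.
have [kT kM kL] := cm_cochar D predT.
pose m c := conjby (wd u) (kap c).
have [k Hk] : exists k : int, forall c, c != 0 -> chi i (m c) = c ^ k.
  apply: chi_cochar; split=> [c c0|c d c0 d0|].
  - by apply: (T_wd D); apply: kT.
  - by rewrite /m kM // conjbyM.
  have cstL (A : 'M[C]_n) : forall a b, laur (fun=> A a b) by move=> a b; apply: laur_cst.
  have := laur_mxM (laur_mxM (cstL (wd u)) kL) (cstL (invmx (wd u))).
  by [].
exists k => c c0; have Tm : T (m c) by apply: (T_wd D); apply: kT.
have Uk : kap c \in unitmx by apply: (pd_unit D); apply: kT.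
have com X : conjby (kap c) (conjby (invmx (wd u)) X) = conjby (invmx (wd u)) (conjby (m c) X).
  rewrite -!conjby_comp //; last exact: pd_unit D _ Tm.
  by congr (conjby _ X); rewrite /m /conjby !mulmxA mulVmx // mul1mx.
by rewrite !com (pd_chie D) // (pd_chif D) // Hk // !conjbyZ invr_expz.
Qed.

(** The vector Ad(w^-1) e_i has a weight k under [kap], and the sign of k decides. If k = 0 it lies
    in [hsp e f] and is fixed by T, but conjugation by w^-1 mu_i(2) w multiplies it by 2^q. *)
Lemma dichotomy u i :
  (conjby (invmx (wd u)) (e i) \in np /\ conjby (invmx (wd u)) (f i) \in nm) \/
  (conjby (invmx (wd u)) (e i) \in nm /\ conjby (invmx (wd u)) (f i) \in np).
Proof.
have Uw := wd_unit D u; have Uwv : invmx (wd u) \in unitmx by rewrite unitmx_inv.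
have [k Hk] := wd_weight u i; set E := conjby _ (e i) in Hk *; set F := conjby _ (f i) in Hk *.
have GE : E \in gs by apply: (gs_wdV D); apply/gs_np/nsp_gen.
have GF : F \in gs by apply: (gs_wdV D); apply/gs_nm/nsp_gen.
have E0 : E != 0 by rewrite conjby_eq0 // (pd_e0 D).
have cV (c : C) : c != 0 -> c^-1 != 0 by rewrite invr_eq0.
case: k Hk => [[|p]|p] Hk.
- have LE : lim kap E E by exists (cst E) => [c c0|]; rewrite ev_cst // (Hk c c0).1 scale1r.
  have HE : E \in hsp e f.
    have cG := cm_GL D predT; have /gs_split [A [H [B [EE HA HH HB]]]] := GE.
    have HAH : A + H \in (nm + hsp e f)%VS by rewrite memv_add.
    have L1 : lim kap (A + H) E.
      have := limD (-1) (np_lim0 D HB) LE; rewrite scaler0 add0r scaleN1r EE addrC addrK.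
      by [].
    have [E1 _] := lim_fixed cG L1 (nmh_pol D predT HAH).
    have B0 : B = 0 by apply: (addrI (A + H)); rewrite addr0 -EE E1.
    have cGV := cm_GL D' predT.
    have L2 : lim (fun c => kap c^-1) E H.
      have := limD 1 (nm_lim0 D HA) (_ : lim _ H H); rewrite scale1r scaler0 add0r.
      rewrite EE B0 addr0; apply.
      by have := hs_lim D' predT; rewrite hsp_opp => /(_ _ HH).
    have LEV : pol (fun c => kap c^-1^-1) E.
      by have [Q HQ _] := LE; exists Q => c c0; rewrite invrK HQ.
    by have [-> _] := lim_fixed cGV L2 LEV.
  have two0 : (2 : C) != 0 by rewrite pnatr_eq0.
  have Tm : T (mu i 2) by case: (pd_mu D i) => H _ _; apply: H.
  have := hs_T D HE (T_wdV D u Tm).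
  rewrite (conjbyV_conj _ Uw (pd_unit D Tm)).
  rewrite (pd_chie D) // (pd_chimu D) // eqxx conjbyZ -/E => /eqP.
  rewrite -subr_eq0 -[X in _ - X]scale1r -scalerBl scaler_eq0 (negPf E0) orbF subr_eq0.
  rewrite -natrX -[1]/(1%:R) eqr_nat => /eqP two; have := pd_q D.
  by case: q two => // r /eqP; rewrite expnS muln_eq1.
- left; split.
    apply: (gs_lim0 D GE); have := @lim_weight _ _ kap E p.+1.
    by apply=> c c0; rewrite (Hk c c0).1.
  apply: (gs_lim0V GF); have := @lim_weight _ _ (fun c => kap c^-1) F p.+1.
  apply=> c c0; rewrite (Hk _ (cV c c0)).2.
  by rewrite -exprz_inv invrK.
right; split.
  apply: (gs_lim0V GE); have := @lim_weight _ _ (fun c => kap c^-1) E p.+1.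
  apply=> c c0; rewrite (Hk _ (cV c c0)).1.
  by rewrite NegzE -exprz_inv invrK.
apply: (gs_lim0 D GF); have := @lim_weight _ _ kap F p.+1.
by apply=> c c0; rewrite (Hk c c0).2 NegzE opprK.
Qed.

Lemma ss_yy i c : ss ph i *m yy ph i c = xx ph i (- c) *m ss ph i.
Proof.
rewrite ss.unlock xx.unlock yy.unlock.
have [Su Sl] := (@SL2_upper R, @SL2_lower R); have Sw := SL2_weyl2 R.
have E := congr1 (ph i) (weyl2_lower c).
etransitivity; first exact: esym (pd_phM D i Sw (Sl c)).
by etransitivity; [exact: E|exact: (pd_phM D i (Su (- c)) Sw)].
Qed.

Lemma ss_f i : conjby (ss ph i) (f i) = - e i.
Proof.
have Us := s_unit D i; apply: (exp_conj (pd_K1 D) Us) => c.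
by rewrite expq_opp -(xxE D) -(yyE D) /conjby ss_yy mulmxK.
Qed.

Lemma ssV_e i : conjby (invmx (ss ph i)) (e i) = - f i.
Proof.
have Us := s_unit D i.
by rewrite -[e i]opprK -ss_f -scaleN1r conjbyZ conjbyK // scaleN1r.
Qed.

(** The Lie algebra of the unipotent radical of the minimal parabolic subgroup attached to j; it is
    stable under s_j because [nu j] commutes with s_j. *)
Definition nj j X := X \in np /\ lim (nu j) X 0.

Lemma nu_ss j c : c != 0 -> conjby (nu j c) (ss ph j) = ss ph j.
Proof.
move=> c0; have Tn := cm_T D (predC1 j) c0; have Un := pd_unit D Tn.
have E1 := chi_cm D (predC1 j) j c0; rewrite /= eqxx expr0 in E1.
rewrite (weylE D) !conjbyM // !(conj_x D) // (conj_y D) // E1 invr1 !mul1r.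
by [].
Qed.

Lemma gs_nj j X : X \in gs -> lim (nu j) X 0 -> nj j X.
Proof.
move=> /gs_split [A [H [B [-> HA HH HB]]]] L; have cG := cm_GL D (predC1 j).
have [a [Y [EB HY LY]]] := np_split D j HB.
have LB : lim (nu j) B (a *: e j).
  have := lim_e D (predC1 j) j; rewrite /= eqxx => Le.
  by have := limD a Le LY; rewrite addr0 -EB.
have HAH : A + H \in (nm + hsp e f)%VS by rewrite memv_add.
have L1 : lim (nu j) (A + H) (- (a *: e j)).
  have := limD (-1) LB L; rewrite addr0 !scaleN1r addrC addrK.
  by [].
have [E1 _] := lim_fixed cG L1 (nmh_pol D _ HAH).
have Hnp : A + H \in np by rewrite E1 memvN memvZ // nsp_gen.
have E0 := np_cap D Hnp HAH.
have a0 : a *: e j = 0 by apply/eqP; rewrite -oppr_eq0 -E1 E0.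
by rewrite E0 add0r EB a0 add0r.
Qed.

Lemma nj_ss j X : nj j X -> nj j (conjby (invmx (ss ph j)) X).
Proof.
move=> [HX [Q HQ Q0]]; have Us := s_unit D j; apply: gs_nj.
  by apply: (gs_ssV D); apply: gs_np.
exists (cst (invmx (ss ph j)) *m Q *m cst (ss ph j)) => [c c0|]; last first.
  by rewrite !evM !ev_cst Q0 mulmx0 mul0mx.
have Un := pd_unit D (cm_T D (predC1 j) c0).
rewrite !evM !ev_cst -(HQ c c0) {2}/conjby invmxK (conjbyM _ _ Un) (conjbyM _ _ Un) (nu_ss j c0).
by rewrite -(conjbyV Un Us) (nu_ss j c0).
Qed.

(* The number of positive roots made negative by the inverse of u. *)
Definition nlen u : nat := \dim (np :&: adv (wd u) nm)%VS.

Lemma np_nm_conj u j : conjby (invmx (wd u)) (e j) \in np ->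
  conjby (invmx (wd u)) (e j) \in nm -> False.
Proof.
have Uuv : invmx (wd u) \in unitmx by rewrite unitmx_inv (wd_unit D).
move=> h1 h2; have /eqP E := np_nm0 D h1 h2; case/negP: (pd_e0 D j).
by rewrite (conjby_eq0 _ Uuv) in E.
Qed.

(** Conjugation by s_j preserves [nj j] and exchanges the lines of e_j and f_j. So, after
    conjugation by s_j^-1, the intersection that measures j :: u is the one for u plus the line of
    f_j. *)
Lemma nlen_up j u : conjby (invmx (wd u)) (e j) \in np -> nlen (j :: u) = (nlen u).+1.
Proof.
move=> ej; have [Us Uu] := (s_unit D j, wd_unit D u).
have Uuv : invmx (wd u) \in unitmx by rewrite unitmx_inv.
have Usv : invmx (ss ph j) \in unitmx by rewrite unitmx_inv.
have fj : conjby (invmx (wd u)) (f j) \in nm.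
  by have [[_ //]|[h _]] := dichotomy u j; case: (np_nm_conj ej h).
pose A := adv (wd u) nm; pose W := (np :&: A)%VS.
have AT t X : T t -> X \in A -> conjby t X \in A.
  move=> Tt; have Ut := pd_unit D Tt; rewrite /A (memadv nm X Uu) (memadv nm _ Uu) => HX.
  by have := nm_T D (T_wdV D u Tt) HX; rewrite (conjbyV_conj _ Uu Ut).
have Wnj X : X \in W -> nj j X.
  rewrite memv_cap => /andP [HX HA]; have [a [Y [EX HY LY]]] := np_split D j HX.
  have LX : lim (nu j) X (a *: e j).
    have := lim_e D (predC1 j) j; rewrite /= eqxx => Le.
    by have := limD a Le LY; rewrite addr0 -EX.
  have aA : a *: e j \in A.
    have [Q HQ <-] := LX; apply: ev_vs0 => c c0; rewrite -HQ //.
    by apply: (AT) => //; apply: (cm_T D _ c0).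
  have a0 : a *: e j = 0.
    rewrite memadv // in aA; apply/eqP; rewrite -(conjby_eq0 _ Uuv); apply/eqP.
    by apply: (np_nm0 D _ aA); rewrite conjbyZ memvZ.
  by split=> //; rewrite -a0.
have fA : f j \in A by rewrite memadv.
have EL : (adv (invmx (ss ph j)) np :&: A)%VS = (<[f j]> + W)%VS.
  apply/eqP; rewrite eqEsubv; apply/andP; split; apply/subvP => X.
    rewrite memv_cap memadv // invmxK => /andP [HX HA].
    have [a [Y [EX HY LY]]] := np_split D j HX.
    have EX' : X = - a *: f j + conjby (invmx (ss ph j)) Y.
      by rewrite -[LHS](conjbyK _ Us) EX conjbyD conjbyZ ssV_e scalerN scaleNr.
    rewrite EX'; apply: memv_add; first by rewrite memvZ // memv_line.
    rewrite memv_cap (nj_ss (conj HY LY)).1 /=.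
    have -> : conjby (invmx (ss ph j)) Y = X + a *: f j by rewrite EX' addrAC scaleNr addNr add0r.
    by apply: memvD => //; apply: memvZ.
  move=> /memv_addP [_ /vlineP [a ->] [Y HY ->]].
  have HYA : Y \in A by move: HY; rewrite memv_cap => /andP [].
  rewrite memv_cap; apply/andP; split; last by apply: memvD => //; apply: memvZ.
  rewrite (memadv _ _ Usv) invmxK conjbyD conjbyZ ss_f.
  apply: memvD; first by rewrite memvZ // memvN nsp_gen.
  have [Y1 Y2] := Wnj Y HY.
  have [T2 U2] := (T_s2 D j, pd_unit D (T_s2 D j)).
  have -> : conjby (ss ph j) Y = conjby (cc ph j (- 1)) (conjby (invmx (ss ph j)) Y).
    rewrite -conjby_comp // -(s_sqr D).
    by rewrite mulmxK.
  by apply: (np_T D); [exact: T2|case: (nj_ss (conj Y1 Y2))].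
have -> : nlen (j :: u) = \dim (<[f j]> + W)%VS.
  rewrite -EL -(dim_adv _ Us); congr (\dim _); apply/vspaceP => X.
  have Um : wd (j :: u) \in unitmx by apply: (wd_unit D).
  rewrite (memadv _ X Us) 2!memv_cap (memadv np _ Usv) invmxK (conjbyVK _ Us).
  by rewrite /A (memadv nm _ Uu) (memadv nm X Um) wd_cons (conjby_compV _ Us Uu).
rewrite dimv_disjoint_sum.
  by rewrite dim_vline (pd_f0 D).
apply/eqP; rewrite -subv0; apply/subvP => X; rewrite memv0 !memv_cap.
move=> /andP [/vlineP [a ->] /andP [H1 _]].
by apply/eqP; apply: (np_nm0 D H1); rewrite memvZ // nsp_gen.
Qed.

Lemma nlen_class u v : same_class T ph u v -> nlen u = nlen v.
Proof.
move=> /(same_classP D) [t Tt E]; have [Uu Ut] := (wd_unit D u, pd_unit D Tt).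
congr (\dim _); apply/vspaceP => X; rewrite !memv_cap; congr (_ && _).
have Uv : wd u *m t \in unitmx by rewrite unitmx_mul Uu.
rewrite E (memadv _ _ Uu) (memadv _ _ Uv) (conjby_compV _ Uu Ut).
apply/idP/idP => [H|H]; first exact: (nm_T D (pd_TV D Tt) H).
by have := nm_T D Tt H; rewrite conjbyVK.
Qed.

(** Prefixing j once more reverses the sign and returns to the class of u, since s_j^2 lies in T:
    this is [nlen_up] for j :: u. *)
Lemma nlen_down j u : conjby (invmx (wd u)) (e j) \in nm -> nlen u = (nlen (j :: u)).+1.
Proof.
move=> ej; have [Us Uu] := (s_unit D j, wd_unit D u).
have fj : conjby (invmx (wd u)) (f j) \in np.
  by have [[h _]|[_ //]] := dichotomy u j; case: (np_nm_conj h ej).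
rewrite -(@nlen_up j (j :: u)).
  apply: nlen_class; apply: (same_class_sym D); apply: (same_class_l D (T_s2 D j)).
  by rewrite !wd_cons mulmxA (s_sqr D).
rewrite wd_cons (conjby_compV _ Us Uu) ssV_e.
by rewrite -scaleN1r conjbyZ scaleN1r memvN.
Qed.

Lemma nlen_nil : nlen [::] = 0%N.
Proof.
apply/eqP; rewrite dimv_eq0 -subv0; apply/subvP => X; rewrite memv_cap wd_nil.
rewrite memadv ?unitmx1 // invmx1 conj1by => /andP [H1 H2].
by rewrite (np_nm0 D H1 H2) mem0v.
Qed.

Lemma nlen_le u : (nlen u <= size u)%N.
Proof.
elim: u => [|j u IH]; first by rewrite nlen_nil.
have [[h _]|[h _]] := dichotomy u j; first by rewrite nlen_up.
by rewrite /= ltnW // -ltnS -nlen_down // ltnS ltnW.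
Qed.

End Exchange.

(** * The exchange condition and longest words *)

Section Reduced.
Variables (R : realType) (n : nat) (I : finType) (T : set 'M[R[i]]_n).
Local Notation C := R[i].
Variables (chi : I -> 'M[C]_n -> C) (ph : I -> 'M[C]_2 -> 'M[C]_n) (K : nat).
Variables (e f : I -> 'M[C]_n) (mu : I -> C -> 'M[C]_n) (q : nat).
Hypothesis D : pdata T chi ph K e f mu q.
Implicit Types (A B X Y Z g t : 'M[C]_n) (u v w : seq I).

Local Notation nu j := (cm mu (predC1 j)).
Local Notation np := (nsp e).
Local Notation nm := (nsp f).
Local Notation wd := (wd ph).
Local Notation nlen := (nlen ph e f).
Local Notation same := (same_class T ph).

(** Follow the weight vector X through the letters of u. While its component on e_j vanishes, X lies
    in [nj] and stays positive after s_j; since it ends up negative, at some letter j it must be a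
    multiple of e_j. *)
Lemma find_simple u X : X \in np -> X != 0 ->
  (forall t, T t -> conjby t X \in <[X]>%VS) -> conjby (invmx (wd u)) X \in nm ->
  exists p j r c, [/\ u = p ++ j :: r, c != 0 & conjby (invmx (wd p)) X = c *: e j].
Proof.
elim: u X => [|j u IH] X HX X0 XT Xm.
  by case/eqP: X0; rewrite wd_nil invmx1 conj1by in Xm; exact: (np_nm0 D HX Xm).
have [Us Uu] := (s_unit D j, wd_unit D u).
have Usv : invmx (ss ph j) \in unitmx by rewrite unitmx_inv.
have [a [Y [EX HY LY]]] := np_split D j HX.
have LX : lim (nu j) X (a *: e j).
  have := lim_e D (predC1 j) j; rewrite /= eqxx => Le.
  by have := limD a Le LY; rewrite addr0 -EX.
have /vlineP [b Eb] : a *: e j \in <[X]>%VS.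
  have [Q HQ <-] := LX; apply: ev_vs0 => c c0; rewrite -HQ //.
  by apply: XT; apply: cm_T D _ _ c0.
case: (eqVneq a 0) => [a0|a0].
  have nX : nj e mu j X by split; rewrite // -(scale0r (e j)) -a0.
  have [HsX _] := nj_ss D nX.
  have sX0 : conjby (invmx (ss ph j)) X != 0 by rewrite conjby_eq0.
  have sXT t : T t -> conjby t (conjby (invmx (ss ph j)) X) \in
      <[conjby (invmx (ss ph j)) X]>%VS.
    move=> Tt; have Tt' := T_s D j Tt; have /vlineP [d Ed] := XT _ Tt'.
    apply/vlineP; exists d; rewrite -conjbyZ -Ed.
    rewrite -(conjbyV_conj _ Us (pd_unit D Tt')).
    by rewrite (conjbyK t Us).
  have sXm : conjby (invmx (wd u)) (conjby (invmx (ss ph j)) X) \in nm.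
    by rewrite -(conjby_compV _ Us Uu) -wd_cons.
  have [p [k [r [c [-> c0 Ec]]]]] := IH _ HsX sX0 sXT sXm.
  exists (j :: p), k, r, c; split=> //.
  by rewrite wd_cons (conjby_compV _ Us (wd_unit D p)).
exists [::], j, u, (a / b); rewrite wd_nil invmx1 conj1by.
have b0 : b != 0.
  apply/eqP => b0; have := Eb; rewrite b0 scale0r => /eqP.
  by rewrite scaler_eq0 (negPf a0) (negPf (pd_e0 D j)).
split=> //; first by rewrite mulf_neq0 // invr_eq0.
by rewrite mulrC -scalerA Eb scalerA mulVf // scale1r.
Qed.

Lemma e_line i t : T t -> conjby t (e i) \in <[e i]>%VS.
Proof. by move=> Tt; apply/vlineP; exists (chi i t); apply: pd_chie D _ _ Tt. Qed.

(* If p maps the simple root of j to that of i, then s_i p = p s_j modulo T. *)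
Lemma conj_simple i j p c : c != 0 -> conjby (invmx (wd p)) (e i) = c *: e j ->
  conjby (invmx (wd p)) (ss ph i) = cc ph j c *m ss ph j.
Proof.
move=> c0 Ec; have Up := wd_unit D p; set g := invmx (wd p) in Ec *.
have Ug : g \in unitmx by rewrite unitmx_inv.
have Fm : conjby g (f i) \in nm.
  have [[_ //]|[h _]] := dichotomy D p i; case: (np_nm_conj D _ h).
  by rewrite Ec memvZ // nsp_gen.
(* The transported f_i has weight chi_j^-1, so [nu j] fixes it, and [nm_split] reduces it to a
   multiple of f_j. *)
have gT t : T t -> conjby t (conjby g (f i)) = (chi j t)^-1 *: conjby g (f i).
  move=> Tt; have Ut := pd_unit D Tt; have Tt' := T_wd D p Tt; have Ut' := pd_unit D Tt'.
  have E1 X : conjby t (conjby g X) = conjby g (conjby (conjby (wd p) t) X).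
    by rewrite -(conjbyV_conj _ Up Ut') conjbyK.
  have : conjby t (conjby g (e i)) = chi i (conjby (wd p) t) *: conjby g (e i).
    by rewrite E1 (pd_chie D) // conjbyZ.
  rewrite Ec conjbyZ (pd_chie D) // !scalerA => /eqP; rewrite -subr_eq0 -scalerBl.
  rewrite scaler_eq0 (negPf (pd_e0 D j)) orbF subr_eq0 mulrC => /eqP /(mulIf c0) Echi.
  by rewrite E1 (pd_chif D) // conjbyZ -Echi.
have [b [Y [EF HY LY]]] := nm_split D j Fm.
have EFb : conjby g (f i) = b *: f j.
  have L1 : lim (fun c => nu j c^-1) (conjby g (f i)) (conjby g (f i)).
    exists (cst (conjby g (f i))) => [d d0|]; rewrite ev_cst //.
    have d0' : d^-1 != 0 by rewrite invr_eq0.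
    rewrite gT; last exact: cm_T D _ _ d0'.
    by rewrite (chi_cm D) // /= eqxx expr0 invr1 scale1r.
  have L2 : lim (fun c => nu j c^-1) (f j) (f j).
    exists (cst (f j)) => [d d0|]; rewrite ev_cst //.
    by rewrite (cm_f D) // /= eqxx expr0 scale1r.
  apply: (lim_uniq L1); have := limD b L2 LY; rewrite addr0 -EF.
  by [].
(* The relation [h_i, e_i] = 2 e_i is transported to the scaled vectors c e_j and b f_j. *)
have cb : c * b = 1.
  have := congr1 (conjby g) (h_e2 D i).
  rewrite conjbyZ !(conjby_br _ _ Ug) Ec EFb !(brZr, brZl) (h_e2 D) !scalerA.
  move=> /eqP; rewrite -subr_eq0 -scalerBl scaler_eq0 (negPf (pd_e0 D j)) orbF subr_eq0.
  have two0 : (2 : C) != 0 by rewrite pnatr_eq0.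
  move=> /eqP H; apply: (mulfI c0); apply: (mulfI two0).
  rewrite mulr1 -H; ring.
have bE : b = c^-1 by apply: (mulfI c0); rewrite cb divff.
rewrite (weylE D) (co_weylE D j c0) !(conjbyM _ _ Ug).
have Ex : conjby g (xx ph i 1) = xx ph j c.
  by rewrite (exp_conj_x D Ug Ec) expq_scale -(xxE D) mulr1.
have Ey : conjby g (yy ph i (- 1)) = yy ph j (- c^-1).
  by rewrite (exp_conj_y D Ug EFb) expq_scale -(yyE D) bE mulrN1.
by rewrite Ex Ey.
Qed.

Definition minimal_word u := forall v, same u v -> (size u <= size v)%N.

(** Otherwise [find_simple] writes u = p j r with p^-1 sending e_i to a multiple of e_j. Then s_i p
    = p s_j modulo T, and i p j r has the class of the word p r, shorter by two letters. *)
Lemma exchange i u : minimal_word (i :: u) -> conjby (invmx (wd u)) (e i) \in np.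
Proof.
move=> red; have [[//]|[Em _]] := dichotomy D u i; exfalso.
have [p [j [r [c [Eu c0 Ec]]]]] :=
  find_simple (nsp_gen e i) (pd_e0 D i) (e_line i) Em.
have [Up Ur] := (wd_unit D p, wd_unit D r).
have E := conj_simple c0 Ec; set t := cc ph j c *m cc ph j (- 1).
have Tt : T t by apply: (pd_TM D); [exact: cc_T D j _ c0|exact: T_s2 D j].
have Es : ss ph i *m wd p = wd p *m (cc ph j c *m ss ph j).
  by rewrite -E /conjby invmxK -!mulmxA mulKVmx.
have H : same (i :: u) (p ++ r).
  apply: (same_class_l D (T_wd D p Tt)).
  rewrite Eu wd_cons !wd_cat wd_cons mulmxA Es /t -(s_sqr D) /conjby.
  by rewrite !mulmxA mulmxKV.
by have := red _ H; rewrite Eu /= !size_cat /= addnS ltnNge leqnSn.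
Qed.

Lemma minimal_cons i u : minimal_word (i :: u) -> minimal_word u.
Proof.
move=> red v H; have := red _ (same_class_cons D i H).
by [].
Qed.

Lemma nlen_minimal u : minimal_word u -> nlen u = size u.
Proof.
elim: u => [|i u IH] red; first exact: nlen_nil D.
by rewrite (nlen_up D (exchange red)) IH //; apply: minimal_cons red.
Qed.

Lemma minimal_nlen u : nlen u = size u -> minimal_word u.
Proof. by move=> H v /(nlen_class D) E; rewrite -H E; apply: nlen_le D v. Qed.

Definition longest_word w := minimal_word w /\
  forall v, minimal_word v -> (size v <= size w)%N.

Lemma longest_negative w j : longest_word w -> conjby (invmx (wd w)) (e j) \in nm.
Proof.
move=> [red lw]; have [[h _]|[//]] := dichotomy D w j; exfalso.
have : minimal_word (j :: w) by apply: minimal_nlen; rewrite (nlen_up D h) nlen_minimal.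
by move=> /lw /=; rewrite ltnn.
Qed.

Lemma all_negative u : (forall j, conjby (invmx (wd u)) (e j) \in nm) ->
  (np <= adv (wd u) nm)%VS.
Proof.
have Uu := wd_unit D u; have Uuv : invmx (wd u) \in unitmx by rewrite unitmx_inv.
move=> H; apply: nsp_sub => [i|j Y]; rewrite !(memadv nm _ Uu); first exact: H.
by move=> HY; rewrite (conjby_br _ _ Uuv); apply: nsp_bracket (H j) HY.
Qed.

Lemma longest_dim w : longest_word w -> \dim np = size w.
Proof.
move=> lw; have H := all_negative (fun j => longest_negative j lw).
by rewrite -(nlen_minimal lw.1); congr (\dim _); apply/esym/capv_idPl.
Qed.

(** If all simple roots became negative, so would all of [np], and the length of u would be the
    dimension of [np]. *)
Lemma short_positive u : (size u < \dim np)%N ->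
  exists j, conjby (invmx (wd u)) (e j) \in np.
Proof.
move=> Hu; apply: contrapT => H.
have Hn : (np <= adv (wd u) nm)%VS.
  apply: all_negative => j; have [[h _]|[//]] := dichotomy D u j.
  by case: H; exists j.
have : nlen u = \dim np by congr (\dim _); apply/capv_idPl.
by move=> E; have := nlen_le D u; rewrite E leqNgt Hu.
Qed.

Lemma minimal_rev u : minimal_word u -> minimal_word (rev u).
Proof.
move=> red v /(same_class_rev D); rewrite revK size_rev => /red.
by rewrite size_rev.
Qed.

Lemma longest_rev w : longest_word w -> longest_word (rev w).
Proof.
by move=> [red lw]; split; [exact: minimal_rev|rewrite size_rev].
Qed.

(* mu_i commutes with s_k for all k <> i. *)
Lemma longest_mem w i : longest_word w -> i \in w.
Proof.
move=> lw; apply: contraT => iw; exfalso.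
have Em := longest_negative i lw.
have muT c : c != 0 -> T (mu i c) by case: (pd_mu D i) => H _ _; apply: H.
have muE (u : seq I) c X : i \notin u -> c != 0 ->
    conjby (mu i c) (conjby (invmx (wd u)) X) = conjby (invmx (wd u)) (conjby (mu i c) X).
  elim: u X => [|k u IH] X; first by rewrite wd_nil invmx1 !conj1by.
  rewrite in_cons negb_or => /andP [ik iu] c0; have [Us Uu] := (s_unit D k, wd_unit D u).
  have Um := pd_unit D (muT c c0); have Usv : invmx (ss ph k) \in unitmx by rewrite unitmx_inv.
  rewrite wd_cons (conjby_compV X Us Uu) (conjby_compV (conjby (mu i c) X) Us Uu).
  rewrite (IH _ iu c0); apply: (congr1 (conjby (invmx (wd u)))).
  have Ek : chi k (mu i c) = 1 by rewrite (pd_chimu D) // eq_sym (negPf ik) expr0.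
  have Es : conjby (mu i c) (ss ph k) = ss ph k.
    rewrite (weylE D) !(conjbyM _ _ Um) !(conj_x D _ _ (muT c c0)) (conj_y D _ _ (muT c c0)).
    by rewrite Ek invr1 !mul1r.
  have Ec : mu i c *m ss ph k = ss ph k *m mu i c by rewrite -{2}Es /conjby mulmxKV.
  rewrite -(conjby_comp _ Um Usv) -(conjby_comp _ Usv Um).
  apply: (congr1 (fun g => conjby g X)).
  by rewrite -[LHS](mulKmx Us) [X in invmx _ *m X]mulmxA -Ec (mulmxK Us).
have X0 : conjby (invmx (wd w)) (e i) != 0.
  by rewrite conjby_eq0 ?unitmx_inv ?(wd_unit D) // (pd_e0 D).
have cmu : cochar (@GL R n) (mu i).
  by have [H1 H2 H3] := pd_mu D i; split=> // c c0; apply/(pd_unit D)/H1.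
have L0 : lim (mu i) (conjby (invmx (wd w)) (e i)) 0.
  have := @lim_weight _ _ (mu i) (conjby (invmx (wd w)) (e i)) q; rewrite (q_neq0 D).
  apply=> c c0; rewrite muE // (pd_chie D) ?(pd_chimu D) // ?eqxx ?conjbyZ //.
  exact: muT.
have pV : pol (fun c => mu i c^-1) (conjby (invmx (wd w)) (e i)).
  have := nm_pol D (pred1 i) Em.
  have E c : cm mu (pred1 i) c = mu i c.
    by rewrite /cm (filter_pred1_uniq (enum_uniq I) (mem_enum I i)) big_cons big_nil mulmx1.
  by move=> [Q HQ]; exists Q => c c0; rewrite -HQ // E.
by have [E _] := lim_fixed cmu L0 pV; rewrite E eqxx in X0.
Qed.

End Reduced.

Local Open Scope complex_scope.

(** * Positive products and Bruhat cells *)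

Section WordProducts.
Variables (R : realType) (n : nat) (I : Type).
Local Notation C := R[i].
Implicit Types (x : I -> C -> 'M[C]_n) (w : seq I) (a : seq R).

Definition prodw x w a : 'M[C]_n := \big[mulmx/1%:M]_(p <- zip w a) x p.1 (p.2)%:C.

Lemma prodw_nil x : prodw x [::] [::] = 1%:M.
Proof. by rewrite /prodw big_nil. Qed.

Lemma prodw_cons x i w s a : prodw x (i :: w) (s :: a) = x i s%:C *m prodw x w a.
Proof. by rewrite /prodw /= big_cons. Qed.

Lemma prodw_cat x w w' a a' : size a = size w ->
  prodw x (w ++ w') (a ++ a') = prodw x w a *m prodw x w' a'.
Proof.
elim: w a => [|i w IH] [|s a] //= => [_|[sa]]; first by rewrite prodw_nil mul1mx.
by rewrite !prodw_cons IH // mulmxA.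
Qed.

Definition bounded_params (M : R) a := all (fun s => 0 < s <= M) a.

Lemma bounded_params_le M M' a : M <= M' -> bounded_params M a -> bounded_params M' a.
Proof.
by move=> MM' /allP H; apply/allP => s /H /andP [-> /le_trans]; apply.
Qed.

Lemma bounded_params_ex a : all (fun s => 0 < s) a -> exists2 M, 1 <= M & bounded_params M a.
Proof.
elim: a => [|s a IH] /=; first by exists 1.
move=> /andP [s0 /IH [M M1 HM]]; exists (Num.max s M); first by rewrite le_max M1 orbT.
rewrite /= s0 le_max lexx /=; apply: bounded_params_le HM.
by rewrite le_max lexx orbT.
Qed.

Lemma bounded_params_pos M a : bounded_params M a -> all (fun s => 0 < s) a.
Proof. by apply: sub_all => s /andP []. Qed.

End WordProducts.

HB.lock Definition xw (R : realType) n (I : Type) (ph : I -> 'M[R[i]]_2 -> 'M[R[i]]_n)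
    (w : seq I) (a : seq R) := prodw (xx ph) w a.
HB.lock Definition yw (R : realType) n (I : Type) (ph : I -> 'M[R[i]]_2 -> 'M[R[i]]_n)
    (w : seq I) (a : seq R) := prodw (yy ph) w a.

Section PositiveTorus.
Variables (R : realType) (n : nat) (I : finType) (T : set 'M[R[i]]_n).
Local Notation C := R[i].
Variables (chi : I -> 'M[C]_n -> C) (ph : I -> 'M[C]_2 -> 'M[C]_n) (K : nat).
Variables (e f : I -> 'M[C]_n) (mu : I -> C -> 'M[C]_n) (q : nat).
Hypothesis D : pdata T chi ph K e f mu q.
Implicit Types (g t : 'M[C]_n) (u v w : seq I) (a b : seq R).
Local Notation xw := (xw ph).
Local Notation yw := (yw ph).

Lemma xw_nil : xw [::] [::] = 1%:M.
Proof. by rewrite xw.unlock prodw_nil. Qed.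

Lemma xw_cons i w s a : xw (i :: w) (s :: a) = xx ph i s%:C *m xw w a.
Proof. by rewrite xw.unlock prodw_cons. Qed.

Lemma xw_cat w w' a a' : size a = size w -> xw (w ++ w') (a ++ a') = xw w a *m xw w' a'.
Proof. by rewrite xw.unlock; apply: prodw_cat. Qed.

Lemma yw_nil : yw [::] [::] = 1%:M.
Proof. by rewrite yw.unlock prodw_nil. Qed.

Lemma yw_cons i w s a : yw (i :: w) (s :: a) = yy ph i s%:C *m yw w a.
Proof. by rewrite yw.unlock prodw_cons. Qed.

Lemma yw_cat w w' a a' : size a = size w -> yw (w ++ w') (a ++ a') = yw w a *m yw w' a'.
Proof. by rewrite yw.unlock; apply: prodw_cat. Qed.

Lemma xw_unit w a : size a = size w -> xw w a \in unitmx.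
Proof.
elim: w a => [|i w IH] [|s a] //= => [_|[sa]]; first by rewrite xw_nil unitmx1.
by rewrite xw_cons unitmx_mul (x_unit D) IH.
Qed.

Lemma yw_unit w a : size a = size w -> yw w a \in unitmx.
Proof.
elim: w a => [|i w IH] [|s a] //= => [_|[sa]]; first by rewrite yw_nil unitmx1.
by rewrite yw_cons unitmx_mul (y_unit D) IH.
Qed.

Lemma xw_inv w a : size a = size w ->
  invmx (xw w a) = xw (rev w) (rev [seq - s | s <- a]).
Proof.
elim: w a => [|i w IH] [|s a] //= => [_|[sa]]; first by rewrite /rev /= xw_nil invmx1.
rewrite xw_cons invmxM ?(x_unit D) ?xw_unit // IH // !rev_cons -!cats1 xw_cat; last first.
  by rewrite !size_rev size_map.
by rewrite xw_cons xw_nil mulmx1 (x_inv D) rmorphN.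
Qed.

Lemma yw_inv w a : size a = size w ->
  invmx (yw w a) = yw (rev w) (rev [seq - s | s <- a]).
Proof.
elim: w a => [|i w IH] [|s a] //= => [_|[sa]]; first by rewrite /rev /= yw_nil invmx1.
rewrite yw_cons invmxM ?(y_unit D) ?yw_unit // IH // !rev_cons -!cats1 yw_cat; last first.
  by rewrite !size_rev size_map.
by rewrite yw_cons yw_nil mulmx1 (y_inv D) rmorphN.
Qed.

Definition Tp : set 'M[C]_n := smallest (@submonoid R n)
  [set A | exists (i : I) (s : R), 0 < s /\ A = cc ph i s%:C].

Lemma Tp1 : Tp 1%:M.
Proof. by move=> H [[H1 _] _]. Qed.

Lemma TpM t t' : Tp t -> Tp t' -> Tp (t *m t').
Proof. by move=> H1 H2 S sS; have [[_ SM] _] := sS; apply: SM; [apply: H1|apply: H2]. Qed.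

Lemma Tp_cc i s : 0 < s -> Tp (cc ph i s%:C).
Proof. by move=> s0 S [_]; apply; exists i, s. Qed.

Lemma Tp_ind (Q : 'M[C]_n -> Prop) : Q 1%:M -> (forall t t', Tp t -> Tp t' -> Q t -> Q t' -> Q (t *m t')) ->
  (forall i s, 0 < s -> Q (cc ph i s%:C)) -> forall t, Tp t -> Q t.
Proof.
move=> Q1 QM Qc t; move=> /(_ [set t | Tp t /\ Q t]) [] //.
split; last by move=> _ [i [s [s0 ->]]]; split; [exact: Tp_cc|exact: Qc].
split; first by split=> //; apply: Tp1.
by move=> A B [TA QA] [TB QB]; split; [exact: TpM|exact: QM].
Qed.

Lemma Tp_T t : Tp t -> T t.
Proof.
move: t; apply: Tp_ind; first exact: pd_T1 D.
  by move=> t t' _ _; apply: pd_TM D t t'.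
by move=> i s s0; apply: (cc_T D); rewrite fmorph_eq0 gt_eqF.
Qed.

Lemma chi_Tp k t : Tp t -> 0 < chi k t.
Proof.
move: t; apply: Tp_ind; first by rewrite (pd_chi1 D) ltr01.
  by move=> t t' /Tp_T Tt /Tp_T Tt' H H'; rewrite (pd_chiM D) // mulr_gt0.
move=> i s s0; have [m Hm] := pd_cork D i k; have s0' : 0 < (s%:C : C) by rewrite ltcR.
by rewrite cc.unlock Hm ?gt_eqF // exprz_gt0.
Qed.

Definition rchi k t : R := complex.Re (chi k t).

Lemma rchiE k t : Tp t -> chi k t = (rchi k t)%:C.
Proof. by move=> /(chi_Tp k) /gtr0_real /RRe_real. Qed.

Lemma rchi_gt0 k t : Tp t -> 0 < rchi k t.
Proof. by move=> Tt; have := chi_Tp k Tt; rewrite rchiE // ltcR. Qed.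

Lemma rchiM k t t' : Tp t -> Tp t' -> rchi k (t *m t') = rchi k t * rchi k t'.
Proof.
move=> Tt Tt'; apply: (@complexI R); rewrite rmorphM /= -!rchiE //; last exact: TpM.
by rewrite (pd_chiM D) //; apply: Tp_T.
Qed.

Lemma cc_mul i c d : c != 0 -> d != 0 -> cc ph i c *m cc ph i d = cc ph i (c * d).
Proof.
move=> c0 d0; rewrite cc.unlock.
have E := congr1 (ph i) (diag2M c d).
by rewrite -E (pd_phM D i (SL2_diag2 c0) (SL2_diag2 d0)).
Qed.

Lemma TpV t : Tp t -> Tp (invmx t).
Proof.
move: t; apply: Tp_ind; first by rewrite invmx1; apply: Tp1.
  move=> t t' Tt Tt' H H'; rewrite invmxM ?(pd_unit D) //; try exact: Tp_T.
  exact: TpM.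
move=> i s s0; have s1 : (s%:C : C) != 0 by rewrite fmorph_eq0 gt_eqF.
have s1' : (s^-1%:C : C) != 0 by rewrite fmorph_eq0 invr_eq0 gt_eqF.
suff -> : invmx (cc ph i s%:C) = cc ph i s^-1%:C by apply: Tp_cc; rewrite invr_gt0.
rewrite -[RHS](mulKmx (co_unit D i s1)) cc_mul // -rmorphM divff ?gt_eqF //.
by rewrite cc.unlock diag2_1 (pd_ph1 D) mulmx1.
Qed.

Lemma t_yw t v b : T t -> (forall k, chi k t = (rchi k t)%:C) -> size b = size v ->
  t *m yw v b = yw v [seq (rchi p.1 t)^-1 * p.2 | p <- zip v b] *m t.
Proof.
move=> Tt Er; elim: v b => [|i v IH] [|s b] //= => [_|[sb]].
  by rewrite yw_nil mul1mx mulmx1.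
rewrite !yw_cons -mulmxA -IH // !mulmxA; apply: (f_equal2 mulmx _ (erefl _)).
have Ut := pd_unit D Tt; rewrite rmorphM /= fmorphV /= -Er -(conj_y D _ _ Tt).
by rewrite /conjby mulmxKV.
Qed.

Lemma xw_t t w a : T t -> (forall k, chi k t = (rchi k t)%:C) -> size a = size w ->
  xw w a *m t = t *m xw w [seq (rchi p.1 t)^-1 * p.2 | p <- zip w a].
Proof.
move=> Tt Er; have Ut := pd_unit D Tt; elim: w a => [|i w IH] [|s a] //= => [_|[sa]].
  by rewrite xw_nil mul1mx mulmx1.
rewrite !xw_cons -mulmxA IH // !mulmxA; apply: (f_equal2 mulmx _ (erefl _)).
have -> : xx ph i s%:C = conjby t (xx ph i ((rchi i t)^-1 * s)%:C).
  rewrite (conj_x D _ _ Tt) Er -rmorphM /= mulVKf //.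
  by have := pd_chi0 D i Tt; rewrite Er fmorph_eq0.
by rewrite /conjby mulmxKV.
Qed.

Definition bounded_torus (M : R) t := forall k, M^-1 <= rchi k t <= M.

Lemma bounded_torus_le M M' t : 1 <= M -> M <= M' -> bounded_torus M t -> bounded_torus M' t.
Proof.
move=> M1 MM' H k; have /andP [h1 h2] := H k.
have M0 : 0 < M by apply: lt_le_trans M1.
rewrite (le_trans h2 MM') andbT; apply: le_trans h1.
by rewrite lef_pV2 // posrE // (lt_le_trans M0).
Qed.

Lemma bounded_torusM M M' t t' : 1 <= M -> 1 <= M' -> Tp t -> Tp t' ->
  bounded_torus M t -> bounded_torus M' t' -> bounded_torus (M * M') (t *m t').
Proof.
move=> M1 M1' Tt Tt' H H' k; have /andP [h1 h2] := H k; have /andP [h1' h2'] := H' k.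
have M0 : 0 < M by apply: lt_le_trans M1.
have M0' : 0 < M' by apply: lt_le_trans M1'.
rewrite rchiM // invfM; apply/andP; split; apply: ler_pM => //; try by rewrite invr_ge0 ltW.
  by apply: ltW; apply: rchi_gt0.
by apply: ltW; apply: rchi_gt0.
Qed.

Lemma bounded_torus1 : bounded_torus 1 1%:M.
Proof.
move=> k; have := rchiE k Tp1; rewrite (pd_chi1 D) => E.
have -> : rchi k 1%:M = 1 by apply: (@complexI R); rewrite -E.
by rewrite invr1 lexx.
Qed.

(** N is the largest absolute value of an exponent of a simple root along a coroot. *)
Lemma bounded_cc : exists N : nat, forall i s, 1 <= s -> bounded_torus (s ^+ N) (cc ph i s%:C).
Proof.
have H (p : I * I) : exists m : int, forall c, c != 0 -> chi p.2 (ph p.1 (diag2 c)) = c ^ m.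
  exact: pd_cork D p.1 p.2.
have [m Hm] := choice H.
exists (\max_(p : I * I) `|m p|)%N => i s s1 k.
have s0 : 0 < s by apply: lt_le_trans s1.
have -> : rchi k (cc ph i s%:C) = s ^ (m (i, k)).
  apply: (@complexI R); rewrite -rchiE; last exact: Tp_cc.
  by rewrite cc.unlock (Hm (i, k)) ?fmorph_eq0 ?gt_eqF // fmorphXz.
have le : (`|m (i, k)| <= \max_(p : I * I) `|m p|)%N by apply: (leq_bigmax (i, k)).
have h : s ^+ `|m (i, k)|%N <= s ^+ (\max_(p : I * I) `|m p|)%N by apply: ler_weXn2l.
have sN (j : nat) : 1 <= s ^+ j by apply: exprn_ege1.
have p0 (j : nat) : 0 < s ^+ j by apply: exprn_gt0.
have hV : (s ^+ (\max_(p : I * I) `|m p|)%N)^-1 <= (s ^+ `|m (i, k)|%N)^-1.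
  by rewrite lef_pV2 // posrE.
have V1 (j : nat) : (s ^+ j)^-1 <= 1 by rewrite invf_le1.
case: (m (i, k)) h hV => j /= h hV; apply/andP; split.
- by apply: le_trans hV _; apply: le_trans (V1 _) (sN _).
- exact: h.
- by rewrite NegzE -invr_expz; exact: hV.
by rewrite NegzE -invr_expz; apply: le_trans (V1 _) (sN _).
Qed.

Lemma bounded_scale M M1 t v b : 1 <= M -> Tp t -> bounded_torus M t ->
  bounded_params M1 b -> bounded_params (M * M1) [seq (rchi p.1 t)^-1 * p.2 | p <- zip v b].
Proof.
move=> M1' Tt Ht; have M0 : 0 < M by apply: lt_le_trans M1'.
elim: b v => [|s b IH] [|i v] //= /andP [/andP [s0 sM] /IH ->]; rewrite andbT.
have r0 := rchi_gt0 i Tt; have /andP [h1 h2] := Ht i.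
rewrite mulr_gt0 ?invr_gt0 //=; apply: ler_pM => //.
- by rewrite invr_ge0 ltW.
- exact: ltW.
by rewrite -[M]invrK lef_pV2 // posrE invr_gt0.
Qed.

Lemma exp_comm (X Y : 'M[C]_n) c d : X *m Y = Y *m X ->
  ev (expq K X) c *m ev (expq K Y) d = ev (expq K Y) d *m ev (expq K X) c.
Proof.
have H (Z W : 'M[C]_n) r : Z *m W = W *m Z ->
    Z *m ev (expq K W) r = ev (expq K W) r *m Z.
  move=> ZW; have ZWk k : Z *m W ^+ k = W ^+ k *m Z.
    elim: k => [|k IH]; first by rewrite !expr0 mulmx1 mul1mx.
    by rewrite exprS -mulmxE mulmxA ZW -mulmxA IH mulmxA.
  rewrite ev_expq mulmx_sumr mulmx_suml; apply: eq_bigr => k _.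
  by rewrite -!scalemxAl -!scalemxAr ZWk.
by move=> XY; apply: (H); apply/esym; apply: (H).
Qed.

Lemma xy_comm i j c d : i != j -> xx ph i c *m yy ph j d = yy ph j d *m xx ph i c.
Proof. by move=> ij; rewrite (xxE D) (yyE D); apply: exp_comm; apply: pd_ef D _ _ ij. Qed.

Lemma xy_move i c d : 1 + c * d != 0 -> xx ph i c *m yy ph i d =
  yy ph i (d / (1 + c * d)) *m cc ph i (1 + c * d) *m xx ph i (c / (1 + c * d)).
Proof.
move=> u0; rewrite xx.unlock yy.unlock cc.unlock.
have E := congr1 (ph i) (upper_lower u0).
have [Su Sl] := (@SL2_upper R, @SL2_lower R); have Sd := SL2_diag2 u0.
etransitivity; first exact: esym (pd_phM D i (Su c) (Sl d)).
by etransitivity; [exact: E|exact: (ph_mul3 D i (Sl _) Sd (Su _))].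
Qed.

(** Each exchange divides the parameter of x by 1 + s r > 1 and creates a torus element that
    rescales the parameters of the y factors to its right. The bounds are uniform in the
    parameters. *)
Lemma x_yw i v M : 1 <= M -> exists2 M', 1 <= M' &
  forall s b, 0 < s <= M -> size b = size v -> bounded_params M b ->
  exists s' b' t, [/\ 0 < s' <= s, size b' = size v, bounded_params M' b',
    Tp t /\ bounded_torus M' t & xx ph i s%:C *m yw v b = yw v b' *m t *m xx ph i s'%:C].
Proof.
move=> M1; have M0 : 0 < M by apply: lt_le_trans M1.
elim: v => [|j v [M' M1' IH]].
  exists 1 => // s [] // /andP [s0 sM] _ _; exists s, [::], 1%:M; split=> //.
  - by rewrite s0 lexx.
  - by split; [exact: Tp1|exact: bounded_torus1].
  by rewrite yw_nil !mulmx1 mul1mx.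
have M0' : 0 < M' by apply: lt_le_trans M1'.
case: (eqVneq i j) => [ij|ij]; last first.
  exists (Num.max M M'); first by rewrite le_max M1.
  move=> s [|r b] // sM /= [sb] /andP [rM bM].
  have [s' [b' [t [h1 h2 h3 [h4 h5] h6]]]] := IH s b sM sb bM.
  exists s', (r :: b'), t; split=> //; first by rewrite /= h2.
  - rewrite /= (bounded_params_le _ h3) ?le_max ?lexx ?orbT // andbT.
    by case/andP: rM => -> ->.
  - by split=> //; apply: bounded_torus_le h5; rewrite // le_max lexx orbT.
  by rewrite !yw_cons mulmxA xy_comm // -!mulmxA h6 !mulmxA.
(* Here 1 + s r <= 1 + M^2, so [L] bounds the simple roots, and their inverses, on the coroot
   created by the exchange. *)
rewrite ij in IH *; have [N HN] := bounded_cc; pose L := (1 + M * M) ^+ N.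
have MM1 : 1 <= 1 + M * M by rewrite lerDl mulr_ge0 ?ltW.
have L1 : 1 <= L by apply: exprn_ege1.
have L0 : 0 < L by apply: lt_le_trans L1.
exists (Num.max M (L * M')); first by rewrite le_max M1.
move=> s [|r b] // /andP [s0 sM] /= [sb] /andP [/andP [r0 rM] bM].
have sr0 : 0 < s * r by apply: mulr_gt0.
pose u := 1 + s * r; have u1 : 1 <= u by rewrite lerDl ltW.
have u0 : 0 < u by apply: lt_le_trans u1.
have uM : u <= 1 + M * M by rewrite lerD2l ler_pM // ltW.
have du x : 0 < x -> 0 < x / u <= x.
  by move=> x0; rewrite divr_gt0 //= ler_pdivrMr // ler_peMr // ltW.
have [s' [b' [t [/andP [h1 h1'] h2 h3 [h4 h5] h6]]]] :
    exists s' b' t, [/\ 0 < s' <= s / u, size b' = size v, bounded_params M' b',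
    Tp t /\ bounded_torus M' t & xx ph j (s / u)%:C *m yw v b = yw v b' *m t *m xx ph j s'%:C].
  have /andP [d1 d2] := du s s0.
  by apply: IH; rewrite ?d1 ?(le_trans d2).
have Tu : Tp (cc ph j u%:C) by apply: Tp_cc.
have Bu : bounded_torus L (cc ph j u%:C).
  apply: bounded_torus_le (HN j u u1); first exact: exprn_ege1.
  by rewrite lerXn2r // nnegrE ltW // (lt_le_trans u0).
have LM : 1 <= L * M' by apply: mulr_ege1.
exists s', (r / u :: [seq (rchi p.1 (cc ph j u%:C))^-1 * p.2 | p <- zip v b']), (cc ph j u%:C *m t).
split.
- by rewrite h1 (le_trans h1') //; case/andP: (du s s0).
- by rewrite /= size_map size_zip h2 minnn.
- rewrite /=; apply/andP; split.
    by have /andP [-> h] := du r r0; rewrite le_max (le_trans h rM).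
  by apply: bounded_params_le (bounded_scale v L1 Tu Bu h3); rewrite le_max lexx orbT.
- split; first exact: TpM.
  by apply: bounded_torus_le (bounded_torusM L1 M1' Tu h4 Bu h5); rewrite // le_max lexx orbT.
have uC : 1 + s%:C * r%:C = u%:C :> C by rewrite /u rmorphD rmorphM rmorph1.
rewrite !yw_cons mulmxA xy_move uC ?fmorph_eq0 ?gt_eqF // -!fmorph_div.
rewrite -!mulmxA h6 !mulmxA; do 2 apply: (f_equal2 mulmx _ (erefl _)).
rewrite -!mulmxA; apply: (f_equal2 mulmx (erefl _)); apply: t_yw => //.
  exact: Tp_T.
by move=> k; apply: rchiE.
Qed.

Lemma xw_yw u v M : 1 <= M -> exists2 M', 1 <= M' &
  forall dlt a b, dlt <= M -> size a = size u -> bounded_params dlt a ->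
  size b = size v -> bounded_params M b ->
  exists a' b' t, [/\ size a' = size u /\ bounded_params (M' * dlt) a',
    size b' = size v /\ bounded_params M' b', Tp t /\ bounded_torus M' t
    & xw u a *m yw v b = yw v b' *m t *m xw u a'].
Proof.
move=> M1; have M0 : 0 < M by apply: lt_le_trans M1.
elim: u => [|i u [M' M1' IH]].
  exists M => // dlt [] // b _ _ _ sb bM; exists [::], b, 1%:M; split=> //.
    split; first exact: Tp1.
    by apply: bounded_torus_le bounded_torus1; rewrite ?lexx.
  by rewrite xw_nil mul1mx !mulmx1.
have M0' : 0 < M' by apply: lt_le_trans M1'.
pose M2 := Num.max M M'; have M21 : 1 <= M2 by rewrite le_max M1.
have [M3 M31 H3] := x_yw i v M21.
have M31' : 0 < M3 by apply: lt_le_trans M31.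
have MM : M' <= M3 * M' by apply: ler_peMl => //; apply: ltW.
have M3M : M3 <= M3 * M' by apply: ler_peMr => //; apply: ltW.
exists (M3 * M'); first exact: mulr_ege1.
move=> dlt [|s a] // b dM /= [sa] /andP [/andP [s0 sd] ad] sb bM.
have [a1 [b1 [t1 [[h1 h2] [h3 h4] [h5 h6] h7]]]] := IH dlt a b dM sa ad sb bM.
have d0 : 0 < dlt by apply: lt_le_trans sd.
have [||s2 [b2 [t2 [/andP [k1 k1'] k2 k3 [k4 k5] k6]]]] := H3 s b1 _ h3.
- by rewrite s0 le_max (le_trans sd dM).
- by apply: bounded_params_le h4; rewrite le_max lexx orbT.
exists ((rchi i t1)^-1 * s2 :: a1), b2, (t2 *m t1); split.
- split; first by rewrite /= h1.
  rewrite /=; apply/andP; split; last first.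
    by apply: bounded_params_le h2; rewrite ler_wpM2r // ltW.
  have r0 := rchi_gt0 i h5; have /andP [r1 r2] := h6 i.
  rewrite mulr_gt0 ?invr_gt0 //=; apply: ler_pM.
  + by rewrite invr_ge0 ltW.
  + exact: ltW.
  + by apply: le_trans MM; rewrite -[M']invrK lef_pV2 // posrE invr_gt0.
  exact: le_trans k1' sd.
- by split=> //; apply: bounded_params_le k3.
- by split; [exact: TpM|apply: bounded_torusM].
have Tt1 := Tp_T h5; have Er k : chi k t1 = (rchi k t1)%:C by apply: rchiE.
rewrite !xw_cons -mulmxA h7 !mulmxA k6.
have E : xx ph i s2%:C *m t1 = t1 *m xx ph i ((rchi i t1)^-1 * s2)%:C.
  have := @xw_t t1 [:: i] [:: s2] Tt1 Er (erefl _).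
  by rewrite /= !xw_cons !xw_nil !mulmx1.
by rewrite -(mulmxA _ (xx ph i s2%:C) t1) E !mulmxA.
Qed.

Lemma xw_yw_pos u v a b : size a = size u -> all (fun s => 0 < s) a ->
  size b = size v -> all (fun s => 0 < s) b -> exists a' b' t,
  [/\ size a' = size u /\ all (fun s => 0 < s) a', size b' = size v /\ all (fun s => 0 < s) b',
    Tp t & xw u a *m yw v b = yw v b' *m t *m xw u a'].
Proof.
move=> sa pa sb pb; have [M1 M11 H1] := bounded_params_ex pa.
have [M2 M22 H2] := bounded_params_ex pb.
pose M := Num.max M1 M2; have M1' : 1 <= M by rewrite le_max M11.
have [M' _ H] := xw_yw u v M1'.
have bM : bounded_params M b by apply: bounded_params_le H2; rewrite le_max lexx orbT.
have MM : M1 <= M by rewrite le_max lexx.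
have [a' [b' [t [[h1 h2] [h3 h4] [h5 _] h6]]]] := H M1 a b MM sa H1 sb bM.
exists a', b', t; split=> //; split=> //; [exact: bounded_params_pos h2|].
exact: bounded_params_pos h4.
Qed.

End PositiveTorus.

Section BruhatCells.
Variables (R : realType) (n : nat) (I : finType) (T : set 'M[R[i]]_n).
Local Notation C := R[i].
Variables (chi : I -> 'M[C]_n -> C) (ph : I -> 'M[C]_2 -> 'M[C]_n) (K : nat).
Variables (e f : I -> 'M[C]_n) (mu : I -> C -> 'M[C]_n) (q : nat).
Hypothesis D : pdata T chi ph K e f mu q.
Implicit Types (X Y Z g t m : 'M[C]_n) (u v w p : seq I) (a b : seq R).
Local Notation xw := (xw ph).
Local Notation yw := (yw ph).
Local Notation wd := (wd ph).
Local Notation np := (nsp e).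
Local Notation nm := (nsp f).
Local Notation Tp := (Tp ph).
Local Notation kap := (cm mu predT).
Local Notation kapV := (fun c => kap c^-1).
Local Notation qs := (nsp f + hsp e f)%VS.
Local Notation pos := (all (fun s : R => 0 < s)).

Let D' := dual_pdata D.
Let cG : cochar (@GL R n) kap := cm_GL D predT.
Let cGV : cochar (@GL R n) kapV := cm_GL D' predT.

Lemma lim_exp (m : C -> 'M[C]_n) X L s : cochar (@GL R n) m -> lim m X L ->
  lim m (ev (expq K X) s) (ev (expq K L) s).
Proof.
move=> cmm [Q HQ QL]; have [E HE] := exp_curve Q K s; exists E.
  by move=> c c0; have [mU _ _] := cmm; rewrite HE conjby_exp ?HQ //; apply: mU.
by rewrite HE QL.
Qed.

Lemma exp_0 s : ev (expq K (0 : 'M[C]_n)) s = 1%:M.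
Proof.
rewrite -(scale0r (0 : 'M[C]_n)) expq_scale mul0r expq0 //.
by have := pd_K1 D; case: K => // k _; rewrite expr0n.
Qed.

Lemma pol_exp_nm X s : X \in nm -> pol kapV (ev (expq K X) s).
Proof.
by move=> /(nm_lim0 D) H; have := lim_exp s cGV H; rewrite exp_0; apply: lim_pol.
Qed.

Lemma polM (m : C -> 'M[C]_n) X Y : cochar (@GL R n) m -> pol m X -> pol m Y -> pol m (X *m Y).
Proof.
move=> cmm /pol_lim [L HL] /pol_lim [L' HL']; apply: lim_pol.
exact: (limM cmm HL HL').
Qed.

Lemma x_bruhat i c : c != 0 -> xx ph i c =
  yy ph i c^-1 *m cc ph i c *m ss ph i *m yy ph i c^-1.
Proof.
move=> c0; rewrite xx.unlock yy.unlock cc.unlock ss.unlock.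
have E := congr1 (ph i) (upper_bruhat c0).
have [Sl Sd] := (@SL2_lower R c^-1, SL2_diag2 c0); have Sw := SL2_weyl2 R.
by etransitivity; [exact: E|exact: (ph_mul4 D i Sl Sd Sw Sl)].
Qed.

Lemma bruhat_regroup g t X Y Y' Z h m : h \in unitmx -> t *m Y = Y' *m t ->
  g *m t *m (Y *m X *m Z *m Y *m h) *m m =
  g *m Y' *m (t *m X) *m (Z *m h) *m (conjby (invmx h) Y *m m).
Proof.
move=> Uh E; rewrite /conjby invmxK !mulmxA (mulmxK Uh); apply: (f_equal2 mulmx _ (erefl _)).
apply: (f_equal2 mulmx _ (erefl _)); apply: (f_equal2 mulmx _ (erefl _)).
by rewrite -(mulmxA g t Y) E !mulmxA.
Qed.

(** A factor x_i is added on the left and moved past the y factors and t. The last factor m stands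
    for an element of B_-, expressed by [pol kapV m]. *)
Lemma bruhat p a : size a = size p -> pos a -> exists v b t u m,
  [/\ xw p a = yw v b *m t *m wd u *m m, size b = size v /\ pos b, Tp t,
      m \in unitmx /\ pol kapV m
    & (size u <= size p)%N /\ (minimal_word T ph p -> v = rev p /\ u = p)].
Proof.
elim: p a => [|i p IH] [|s a] //=.
  move=> _ _; exists [::], [::], 1%:M, [::], 1%:M; split=> //.
  - by rewrite xw_nil yw_nil wd_nil !mulmx1.
  - exact: Tp1.
  split; first exact: unitmx1.
  exact: lim_pol (lim1 cGV).
move=> [sa] /andP [s0 pa].
have [v [b [t [u [m [Ex [sb pb] Tt [Um pm] [su Hred]]]]]]] := IH a sa pa.
have [Uw Tt'] := (wd_unit D u, Tp_T D Tt).
have Uuv : invmx (wd u) \in unitmx by rewrite unitmx_inv.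
have ps : pos [:: s] by rewrite /= s0.
have [a1 [b1 [t1 [[sa1 pa1] [sb1 pb1] Tt1 E1]]]] :=
  xw_yw_pos D (u := [:: i]) (a := [:: s]) (erefl _) ps sb pb.
case: a1 sa1 pa1 E1 => [|s1 [|//]] //= _ /andP [s10 _] E1.
rewrite !xw_cons !xw_nil !mulmx1 in E1.
pose s2 := (rchi chi i t)^-1 * s1.
have r0 := rchi_gt0 D i Tt; have s20 : 0 < s2 by rewrite mulr_gt0 ?invr_gt0.
have s2C : (s2%:C : C) != 0 by rewrite fmorph_eq0 gt_eqF.
have E2 : xx ph i s1%:C *m t = t *m xx ph i s2%:C.
  have := @xw_t _ _ _ _ _ _ _ _ _ _ _ D t [:: i] [:: s1] Tt' (fun k => rchiE D k Tt) (erefl _).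
  by rewrite /= !xw_cons !xw_nil !mulmx1.
have E3 : xw (i :: p) (s :: a) =
    yw v b1 *m (t1 *m t) *m (xx ph i s2%:C *m wd u) *m m.
  rewrite xw_cons Ex !mulmxA E1 -(mulmxA _ (xx ph i s1%:C) t) E2.
  by rewrite !mulmxA.
have wdC X : X *m wd u = wd u *m conjby (invmx (wd u)) X.
  by rewrite /conjby invmxK !mulmxA mulmxV // mul1mx.
(* If w^-1 e_i is negative, x_i passes through w and joins m; for a minimal word this contradicts
   [exchange]. Otherwise [x_bruhat] adds the letter i to u, one y factor joins the word v and the
   other, conjugated by w^-1, joins m. *)
have [[ep fp]|[em _]] := dichotomy D u i; last first.
  exists v, b1, (t1 *m t), u, (conjby (invmx (wd u)) (xx ph i s2%:C) *m m); split=> //.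
  - by rewrite E3 wdC !mulmxA.
  - exact: TpM.
  - split; first by rewrite unitmx_mul Um andbT conjby_unit // (x_unit D).
    apply: (polM cGV _ pm); rewrite (exp_conj_x D Uuv (erefl _)).
    exact: pol_exp_nm.
  split; first exact: ltnW.
  move=> red; have [_ Eu] := Hred (minimal_cons D red).
  by have := exchange D red; rewrite -{1}Eu => h; case: (np_nm_conj D h em).
set t' := t1 *m t in E3; have Tt2 : Tp t' by apply: TpM.
pose s3 := (rchi chi i t')^-1 * s2^-1.
have s30 : 0 < s3 by rewrite mulr_gt0 ?invr_gt0 // (rchi_gt0 D).
have E4 : t' *m yy ph i (s2%:C)^-1 = yy ph i s3%:C *m t'.
  have := @t_yw _ _ _ _ _ _ _ _ _ _ _ D t' [:: i] [:: s2^-1] (Tp_T D Tt2)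
    (fun k => rchiE D k Tt2) (erefl _).
  by rewrite /= !yw_cons !yw_nil !mulmx1 fmorphV.
exists (v ++ [:: i]), (b1 ++ [:: s3]), (t' *m cc ph i s2%:C), (i :: u),
  (conjby (invmx (wd u)) (yy ph i (s2%:C)^-1) *m m); split.
- rewrite E3 (x_bruhat i s2C) (yw_cat _ _ _ sb1) yw_cons yw_nil mulmx1 wd_cons.
  exact: bruhat_regroup.
- by rewrite !size_cat sb1 all_cat pb1 /= s30.
- by apply: TpM => //; apply: Tp_cc.
- split; first by rewrite unitmx_mul Um andbT conjby_unit // (y_unit D).
  apply: (polM cGV _ pm); rewrite (exp_conj_y D Uuv (erefl _)).
  exact: pol_exp_nm.
split; first by rewrite /= ltnS.
move=> red; have [-> ->] := Hred (minimal_cons D red).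
by rewrite rev_cons cats1.
Qed.

Lemma qs_nm X : X \in nm -> X \in qs.
Proof. exact: (subvP (addvSl _ _)). Qed.

Lemma qs_hs X : X \in hsp e f -> X \in qs.
Proof. exact: (subvP (addvSr _ _)). Qed.

Lemma qs_e j X : X \in qs -> br (e j) X \in (qs + <[e j]>)%VS.
Proof.
move=> /memv_addP [A HA [H HH ->]]; rewrite brDr; apply: memv_add.
  exact: br_e_nm D j _ HA.
exact: br_e_hs D j _ HH.
Qed.

Lemma qs_f j X : X \in qs -> br (f j) X \in nm.
Proof.
move=> /memv_addP [A HA [H HH ->]]; rewrite brDr; apply: memvD; first exact: nsp_br.
by rewrite brN memvN (br_f_hs D).
Qed.

Lemma qs_x j c X : X \in qs -> conjby (xx ph j c) X \in (qs + <[e j]>)%VS.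
Proof.
move=> HX; rewrite (xxE D); apply: exp_stable; first exact: pd_eK D j.
  move=> Y /memv_addP [A HA [_ /vlineP [d ->] ->]]; rewrite brDr brZr.
  by rewrite [br (e j) (e j)]subrr scaler0 addr0 qs_e.
exact: (subvP (addvSl _ _)).
Qed.

(** The properties of Ad(g) for g in B_- that are used: it preserves b_-, and modulo b_- it only
    rescales each e_j. *)
Definition lower_like g := [/\ g \in unitmx, forall X, X \in qs -> conjby g X \in qs
  & forall j, exists2 l, l != 0 & conjby g (e j) - l *: e j \in qs].

Lemma lower_likeM g h : lower_like g -> lower_like h -> lower_like (g *m h).
Proof.
move=> [Ug gq ge] [Uh hq he]; split; first by rewrite unitmx_mul Ug.
  by move=> X HX; rewrite conjby_comp //; apply/gq/hq.
move=> j; have [l l0 Hl] := he j; have [l' l'0 Hl'] := ge j.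
exists (l * l'); first by rewrite mulf_neq0.
have -> : conjby (g *m h) (e j) - (l * l') *: e j =
    conjby g (conjby h (e j) - l *: e j) + l *: (conjby g (e j) - l' *: e j).
  by rewrite conjby_comp // conjbyB conjbyZ scalerBr scalerA addrA subrK.
by apply: memvD; [exact: gq|apply: memvZ].
Qed.

Lemma lower_like_T t : T t -> lower_like t.
Proof.
move=> Tt; split; first exact: pd_unit D _ Tt.
  move=> X /memv_addP [A HA [H HH ->]]; rewrite conjbyD; apply: memv_add.
    exact: nm_T D _ _ Tt HA.
  by rewrite (hs_T D HH Tt).
by move=> j; exists (chi j t); [exact: pd_chi0 D _ _ Tt|rewrite (pd_chie D) // subrr mem0v].
Qed.

Lemma qs_y i c X : X \in qs -> conjby (yy ph i c) X \in qs.
Proof.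
move=> HX; rewrite (yyE D); apply: exp_stable HX; first exact: pd_fK D i.
by move=> Y HY; apply/qs_nm/qs_f.
Qed.

Lemma e_notin_qs j : e j \in qs -> False.
Proof.
by move=> H; have := np_cap D (nsp_gen e j) H; apply/eqP/(pd_e0 D).
Qed.

Lemma lower_like_y i c : lower_like (yy ph i c).
Proof.
split; [exact: y_unit D i c|by move=> X; apply: qs_y|move=> j].
have H : conjby (yy ph i c) (e j) \in (<[e j]> + qs)%VS.
  rewrite (yyE D); apply: exp_stable; first exact: pd_fK D i.
    move=> Y /memv_addP [_ /vlineP [d ->] [Z HZ ->]]; rewrite brDr brZr.
    rewrite -[_ + _]add0r; apply: memv_add; first exact: mem0v.
    apply: memvD; last exact/qs_nm/qs_f.
    apply: memvZ; rewrite brN memvN; case: (eqVneq j i) => [->|ji].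
      exact/qs_hs/hsp_gen.
    by rewrite /br (pd_ef D) // subrr mem0v.
  by apply: (subvP (addvSl _ _)); apply: memv_line.
have [_ /vlineP [d ->] [Z HZ E]] := memv_addP H.
exists d; last by rewrite E addrAC subrr add0r.
apply/eqP => d0; apply: (@e_notin_qs j).
rewrite -(conjbyK (e j) (y_unit D i c)) E d0 scale0r add0r (y_inv D).
exact: qs_y.
Qed.

Lemma lower_like_word v b : size b = size v -> lower_like (yw v b).
Proof.
elim: v b => [|i u IH] [|s a] => [_|E|E|[sa]]; [|discriminate E|discriminate E|].
  by rewrite yw_nil; exact: lower_like_T (pd_T1 D).
by rewrite yw_cons; apply: lower_likeM; [exact: lower_like_y|exact: IH].
Qed.

Lemma lower_like_yw v b t : size b = size v -> T t ->
  lower_like (yw v b *m t) /\ lower_like (invmx (yw v b *m t)).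
Proof.
move=> sb Tt; have Ut := pd_unit D Tt; have Uy := yw_unit D sb.
rewrite invmxM //; have Lt := lower_like_T Tt; have LtV := lower_like_T (pd_TV D Tt).
split; apply: lower_likeM; [exact: lower_like_word|exact: Lt|exact: LtV|].
by rewrite (yw_inv D sb); apply: lower_like_word; rewrite !size_rev size_map.
Qed.

(* The Lie algebra version of e_j being in b_- + Ad(g) b_-. *)
Definition reachable g j := exists X Y, [/\ X \in qs, pol kapV Y & e j = X + conjby g Y].

(** The outer factors from B_- do not affect reachability, so it is a property of w: it says that
    e_j lies in b_- + Ad(w) b_-, which depends on the sign of w^-1 e_j. *)
Lemma reachable_gen v b t u m j : size b = size v -> T t -> m \in unitmx -> pol kapV m ->
  reachable (yw v b *m t *m wd u *m m) j <-> conjby (invmx (wd u)) (e j) \in nm.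
Proof.
move=> sb Tt Um pm; set y := yw v b *m t.
have [[Uy yq ye] [Uy' yq' ye']] := lower_like_yw sb Tt; rewrite -/y in Uy yq ye Uy' yq' ye'.
have Uw := wd_unit D u; have Uwv : invmx (wd u) \in unitmx by rewrite unitmx_inv.
have Uyw : y *m wd u \in unitmx by rewrite unitmx_mul Uy.
have pconj g Y : g \in unitmx -> pol kapV g -> pol kapV Y -> pol kapV (conjby g Y).
  move=> Ug pg pY; apply: (polM cGV (polM cGV pg pY)).
  by have [L HL] := pol_lim pg; apply: lim_pol (limV cGV HL Ug).
have com Y : conjby (y *m wd u *m m) Y = conjby y (conjby (wd u) (conjby m Y)).
  by rewrite (conjby_comp _ Uyw Um) (conjby_comp _ Uy Uw).
split.
- move=> [X [Y [HX pY E]]]; have [[ep _]|[//]] := dichotomy D u j; exfalso.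
  have [l l0 Hl] := ye' j; pose P := conjby m Y; have pP : pol kapV P by apply: pconj.
  have E1 : l *: e j - conjby (wd u) P \in qs.
    have -> : l *: e j - conjby (wd u) P =
        conjby (invmx y) X - (conjby (invmx y) (e j) - l *: e j).
      rewrite {2}E conjbyD com (conjbyK _ Uy) -/P opprB addrCA.
      by rewrite opprD [conjby _ X + _]addrA subrr sub0r.
    by apply: memvB => //; apply: yq'.
  have [k Hk] := wd_weight D u j; set E0 := conjby (invmx (wd u)) (e j) in ep Hk.
  have k0 : 0 < k.
    rewrite ltNge; apply/negP => k0; case: k k0 Hk => [[|//]|p] _ Hk.
      have L1 : lim kap E0 E0.
        by exists (cst E0) => [c c0|]; rewrite ev_cst // (Hk c c0).1 expr0z scale1r.
      have E00 := lim_uniq L1 (np_lim0 D ep); case/eqP: (pd_e0 D j).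
      by apply/eqP; rewrite -(conjby_eq0 (e j) Uwv) -/E0 E00.
    have L1 : lim kapV E0 0.
      have := @lim_weight _ _ kapV E0 p.+1; apply=> c c0.
      have c0' : c^-1 != 0 by rewrite invr_eq0.
      by rewrite (Hk _ c0').1 NegzE -exprz_inv invrK.
    have E0m : E0 \in nm by apply: (gs_lim0V D) => //; apply: gs_np.
    exact: (np_nm_conj D ep E0m).
  case: k k0 Hk => [[//|p]|//] _ Hk.
  have [Q HQ] := pP.
  have Tl c : c != 0 -> T (conjby (wd u) (kap c)).
    by move=> c0; apply: (T_wd D); apply: cm_T D _ _ c0.
  (* For d <> 0, F(d) is d^(p+1) times the conjugate of l e_j - Ad(w) P by an element of T, hence in
     b_-. At d = 0 only l e_j remains, which would lie in b_-. *)
  pose F := (l%:P : {poly C}) *: cst (e j) - 'X^(p.+1) *: (cst (wd u) *m Q *m cst (invmx (wd u))).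
  have F0 : ev F 0 = l *: e j.
    by rewrite evB !evZ ev_cst hornerC hornerXn expr0n /= scale0r subr0.
  have : ev F 0 \in qs.
    apply: ev_vs0 => d d0; have d0' : d^-1 != 0 by rewrite invr_eq0.
    rewrite evB !evZ !evM !ev_cst hornerC hornerXn -(HQ d d0).
    rewrite -[_ *m _ *m _]/(conjby (wd u) (conjby (kap d^-1) P)).
    have Uk := pd_unit D (cm_T D predT d0').
    have Ul := pd_unit D (Tl _ d0').
    have -> : conjby (wd u) (conjby (kap d^-1) P) =
        conjby (conjby (wd u) (kap d^-1)) (conjby (wd u) P).
      have := conjbyV_conj P Uwv Uk; rewrite invmxK => ->.
      by [].
    have El : conjby (conjby (wd u) (kap d^-1)) (e j) = d ^- p.+1 *: e j.
      have Hd := (Hk _ d0').1; rewrite -exprnP exprVn in Hd.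
      rewrite -{1}(conjbyVK (e j) Uw) -/E0.
      have := conjbyV_conj E0 Uwv Uk; rewrite invmxK => ->.
      by rewrite Hd conjbyZ conjbyVK.
    have -> : l *: e j - d ^+ p.+1 *: conjby (conjby (wd u) (kap d^-1)) (conjby (wd u) P) =
        d ^+ p.+1 *: conjby (conjby (wd u) (kap d^-1)) (l *: e j - conjby (wd u) P).
      rewrite conjbyB conjbyZ El scalerBr !scalerA; congr (_ *: _ - _).
      by rewrite mulrAC divff ?mul1r // expf_neq0.
    apply: memvZ; have [_ tq _] := lower_like_T (Tl _ d0'); exact: tq.
  rewrite F0 => H; apply: (@e_notin_qs j).
  by rewrite -[e j]scale1r -(mulVf l0) -scalerA memvZ.
move=> em; have [l l0 Hl] := ye j.
pose P := conjby (invmx m) (conjby (invmx (wd u)) (e j)).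
have Em : conjby (y *m wd u *m m) P = conjby y (e j).
  by rewrite com /P !conjbyVK.
exists (- l^-1 *: (conjby y (e j) - l *: e j)), (l^-1 *: P); split.
- exact: memvZ.
- have pP : pol kapV P.
    apply: pconj; rewrite ?unitmx_inv //.
      by have [L HL] := pol_lim pm; apply: lim_pol (limV cGV HL Um).
    exact: lim_pol (nm_lim0 D em).
  have [Q HQ] := pP; exists ((l^-1)%:P *: Q) => c c0.
  by rewrite conjbyZ HQ // evZ hornerC.
rewrite conjbyZ Em scaleNr scalerBr opprB scalerA mulVf // scale1r.
by rewrite subrK.
Qed.

Lemma reachable_minimal p a j : size a = size p -> pos a -> minimal_word T ph p ->
  reachable (xw p a) j <-> conjby (invmx (wd p)) (e j) \in nm.
Proof.
move=> sa pa red; have [v [b [t [u [m [E [sb _] Tt [Um pm] [_ Hu]]]]]]] := bruhat sa pa.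
have [_ Eu] := Hu red; rewrite E Eu; apply: reachable_gen => //.
exact: (Tp_T D Tt).
Qed.

Lemma short_unreachable p a : size a = size p -> pos a -> (size p < \dim np)%N ->
  exists j, ~ reachable (xw p a) j.
Proof.
move=> sa pa sp; have [v [b [t [u [m [E [sb _] Tt [Um pm] [su _]]]]]]] := bruhat sa pa.
have [j Hj] := short_positive D (leq_ltn_trans su sp); exists j; rewrite E.
move=> /(reachable_gen u j sb (Tp_T D Tt) Um pm) H.
exact: (np_nm_conj D Hj H).
Qed.

(* xi p a lists the right logarithmic derivatives of xw p at a. *)
Fixpoint xi p a : seq 'M[C]_n :=
  match p, a with
  | i :: p', s :: a' => e i :: [seq conjby (xx ph i s%:C) X | X <- xi p' a']
  | _, _ => [::]
  end.

Lemma size_xi p a : size a = size p -> size (xi p a) = size p.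
Proof. by elim: p a => [|i p IH] [|s a] //= [sa]; rewrite size_map IH. Qed.

Lemma np_x i c X : X \in np -> conjby (xx ph i c) X \in np.
Proof.
move=> HX; rewrite (xxE D); apply: exp_stable HX; first exact: pd_eK D i.
by move=> Y; apply: nsp_br.
Qed.

Lemma xi_np p a : all (fun X => X \in np) (xi p a).
Proof.
elim: p a => [|i p IH] [|s a] //=; rewrite nsp_gen all_map.
by apply: sub_all (IH a) => X; apply: np_x.
Qed.

Fact reach_space g : g \in unitmx -> exists U : {vspace 'M[C]_n}, forall X, X \in U <->
  exists Q Y, [/\ Q \in qs, pol kapV Y & X = Q + conjby g Y].
Proof.
move=> Ug; apply: vspace_of.
  exists 0, 0; rewrite mem0v linear0 addr0; split=> //.
  exact: lim_pol (lim0 _).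
move=> c X X' [Q [Y [HQ /pol_lim [L HL] ->]]] [Q' [Y' [HQ' /pol_lim [L' HL'] ->]]].
exists (c *: Q + Q'), (c *: Y + Y'); split.
- by apply: memvD => //; apply: memvZ.
- exact: lim_pol (limD c HL HL').
by rewrite conjbyD conjbyZ scalerDr addrACA.
Qed.

(** Induction on the word: Ad(x_i) maps b_- into b_- plus the line of e_i, and e_i is itself
    reachable because the word is minimal. *)
Lemma xi_reachable p a : size a = size p -> pos a -> minimal_word T ph p ->
  forall X, X \in <<xi p a>>%VS ->
  exists Q Y, [/\ Q \in qs, pol kapV Y & X = Q + conjby (xw p a) Y].
Proof.
elim: p a => [|i p IH] [|s a] => [_ _ _|E|E|[sa]].
- move=> X; rewrite span_nil memv0 => /eqP ->; exists 0, 0.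
  by rewrite mem0v linear0 addr0; split=> //; apply: lim_pol (lim0 _).
- discriminate E.
- discriminate E.
move=> ppa red; have /andP [s0 pa] := ppa; have red' := minimal_cons D red.
have Ux := x_unit D i s%:C; have Uw := xw_unit D sa.
have Up : xw (i :: p) (s :: a) \in unitmx by apply: xw_unit D _ _ _; rewrite /= sa.
have [U HU] := reach_space Up.
have com Y : conjby (xw (i :: p) (s :: a)) Y = conjby (xx ph i s%:C) (conjby (xw p a) Y).
  by rewrite xw_cons conjby_comp.
have He : e i \in U.
  apply/HU; apply/(@reachable_minimal (i :: p) (s :: a) i); rewrite ?sa //=.
    by rewrite sa.
  have [Us Uwd] := (s_unit D i, wd_unit D p).
  rewrite wd_cons (conjby_compV _ Us Uwd) (ssV_e D) -scaleN1r conjbyZ memvZ //.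
  have [[_ //]|[h _]] := dichotomy D p i.
  by case: (np_nm_conj D (exchange D red) h).
have Hq Q : Q \in qs -> Q \in U.
  by move=> HQ; apply/HU; exists Q, 0; split; rewrite ?linear0 ?addr0 //; apply: lim_pol (lim0 _).
suff /subvP H : (<<xi (i :: p) (s :: a)>> <= U)%VS by move=> X /H /HU.
apply/span_subvP => X /=; rewrite in_cons => /orP [/eqP -> //|/mapP [Z HZ ->]].
have [Q [Y [HQ pY ->]]] := IH a sa pa red' Z (memv_span HZ).
rewrite conjbyD; apply: memvD.
  have /memv_addP [Q' HQ' [_ /vlineP [d ->] ->]] := qs_x i s%:C HQ.
  by apply: memvD; [exact: Hq|apply: memvZ].
by apply/HU; exists 0, Y; rewrite mem0v add0r com.
Qed.

Lemma free_conj g (X : seq 'M[C]_n) : g \in unitmx -> free X -> free [seq conjby g Y | Y <- X].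
Proof.
move=> Ug; rewrite /free size_map => /eqP <-; rewrite -(dim_adv <<X>>%VS Ug).
rewrite adv.unlock limg_span; apply/eqP; congr (\dim (span _)).
by apply: eq_map => Y; rewrite lfunE.
Qed.

(** After removing the conjugation by x_i, which fixes e_i, a dependence would put e_i in the span
    for the tail of the word; there e_i is not reachable, by [exchange]. *)
Lemma xi_free p a : size a = size p -> pos a -> minimal_word T ph p -> free (xi p a).
Proof.
elim: p a => [|i p IH] [|s a] => [_ _ _|E|E|[sa]]; [exact: nil_free|discriminate E|discriminate E|].
move=> /andP [s0 pa] red; have red' := minimal_cons D red.
have Ux := x_unit D i s%:C.
rewrite /= free_cons (free_conj Ux (IH a sa pa red')) andbT.
apply/negP => H.
have H1 : e i \in <<xi p a>>%VS.
  have : e i \in adv (xx ph i s%:C) <<xi p a>>%VS.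
    rewrite adv.unlock limg_span; move: H; congr (_ \in span _).
    by apply: eq_map => Y; rewrite lfunE.
  rewrite (memadv _ _ Ux) (x_inv D) (xxE D).
  have -> : conjby (ev (expq K (e i)) (- s%:C)) (e i) = e i.
    have Ue := exp_GL (- s%:C) (pd_eK D i).
    rewrite /conjby; have := cst_expq (pd_eK D i) => /(congr1 (fun P => ev P (- s%:C))).
    by rewrite !evM !ev_cst => <-; rewrite mulmxK.
  by [].
have [Q [Y [HQ pY E]]] := xi_reachable sa pa red' H1.
have : reachable (xw p a) i by exists Q, Y.
move=> /(reachable_minimal i sa pa red') h.
exact: (np_nm_conj D (exchange D red) h).
Qed.

Lemma xi_span w a : size a = size w -> pos a -> longest_word T ph w ->
  <<xi w a>>%VS = np.
Proof.
move=> sa pa lw; apply/eqP; rewrite eqEdim; apply/andP; split.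
  by apply/span_subvP => X; apply: (allP (xi_np w a)).
have := xi_free sa pa lw.1; rewrite /free => /eqP ->.
by rewrite size_xi // (longest_dim D lw).
Qed.

(* A product over the longest word with a vanishing parameter lies in a smaller
   Bruhat cell. *)
Lemma support_full w w' a b : longest_word T ph w -> longest_word T ph w' ->
  size a = size w -> all (fun s : R => 0 <= s) a -> size b = size w' -> pos b ->
  xw w a = xw w' b -> pos a.
Proof.
move=> lw lw' sa a0 sb pb E; apply: contraT => na; exfalso.
(* Letters with parameter 0 are dropped, so p is strictly shorter than w when some parameter
   vanishes. *)
have [p [c [sc pc sp Ep]]] : exists p c, [/\ size c = size p, pos c,
    (size p + ~~ pos a <= size w)%N & xw w a = xw p c].
  move: na => _; clear E lw; elim: w a sa a0 => [|i w IH] [|s a] //= => [_ _|[sa]].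
    by exists [::], [::].
  move=> /andP [s0 a0]; have [p [c [sc pc sp Ep]]] := IH a sa a0.
  case: (ltP 0 s) => s0' /=.
    exists (i :: p), (s :: c); rewrite /= sc s0' pc !xw_cons Ep; split=> //.
  exists p, c; split=> //; first by lia.
  have -> : s = 0 by apply/eqP; rewrite eq_le s0 s0'.
  rewrite xw_cons Ep xx.unlock (_ : (0 : R)%:C = 0) // upper0 (pd_ph1 D) mul1mx.
  by [].
have w0 : (0 < size w)%N.
  by case: w a sa a0 na {lw E sp Ep} => [|i w] [|s a].
have sp' : (size p < \dim np)%N by rewrite (longest_dim D lw); rewrite na in sp; lia.
have [j Hj] := short_unreachable sc pc sp'; apply: Hj; rewrite -Ep E.
by apply/(reachable_minimal j sb pb lw'.1); exact: (longest_negative D j lw').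
Qed.

End BruhatCells.

(** * The triangular factorization *)

Section CoordinateSums.
Variables (R : realType) (n : nat) (I : finType) (T : set 'M[R[i]]_n).
Local Notation C := R[i].
Variables (chi : I -> 'M[C]_n -> C) (ph : I -> 'M[C]_2 -> 'M[C]_n) (K : nat).
Variables (e f : I -> 'M[C]_n) (mu : I -> C -> 'M[C]_n) (q : nat).
Hypothesis D : pdata T chi ph K e f mu q.
Implicit Types (w u v : seq I) (a b : seq R) (t x y : 'M[C]_n).
Local Notation xw := (xw ph).
Local Notation pos := (all (fun s : R => 0 < s)).

Let D' := dual_pdata D.
Local Notation kap := (cm mu predT).
Local Notation kapV := (cm (fun j c => mu j c^-1) predT).
Local Notation nu j := (cm mu (predC1 j)).

Lemma x_inj i : injective (xx ph i).
Proof.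
move=> c d E; apply/eqP; rewrite -subr_eq0; apply/eqP; set s := c - d.
have xs : xx ph i s = 1%:M.
  by rewrite /s -(x_add D) E -(x_inv D) mulmxV // (x_unit D).
have Hs (k : nat) : xx ph i (k%:R * s) = 1%:M.
  elim: k => [|k IH]; first by rewrite mul0r xx.unlock upper0 (pd_ph1 D).
  by rewrite -addn1 natrD mulrDl mul1r -(x_add D) IH xs mulmx1.
have E0 : expq K (s *: e i) = expq K 0.
  by apply: ev_inj_nat => k; rewrite (exp_0 D) expq_scale mulrC -(xxE D) Hs.
have := congr1 (cf 1) E0; rewrite !cf1_expq ?(pd_K1 D) // => /eqP.
by rewrite scaler_eq0 (negPf (pd_e0 D i)) orbF => /eqP.
Qed.

Lemma lim_T P t : T t -> lim (cm mu P) t t.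
Proof.
move=> Tt; exists (cst t) => [c c0|]; rewrite ev_cst //.
exact: (pd_conjT D (cm_T D P c0) Tt).
Qed.

(** The i-th coordinate in the abelianization of U_+. By [xw_lim_nu] it is read off the limit along
    [nu i], which retains only the factors x_i. *)
Definition csum i w a : R := \sum_(p <- zip w a | p.1 == i) p.2.

Lemma csum_cons i j w s a : csum i (j :: w) (s :: a) = (if j == i then s else 0) + csum i w a.
Proof. by rewrite /csum /= big_cons; case: ifP => _; rewrite ?add0r. Qed.

Lemma csum_ge0 i w a : all (fun s : R => 0 <= s) a -> 0 <= csum i w a.
Proof.
elim: w a => [|j w IH] [|s a]; rewrite /csum /= ?big_nil // -/(csum _ _ _).
move=> /andP [s0 a0]; rewrite -/(zip (j :: w) (s :: a)) -/(csum _ _ _) csum_cons.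
by rewrite addr_ge0 ?IH //; case: ifP.
Qed.

Lemma csum_gt0 i w a : size a = size w -> pos a -> i \in w -> 0 < csum i w a.
Proof.
elim: w a => [|j w IH] [|s a] //= [sa] /andP [s0 pa]; rewrite csum_cons in_cons.
have a0 : all (fun s : R => 0 <= s) a by apply: sub_all pa => r; apply: ltW.
case: (altP (i =P j)) => [->|ij] /=; first by rewrite eqxx ltr_pwDl // csum_ge0.
by move=> /(IH a sa pa) H; rewrite eq_sym (negPf ij) add0r.
Qed.

Lemma csum_total w a : size a = size w -> all (fun s : R => 0 <= s) a ->
  \sum_i csum i w a = \sum_(s <- a) `|s|.
Proof.
elim: w a => [|j w IH] [|s a] //= => [_ _|[sa] /andP [s0 a0]].
  by rewrite big_nil big1 // => i _; rewrite /csum big_nil.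
under eq_bigr do rewrite csum_cons.
rewrite big_split /= IH // big_cons; congr (_ + _).
by rewrite -big_mkcond /= (eq_bigl (pred1 j)) => [|i]; rewrite ?big_pred1_eq ?ger0_norm //= eq_sym.
Qed.

Lemma xw_lim_kap w a : size a = size w -> lim kap (xw w a) 1%:M.
Proof.
have cG := cm_GL D predT.
elim: w a => [|i w IH] [|s a] //= => [_|[sa]]; first by rewrite xw_nil; exact: (lim1 cG).
rewrite xw_cons -[1%:M]mulmx1; apply: (limM cG); last exact: IH.
by rewrite (xxE D) -(exp_0 D s%:C); apply: (lim_exp K _ cG); exact: (lim_e D predT i).
Qed.

Lemma xw_lim_nu i w a : size a = size w -> lim (nu i) (xw w a) (xx ph i (csum i w a)%:C).
Proof.
have cG := cm_GL D (predC1 i).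
elim: w a => [|j w IH] [|s a] //= => [_|[sa]].
  by rewrite xw_nil /csum big_nil xx.unlock upper0 (pd_ph1 D); exact: (lim1 cG).
rewrite xw_cons csum_cons rmorphD -(x_add D); apply: (limM cG); last exact: IH.
rewrite (xxE D); have := lim_exp K s%:C cG (lim_e D (predC1 i) j); rewrite /= eq_sym.
case: (altP (i =P j)) => [<-|ij] /=; first by rewrite (xxE D).
by rewrite (exp_0 D) xx.unlock upper0 (pd_ph1 D).
Qed.

Lemma csum_eq i w u a b : size a = size w -> size b = size u -> xw w a = xw u b ->
  csum i w a = csum i u b.
Proof.
move=> sa sb E; have := xw_lim_nu i sa; rewrite E => /lim_uniq /(_ (xw_lim_nu i sb)).
by move=> /x_inj /complexI.
Qed.

(** For nonnegative parameters the norm is the sum of all abelianized coordinates, so it depends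
    only on the product. This is what bounds parameters along a path. *)
Lemma xw_sum_norm w u a b : size a = size w -> size b = size u ->
  all (fun s : R => 0 <= s) a -> all (fun s : R => 0 <= s) b -> xw w a = xw u b ->
  \sum_(s <- a) `|s| = \sum_(s <- b) `|s|.
Proof.
move=> sa sb a0 b0 E; rewrite -(csum_total sa a0) -(csum_total sb b0).
by apply: eq_bigr => i _; apply: csum_eq.
Qed.

(* The quotients of two factorizations in U_- T U_+ have limits under both kap
   and its inverse. *)
Lemma triangular_unique y t x y' t' x' : y \in unitmx -> y' \in unitmx -> x \in unitmx ->
  x' \in unitmx -> T t -> T t' -> lim kapV y 1%:M -> lim kapV y' 1%:M ->
  lim kap x 1%:M -> lim kap x' 1%:M -> y *m t *m x = y' *m t' *m x' ->
  [/\ y = y', t = t' & x = x'].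
Proof.
move=> Uy Uy' Ux Ux' Tt Tt' Ly Ly' Lx Lx' E.
have [cG cGV] := (cm_GL D predT, cm_GL D' predT).
have [Ut Ut'] := (pd_unit D Tt, pd_unit D Tt').
pose Z := invmx y' *m y *m t.
have EZ : Z = t' *m (x' *m invmx x).
  rewrite /Z !mulmxA; apply: (canRL (mulmxK Ux)); rewrite -!mulmxA.
  by apply: (canLR (mulKmx Uy')); rewrite !mulmxA.
have L1 : lim kap Z t'.
  rewrite EZ -[X in lim _ _ X]mulmx1; apply: (limM cG); first exact: lim_T.
  by have := limM cG Lx' (limV cG Lx Ux); rewrite invmx1 mulmx1.
have L2 : lim kapV Z t.
  rewrite -[X in lim _ _ X]mul1mx; apply: (limM cGV); last first.
    by exists (cst t) => [c c0|]; rewrite ev_cst //; exact: (pd_conjT D (cm_T D' predT c0) Tt).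
  by have := limM cGV (limV cGV Ly' Uy') Ly; rewrite invmx1 mulmx1.
have [Zt _] := lim_fixed cG L1 (lim_pol L2).
have tt' : t = t'.
  apply: (lim_uniq L2); rewrite Zt; exists (cst t') => [c c0|]; rewrite ev_cst //.
  by apply: (pd_conjT D _ Tt'); apply: (cm_T D' predT).
split=> //.
  have : invmx y' *m y = 1%:M by rewrite -[LHS](mulmxK Ut) -/Z Zt -tt' mulmxV.
  by move=> /(congr1 (mulmx y')); rewrite mulKVmx // mulmx1.
move: EZ; rewrite Zt -{1}[t']mulmx1 => /(congr1 (mulmx (invmx t'))); rewrite !mulKmx //.
by move=> /(congr1 (mulmx^~ x)); rewrite mul1mx mulmxKV.
Qed.

End CoordinateSums.

From mathcomp Require topology normedtype sequences derive exp.

(** * Compactness and continuity for lists of parameters *)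

Section Analysis.
Import topology normedtype sequences derive exp.
Import numFieldNormedType.Exports.

(** Compactness enters the proof in this form; the constraints g are arbitrary continuous functions,
    and equalities are given by pairs of inequalities or by a norm. *)
Lemma minimum_on_polyhedron (R : realType) m (M : R) (J : Type) (g : J -> 'rV[R]_m -> R)
    (f : 'rV[R]_m -> R) (u : 'rV[R]_m) : continuous f -> (forall j, continuous (g j)) ->
  (forall k, `|u 0 k| <= M) -> (forall j, g j u <= 0) ->
  exists v : 'rV[R]_m, [/\ forall k, `|v 0 k| <= M, forall j, g j v <= 0
    & forall v' : 'rV[R]_m, (forall k, `|v' 0 k| <= M) -> (forall j, g j v' <= 0) -> f v <= f v'].
Proof.
move=> cf cg uM gu; pose A := [set v : 'rV[R]_m | (forall k, `|v 0 k| <= M) /\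
  forall j, g j v <= 0].
have cA : compact A.
  have cB : compact [set v : 'rV[R]_m | forall k, `[- M, M]%classic (v ord0 k)].
    apply: (@rV_compact _ _ (fun=> `[- M, M]%classic)) => _.
    exact: segment_compact.
  apply: subclosed_compact cB _; last by move=> v [H _] k; rewrite /= in_itv /= -ler_norml.
  have -> : A = \bigcap_k [set v : 'rV[R]_m | `|v 0 k| <= M] `&`
      \bigcap_j [set v | g j v <= 0].
    apply/seteqP; split=> v [H1 H2]; split.
    - by move=> k _; exact: (H1 k).
    - by move=> k _; exact: (H2 k).
    - by move=> k; exact: (H1 k Logic.I).
    - by move=> k; exact: (H2 k Logic.I).
  apply: closedI; apply: closed_bigI => k _.
    have cf' : continuous (fun v : 'rV[R]_m => `|v 0 k|).
      by move=> v; apply: continuous_comp; [exact: coord_continuous|exact: norm_continuous].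
    exact: ((continuous_closedP _).1 cf' _ (@closed_le R M)).
  exact: ((continuous_closedP _).1 (cg k) _ (@closed_le R 0)).
have [v /set_mem [H1 H2] fv] : exists2 v, v \in A & forall v', v' \in A -> f v <= f v'.
  apply: EVT_min_rV => //; first by exists u.
  exact: continuous_subspaceT.
by exists v; split=> // v' H1' H2'; apply/fv/mem_set.
Qed.

(** * Paths of positive products *)

Section MatrixNorm.
Variables (R : realType) (n : nat).
Implicit Types (A B : 'M[R]_n).

Definition nrm A : R := \sum_i \sum_j `|A i j|.

Lemma nrm_ge0 A : 0 <= nrm A.
Proof. by apply: sumr_ge0 => i _; apply: sumr_ge0 => j _. Qed.

Lemma nrm_eq0 A : nrm A = 0 -> A = 0.
Proof.
move=> /eqP; rewrite psumr_eq0; last by move=> i _; apply: sumr_ge0.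
move=> /allP H; apply/matrixP => i j; have := H i (mem_index_enum i).
rewrite psumr_eq0 => [/allP /(_ j (mem_index_enum j))|//].
by rewrite normr_eq0 mxE => /eqP.
Qed.

Lemma nrm0 : nrm 0 = 0.
Proof. by apply: big1 => i _; apply: big1 => j _; rewrite mxE normr0. Qed.

Lemma nrmD A B : nrm (A + B) <= nrm A + nrm B.
Proof.
rewrite /nrm -big_split; apply: ler_sum => i _; rewrite -big_split; apply: ler_sum => j _.
by rewrite mxE; apply: ler_normD.
Qed.

Lemma nrmZ (c : R) A : nrm (c *: A) = `|c| * nrm A.
Proof.
rewrite /nrm mulr_sumr; apply: eq_bigr => i _; rewrite mulr_sumr; apply: eq_bigr => j _.
by rewrite mxE normrM.
Qed.

Lemma nrmN A : nrm (- A) = nrm A.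
Proof. by rewrite -scaleN1r nrmZ normrN1 mul1r. Qed.

Lemma nrmB A B : nrm (A - B) <= nrm A + nrm B.
Proof. by rewrite -(nrmN B); apply: nrmD. Qed.

Lemma nrmM A B : nrm (A *m B) <= nrm A * nrm B.
Proof.
have H i j : `|(A *m B) i j| <= \sum_k `|A i k| * `|B k j|.
  rewrite mulmxij; apply: le_trans (ler_norm_sum _ _ _) _.
  by apply: ler_sum => k _; rewrite normrM.
apply: (@le_trans _ _ (\sum_i \sum_j \sum_k `|A i k| * `|B k j|)).
  by apply: ler_sum => i _; apply: ler_sum => j _; apply: H.
rewrite /nrm mulr_suml; apply: ler_sum => i _; rewrite exchange_big mulr_suml /=.
apply: ler_sum => k _; rewrite -mulr_sumr; apply: ler_wpM2l => //.
rewrite [leRHS](bigD1 k) //= lerDl.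
by apply: sumr_ge0 => k' _; apply: sumr_ge0 => j _.
Qed.

Lemma nrm_sum J (r : seq J) (F : J -> 'M[R]_n) :
  nrm (\sum_(j <- r) F j) <= \sum_(j <- r) nrm (F j).
Proof.
elim: r => [|j r IH]; first by rewrite !big_nil nrm0.
by rewrite !big_cons; apply: le_trans (nrmD _ _) _; rewrite lerD2l.
Qed.

Lemma nrmMbound A B (a b : R) : nrm A <= a -> nrm B <= b -> nrm (A *m B) <= a * b.
Proof.
by move=> Aa Bb; apply: le_trans (nrmM _ _) _; apply: ler_pM => //; apply: nrm_ge0.
Qed.

Lemma nrmDbound A B (a b : R) : nrm A <= a -> nrm B <= b -> nrm (A + B) <= a + b.
Proof. by move=> Aa Bb; apply: le_trans (nrmD _ _) _; apply: lerD. Qed.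

End MatrixNorm.

Section RealWords.
Variables (R : realType) (n : nat) (I : Type) (K : nat) (er : I -> 'M[R]_n).
Implicit Types (A B Z : 'M[R]_n) (w : seq I) (a z : seq R) (s h M C : R).

Definition rx i s : 'M[R]_n := \sum_(k < K) s ^+ k *: ((k`!%:R)^-1 *: er i ^+ k).

Fixpoint rw w a : 'M[R]_n :=
  match w, a with i :: w', s :: a' => rx i s *m rw w' a' | _, _ => 1%:M end.

Fixpoint rxi w a z : 'M[R]_n :=
  match w, a, z with
  | i :: w', s :: a', r :: z' => r *: er i + rx i s *m rxi w' a' z' *m rx i (- s)
  | _, _, _ => 0
  end.

Definition shift_params a h z : seq R := [seq p.1 + h * p.2 | p <- zip a z].
Definition bnd M a := all (fun s => `|s| <= M) a.
Definition sum_norm z : R := \sum_(s <- z) `|s|.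

Hypotheses (K1 : (1 < K)%N) (rxD : forall i s s', rx i (s + s') = rx i s *m rx i s').
Hypothesis rx0 : forall i, rx i 0 = 1%:M.

Lemma rx_bound i M : exists C, 0 <= C /\ forall s, `|s| <= M -> nrm (rx i s) <= C.
Proof.
exists (\sum_(k < K) `|M| ^+ k * nrm ((k`!%:R)^-1 *: er i ^+ k)); split.
  by apply: sumr_ge0 => k _; rewrite mulr_ge0 ?exprn_ge0 ?nrm_ge0.
move=> s sM; apply: le_trans (nrm_sum _ _) _; apply: ler_sum => k _.
rewrite nrmZ normrX; apply: ler_wpM2r; first exact: nrm_ge0.
by apply: lerXn2r; rewrite ?nnegrE //; apply: le_trans sM (ler_norm _).
Qed.

Lemma rx_taylor i M : exists C, 0 <= C /\ forall s h r, `|s| <= M -> `|r| <= M -> `|h| <= 1 ->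
  nrm (rx i (s + h * r) - (1%:M + (h * r) *: er i) *m rx i s) <= C * h ^+ 2.
Proof.
have [C [C0 HC]] := rx_bound i M.
have [C1 [C10 HC1]] : exists C1, 0 <= C1 /\ forall h r, `|r| <= M -> `|h| <= 1 ->
    nrm (rx i (h * r) - (1%:M + (h * r) *: er i)) <= C1 * h ^+ 2.
  exists (\sum_(k < K.-2) `|M| ^+ k.+2 * nrm ((k.+2`!%:R)^-1 *: er i ^+ k.+2)); split.
    by apply: sumr_ge0 => k _; rewrite mulr_ge0 ?exprn_ge0 ?nrm_ge0.
  move=> h r rM h1; rewrite /rx; case: K K1 => [|[|k']] // _.
  rewrite big_ord_recl big_ord_recl /= expr0 scale1r fact0 invr1 scale1r expr0.
  rewrite (_ : bump 0 0 = 1%N) // scale1r !expr1 addrA.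
  rewrite [X in nrm X](_ : _ = \sum_(k < k') (h * r) ^+ bump 0 (bump 0 k) *:
     ((bump 0 (bump 0 k))`!%:R^-1 *: er i ^+ bump 0 (bump 0 k))); last first.
    move: (\sum_(_ < _) _) => S; rewrite (_ : (1%:M : 'M[R]_n) = 1) //.
    apply/matrixP => i' j'; rewrite !mxE; ring.
  apply: le_trans (nrm_sum _ _) _.
  rewrite mulr_suml; apply: ler_sum => k _; rewrite /bump /= !add1n nrmZ.
  rewrite mulrAC; apply: ler_wpM2r; first exact: nrm_ge0.
  rewrite normrX normrM exprMn mulrC; apply: ler_pM.
  - by rewrite exprn_ge0.
  - by rewrite exprn_ge0.
  - by apply: lerXn2r; rewrite ?nnegrE //; apply: le_trans rM (ler_norm _).
  rewrite -[h ^+ 2]ger0_norm ?sqr_ge0 // normrX -[k.+2]addn2 exprD.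
  by apply: ler_piMl; [rewrite sqr_ge0|apply: exprn_ile1].
exists (C1 * C); split=> [|s h r sM rM h1]; first exact: mulr_ge0.
rewrite [s + _]addrC rxD -mulmxBl mulrAC.
by apply: nrmMbound; [apply: HC1|apply: HC].
Qed.

Lemma rxi_bound w M : exists C, 0 <= C /\ forall a z, size a = size w -> size z = size w ->
  bnd M a -> nrm (rxi w a z) <= C * sum_norm z.
Proof.
elim: w => [|i w [C [C0 IH]]].
  by exists 0; split=> // -[|? ?] [|? ?] //= _ _ _; rewrite nrm0 mul0r.
have [C1 [C10 H1]] := rx_bound i M.
exists (nrm (er i) + C1 * C * C1); split.
  by rewrite addr_ge0 ?nrm_ge0 // !mulr_ge0.
move=> [|s a] [|r z] //= [sa] [sz] /andP [sM aM]; rewrite /sum_norm big_cons.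
rewrite mulrDr; apply: le_trans (nrmD _ _) _.
have z0 : 0 <= \sum_(j <- z) `|j| by apply: sumr_ge0.
apply: lerD.
  rewrite nrmZ mulrC; apply: ler_wpM2r => //.
  by rewrite lerDl !mulr_ge0.
apply: (@le_trans _ _ (C1 * (C * \sum_(j <- z) `|j|) * C1)).
  apply: nrmMbound; last by apply: H1; rewrite normrN.
  by apply: nrmMbound; [apply: H1|apply: IH].
rewrite mulrA mulrAC; apply: ler_wpM2r => //.
by rewrite lerDr nrm_ge0.
Qed.

Lemma rw_bound w M : exists C, 0 <= C /\ forall a, size a = size w -> bnd M a ->
  nrm (rw w a) <= C.
Proof.
elim: w => [|i w [C [C0 IH]]].
  by exists (nrm (1%:M : 'M[R]_n)); split=> [|[]//]; apply: nrm_ge0.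
have [C1 [C10 H1]] := rx_bound i M; exists (C1 * C); split; first exact: mulr_ge0.
by move=> [|s a] //= [sa] /andP [sM aM]; apply: nrmMbound; [apply: H1|apply: IH].
Qed.

Lemma sum_norm_bnd M z : bnd M z -> sum_norm z <= (size z)%:R * M.
Proof.
rewrite /sum_norm; elim: z => [|s z IH] /=; first by rewrite big_nil mul0r.
move=> /andP [sM /IH H]; rewrite big_cons -addn1 natrD mulrDl mul1r addrC.
exact: lerD.
Qed.

Lemma taylor_product X X' W W' e Xi h (r : R) (Xn : 'M[R]_n) : Xn *m X = 1%:M ->
  X' *m W' - (1%:M + h *: (r *: e + X *m Xi *m Xn)) *m (X *m W) =
  X' *m (W' - (1%:M + h *: Xi) *m W) + (X' - (1%:M + (h * r) *: e) *m X) *m W +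
  (h *: ((X' - (1%:M + (h * r) *: e) *m X) *m Xi *m W) +
   (h ^+ 2 * r) *: (e *m X *m Xi *m W)) :> 'M[R]_n.
Proof.
move=> E; have E' : X *m Xi *m Xn *m X = X *m Xi by rewrite -mulmxA E mulmx1.
rewrite !(mulmxDl, mulmxDr, mulmxN, mulNmx, mul1mx, =^~ scalemxAl, =^~ scalemxAr, mulmxA).
rewrite E'; move: (X' *m W') (X *m W) (e *m X *m W) (X *m Xi *m W) (X' *m W) (X' *m Xi *m W).
move: (e *m X *m Xi *m W) => A1 A2 A3 A4 A5 A6 A7.
apply/matrixP => i j; rewrite !mxE; ring.
Qed.

Lemma rw_taylor w M : exists C, 0 <= C /\ forall a z h, size a = size w -> size z = size w ->
  bnd M a -> bnd M z -> `|h| <= 1 ->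
  nrm (rw w (shift_params a h z) - (1%:M + h *: rxi w a z) *m rw w a) <= C * h ^+ 2.
Proof.
elim: w => [|i w [C [C0 IH]]].
  exists 0; split=> // -[|? ?] [|? ?] // h _ _ _ _ _ /=.
  by rewrite scaler0 addr0 mul1mx subrr nrm0 mul0r.
have [C1 [C10 H1]] := rx_taylor i M; have [C2 [C20 H2]] := rw_bound w M.
have [C3 [C30 H3]] := rx_bound i (M + M); have [C4 [C40 H4]] := rxi_bound w M.
pose C5 := C4 * ((size w)%:R * `|M|).
have C50 : 0 <= C5 by rewrite !mulr_ge0.
exists (C3 * C + C1 * C2 + (C1 * C5 * C2 + `|M| * (nrm (er i) * C3 * C5 * C2))); split.
  by rewrite !(addr_ge0, mulr_ge0) ?nrm_ge0.
move=> [|s a] [|r z] h //= [sa] [sz] /andP [sM aM] /andP [rM zM] h1.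
have M0 : 0 <= M by apply: le_trans rM.
have hh : h ^+ 2 <= 1 by rewrite -[h ^+ 2]ger0_norm ?sqr_ge0 // normrX exprn_ile1.
have h0 : 0 <= h ^+ 2 by apply: sqr_ge0.
rewrite (@taylor_product (rx i s) (rx i (s + h * r)) _ _ (er i) (rxi w a z) h r); last first.
  by rewrite -rxD addNr rx0.
have B5 : nrm (rxi w a z) <= C5.
  apply: le_trans (H4 a z sa sz aM) _; apply: ler_wpM2l => //.
  by apply: le_trans (sum_norm_bnd zM) _; rewrite sz ler_wpM2l // ler_norm.
have B1 := H1 s h r sM rM h1; have B2 := H2 a sa aM.
have B3 : nrm (rx i (s + h * r)) <= C3.
  apply: H3; apply: le_trans (ler_normD _ _) _; apply: lerD => //.
  by rewrite normrM -[M]mul1r; apply: ler_pM.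
have B3' : nrm (rx i s) <= C3 by apply: H3; apply: le_trans sM _; rewrite lerDl.
rewrite 2!mulrDl [X in _ <= _ + X]mulrDl; apply: nrmDbound.
  apply: nrmDbound.
    by rewrite -mulrA; apply: nrmMbound => //; apply: IH.
  by rewrite mulrAC; apply: nrmMbound.
apply: nrmDbound.
  rewrite nrmZ; apply: (@le_trans _ _ (1 * (C1 * h ^+ 2 * C5 * C2))).
    apply: ler_pM => //; first exact: nrm_ge0.
    by do 2 apply: nrmMbound => //.
  by rewrite mul1r ![_ * h ^+ 2 * _]mulrAC.
rewrite nrmZ normrM [`|h ^+ 2|]ger0_norm // [X in _ <= X]mulrC -[_ * `|r| * _]mulrA.
apply: ler_wpM2l; first exact: h0.
apply: ler_pM => //; first exact: nrm_ge0.
  by apply: le_trans rM (ler_norm _).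
by do 2 apply: nrmMbound => //; apply: nrmMbound.
Qed.

End RealWords.

Section SeqContinuity.
Variables (R : realType) (l : nat).
Implicit Types (F G : seq R -> R) (s : seq R).

Definition seq_of_row (v : 'rV[R]_l) : seq R := [seq v 0 k | k <- enum 'I_l].

(** Parameters of words are lists, while the topology is that of row vectors; only lists of length l
    are concerned. *)
Definition contf F := continuous (fun v : 'rV[R]_l => F (seq_of_row v)).

Lemma size_seq_of_row v : size (seq_of_row v) = l.
Proof. by rewrite size_map size_enum_ord. Qed.

Lemma row_of_seqK s : size s = l -> seq_of_row (\row_k s`_k) = s.
Proof.
move=> sl; apply: (@eq_from_nth _ 0); rewrite size_seq_of_row // => k kl.
by rewrite (nth_map (Ordinal kl)) ?size_enum_ord // mxE nth_enum_ord.
Qed.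

Lemma contf_ext F G : (forall s, size s = l -> F s = G s) -> contf F -> contf G.
Proof.
move=> FG; rewrite /contf (_ : (fun v => F (seq_of_row v)) = (fun v => G (seq_of_row v))) //.
by apply/funext => v; apply/FG/size_seq_of_row.
Qed.

Lemma contf_cst c : contf (fun=> c).
Proof. exact: cst_continuous. Qed.

Lemma contfD F G : contf F -> contf G -> contf (fun s => F s + G s).
Proof. by move=> cF cG v; exact: (cvgD (cF v) (cG v)). Qed.

Lemma contfM F G : contf F -> contf G -> contf (fun s => F s * G s).
Proof. by move=> cF cG v; exact: (cvgM (cF v) (cG v)). Qed.

Lemma contfN F : contf F -> contf (fun s => - F s).
Proof. by move=> cF v; exact: (cvgN (cF v)). Qed.

Lemma contf_norm F : contf F -> contf (fun s => `|F s|).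
Proof. by move=> cF v; exact: (cvg_norm (cF v)). Qed.

Lemma contf_nth k : contf (fun s => s`_k).
Proof.
case: (ltnP k l) => kl.
  move=> v; rewrite (_ : (fun v => _) = (fun v : 'rV[R]_l => v 0 (Ordinal kl))).
    exact: coord_continuous.
  by apply/funext => u; rewrite (nth_map (Ordinal kl)) ?size_enum_ord // (nth_ord_enum _ (Ordinal kl)).
apply: (@contf_ext (fun=> 0)); last exact: contf_cst.
by move=> s sl; rewrite nth_default ?sl.
Qed.

Lemma contf_sum J (r : seq J) (F : J -> seq R -> R) : (forall j, contf (F j)) ->
  contf (fun s => \sum_(j <- r) F j s).
Proof.
move=> cF; elim: r => [|j r IH].
  refine (contf_ext _ (@contf_cst 0)); move=> s _; by rewrite big_nil.
by apply: contf_ext (contfD (cF j) IH) => s _; rewrite big_cons.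
Qed.

Lemma contfX F k : contf F -> contf (fun s => F s ^+ k).
Proof.
move=> cF; elim: k => [|k IH].
  refine (contf_ext _ (@contf_cst 1)); move=> s _; by rewrite expr0.
by apply: contf_ext (contfM cF IH) => s _; rewrite exprS.
Qed.

Lemma minimum_on_seqs (M : R) J (g : J -> seq R -> R) F u : size u = l ->
  contf F -> (forall j, contf (g j)) -> bnd M u -> (forall j, g j u <= 0) ->
  exists v, [/\ size v = l, bnd M v, forall j, g j v <= 0 &
    forall v', size v' = l -> bnd M v' -> (forall j, g j v' <= 0) -> F v <= F v'].
Proof.
move=> ul cF cg uM gu.
have bndP v : bnd M (seq_of_row v) <-> forall k, `|v 0 k| <= M.
  rewrite /bnd /seq_of_row all_map; split=> [/allP H k|H].
    exact: (H k (mem_enum _ k)).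
  by apply/allP => k _; apply: H.
have := @minimum_on_polyhedron R l M J (fun j v => g j (seq_of_row v))
  (fun v => F (seq_of_row v)) (\row_k u`_k) cF cg.
rewrite row_of_seqK // => -[||v [H1 H2 H3]] //.
  by apply/bndP; rewrite row_of_seqK.
exists (seq_of_row v); split=> //; first exact: size_seq_of_row.
  exact/bndP.
move=> v' v'l v'M gv'; have := H3 (\row_k v'`_k); rewrite row_of_seqK //; apply=> //.
by apply/bndP; rewrite row_of_seqK.
Qed.

Section MatrixValued.
Variables (n : nat).
Implicit Types (A B : seq R -> 'M[R]_n).

Definition contm A := forall i j, contf (fun s => A s i j).

Lemma contm_cst (X : 'M[R]_n) : contm (fun=> X).
Proof. by move=> i j; apply: contf_cst. Qed.

Lemma contm_ext A B : (forall s, size s = l -> A s = B s) -> contm A -> contm B.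
Proof. by move=> AB cA i j; apply: contf_ext (cA i j) => s /AB ->. Qed.

Lemma contmD A B : contm A -> contm B -> contm (fun s => A s + B s).
Proof. by move=> cA cB i j; apply: contf_ext (contfD (cA i j) (cB i j)) => s _; rewrite mxE. Qed.

Lemma contmZ F A : contf F -> contm A -> contm (fun s => F s *: A s).
Proof. by move=> cF cA i j; apply: contf_ext (contfM cF (cA i j)) => s _; rewrite mxE. Qed.

Lemma contmM A B : contm A -> contm B -> contm (fun s => A s *m B s).
Proof.
move=> cA cB i j; apply: (@contf_ext (fun s => \sum_k A s i k * B s k j)).
  by move=> s _; rewrite mulmxij.
by apply: contf_sum => k; apply: contfM.
Qed.

Lemma contm_sum J (r : seq J) (A : J -> seq R -> 'M[R]_n) : (forall j, contm (A j)) ->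
  contm (fun s => \sum_(j <- r) A j s).
Proof.
move=> cA; elim: r => [|j r IH].
  refine (contm_ext _ (@contm_cst 0)); move=> s _; by rewrite big_nil.
by apply: contm_ext (contmD (cA j) IH) => s _; rewrite big_cons.
Qed.

Lemma contf_nrm A : contm A -> contf (fun s => nrm (A s)).
Proof. by move=> cA; apply: contf_sum => i; apply: contf_sum => j; apply/contf_norm/cA. Qed.

Variables (I : Type) (K : nat) (er : I -> 'M[R]_n).

Lemma contm_rx i F : contf F -> contm (fun s => rx K er i (F s)).
Proof.
move=> cF; apply: contm_sum => k; apply: contmZ; first exact: contfX.
exact: contm_cst.
Qed.

Lemma contm_rw (w : seq I) (a : seq R -> seq R) :
  (forall s, size s = l -> size (a s) = size w) -> (forall k, contf (fun s => (a s)`_k)) ->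
  contm (fun s => rw K er w (a s)).
Proof.
elim: w a => [|i w IH] a sa ca; first exact: contm_cst.
have cb : contm (fun s => rw K er w (behead (a s))).
  apply: IH => [s /sa|k]; first by case: (a s) => [|? ?] //= [].
  by apply: contf_ext (ca k.+1) => s /sa; case: (a s).
refine (contm_ext _ (contmM (@contm_rx i _ (ca 0%N)) cb)); move=> s /sa.
by case: (a s).
Qed.

Lemma contm_rxi (w : seq I) (a z : seq R -> seq R) :
  (forall s, size s = l -> size (a s) = size w) -> (forall k, contf (fun s => (a s)`_k)) ->
  (forall s, size s = l -> size (z s) = size w) -> (forall k, contf (fun s => (z s)`_k)) ->
  contm (fun s => rxi K er w (a s) (z s)).
Proof.
elim: w a z => [|i w IH] a z sa ca sz cz.
  exact: contm_cst.
have cb : contm (fun s => rxi K er w (behead (a s)) (behead (z s))).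
  apply: IH => [s /sa|k|s /sz|k].
  - by case: (a s) => [|? ?] //= [].
  - by apply: contf_ext (ca k.+1) => s /sa; case: (a s).
  - by case: (z s) => [|? ?] //= [].
  by apply: contf_ext (cz k.+1) => s /sz; case: (z s).
have c0 := @contm_rx i _ (ca 0%N); have c0N := @contm_rx i _ (contfN (ca 0%N)).
refine (contm_ext _ (contmD (contmZ (cz 0%N) (@contm_cst (er i))) (contmM (contmM c0 cb) c0N))); move=> s sl.
by move: (sa s sl) (sz s sl); case: (a s) => [|? ?] //; case: (z s).
Qed.

End MatrixValued.
End SeqContinuity.

Section SequenceDistance.
Variable R : realType.
Implicit Types (a b z : seq R) (h r M : R).

Lemma size_shift a h z : size a = size z -> size (shift_params a h z) = size a.
Proof. by move=> E; rewrite size_map size_zip E minnn. Qed.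

Lemma nth_shift a h z k : size a = size z -> (shift_params a h z)`_k = a`_k + h * z`_k.
Proof.
move=> E; case: (ltnP k (size a)) => ka.
  by rewrite (nth_map (0, 0)) ?size_zip ?E ?minnn -?E // nth_zip.
by rewrite !nth_default ?size_shift -?E // mulr0 addr0.
Qed.

Lemma shift0 a z : size a = size z -> shift_params a 0 z = a.
Proof.
move=> E; apply: (@eq_from_nth _ 0) => [|k _]; first exact: size_shift.
by rewrite nth_shift // mul0r addr0.
Qed.

Lemma shiftD a h h' z : size a = size z ->
  shift_params (shift_params a h z) h' z = shift_params a (h + h') z.
Proof.
move=> E; have E' : size (shift_params a h z) = size z by rewrite size_shift.
apply: (@eq_from_nth _ 0) => [|k _]; first by rewrite !size_shift.
by rewrite !nth_shift // mulrDl addrA.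
Qed.

Definition dist a b : R := sum_norm (shift_params a (- 1) b).

Lemma sum_norm_ge0 z : 0 <= sum_norm z.
Proof. exact: sumr_ge0. Qed.

Lemma sum_norm_bndl z M : sum_norm z <= M -> bnd M z.
Proof.
rewrite /sum_norm; elim: z => [|s z IH] //=; rewrite big_cons => H; apply/andP; split.
  by apply: le_trans H; rewrite lerDl; apply: sum_norm_ge0.
by apply: IH; apply: le_trans H; rewrite lerDr.
Qed.

Lemma dist_refl a : dist a a = 0.
Proof.
rewrite /dist /sum_norm; elim: a => [|s a IH]; first by rewrite big_nil.
by rewrite /shift_params /= big_cons IH mulN1r subrr normr0 addr0.
Qed.

Lemma dist_shift a h z b : size a = size z -> size a = size b ->
  dist (shift_params a h z) b <= dist a b + `|h| * sum_norm z.
Proof.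
rewrite /dist /sum_norm; elim: a z b => [|s a IH] [|t z] [|u b] //=.
  by rewrite !big_nil mulr0 addr0.
move=> [E] [E']; have := IH z b E E'; rewrite /shift_params /= !big_cons => H.
rewrite mulrDr addrACA; apply: lerD => //.
by rewrite addrAC -normrM; apply: ler_normD.
Qed.

Lemma dist_pos a b r : size a = size b -> dist a b <= r -> all (fun s => r < s) b ->
  all (fun s => 0 < s) a.
Proof.
rewrite /dist /sum_norm; elim: a b => [|s a IH] [|t b] //= [E].
rewrite /shift_params /= big_cons => H /andP [rt rb].
have H0 := sum_norm_ge0 (shift_params a (-1) b).
have H1 := normr_ge0 (s + -1 * t).
rewrite (IH b) // ?andbT; last by apply: le_trans H; rewrite lerDr.
have : `|s + -1 * t| <= r by apply: le_trans H; rewrite lerDl.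
by rewrite ler_norml => /andP [H2 _]; lra.
Qed.

Lemma dist_bnd a b r M : size a = size b -> dist a b <= r -> bnd M b -> bnd (M + r) a.
Proof.
rewrite /dist /sum_norm; elim: a b => [|s a IH] [|t b] //= [E].
rewrite /shift_params /= big_cons => H /andP [tM bM].
have H0 := sum_norm_ge0 (shift_params a (-1) b).
rewrite (IH b) // ?andbT; last by apply: le_trans H; rewrite lerDr.
have H1 : `|s + -1 * t| <= r by apply: le_trans H; rewrite lerDl.
rewrite (_ : s = t + (s + -1 * t)); last by ring.
by apply: le_trans (ler_normD _ _) _; apply: lerD.
Qed.

Lemma bnd_ex a : exists2 M, 0 <= M & bnd M a.
Proof. by exists (sum_norm a); [exact: sum_norm_ge0|exact: sum_norm_bndl]. Qed.

Lemma bnd_le M M' a : M <= M' -> bnd M a -> bnd M' a.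
Proof. by move=> MM'; apply: sub_all => s /le_trans; apply. Qed.

Lemma pos_margin a : all (fun s => 0 < s) a -> exists2 r, 0 < r & all (fun s => r < s) a.
Proof.
elim: a => [|s a IH] /=; first by exists 1.
move=> /andP [s0 /IH [r r0 H]]; exists (Num.min (s / 2) r).
  by rewrite lt_min r0 andbT; lra.
rewrite gt_min; apply/andP; split; first by apply/orP; left; lra.
by apply: sub_all H => t rt; rewrite gt_min rt orbT.
Qed.

Lemma contf_sum_norm l m (b : seq R -> seq R) : (forall s, size s = l -> size (b s) = m) ->
  (forall k, contf l (fun s => (b s)`_k)) -> contf l (fun s => sum_norm (b s)).
Proof.
move=> sb cb.
have H : contf l (fun s => \sum_(k <- iota 0 m) `|(b s)`_k|).
  by apply: contf_sum => k; apply/contf_norm/cb.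
refine (contf_ext _ H); move=> s /sb sm.
by rewrite /sum_norm [RHS](big_nth 0) sm /index_iota subn0.
Qed.

Lemma contf_dist l m (b : seq R -> seq R) c : size c = m ->
  (forall s, size s = l -> size (b s) = m) ->
  (forall k, contf l (fun s => (b s)`_k)) -> contf l (fun s => dist (b s) c).
Proof.
move=> cm sb cb; apply: (@contf_sum_norm l m) => [s sl|k].
  by rewrite size_shift sb.
have H := contfD (cb k) (@contf_cst _ l (- 1 * c`_k)).
by refine (contf_ext _ H); move=> s sl; rewrite nth_shift // sb.
Qed.

End SequenceDistance.

(** * Real logarithmic derivatives and Euler polygons *)

Section RealStructure.
Variables (R : realType) (n : nat) (I : finType) (T : set 'M[R[i]]_n).
Local Notation C := R[i].
Variables (chi : I -> 'M[C]_n -> C) (ph : I -> 'M[C]_2 -> 'M[C]_n) (K : nat).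
Variables (e f : I -> 'M[C]_n) (mu : I -> C -> 'M[C]_n) (q : nat).
Hypothesis D : pdata T chi ph K e f mu q.
Variable er : I -> 'M[R]_n.
Local Notation rc := (map_mx (real_complex R)).
Hypothesis he : forall i, e i = rc (er i).
Implicit Types (w u v : seq I) (a b p z : seq R).
Local Notation xw := (xw ph).
Local Notation rx := (rx K er).
Local Notation rw := (rw K er).
Local Notation rxi := (rxi K er).
Local Notation pos := (all (fun s : R => 0 < s)).
Local Notation xi := (xi ph e).

Lemma rc_inj : injective (rc : 'M[R]_n -> 'M[C]_n).
Proof.
by move=> A B /matrixP E; apply/matrixP => i j; have := E i j; rewrite !mxE => /complexI.
Qed.

Lemma rcX (A : 'M[R]_n) k : rc (A ^+ k) = rc A ^+ k.
Proof.
by elim: k => [|k IH]; rewrite ?expr0 ?exprS ?map_mx1 // -!mulmxE map_mxM IH.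
Qed.

Lemma xx_real i s : xx ph i s%:C = rc (rx i s).
Proof.
rewrite (xxE D) ev_expq /rx raddf_sum; apply: eq_bigr => k _.
by rewrite /= !map_mxZ rcX he rmorphXn fmorphV rmorph_nat.
Qed.

Lemma rxD i s s' : rx i (s + s') = rx i s *m rx i s'.
Proof. by apply: rc_inj; rewrite map_mxM -!xx_real rmorphD (x_add D). Qed.

Lemma rx0 i : rx i 0 = 1%:M.
Proof.
by apply: rc_inj; rewrite map_mx1 -xx_real (_ : (0 : R)%:C = 0) // xx.unlock upper0 (pd_ph1 D).
Qed.

Lemma rw_real w a : size a = size w -> xw w a = rc (rw w a).
Proof.
elim: w a => [|i w IH] [|s a] //= => [_|[sa]]; first by rewrite xw_nil map_mx1.
by rewrite xw_cons xx_real IH // map_mxM.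
Qed.

Lemma rxi_real w a z : size a = size w -> size z = size w ->
  rc (rxi w a z) = \sum_(k < size w) (z`_k)%:C *: (xi w a)`_k.
Proof.
elim: w a z => [|i w IH] [|s a] [|r z] //= => [_ _|[sa] [sz]].
  by rewrite big_ord0 raddf0.
rewrite big_ord_recl /= map_mxD map_mxZ -he; congr (_ + _).
rewrite !map_mxM IH // -!xx_real rmorphN -(x_inv D) -/(conjby _ _).
rewrite linear_sum /=; apply: eq_bigr => k _; rewrite conjbyZ.
by rewrite !add0n (nth_map 0) // (size_xi ph e sa).
Qed.

Lemma xi_real w a k : size a = size w -> exists Y, (xi w a)`_k = rc Y.
Proof.
elim: w a k => [|i w IH] [|s a] k //= => [_|[sa]].
  by exists 0; rewrite nth_nil raddf0.
case: k => [|k] /=; first by exists (er i); rewrite he.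
case: (ltnP k (size w)) => kw; last first.
  by exists 0; rewrite nth_default ?raddf0 // size_map size_xi.
have [Y HY] := IH a k sa; exists (rx i s *m Y *m rx i (- s)).
rewrite (nth_map 0) ?size_xi // HY /conjby (x_inv D) -rmorphN !xx_real.
by rewrite !map_mxM.
Qed.

Lemma rxi_np w a z : size a = size w -> size z = size w -> rc (rxi w a z) \in nsp e.
Proof.
move=> sa sz; rewrite rxi_real //; apply: memv_suml => k _; apply: memvZ.
by apply: (allP (xi_np D w a)); rewrite mem_nth // size_xi.
Qed.

Lemma rxiZ w a z c : size a = size w -> size z = size w ->
  rxi w a [seq c * s | s <- z] = c *: rxi w a z.
Proof.
elim: w a z => [|i w IH] [|s a] [|r z] //= => [_ _|[sa] [sz]]; first by rewrite scaler0.
by rewrite IH // scalerDr scalerA -scalemxAr -scalemxAl.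
Qed.

Lemma Re_sum m (F : 'I_m -> C) : complex.Re (\sum_k F k) = \sum_k complex.Re (F k).
Proof. by apply: (big_morph (@complex.Re R)) => // -[x y] [x' y']. Qed.

(** The complex coefficients given by [xi_span] may be replaced by their real parts, because Z and
    the logarithmic derivatives are real. *)
Lemma rxi_surj w a Z : longest_word T ph w -> size a = size w -> pos a ->
  rc Z \in nsp e -> exists2 z, size z = size w & rxi w a z = Z.
Proof.
move=> lw sa pa HZ; rewrite -(xi_span D sa pa lw) in HZ.
have sx := size_xi ph e sa; pose X := in_tuple (xi w a).
have EZ : rc Z = \sum_(k < size (xi w a)) coord X k (rc Z) *: (xi w a)`_k by apply: (@coord_span _ _ _ X).
pose c k := if insub k is Some k' then coord X k' (rc Z) else 0.
have {}EZ : rc Z = \sum_(k < size w) c k *: (xi w a)`_k.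
  rewrite -sx [LHS]EZ; apply: eq_bigr => k _; congr (_ *: _).
  by rewrite /c valK.
exists (mkseq (fun k => complex.Re (c k)) (size w)); first by rewrite size_mkseq.
apply: rc_inj; rewrite rxi_real ?size_mkseq //; apply/matrixP => i j.
have Er (k : 'I_(size w)) : (xi w a)`_k i j = (complex.Re ((xi w a)`_k i j))%:C.
  by have [Y ->] := xi_real k sa; rewrite mxE.
have := congr1 (fun A : 'M[C]_n => complex.Re (A i j)) EZ.
rewrite !summxE /= Re_sum => H.
have -> : rc Z i j = (complex.Re (rc Z i j))%:C by rewrite mxE.
rewrite H rmorph_sum; apply: eq_bigr => k _.
rewrite nth_mkseq // [LHS]mxE [in RHS]mxE Er.
move: (c k) (complex.Re ((xi w a)`_k i j)) => [x y] t /=.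
by rewrite mulr0 subr0 rmorphM.
Qed.

Lemma rxi_eq0 w a z : longest_word T ph w -> size a = size w -> pos a -> size z = size w ->
  rxi w a z = 0 -> sum_norm z = 0.
Proof.
move=> lw sa pa sz E; have := xi_free D sa pa lw.1 => fx.
have sx := size_xi ph e sa.
have := congr1 rc E; rewrite rxi_real // raddf0 => E'.
have /freeP H : free (in_tuple (xi w a)) by [].
have z0 (k : 'I_(size (xi w a))) : (z`_k)%:C = 0.
  by apply: (H (fun k : 'I_(size (xi w a)) => (z`_k)%:C)); move: E'; rewrite -sx.
rewrite /sum_norm (big_nth 0) big_nat big1 // => k /andP [_ kz].
have kx : (k < size (xi w a))%N by rewrite sx -sz.
by have /eqP := z0 (Ordinal kx); rewrite fmorph_eq0 => /eqP /= ->; rewrite normr0.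
Qed.

(** The inverse of the logarithmic derivative is bounded uniformly near a0: on the compact set of
    pairs (a, z) with a near a0 and z of norm 1, the norm of [rxi w a z] has a positive minimum m by
    freeness, and c = 1/m. *)
Lemma rxi_solve w a0 : longest_word T ph w -> size a0 = size w -> pos a0 ->
  exists r c, [/\ 0 < r, 0 <= c, all (fun s => r < s) a0 &
    forall a Z, size a = size w -> dist a a0 <= r -> rc Z \in nsp e ->
    exists z, [/\ size z = size w, rxi w a z = Z & sum_norm z <= c * nrm Z]].
Proof.
move=> lw sa0 pa0; have [r r0 ra0] := pos_margin pa0; exists r.
have [M M0 bM] := bnd_ex a0; set l := size w.
(* For the empty word there is no vector of norm 1 to start the minimization. *)
case: (posnP l) => [l0|l0].
  exists 0; split=> // a Z sa da /(rxi_surj lw sa (dist_pos (etrans sa (esym sa0)) da ra0)).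
  move=> [z sz <-]; exists z; split=> //; rewrite mul0r.
  by move: sz; rewrite -/l l0 => /size0nil ->; rewrite /sum_norm big_nil.
pose z0 : seq R := 1 :: nseq l.-1 0.
have sz0 : size z0 = l by rewrite /= size_nseq prednK.
have nz0 : sum_norm z0 = 1.
  rewrite /sum_norm /= big_cons normr1 big1_seq ?addr0 // => s.
  by rewrite mem_nseq andTb => /andP [_ /eqP ->]; rewrite normr0.
(* A list of length 2l encodes the pair (a, z); the two boolean constraints together say that z has
   norm 1. *)
pose g (j : option bool) s := match j with
  | None => dist (take l s) a0 - r
  | Some true => sum_norm (drop l s) - 1
  | Some false => 1 - sum_norm (drop l s) end.
have st (s : seq R) : size s = (l + l)%N -> size (take l s) = l /\ size (drop l s) = l.
  by move=> E; rewrite size_takel ?size_drop E ?addnK ?leq_addr.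
have ct k : contf (l + l) (fun s : seq R => (take l s)`_k).
  case: (ltnP k l) => kl.
    have H := @contf_nth R (l + l) k.
    by refine (contf_ext _ H); move=> s _; rewrite nth_take.
  have H := @contf_cst R (l + l) 0.
  by refine (contf_ext _ H); move=> s /st [E _]; rewrite nth_default ?E.
have cd k : contf (l + l) (fun s : seq R => (drop l s)`_k).
  have H := @contf_nth R (l + l) (l + k).
  by refine (contf_ext _ H); move=> s _; rewrite nth_drop.
have cn : contf (l + l) (fun s : seq R => sum_norm (drop l s)).
  by apply: (@contf_sum_norm _ _ l) => // s /st [].
have cg j : contf (l + l) (g j).
  case: j => [[]|] /=.
  - exact: contfD cn (@contf_cst _ _ _).
  - exact: contfD (@contf_cst _ _ _) (contfN cn).
  apply: contfD (@contf_cst _ _ _).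
  by apply: (@contf_dist _ _ l) => // s /st [].
have cF : contf (l + l) (fun s : seq R => nrm (rxi w (take l s) (drop l s))).
  by apply/contf_nrm/contm_rxi => // s /st [].
have [|||v [sv bv gv Hv]] := @minimum_on_seqs _ _ (Num.max (M + r) 1) _ g _ (a0 ++ z0) _ cF cg.
- by rewrite size_cat sz0 sa0.
- rewrite /bnd all_cat; apply/andP; split.
    by apply: bnd_le bM; rewrite le_max; apply/orP; left; lra.
  have b1 : bnd 1 z0 by apply: sum_norm_bndl; rewrite nz0.
    by apply: bnd_le b1; rewrite le_max lexx orbT.
- by case=> [[]|]; rewrite /g ?take_size_cat ?drop_size_cat // ?nz0 ?dist_refl; lra.
have [st1 st2] := st v sv.
have dv : dist (take l v) a0 <= r by have := gv None; rewrite /= subr_le0.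
have nv : sum_norm (drop l v) = 1.
  have := gv (Some true); have := gv (Some false) => /=; lra.
set m := nrm (rxi w (take l v) (drop l v)) in Hv.
have m0 : 0 < m.
  rewrite lt_neqAle nrm_ge0 andbT; apply/eqP => /esym /nrm_eq0 H.
  have := rxi_eq0 lw st1 (dist_pos (etrans st1 (esym sa0)) dv ra0) st2 H.
  by rewrite nv => /eqP; rewrite oner_eq0.
exists m^-1; split=> //; first by rewrite invr_ge0 ltW.
move=> a Z sa da HZ; have pa := dist_pos (etrans sa (esym sa0)) da ra0.
have [z sz Ez] := rxi_surj lw sa pa HZ; exists z; split=> //.
set N := sum_norm z; have := sum_norm_ge0 z; rewrite -/N le_eqVlt => /orP [/eqP <-|N0].
  by rewrite mulr_ge0 ?nrm_ge0 // invr_ge0 ltW.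
pose z' := [seq N^-1 * s | s <- z]; have sz' : size z' = l by rewrite size_map.
have nz' : sum_norm z' = 1.
  rewrite /sum_norm big_map; under eq_bigr do rewrite normrM.
  by rewrite -mulr_sumr -/(sum_norm z) -/N gtr0_norm ?invr_gt0 // mulVf ?gt_eqF.
have := Hv (a ++ z'); rewrite take_size_cat ?drop_size_cat // rxiZ // Ez nrmZ.
rewrite gtr0_norm ?invr_gt0 // => H.
rewrite mulrC ler_pdivlMr // mulrC -ler_pdivlMr // [X in _ <= X]mulrC; apply: H.
- by rewrite size_cat sa sz'.
- rewrite /bnd all_cat; apply/andP; split.
    by apply: bnd_le (dist_bnd (etrans sa (esym sa0)) da bM); rewrite le_max lexx.
  have b1 : bnd 1 z' by apply: sum_norm_bndl; rewrite nz'.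
    by apply: bnd_le b1; rewrite le_max lexx orbT.
- by case=> [[]|] /=; rewrite ?take_size_cat ?drop_size_cat // ?nz' ?subrr // subr_le0.
Qed.

End RealStructure.

Section EulerPolygons.
Variables (R : realType) (n : nat) (I : finType) (T : set 'M[R[i]]_n).
Local Notation C := R[i].
Variables (chi : I -> 'M[C]_n -> C) (ph : I -> 'M[C]_2 -> 'M[C]_n) (K : nat).
Variables (e f : I -> 'M[C]_n) (mu : I -> C -> 'M[C]_n) (q : nat).
Hypothesis D : pdata T chi ph K e f mu q.
Variable er : I -> 'M[R]_n.
Local Notation rc := (map_mx (real_complex R)).
Hypothesis he : forall i, e i = rc (er i).
Implicit Types (w u v : seq I) (a b p z : seq R).
Local Notation rx := (rx K er).
Local Notation rw := (rw K er).
Local Notation rxi := (rxi K er).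
Local Notation pos := (all (fun s : R => 0 < s)).

Lemma euler_error (A A' W W' V Xi : 'M[R]_n) (h : R) :
  A' - W' *m V = (A' - (1%:M + h *: Xi) *m A) + ((A - W *m V) + h *: (Xi *m (A - W *m V)))
    - (W' - (1%:M + h *: Xi) *m W) *m V.
Proof.
rewrite !(mulmxDl, mulmxDr, mulmxN, mulNmx, mul1mx, =^~ scalemxAl, =^~ scalemxAr, mulmxA).
move: (W' *m V) (W *m V) (Xi *m A) (Xi *m W *m V) => B1 B2 B3 B4.
apply/matrixP => i j; rewrite !mxE; ring.
Qed.

Lemma euler_rec (h k t : R) :
  k * h ^+ 2 + (1 + h * k) * (h * (t - 1)) = h * ((1 + h * k) * t - 1).
Proof. ring. Qed.

Lemma small_all_nat (m c : R) : 0 <= m -> 0 <= c ->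
  (forall N : nat, (0 < N)%N -> m <= N%:R^-1 * c) -> m = 0.
Proof.
move=> m0 c0 H; apply/eqP; rewrite eq_le m0 andbT leNgt; apply/negP => mp.
have := archi_boundP (divr_ge0 c0 m0); set N := Num.bound _ => HN.
have N0 : (0 < N)%N by rewrite -(ltr_nat R); apply: le_lt_trans HN; rewrite divr_ge0.
have N0' : 0 < N%:R :> R by rewrite ltr0n.
have := H N N0; rewrite mulrC ler_pdivlMr // mulrC -ler_pdivlMr // leNgt.
by rewrite HN.
Qed.

Lemma euler_growth (N : nat) (k : R) : (0 < N)%N -> 0 <= k ->
  (1 + N%:R^-1 * k) ^+ N <= expR k.
Proof.
move=> N0 k0; have N0' : N%:R != 0 :> R by rewrite pnatr_eq0 -lt0n.
apply: (@le_trans _ _ (expR (N%:R^-1 * k) ^+ N)).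
  apply: lerXn2r; rewrite ?nnegrE ?expR_ge0 ?expR_ge1Dx //.
  by rewrite addr_ge0 // mulr_ge0 // invr_ge0 ler0n.
by rewrite -expRM_natl mulrA divff // mul1r.
Qed.

(* A path from rw w a0 of small logarithmic speed is followed by Euler polygons
   in the parameters of w. *)
Lemma stay_positive w a0 W' M : longest_word T ph w -> size a0 = size w -> pos a0 -> 0 <= M ->
  exists2 eta, 0 < eta & forall p z V, size p = size W' -> size z = size W' -> bnd M p ->
    sum_norm z <= eta -> rw W' p *m V = rw w a0 ->
    exists a, [/\ size a = size w, pos a & rw w a = rw W' (shift_params p 1 z) *m V].
Proof.
move=> lw sa0 pa0 M0; have [r [c [r0 c0 ra0 Hsol]]] := rxi_solve D he lw sa0 pa0.
have [[K1 rD] rO] := (pd_K1 D, rxD D he, rx0 D he).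
have [C1 [C10 H1]] := rxi_bound K er W' (M + 1).
(* The speed in the parameters of w is at most c * C1 * eta <= r, so the polygon stays in the ball
   of radius r during unit time. The bound by 1 keeps the parameters of W' below M + 1. *)
pose eta := Num.min 1 (r / (c * C1 + 1)).
have cC : 0 < c * C1 + 1 by rewrite ltr_wpDl // mulr_ge0.
have eta0 : 0 < eta by rewrite lt_min ltr01 divr_gt0.
have eta1 : eta <= 1 by rewrite ge_min lexx.
have etar : c * (C1 * eta) <= r.
  apply: (@le_trans _ _ ((c * C1 + 1) * (r / (c * C1 + 1)))); last first.
    by rewrite mulrC divfK // gt_eqF.
  rewrite [c * (_ * _)]mulrA; apply: ler_pM; rewrite ?mulr_ge0 ?(ltW eta0) ?lerDl //.
  by rewrite ge_min lexx orbT.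
exists eta => // p z V sp sz bp nz EV.
have [M1 M10 b0] := bnd_ex a0.
have [C2 [C20 H2]] := rw_taylor K1 rD rO W' (M + 1).
have [C3 [C30 H3]] := rw_taylor K1 rD rO w (M1 + r).
(* One constant for the amplification of an existing error, through C1, and for the second-order
   errors on both words. *)
pose k := C1 + C3 + C2 * nrm V.
have k0 : 0 <= k by rewrite !addr_ge0 // mulr_ge0 // nrm_ge0.
pose W s := rw W' (shift_params p s z).
(* The polygon with steps 1/N: the velocity z on the side of W' is converted by [rxi_solve] into a
   velocity y for w with the same logarithmic derivative. The error obeys a discrete Gronwall
   inequality. *)
have step N : (0 < N)%N -> forall j, (j <= N)%N -> exists a, [/\ size a = size w,
    dist a a0 <= N%:R^-1 * j%:R * r &
    nrm (rw w a - W (N%:R^-1 * j%:R) *m V) <= N%:R^-1 * ((1 + N%:R^-1 * k) ^+ j - 1)].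
  move=> N0; set h : R := N%:R^-1.
  have h0 : 0 <= h by rewrite invr_ge0 ler0n.
  have h1 : h <= 1 by rewrite invf_le1 ?ler1n ?ltr0n.
  have hN : `|h| <= 1 by rewrite ger0_norm.
  elim=> [_|j IH jN].
    exists a0; split=> //; first by rewrite dist_refl mulr0 mul0r.
    by rewrite /W mulr0 shift0 ?sp // EV subrr nrm0 expr0 subrr mulr0.
  have [a [sa da Ea]] := IH (ltnW jN).
  have hj1 : h * j%:R <= 1 by rewrite mulrC ler_pdivrMr ?ltr0n // mul1r ler_nat ltnW.
  have hj0 : 0 <= h * j%:R by rewrite mulr_ge0 ?ler0n.
  have spz : size p = size z by rewrite sp sz.
  pose pj := shift_params p (h * j%:R) z; pose Xi := rxi W' pj z.
  have spj : size pj = size W' by rewrite size_shift.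
  have bz : bnd 1 z by apply: sum_norm_bndl; apply: le_trans nz eta1.
  have bpj : bnd (M + 1) pj.
    apply/(all_nthP 0) => i; rewrite spj => iW; rewrite nth_shift //.
    apply: le_trans (ler_normD _ _) _; apply: lerD.
      by apply: (all_nthP 0 bp); rewrite sp.
    rewrite normrM ger0_norm // -[leRHS]mulr1; apply: ler_pM => //.
    by apply: (all_nthP 0 bz); rewrite sz.
  have nXi : nrm Xi <= C1 * eta.
    by apply: le_trans (H1 pj z spj sz bpj) _; apply: ler_wpM2l.
  have da1 : dist a a0 <= r by apply: le_trans da _; apply: ler_piMl => //; apply: ltW.
  have [y [sy Ey ny]] := Hsol a Xi sa da1 (rxi_np D he spj sz).
  have nyr : sum_norm y <= r.
    by apply: le_trans ny _; apply: le_trans etar; apply: ler_wpM2l.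
  have say : size a = size y by rewrite sa sy.
  exists (shift_params a h y); split; first by rewrite size_shift.
    apply: le_trans (dist_shift h say (etrans sa (esym sa0))) _.
    rewrite ger0_norm // -natr1 mulrDr mulr1 mulrDl; apply: lerD => //.
    exact: ler_wpM2l.
  have -> : W (h * j.+1%:R) = rw W' (shift_params pj h z).
    by rewrite /pj shiftD // -natr1 mulrDr mulr1.
  have bpz : bnd (M + 1) z by apply: bnd_le bz; rewrite lerDr.
  have T2 := H2 pj z h spj sz bpj bpz hN.
  have ba := dist_bnd (etrans sa (esym sa0)) da1 b0.
  have by' : bnd (M1 + r) y by apply: (@bnd_le _ r); [rewrite lerDr|apply: sum_norm_bndl].
  have T3 := H3 a y h sa sy ba by' hN; rewrite Ey in T3.
  rewrite (euler_error (rw w a) _ (rw W' pj) _ V Xi h).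
  set E := rw w a - rw W' pj *m V; rewrite -/E in Ea.
  have nE : nrm (E + h *: (Xi *m E)) <= (1 + h * k) * nrm E.
    apply: le_trans (nrmD _ _) _; rewrite mulrDl mul1r lerD2l nrmZ ger0_norm // -mulrA.
    apply: ler_wpM2l => //; apply: le_trans (nrmM _ _) _.
    apply: ler_wpM2r; first exact: nrm_ge0.
    apply: le_trans nXi _; apply: le_trans (_ : C1 <= _).
      by rewrite -[leRHS]mulr1; apply: ler_wpM2l.
    by rewrite /k -addrA lerDl addr_ge0 // mulr_ge0 // nrm_ge0.
  apply: le_trans (nrmB _ _) _.
  apply: (@le_trans _ _ (C3 * h ^+ 2 + (1 + h * k) * nrm E + C2 * h ^+ 2 * nrm V)).
    apply: lerD; last by apply: le_trans (nrmM _ _) _; apply: ler_wpM2r => //; apply: nrm_ge0.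
    by apply: nrmDbound.
  have hk : 0 <= h * k by apply: mulr_ge0.
  have H4 : (1 + h * k) * nrm E <= (1 + h * k) * (h * ((1 + h * k) ^+ j - 1)).
    by apply: ler_wpM2l => //; apply: addr_ge0.
  apply: (@le_trans _ _ (k * h ^+ 2 + (1 + h * k) * (h * ((1 + h * k) ^+ j - 1)))).
    rewrite addrAC; apply: lerD => //.
    rewrite mulrAC -mulrDl; apply: ler_wpM2r; first exact: sqr_ge0.
    by rewrite /k -addrA lerDr.
  by rewrite [_ ^+ j.+1]exprS euler_rec.
(* Instead of a limit of polygons, a minimizer of the error over the ball is taken: polygons with N
   steps bound the minimum by a multiple of 1/N, so it is 0. *)
have cF : contf (size w) (fun a => nrm (rw w a - W 1 *m V)).
  apply: contf_nrm; apply: contmD; last exact: contm_cst.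
  by apply: contm_rw => // i; apply: contf_nth.
have cg (j : unit) : contf (size w) (fun a => dist a a0 - r).
  apply: contfD (@contf_cst _ _ _).
  by apply: (@contf_dist _ _ (size w)) => // i; apply: contf_nth.
have [|||a [sa ba /(_ tt) da Ha]] := @minimum_on_seqs _ _ (M1 + r) _ _ _ a0 _ cF cg => //.
- by apply: bnd_le b0; rewrite lerDl ltW.
- by move=> _; rewrite dist_refl sub0r oppr_le0 ltW.
have pa : pos a by apply: dist_pos ra0; rewrite ?sa ?sa0 // -subr_le0.
exists a; split=> //; apply/eqP; rewrite -subr_eq0; apply/eqP/nrm_eq0.
apply: (small_all_nat (nrm_ge0 _) (expR_ge0 k)) => N N0.
have [b [sb db Eb]] := step N N0 N (leqnn N).
have N0' : N%:R != 0 :> R by rewrite pnatr_eq0 -lt0n.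
rewrite mulVf // mul1r in db Eb.
apply: le_trans (Ha b sb (dist_bnd (etrans sb (esym sa0)) db b0) _) _.
  by move=> _; rewrite subr_le0.
apply: le_trans Eb _; apply: ler_wpM2l; first by rewrite invr_ge0 ler0n.
by apply: le_trans (euler_growth N0 k0); rewrite gerBl.
Qed.

End EulerPolygons.

Section WordChange.
Variables (R : realType) (n : nat) (I : finType) (T : set 'M[R[i]]_n).
Local Notation C := R[i].
Variables (chi : I -> 'M[C]_n -> C) (ph : I -> 'M[C]_2 -> 'M[C]_n) (K : nat).
Variables (e f : I -> 'M[C]_n) (mu : I -> C -> 'M[C]_n) (q : nat).
Hypothesis D : pdata T chi ph K e f mu q.
Implicit Types (w u v : seq I) (a b : seq R) (t x y : 'M[C]_n).
Local Notation xw := (xw ph).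
Local Notation pos := (all (fun s : R => 0 < s)).

Variable er : I -> 'M[R]_n.
Local Notation rc := (map_mx (real_complex R)).
Hypothesis he : forall i, e i = rc (er i).
Local Notation rw := (rw K er).

Lemma xw_rw w u a b : size a = size w -> size b = size u ->
  xw w a = xw u b <-> rw w a = rw u b.
Proof. by move=> sa sb; rewrite !(rw_real D he) //; split=> [/rc_inj|->]. Qed.

(* Along the segment from b0 to b, the last parameter that is reached from w is b:
   the condition is closed by compactness and support_full, open by stay_positive. *)
Lemma xw_change w u a b0 b : longest_word T ph w -> longest_word T ph u ->
  size a = size w -> size b0 = size u -> size b = size u -> pos a -> pos b0 -> pos b ->
  xw w a = xw u b0 -> exists a', [/\ size a' = size w, pos a' & xw w a' = xw u b].
Proof.
move=> lw lu sa sb0 sb pa pb0 pb E.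
have pos_ge0 (c : seq R) : pos c -> all (fun s : R => 0 <= s) c.
  by apply: sub_all => s; apply: ltW.
pose d := shift_params b (- 1) b0; pose c s := shift_params b0 s d.
have sd : size d = size u by rewrite size_shift ?sb ?sb0.
have sc s : size (c s) = size u by rewrite size_shift ?sb0 ?sd.
have nc s k : (c s)`_k = b0`_k + s * (b`_k - b0`_k).
  by rewrite nth_shift ?sb0 ?sd // nth_shift ?sb ?sb0 // mulN1r.
have c1 : c 1 = b.
  by apply: (@eq_from_nth _ 0) => [|k _]; rewrite ?sc ?sb // nc mul1r addrC subrK.
have c0 : c 0 = b0 by apply: shift0; rewrite sb0 sd.
have pc s : 0 <= s <= 1 -> pos (c s).
  move=> /andP [s0 s1]; apply/(all_nthP 0) => k; rewrite sc nc => ku.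
  have H1 : 0 < b0`_k by apply: (all_nthP 0 pb0); rewrite sb0.
  have H2 : 0 < b`_k by apply: (all_nthP 0 pb); rewrite sb.
  case: (ltrP s 1) => s1'.
    have : 0 < (1 - s) * b0`_k by rewrite mulr_gt0 // subr_gt0.
    have : 0 <= s * b`_k by rewrite mulr_ge0 // ltW.
    by lra.
  have -> : s = 1 by apply/eqP; rewrite eq_le s1 s1'.
  by rewrite mul1r addrC subrK.
have nd : 0 <= sum_norm d by apply: sum_norm_ge0.
(* By [xw_sum_norm] this also bounds the parameters along w; the added 1 covers the time parameter s
   stored in the same list. *)
pose M := sum_norm b0 + sum_norm d + 1.
have M0 : 0 <= sum_norm b0 by apply: sum_norm_ge0.
have cM s : 0 <= s <= 1 -> sum_norm (c s) <= M.
  move=> /andP [s0 s1]; apply: (@le_trans _ _ (sum_norm b0 + s * sum_norm d)).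
    have := @dist_shift R b0 s d (nseq (size u) 0).
    rewrite sb0 sd size_nseq ger0_norm // => /(_ erefl erefl).
    rewrite /dist; suff H (z : seq R) : size z = size u ->
        shift_params z (-1) (nseq (size u) 0) = z by rewrite !H // sc.
    move=> sz; apply: (@eq_from_nth _ 0) => [|k _]; first by rewrite size_shift ?size_nseq.
    by rewrite nth_shift ?size_nseq // nth_nseq if_same mulr0 addr0.
  have : s * sum_norm d <= sum_norm d by apply: ler_piMl.
  by rewrite /M; lra.
(* Lists s :: a with s <= 1, nonnegative entries and xw w a = xw u (c s). *)
pose g (j : option (option nat)) s := match j with
  | None => nrm (rw w (behead s) - rw u (c s`_0))
  | Some None => s`_0 - 1
  | Some (Some k) => - s`_k end.
have cg j : contf (size w).+1 (g j).
  case: j => [[k|]|] /=.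
  - exact: contfN (@contf_nth _ _ _).
  - exact: contfD (@contf_nth _ _ _) (@contf_cst _ _ _).
  apply: contf_nrm; apply: contmD.
    apply: contm_rw => [s|k]; first by case: s => [|? ?] //= [].
    have H := @contf_nth R (size w).+1 k.+1.
    by refine (contf_ext _ H); move=> s; case: s.
  have H : contm (size w).+1 (fun s : seq R => rw u (c s`_0)).
    apply: contm_rw => [s _|k]; first exact: sc.
    have H := contfD (@contf_cst R (size w).+1 b0`_k)
      (contfM (@contf_nth R (size w).+1 0) (@contf_cst _ _ (b`_k - b0`_k))).
    by refine (contf_ext _ H); move=> s _; rewrite nc.
  have H' := contmZ (@contf_cst _ _ (-1)) H.
  by refine (contm_ext _ H'); move=> s _; rewrite scaleN1r.
have feas s a' : size a' = size w -> pos a' -> 0 <= s <= 1 -> rw w a' = rw u (c s) ->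
    [/\ size (s :: a') = (size w).+1, bnd M (s :: a') & forall j, g j (s :: a') <= 0].
  move=> sa' pa' s01 Ew; have [s0 s1] := andP s01; split.
  - by rewrite /= sa'.
  - apply/andP; split; first by rewrite ger0_norm //; apply: le_trans s1 _; rewrite /M; lra.
    apply: sum_norm_bndl; rewrite /sum_norm (xw_sum_norm D sa' (sc s)) -/(sum_norm _) ?cM //; try exact: pos_ge0.
      by apply/pos_ge0/pc.
    exact/(xw_rw sa' (sc s)).
  case=> [[[|k]|]|] /=; rewrite ?oppr_le0 ?subr_le0 //.
    case: (ltnP k (size a')) => ka; last by rewrite nth_default.
    by apply: ltW; apply: (all_nthP 0 pa').
  by rewrite Ew subrr nrm0.
have Er : rw w a = rw u (c 0) by rewrite c0; apply/xw_rw.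
have [sz0 bz0 gz0] := feas 0 a sa pa (introT andP (conj (lexx 0) ler01)) Er.
have [v [sv bv gv Hv]] :=
  @minimum_on_seqs _ _ M _ g (fun s => - s`_0) _ sz0 (contfN (@contf_nth _ _ _)) cg bz0 gz0.
case: v sv bv gv Hv => [|s a1] //= [sa1] /andP [_ ba1] gv Hv.
have Ew : rw w a1 = rw u (c s).
  apply/eqP; rewrite -subr_eq0; apply/eqP/nrm_eq0/eqP.
  by rewrite eq_le nrm_ge0 andbT; apply: (gv None).
have s0 : 0 <= s by have := gv (Some (Some 0%N)); rewrite /= oppr_le0.
have s1 : s <= 1 by have := gv (Some None); rewrite /= subr_le0.
have s01 : 0 <= s <= 1 by rewrite s0.
have a1ge : all (fun t : R => 0 <= t) a1.
  by apply/(all_nthP 0) => k ka; have := gv (Some (Some k.+1)); rewrite /= oppr_le0.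
have Ex : xw w a1 = xw u (c s) by apply/(xw_rw sa1 (sc s)).
have pa1 := support_full D lw lu sa1 a1ge (sc s) (pc s s01) Ex.
move: s1; rewrite le_eqVlt => /orP [/eqP s1|s1].
  by exists a1; split=> //; rewrite Ex s1 c1.
have M0' : 0 <= M by rewrite /M; lra.
have [eta eta0 Heta] := stay_positive D he u lw sa1 pa1 M0'.
exfalso.
(* A step small enough for [stay_positive] that does not pass time 1; it contradicts the maximality
   of s. *)
pose h := Num.min (1 - s) (eta / (sum_norm d + 1)).
have d1 : 0 < sum_norm d + 1 by rewrite ltr_wpDl.
have h0 : 0 < h by rewrite lt_min subr_gt0 s1 divr_gt0.
have h1 : s + h <= 1.
  have : h <= 1 - s by rewrite ge_min lexx.
  lra.
have sh : size [seq h * r | r <- d] = size u by rewrite size_map.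
have nh : sum_norm [seq h * r | r <- d] <= eta.
  rewrite /sum_norm big_map; under eq_bigr do rewrite normrM gtr0_norm //.
  rewrite -mulr_sumr -/(sum_norm d); apply: (@le_trans _ _ (eta / (sum_norm d + 1) * (sum_norm d + 1))).
    by apply: ler_pM; rewrite ?(ltW h0) ?lerDl // ge_min lexx orbT.
  by rewrite divfK // gt_eqF.
have Ec : shift_params (c s) 1 [seq h * r | r <- d] = c (s + h).
  apply: (@eq_from_nth _ 0) => [|k ku]; first by rewrite size_shift ?sc ?sh.
  rewrite nth_shift ?sc ?sh // !nc mul1r; case: (ltnP k (size u)) => k'.
    rewrite (nth_map 0) ?sd // nth_shift ?sb ?sb0 //; ring.
  by move: ku; rewrite size_shift ?sc ?sh // ltnNge k'.
have [||a2 [sa2 pa2]] := Heta (c s) _ 1%:M (sc s) sh _ nh.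
- by apply: sum_norm_bndl; apply: cM.
- by rewrite mulmx1.
rewrite Ec mulmx1 => E2.
have sh01 : 0 <= s + h <= 1 by rewrite h1 addr_ge0 // ltW.
have [sz2 bz2 gz2] := feas (s + h) a2 sa2 pa2 sh01 E2.
by have := Hv _ sz2 bz2 gz2; rewrite /= lerN2 gerDl leNgt h0.
Qed.

End WordChange.

End Analysis.

(** * The positive part of a positive torus *)

Section TotalPositivity.
Variables (R : realType) (n : nat) (I : finType) (T : set 'M[R[i]]_n).
Local Notation C := R[i].
Variables (chi : I -> 'M[C]_n -> C) (ph : I -> 'M[C]_2 -> 'M[C]_n) (K : nat).
Variables (e f : I -> 'M[C]_n) (mu : I -> C -> 'M[C]_n) (q : nat).
Hypothesis D : pdata T chi ph K e f mu q.
Implicit Types (w u v : seq I) (a b c d : seq R) (g t x y : 'M[C]_n).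
Local Notation xp := (xw ph).
Local Notation yp := (yw ph).
Local Notation Tp := (Tp ph).
Local Notation rchi := (rchi chi).
Local Notation pos := (all (fun s : R => 0 < s)).

Let D' := dual_pdata D.
Local Notation ph' := (fun i (A : 'M[C]_2) => ph i (flip A)).
Local Notation kap := (cm mu predT).
Local Notation kapV := (cm (fun j (z : C) => mu j z^-1) predT).
Local Notation opp := (map (fun s : R => - s)).

Lemma dual_xw w b : size b = size w -> xw ph' w b = yp w (opp b).
Proof.
elim: w b => [|i w IH] [|s b] //= => [_|[sb]]; first by rewrite xw_nil yw_nil.
by rewrite xw_cons yw_cons IH // dual_xx rmorphN.
Qed.

Lemma dual_yw w b : size b = size w -> yw ph' w b = xp w (opp b).
Proof.
elim: w b => [|i w IH] [|s b] //= => [_|[sb]]; first by rewrite xw_nil yw_nil.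
by rewrite xw_cons yw_cons IH // dual_yy rmorphN.
Qed.

Lemma oppK b : opp (opp b) = b.
Proof. by rewrite -map_comp -[RHS]map_id; apply: eq_map => s /=; rewrite opprK. Qed.

Lemma yw_lim_kapV w b : size b = size w -> lim kapV (yp w b) 1%:M.
Proof.
by move=> sb; rewrite -[b]oppK -dual_xw ?size_map //; apply: (xw_lim_kap D'); rewrite size_map.
Qed.

Lemma size_scaled t w a : size a = size w ->
  size [seq (rchi p.1 t)^-1 * p.2 | p <- zip w a] = size w.
Proof. by move=> sa; rewrite size_map size_zip sa minnn. Qed.

Lemma csum_scaled t i w a : size a = size w ->
  csum i w [seq (rchi p.1 t)^-1 * p.2 | p <- zip w a] = (rchi i t)^-1 * csum i w a.
Proof.
elim: w a => [|j w IH] [|s a] //= => [_|[sa]]; first by rewrite /csum big_nil mulr0.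
by rewrite !csum_cons IH // mulrDr; congr (_ + _); case: eqP => [->|_]; rewrite ?mulr0.
Qed.

Lemma csum_cat i w u a b : size a = size w ->
  csum i (w ++ u) (a ++ b) = csum i w a + csum i u b.
Proof. by move=> sa; rewrite /csum zip_cat ?sa // big_cat. Qed.

Lemma conjby_conjby g h A : g \in unitmx -> h \in unitmx ->
  conjby g (conjby h A) = conjby (conjby g h) (conjby g A).
Proof.
move=> Ug Uh; rewrite [conjby h A]/conjby [RHS]/conjby (conjbyV Ug Uh).
by rewrite (conjbyM _ _ Ug) (conjbyM _ _ Ug).
Qed.

Lemma conj_cancel t g : t \in unitmx -> g \in unitmx ->
  invmx t *m g *m t *m (invmx t *m invmx g *m t *m g) = g.
Proof. by move=> Ut Ug; rewrite !mulmxA (mulmxK Ut) (mulmxK Ug) (mulVmx Ut) mul1mx. Qed.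

Lemma torus_expands w a b c d t t' : longest_word T ph w -> size a = size w -> pos a ->
  size b = size w -> size c = size w -> pos c -> size d = size w -> pos d -> T t -> Tp t' ->
  yp w d *m invmx (xp w a) *m t *m xp w a *m invmx (yp w d) = yp w b *m t' *m xp w c ->
  Tp t /\ forall i, 1 < rchi i t.
Proof.
move=> lw sa pa sb sc pc sd pd Tt Tt' E.
have [c' [d' [t'' [[sc' pc'] [sd' _] Tt'' E']]]] := xw_yw_pos D sc pc sd pd.
have [Uh Ud] := (xw_unit D sa, yw_unit D sd).
have Tt1 := Tp_T D Tt'; have Tt2 := Tp_T D Tt''.
have Ut := pd_unit D Tt; have cG := cm_GL D predT.
have cGV := cm_GL D' predT.
have TtV := pd_TV D Tt.
pose d1 := [seq (rchi p.1 t')^-1 * p.2 | p <- zip w d'].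
have sd1 : size d1 = size w by apply: size_scaled.
(* Both sides are put in the form U_- T U_+: on the left h^-1 t h = t (t^-1 h^-1 t h), on the right
   v is moved past g1. *)
have E2 : yp w d *m t *m (invmx t *m invmx (xp w a) *m t *m xp w a) =
    (yp w b *m yp w d1) *m (t' *m t'') *m xp w c'.
  rewrite !mulmxA (mulmxK Ut) (canRL (mulmxKV Ud) E).
  rewrite -(mulmxA (yp w b *m t')) E' !mulmxA; do 2 congr (_ *m _).
  by rewrite -!mulmxA; congr (_ *m _); apply: (t_yw D) => // k; apply: (rchiE D k Tt').
have UhV : invmx (xp w a) \in unitmx by rewrite unitmx_inv.
have UtV : invmx t \in unitmx by rewrite unitmx_inv.
have [_ Ett Ex] : [/\ yp w d = yp w b *m yp w d1, t = t' *m t'' &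
    invmx t *m invmx (xp w a) *m t *m xp w a = xp w c'].
  apply: (triangular_unique D _ _ _ _ Tt (pd_TM D Tt1 Tt2) _ _ _ _ E2).
  - exact: Ud.
  - by rewrite unitmx_mul (yw_unit D sb) (yw_unit D sd1).
  - by rewrite !unitmx_mul UtV UhV Ut Uh.
  - exact: (xw_unit D sc').
  - exact: yw_lim_kapV.
  - by rewrite -[1%:M]mulmx1; apply: (limM cGV); apply: yw_lim_kapV.
  - have L := limM cG (limM cG (limM cG (lim_T D predT TtV) (limV cG (xw_lim_kap D sa) Uh))
      (lim_T D predT Tt)) (xw_lim_kap D sa).
    rewrite invmx1 !mulmx1 (mulVmx Ut) in L; exact: L.
  - exact: (xw_lim_kap D sc').
have Tpt : Tp t by rewrite Ett; apply: TpM.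
split=> // i; have rt := rchi_gt0 D i Tpt.
pose a1 := [seq (rchi p.1 t)^-1 * p.2 | p <- zip w a].
have sa1 : size a1 = size w by apply: size_scaled.
have E3 : xp (w ++ w) (a1 ++ c') = xp w a.
  rewrite xw_cat // -Ex; have := xw_t D Tt (fun k => rchiE D k Tpt) sa; rewrite -/a1 => H.
  rewrite (_ : xp w a1 = invmx t *m xp w a *m t); last by rewrite -mulmxA H mulKmx.
  exact: conj_cancel.
have sac : size (a1 ++ c') = size (w ++ w) by rewrite !size_cat sa1 sc'.
have := csum_eq D i sac sa E3; rewrite csum_cat // csum_scaled //.
have H1 := csum_gt0 sa pa (longest_mem D i lw).
have H2 := csum_gt0 sc' pc' (longest_mem D i lw).
move=> H; rewrite ltNge; apply/negP => rt1.
have : csum i w a <= (rchi i t)^-1 * csum i w a.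
  by apply: ler_peMl; [exact: ltW|rewrite invf_ge1].
lra.
Qed.

(** An element commuting with T has a constant curve along [kap], so it equals its limit. *)
Lemma conj_T_eq1 z : z \in unitmx -> lim kap z 1%:M ->
  (forall t, T t -> conjby z t = t) -> z = 1%:M.
Proof.
move=> Uz Lz H; apply: lim_uniq Lz; exists (cst z) => [c c0|]; rewrite ev_cst //.
have Tc := cm_T D predT c0; have Uc := pd_unit D Tc.
have := H _ Tc; rewrite /conjby => E.
have Ez : z *m cm mu predT c = cm mu predT c *m z by rewrite -{2}E (mulmxKV Uz).
by rewrite /conjby -Ez (mulmxK Uc).
Qed.

Section OppositeCell.
(** In the application V is the inverse of the representative of the reversed longest word; the
    hypotheses say that it exchanges the two signs and normalizes T. *)
Variables (w : seq I) (V : 'M[C]_n).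
Hypotheses (lw : longest_word T ph w) (UV : V \in unitmx).
Hypothesis Ve : forall j, conjby V (e j) \in nsp f.
Hypothesis Vf : forall j, conjby V (f j) \in nsp e.
Hypothesis VT : forall t, T t -> T (conjby V t).

Let cG := cm_GL D predT.
Let cGV := cm_GL D' predT.

Lemma conjV_xw u a : size a = size u -> lim kapV (conjby V (xp u a)) 1%:M.
Proof.
elim: u a => [|i u IH] [|s a] //= => [_|[sa]].
  by rewrite xw_nil /conjby mulmx1 (mulmxV UV); exact: (lim1 cGV).
rewrite xw_cons conjbyM // -[1%:M]mulmx1; apply: (limM cGV); last exact: IH.
rewrite (exp_conj_x D UV (erefl _)) -(exp_0 D s%:C).
by apply: (lim_exp K _ cGV); apply: (nm_lim0 D).
Qed.

Lemma conjV_yw u a : size a = size u -> lim kap (conjby V (yp u a)) 1%:M.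
Proof.
elim: u a => [|i u IH] [|s a] //= => [_|[sa]].
  by rewrite yw_nil /conjby mulmx1 (mulmxV UV); exact: (lim1 cG).
rewrite yw_cons conjbyM // -[1%:M]mulmx1; apply: (limM cG); last exact: IH.
rewrite (exp_conj_y D UV (erefl _)) -(exp_0 D s%:C).
by apply: (lim_exp K _ cG); apply: (np_lim0 D).
Qed.

(* The matrix conjby V (conjby z t) has limits under both kap and its inverse. *)
Lemma opposite_rigid z y s : z \in unitmx -> y \in unitmx -> lim kap z 1%:M ->
  lim kapV (conjby V z) 1%:M -> lim kap (conjby V y) s ->
  (forall t, T t -> pol kap (conjby (V *m (y *m z)) t)) -> z = 1%:M.
Proof.
move=> Uz Uy Lz LV Ly H; apply: conj_T_eq1 => // t Tt.
have UVz : conjby V z \in unitmx by apply: conjby_unit.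
have UVy : conjby V y \in unitmx by apply: conjby_unit.
have Uyz : y *m z \in unitmx by rewrite unitmx_mul Uy.
have L1 : lim kapV (conjby V (conjby z t)) (conjby V t).
  have L := limM cGV (limM cGV LV (lim_T D' predT (VT Tt))) (limV cGV LV UVz).
  by rewrite invmx1 mulmx1 mul1mx in L; rewrite (conjby_conjby _ UV Uz).
have L2 : pol kap (conjby V (conjby z t)).
  have [B HB] := pol_lim (H t Tt).
  have L := limM cG (limM cG (limV cG Ly UVy) HB) Ly.
  suff E : conjby V (conjby z t) =
      invmx (conjby V y) *m conjby (V *m (y *m z)) t *m conjby V y by rewrite E; apply: lim_pol L.
  rewrite (conjby_comp _ UV Uyz) (conjby_comp _ Uy Uz) (conjbyV UV Uy).
  rewrite -!(conjbyM _ _ UV); congr (conjby V _).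
  by rewrite -[LHS](conjbyK _ Uy) [LHS]/conjby invmxK.
have LL : pol (fun r : C => kapV r^-1) (conjby V (conjby z t)).
  have [Q HQ] := L2; exists Q => c c0; rewrite -HQ //; congr (conjby _ _).
  by rewrite /cm; apply: eq_bigr => j _; rewrite invrK.
have [E _] := lim_fixed cGV L1 LL.
by rewrite -(conjbyK (conjby z t) UV) E (conjbyK _ UV).
Qed.

(** The quotient z of the two products has limit 1 along [kap], and its conjugate by V has limit 1
    along the inverse, so [opposite_rigid] applies. *)
Lemma positive_part_unique u u' a b y s : size a = size u -> size b = size u' ->
  y \in unitmx -> lim kap (conjby V y) s ->
  (forall t', T t' -> pol kap (conjby (V *m (y *m (xp u a *m invmx (xp u' b)))) t')) ->
  xp u a = xp u' b.
Proof.
move=> sa sb Uy L3; have [Ux Ux'] := (xw_unit D sa, xw_unit D sb).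
have L1 := limM cG (xw_lim_kap D sa) (limV cG (xw_lim_kap D sb) Ux').
rewrite invmx1 mulmx1 in L1.
have Uc : conjby V (xp u' b) \in unitmx by apply: conjby_unit.
have L2 := limM cGV (conjV_xw sa) (limV cGV (conjV_xw sb) Uc).
rewrite invmx1 mulmx1 (conjbyV UV Ux') -(conjbyM _ _ UV) in L2.
move: L1 L2; move: (xp u a) (xp u' b) Ux Ux' => x x' Ux Ux' L1 L2.
have Uz : x *m invmx x' \in unitmx by rewrite unitmx_mul Ux unitmx_inv.
move=> /(opposite_rigid Uz Uy L1 L2 L3) E.
by rewrite -[LHS](mulmxKV Ux') E mul1mx.
Qed.

End OppositeCell.

Lemma dual_wd u : wd ph' u = wd ph u.
Proof. by elim: u => [|i u IH]; rewrite ?wd_nil // !wd_cons IH dual_ss. Qed.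

Lemma dual_longest w : longest_word T ph w -> longest_word T ph' w.
Proof.
have Hm u : minimal_word T ph' u <-> minimal_word T ph u.
  by split=> H v; have := H v; rewrite /same_class !dual_wd.
by move=> [mw lw]; split; [apply/Hm|move=> v /Hm; apply: lw].
Qed.

Variables (er fr : I -> 'M[R]_n).
Local Notation rc := (map_mx (real_complex R)).
Hypotheses (he : forall i, e i = rc (er i)) (hf : forall i, f i = rc (fr i)).

Lemma invmx_cell x t g h : x \in unitmx -> t \in unitmx -> g \in unitmx -> h \in unitmx ->
  invmx (invmx x *m t *m g *m h) = invmx h *m (invmx g *m (invmx t *m x)).
Proof.
move=> Ux Ut Ug Uh; have Ux' : invmx x \in unitmx by rewrite unitmx_inv.
have Uxt : invmx x *m t \in unitmx by rewrite unitmx_mul Ux'.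
have Uxtg : invmx x *m t *m g \in unitmx by rewrite unitmx_mul Uxt.
by rewrite (invmxM Uxtg Uh) (invmxM Uxt Ug) (invmxM Ux' Ut) invmxK.
Qed.

Lemma pol_conjV g h t : g \in unitmx -> h \in unitmx -> pol kap g ->
  pol kap (conjby (invmx g *m h) t) -> pol kap (conjby h t).
Proof.
move=> Ug Uh /pol_lim [Lg HLg] /pol_lim [L HL]; have cG := cm_GL D predT.
have H := limM cG (limM cG HLg HL) (limV cG HLg Ug).
have UgV : invmx g \in unitmx by rewrite unitmx_inv.
rewrite -(conjbyVK (conjby h t) Ug) -(conjby_comp _ UgV Uh); exact: lim_pol H.
Qed.

Lemma mulmx_unit g h : g \in unitmx -> h \in unitmx -> g *m h \in unitmx.
Proof. by move=> Ug Uh; rewrite unitmx_mul Ug. Qed.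

Lemma regroup_cell (m0 V0 t0 t x y y' z g h : 'M[C]_n) : g = m0 *m (V0 *m (t0 *m x)) ->
  x *m y = y' *m t *m z ->
  g *m y *m h = m0 *m (V0 *m (t0 *m (y' *m t) *m (z *m h))).
Proof. by move=> -> E; rewrite -!mulmxA (mulmxA x y h) E -!mulmxA. Qed.

Lemma opposite_position w a b d : longest_word T ph w -> size a = size w -> pos a ->
  size b = size w -> pos b -> size d = size w -> pos d ->
  (forall t, T t -> pol kap (conjby (yp w b *m yp w d *m invmx (xp w a)) t)) ->
  exists a' d' t', [/\ size a' = size w /\ pos a', size d' = size w /\ pos d', Tp t' &
    xp w a' *m yp w d = yp w d' *m t' *m xp w a].
Proof.
move=> lw sa pa sb pb sd pd HB; have lr := longest_rev D lw.
have lr' := dual_longest lr.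
have pos_rev (c : seq R) : pos c -> pos (rev c) by rewrite all_rev.
have srb : size (rev b) = size (rev w) by rewrite !size_rev.
(* The inverse of yp w b is, for the dual data, a positive product along the reversed word; its dual
   Bruhat form involves elements of U_+ and a factor m with limits along [kap]. *)
have [v [b' [t0 [u [m [E [sb' pb'] Tt0 [Um pm] [_ Hu]]]]]]] := bruhat D' srb (pos_rev b pb).
have [Ev Eu] := Hu lr'.1; rewrite Ev Eu revK in E sb'; clear v u Ev Eu Hu.
have {}Tt0 := Tp_T D' Tt0; have Ut0 := pd_unit D Tt0.
have cG := cm_GL D predT.
have {}pm : pol kap m.
  have [Q HQ] := pm; exists Q => c c0; rewrite -(HQ c c0); congr (conjby _ _).
  by rewrite /cm; apply: eq_bigr => j _; rewrite invrK.
have Erb : xw ph' (rev w) (rev b) = invmx (yp w b).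
  by rewrite dual_xw // (yw_inv D sb) map_rev.
rewrite {}Erb (dual_yw sb') dual_wd in E.
set b1 := rev b'; have sb1 : size b1 = size (rev w) by rewrite !size_rev.
have Eb1 : xp w (opp b') = invmx (xp (rev w) b1) by rewrite (xw_inv D sb1) revK -map_rev revK.
rewrite {}Eb1 in E.
have [Ub Ub1] := (yw_unit D sb, xw_unit D sb1); have UW := wd_unit D (rev w).
have {}E : yp w b = invmx m *m (invmx (wd ph (rev w)) *m (invmx t0 *m xp (rev w) b1)).
  rewrite -[LHS]invmxK E.
  exact: invmx_cell.
have [c [d' [t' [[sc pc] [sd' pd'] Tt' E']]]] := xw_yw_pos D sb1 (pos_rev b' pb') sd pd.
have Uh := xw_unit D sa; have Ud' := yw_unit D sd'; have Ut' := pd_unit D (Tp_T D Tt').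
set V := invmx (wd ph (rev w)) in E.
have UV : V \in unitmx by rewrite unitmx_inv.
have Ve j : conjby V (e j) \in nsp f by apply: (longest_negative D).
have Vf j : conjby V (f j) \in nsp e.
  have := longest_negative D' j lr'; rewrite dual_wd nsp_opp -/V -scaleN1r conjbyZ scaleN1r.
  by rewrite memvN.
have VT t : T t -> T (conjby V t) by apply: (T_wdV D).
set y := invmx t0 *m (yp w d' *m t').
have Uy : y \in unitmx by rewrite !unitmx_mul unitmx_inv Ut0 Ud'.
have Ly : lim kap (conjby V y) (conjby V (invmx t0) *m (1%:M *m conjby V t')).
  rewrite (conjbyM _ _ UV) (conjbyM _ _ UV); apply: (limM cG).
    exact: (lim_T D predT (VT _ (pd_TV D Tt0))).
  by apply: (limM cG); [exact: (conjV_yw UV Vf)|exact: (lim_T D predT (VT _ (Tp_T D Tt')))].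
have Ecg : xp (rev w) c = xp w a.
  apply: (positive_part_unique UV Ve VT sc sa Uy Ly) => t Tt.
  have Uxc := xw_unit D sc.
  have UhV : invmx (xp w a) \in unitmx by rewrite unitmx_inv.
  have Uz := mulmx_unit Uxc UhV.
  have UG : V *m (y *m (xp (rev w) c *m invmx (xp w a))) \in unitmx.
    exact: (mulmx_unit UV (mulmx_unit Uy Uz)).
  apply: (pol_conjV Um UG pm); rewrite /y -(regroup_cell _ E E'); exact: HB.
(* The element xp w a is now positive along both words. Along this common point every positive
   product for the reversed word becomes one for w. *)
have [a' [sa' pa' Ea']] := xw_change D he lw lr sa sc sb1 pa pc (pos_rev b' pb') (esym Ecg).
by exists a', d', t'; rewrite Ea' E' Ecg.
Qed.

End TotalPositivity.

(** * Stability under factors close to 1 and under large torus elements *)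

Section NearbyProducts.
Variables (R : realType) (n : nat) (I : finType) (T : set 'M[R[i]]_n).
Local Notation C := R[i].
Variables (chi : I -> 'M[C]_n -> C) (ph : I -> 'M[C]_2 -> 'M[C]_n) (K : nat).
Variables (e f : I -> 'M[C]_n) (mu : I -> C -> 'M[C]_n) (q : nat).
Hypothesis D : pdata T chi ph K e f mu q.
Implicit Types (w u v : seq I) (a b c d z : seq R) (g t x y : 'M[C]_n).
Local Notation xp := (xw ph).
Local Notation yp := (yw ph).
Local Notation Tp := (Tp ph).
Local Notation rchi := (rchi chi).
Local Notation pos := (all (fun s : R => 0 < s)).
Local Notation opp := (map (fun s : R => - s)).
Let D' := dual_pdata D.
Local Notation ph' := (fun i (A : 'M[C]_2) => ph i (flip A)).
Local Notation rc := (map_mx (real_complex R)).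

(** [stay_positive] for the path in which the parameters of u run from 0 to -z, starting at the
    given positive product. Negative parameters are allowed on this side. *)
Lemma near_right w u a (er : I -> 'M[R]_n) : (forall i, e i = rc (er i)) ->
  longest_word T ph w -> size a = size w -> pos a ->
  exists2 eps, 0 < eps & forall z, size z = size u -> bounded_params eps z ->
  exists a', [/\ size a' = size w, pos a' & xp u (opp z) *m xp w a = xp w a'].
Proof.
move=> he lw sa pa.
have [eta eta0 H] := stay_positive D he u lw sa pa (lexx 0).
have u1 : 0 < (size u)%:R + 1 :> R by rewrite ltr_wpDl.
exists (eta / ((size u)%:R + 1)) => [|z sz bz]; first by rewrite divr_gt0.
have sz0 : size (opp z) = size u by rewrite size_map.
have b0 : bnd 0 (nseq (size u) (0 : R)) by rewrite /bnd all_nseq normr0 lexx orbT.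
have nz : sum_norm (opp z) <= eta.
  have bo : bnd (eta / ((size u)%:R + 1)) (opp z).
    rewrite /bnd all_map; apply: sub_all bz => s /andP [s0 sM] /=.
    by rewrite normrN gtr0_norm.
  apply: le_trans (sum_norm_bnd bo) _; rewrite sz0 mulrA ler_pdivrMr // mulrC.
  by rewrite ler_wpM2l ?(ltW eta0) // lerDl.
have [] := H (nseq (size u) 0) (opp z) (rw K er w a) (size_nseq _ _) sz0 b0 nz _.
  have -> : rw K er u (nseq (size u) 0) = 1%:M; last by rewrite mul1mx.
  elim: (u) => //= i v IH; rewrite IH mulmx1; exact: (rx0 D he).
move=> a' [sa' pa' E]; exists a'; split=> //.
rewrite (_ : shift_params _ _ _ = opp z) in E; last first.
  apply: (@eq_from_nth _ 0) => [|k _]; first by rewrite size_shift size_nseq.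
  by rewrite nth_shift ?size_nseq // nth_nseq if_same add0r mul1r.
by rewrite (rw_real D he sz0) (rw_real D he sa) (rw_real D he sa') -map_mxM E.
Qed.

End NearbyProducts.

Section TorusContraction.
Variables (R : realType) (n : nat) (I : finType) (T : set 'M[R[i]]_n).
Local Notation C := R[i].
Variables (chi : I -> 'M[C]_n -> C) (ph : I -> 'M[C]_2 -> 'M[C]_n) (K : nat).
Variables (e f : I -> 'M[C]_n) (mu : I -> C -> 'M[C]_n) (q : nat).
Hypothesis D : pdata T chi ph K e f mu q.
Implicit Types (w u v : seq I) (a b c d z : seq R) (g t x y : 'M[C]_n).
Local Notation xp := (xw ph).
Local Notation yp := (yw ph).
Local Notation Tp := (Tp ph).
Local Notation rchi := (rchi chi).
Local Notation pos := (all (fun s : R => 0 < s)).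
Local Notation opp := (map (fun s : R => - s)).
Let D' := dual_pdata D.
Local Notation ph' := (fun i (A : 'M[C]_2) => ph i (flip A)).
Local Notation rc := (map_mx (real_complex R)).

(** The dual of [near_right], transported by inversion, which reverses words and exchanges left and
    right. *)
Lemma near_left w u d (fr : I -> 'M[R]_n) : (forall i, f i = rc (fr i)) ->
  longest_word T ph w -> size d = size w -> pos d ->
  exists2 eps, 0 < eps & forall z, size z = size u -> bounded_params eps z ->
  exists d', [/\ size d' = size w, pos d' & yp w d *m yp u (opp z) = yp w d'].
Proof.
move=> hf lw sd pd; have lr := longest_rev D lw.
have hf' i : - f i = rc (- fr i) by rewrite hf map_mxN.
have sr : size (rev d) = size (rev w) by rewrite !size_rev.
have pr : pos (rev d) by rewrite all_rev.
have [eps eps0 H] := near_right D' (rev u) hf' (dual_longest lr) sr pr.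
exists eps => // z sz bz.
have szr : size (rev z) = size (rev u) by rewrite !size_rev.
have [|a' [sa' pa' E]] := H (rev z) szr; first by rewrite /bounded_params all_rev.
have srr (c : seq R) v : size c = size v -> size (rev c) = size (rev v) by rewrite !size_rev.
have dual_inv v c : size c = size v -> xw ph' (rev v) (rev c) = invmx (yp v c).
  by move=> sc; rewrite (dual_xw _ (srr _ _ sc)) (yw_inv D sc) -map_rev.
have szo : size (opp z) = size u by rewrite size_map.
have sa2 : size (rev a') = size w by rewrite size_rev sa' size_rev.
exists (rev a'); split=> //; first by rewrite all_rev.
have [Ud Uz Ua] := And3 (yw_unit D sd) (yw_unit D szo) (yw_unit D sa2).
apply: (can_inj (@invmxK _ _)); rewrite (invmxM Ud Uz) -!dual_inv //.
by rewrite revK -E map_rev.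
Qed.

Lemma bounded_scaled t w b (r M : R) : (forall i, r <= rchi i t) -> 0 < r -> 0 < M ->
  bounded_params M b -> bounded_params (M / r) [seq (rchi p.1 t)^-1 * p.2 | p <- zip w b].
Proof.
move=> Hr r0 M0; elim: w b => [|i w IH] [|s b] //= /andP [/andP [s0 sM] bM].
have ri := lt_le_trans r0 (Hr i).
rewrite IH // andbT mulr_gt0 ?invr_gt0 //= mulrC; apply: ler_pM => //.
- exact: ltW.
- by rewrite invr_ge0 ltW.
- by rewrite lef_pV2.
Qed.

Lemma scaled_opp t w b : [seq (rchi p.1 t)^-1 * p.2 | p <- zip w (opp b)] =
  opp [seq (rchi p.1 t)^-1 * p.2 | p <- zip w b].
Proof. by elim: w b => [|i w IH] [|s b] //=; rewrite mulrN IH. Qed.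

(** All simple roots take the value -1 on the regular cocharacter at a q-th root of -1. Conjugation
    by this element transfers [xw_yw] to products with negative parameters. *)
Lemma sign_torus : exists2 t, T t & forall u c, size c = size u ->
  conjby t (xp u c) = xp u (opp c) /\ conjby t (yp u c) = yp u (opp c).
Proof.
pose s : C := q.-root (-1); have sq : s ^+ q = -1 by rewrite rootCK // (pd_q D).
have s0 : s != 0.
  apply/eqP => E; move: sq; rewrite E expr0n (q_neq0 D) => /esym/eqP.
  by rewrite oppr_eq0 oner_eq0.
have Tt := cm_T D predT s0; have Ut := pd_unit D Tt; exists (cm mu predT s) => // u c.
elim: u c => [|i u IH] [|r c] //= => [_|[/IH [IH1 IH2]]].
  by rewrite xw_nil yw_nil /conjby mulmx1 (mulmxV Ut).
rewrite !xw_cons !yw_cons (conjbyM _ _ Ut) (conjbyM _ _ Ut) IH1 IH2.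
rewrite (conj_x D i _ Tt) (conj_y D i _ Tt) (chi_cm D predT i s0) sq invrN1 !mulN1r.
by rewrite rmorphN.
Qed.

Lemma regroup_conj (g1 h t t' y v s x1 x2 y1 tau : 'M[C]_n) : g1 \in unitmx -> t' \in unitmx ->
  y \in unitmx -> v *m g1 = y *m t' *m h -> tau = t *m invmx t' ->
  invmx h *m tau = tau *m x1 -> x1 *m invmx y = y1 *m s *m x2 ->
  g1 *m invmx h *m t *m h *m invmx g1 = g1 *m (tau *m y1) *m s *m (x2 *m v).
Proof.
move=> Ug Ut Uy E Et E1 E2.
have Eh : h *m invmx g1 = invmx t' *m (invmx y *m v).
  have : v = y *m (t' *m (h *m invmx g1)) by rewrite -[v](mulmxK Ug) E !mulmxA.
  by move=> ->; rewrite (mulKmx Uy) (mulKmx Ut).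
rewrite -(mulmxA _ h) Eh.
have -> : g1 *m invmx h *m t *m (invmx t' *m (invmx y *m v)) =
    g1 *m (invmx h *m tau) *m (invmx y *m v) by rewrite Et !mulmxA.
rewrite E1; have -> : g1 *m (tau *m x1) *m (invmx y *m v) = g1 *m tau *m (x1 *m invmx y) *m v.
  by rewrite !mulmxA.
by rewrite E2 !mulmxA.
Qed.

Lemma torus_positive w a b d (er fr : I -> 'M[R]_n) : (forall i, e i = rc (er i)) ->
  (forall i, f i = rc (fr i)) -> longest_word T ph w -> size a = size w -> pos a ->
  size b = size w -> pos b -> size d = size w -> pos d ->
  (forall t, T t -> pol (cm mu predT) (conjby (yp w b *m yp w d *m invmx (xp w a)) t)) ->
  exists2 p : R, 0 < p & forall t, Tp t -> (forall i, p < rchi i t) ->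
  exists d2 t2 c2, [/\ size d2 = size w /\ pos d2, Tp t2, size c2 = size w /\ pos c2 &
    yp w d *m invmx (xp w a) *m t *m xp w a *m invmx (yp w d) = yp w d2 *m t2 *m xp w c2].
Proof.
move=> he hf lw sa pa sb pb sd pd HB.
have [a' [d' [t' [[sa' pa'] [sd' pd'] Tt' E]]]] := opposite_position D he lw sa pa sb pb sd pd HB.
have [eps1 eps10 H1] := near_right D (rev w) he lw sa' pa'.
have [eps2 eps20 H2] := near_left (rev w) hf lw sd pd.
have [sr srd] : size (rev a) = size (rev w) /\ size (rev d') = size (rev w) by rewrite !size_rev.
have [prd pra] : pos (rev d') /\ pos (rev a) by rewrite !all_rev.
have [M1 M11 bM1] := bounded_params_ex prd; have [M2 M21 bM2] := bounded_params_ex pra.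
(* A common bound for the parameters of d' and a and for the simple roots on t'. *)
pose M := M1 + M2 + \sum_i rchi i t'.
have S0 : 0 <= \sum_i rchi i t' by apply: sumr_ge0 => i _; apply/ltW/(rchi_gt0 D).
have MM : 1 <= M /\ (M1 <= M /\ M2 <= M) by rewrite /M; lra.
have [M_1 [M1M M2M]] := MM; have M0 : 0 < M by apply: lt_le_trans M_1.
have Mt i : rchi i t' <= M.
  apply: (@le_trans _ _ (\sum_i rchi i t')); last by rewrite /M; lra.
  by rewrite (bigD1 i) //= lerDl; apply: sumr_ge0 => j _; apply/ltW/(rchi_gt0 D).
have [M' M'1 Hm] := xw_yw D (rev w) (rev w) M_1; have M'0 : 0 < M' by apply: lt_le_trans M'1.
(* On tau the simple roots are at least r = p / M, so conjugation makes the parameters of h at most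
   M^2 / p. The three summands ensure that this is at most M, that M' times it is at most eps1, and
   that M' / r is at most eps2. *)
pose p := M * M * (1 + M' / eps1 + M' / eps2).
have e1 : 0 < M' / eps1 by rewrite divr_gt0.
have e2 : 0 < M' / eps2 by rewrite divr_gt0.
have p0 : 0 < p by rewrite !mulr_gt0 //; lra.
exists p => // t Tt Ht; pose tau := t *m invmx t'; pose r := p / M.
have r0 : 0 < r by rewrite divr_gt0.
have TtV := TpV D Tt'; have Ttau : Tp tau by apply: TpM.
have Hr i : r <= rchi i tau.
  have ri := rchi_gt0 D i Tt'; have riV := rchi_gt0 D i TtV.
  have Ut' := pd_unit D (Tp_T D Tt').
  have E1 : rchi i t' * rchi i (invmx t') = 1.
    rewrite -(rchiM D i Tt' TtV) (mulmxV Ut') /rchi.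
    have -> : chi i 1%:M = 1 by apply: (pd_chi1 D).
    by [].
  rewrite (rchiM D i Tt TtV) (_ : rchi i (invmx t') = (rchi i t')^-1).
    apply: ler_pM; [exact: ltW|by rewrite invr_ge0 ltW|exact/ltW/Ht|by rewrite lef_pV2].
  by apply: (mulfI (lt0r_neq0 ri)); rewrite E1 mulfV // lt0r_neq0.
pose al := [seq (rchi p.1 tau)^-1 * p.2 | p <- zip (rev w) (rev a)].
have sal : size al = size (rev w) by rewrite size_map size_zip sr minnn.
have bal : bounded_params (M / r) al.
  by apply: bounded_scaled => //; apply: bounded_params_le bM2.
have Er : M / r = M * M / p by rewrite /r invf_div mulrA.
have dM : M / r <= M.
  rewrite ler_pdivrMr // /r -{1}[M]mulr1 ler_wpM2l ?(ltW M0) // ler_pdivlMr // mul1r.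
  rewrite /p -mulrA -{1}[M]mulr1 ler_wpM2l ?(ltW M0) //.
  by rewrite mulr_ege1 //; lra.
have bM1' : bounded_params M (rev d') := bounded_params_le M1M bM1.
have [al' [be' [s [[sal' bal'] [sbe' bbe'] [Ts _] Es]]]] := Hm _ al (rev d') dM sal bal srd bM1'.
have pe : p * eps1 >= M' * (M * M) /\ p * eps2 >= M' * (M * M).
  have MM0 : 0 < M * M by rewrite mulr_gt0.
  split; rewrite -ler_pdivrMr // mulrAC [leLHS]mulrC; apply: ler_wpM2l; rewrite ?(ltW MM0) //.
    by rewrite -addrA addrCA lerDl addr_ge0 // ltW.
  by rewrite lerDr addr_ge0 // ltW.
have b1 : bounded_params eps1 al'.
  apply: bounded_params_le bal'; rewrite Er mulrA ler_pdivrMr // mulrC [leRHS]mulrC.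
  by rewrite mulrC; case: pe.
have [c2 [sc2 pc2 Ec2]] := H1 al' sal' b1.
pose ga := [seq (rchi p.1 tau)^-1 * p.2 | p <- zip (rev w) be'].
have sga : size ga = size (rev w) by rewrite size_map size_zip sbe' minnn.
have b2 : bounded_params eps2 ga.
  apply: (@bounded_params_le _ (M' / r)); last exact: bounded_scaled.
  rewrite /r invf_div mulrA ler_pdivrMr // [leRHS]mulrC; apply: le_trans pe.2.
  by rewrite ler_wpM2l ?(ltW M'0) // -{1}[M]mulr1 ler_wpM2l ?(ltW M0).
have [d2 [sd2 pd2 Ed2]] := H2 ga sga b2.
exists d2, (tau *m s), c2; split=> //; first exact: TpM.
(* The factors to be exchanged are inverses of positive products, with negative parameters;
   conjugation by [sg] reduces them to [Es]. *)
have [sg Tsg Hsg] := sign_torus; have Usg := pd_unit D Tsg.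
have Ut' := pd_unit D (Tp_T D Tt').
have soal : size (opp (rev a)) = size (rev w) by rewrite size_map.
have E1 : invmx (xp w a) *m tau = tau *m xp (rev w) (opp al).
  rewrite (xw_inv D sa) -map_rev.
  rewrite (xw_t D (Tp_T D Ttau) (fun k => rchiE D k Ttau) soal).
  by rewrite scaled_opp.
have E2 : xp (rev w) (opp al) *m invmx (yp w d') =
    yp (rev w) (opp be') *m s *m xp (rev w) (opp al').
  rewrite (yw_inv D sd') -map_rev.
  rewrite -(Hsg _ _ sal).1 -(Hsg _ _ srd).2 -(Hsg _ _ sal').1 -(Hsg _ _ sbe').2.
  rewrite -(conjbyM _ _ Usg) Es (conjbyM _ _ Usg) (conjbyM _ _ Usg).
  by rewrite (pd_conjT D Tsg (Tp_T D Ts)).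
have sobe : size (opp be') = size (rev w) by rewrite size_map.
rewrite (regroup_conj (yw_unit D sd) Ut' (yw_unit D sd') E (erefl tau) E1 E2) Ec2.
have := t_yw D (Tp_T D Ttau) (fun k => rchiE D k Ttau) sobe; rewrite scaled_opp -/ga => ->.
by rewrite mulmxA Ed2 !mulmxA.
Qed.

End TorusContraction.

(** * The data of a pinning *)

Section RealPoints.
Variable R : realType.
Local Notation C := R[i].

Lemma realpts_conj (z : C) : realpts z <-> Num.conj z = z.
Proof.
split=> [[r _ <-]|]; first apply/CrealP.
  by rewrite realE -(rmorph0 (real_complex R)) !lecR le_total.
by move=> /CrealP zr; exists (complex.Re z) => //; rewrite RRe_real.
Qed.

Lemma conj_mxeval n (p : {mpoly C[n * n]}) (A : 'M[C]_n) : coeffs_in (@realpts R) p ->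
  Num.conj (mxeval p A) = mxeval p (map_mx Num.conj A).
Proof.
move=> pr; rewrite /mxeval !mevalE rmorph_sum; apply: eq_bigr => m _.
rewrite rmorphM rmorph_prod; congr (_ * _); first exact/realpts_conj.
apply: eq_bigr => k _; rewrite rmorphXn; congr (_ ^+ _).
by case/mxvec_indexP: k => i j; rewrite !mxvecE mxE.
Qed.

Lemma conj_real_mx n (A : 'M[C]_n) : map_mx Num.conj A = A ->
  A = map_mx (real_complex R) (map_mx (@complex.Re R) A).
Proof.
move=> E; apply/matrixP => i j; rewrite !mxE RRe_real //; apply/CrealP.
by rewrite -{2}E mxE.
Qed.

(** The exponentials of N and of its complex conjugate agree at all integers, hence as polynomials,
    and the coefficient of order 1 is N. *)
Lemma exp_real n K (N : 'M[C]_n) : (1 < K)%N ->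
  (forall k : nat, map_mx Num.conj (ev (expq K N) k%:R) = ev (expq K N) k%:R) ->
  N = map_mx (real_complex R) (map_mx (@complex.Re R) N).
Proof.
move=> K1 H; apply: conj_real_mx.
have E : expq K (map_mx Num.conj N) = expq K N.
  apply: ev_inj_nat => k; rewrite -H !ev_expq raddf_sum; apply: eq_bigr => j _ /=.
  rewrite !map_mxZ rmorphXn fmorphV !rmorph_nat; congr (_ *: (_ *: _)).
  elim: {j}(j : nat) => [|j IH]; first by rewrite !expr0 map_mx1.
  by rewrite !exprS -!mulmxE map_mxM IH.
by have := congr1 (cf 1) E; rewrite !cf1_expq.
Qed.

End RealPoints.

Lemma laur_diag2 (R : realType) a b : laur (fun c : R[i] => diag2 c a b).
Proof.
apply: (@laur_eq _ (fun c : R[i] => mx2 c 0 0 c^-1 a b)) => [c _|]; first by rewrite diag2E.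
apply: (@laur_eq _ (fun c : R[i] => if a == 0 then if b == 0 then c else 0 else
  if b == 0 then 0 else c^-1)) => [c _|]; first by rewrite mxE.
case: (a == 0); case: (b == 0); try exact: laur_cst.
  by apply: (laur_eq _ (laur_expz R 1)) => c _; rewrite expr1z.
by apply: (laur_eq _ (laur_expz R (-1))) => c _.
Qed.

Lemma conj_upper_nat (R : realType) k : map_mx Num.conj (upper k%:R : 'M[R[i]]_2) = upper k%:R.
Proof.
rewrite upperE; apply/matrixP => a b; rewrite !mxE.
by case: (a == 0); case: (b == 0); rewrite ?rmorph0 ?rmorph1 ?rmorph_nat.
Qed.

Lemma conj_lower_nat (R : realType) k : map_mx Num.conj (lower k%:R : 'M[R[i]]_2) = lower k%:R.
Proof.
rewrite lowerE; apply/matrixP => a b; rewrite !mxE.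
by case: (a == 0); case: (b == 0); rewrite ?rmorph0 ?rmorph1 ?rmorph_nat.
Qed.

Section PinningData.
Variables (R : realType) (n : nat) (G : set 'M[R[i]]_n) (I : finType) (P : pinning G I).
Local Notation C := R[i].
Hypothesis G_alg : alg_group (@realpts R) G.
Local Notation T := (T0 P).
Local Notation ph := (phi P).

Let Gcl : zclosed setT G. Proof. by case: G_alg => /zclosed_setT. Qed.
Let sG : subgroup G. Proof. by case: G_alg. Qed.
Let GGL : G `<=` @GL R n. Proof. by case: sG. Qed.
Let TB : T `<=` Bplus P. Proof. by rewrite -(Bplus_Bminus P) => A []. Qed.
Let spl : split_torus setT T. Proof. by case: (T0_max P). Qed.
Let TG : T `<=` G. Proof. by case: (T0_max P). Qed.

Lemma phi1 i : ph i 1%:M = 1%:M.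
Proof.
have [H1 H2 _] := phi_morphism P i; have G1 := H1 _ (SL2_1 R).
have := H2 _ _ (SL2_1 R) (SL2_1 R); rewrite mulmx1 => E.
by have := congr1 (mulmx (invmx (ph i 1%:M))) E; rewrite (mulKmx (GGL G1)) (mulVmx (GGL G1)).
Qed.

Lemma phiM i A B : SL2 A -> SL2 B -> ph i (A *m B) = ph i A *m ph i B.
Proof. by have [_ H _] := phi_morphism P i; apply: H. Qed.

Lemma phi_conj i A : SL2 A -> map_mx Num.conj A = A -> map_mx Num.conj (ph i A) = ph i A.
Proof.
move=> SA EA; have [_ _ H] := phi_morphism P i; apply/matrixP => k l; rewrite mxE.
have [p [N [pr /(_ A SA) ->]]] := H k l.
by rewrite SA expr1n divr1 conj_mxeval // EA.
Qed.

(** The parameter a is free: conjugation by t with alpha_i(t) = a carries the image of this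
    factorization for 1 to that for a. Therefore t commutes with the coroot ([conj_coroot]), before
    it is known that the coroot lies in T_0. *)
Lemma diag2_six (a c : C) : a != 0 -> c != 0 ->
  diag2 c = (upper (a * c) *m lower (- (a * c)^-1) *m upper (a * c)) *m
    (upper (- a) *m lower a^-1 *m upper (- a)).
Proof.
move=> a0 c0; rewrite diag2E !lowerE !upperE !mx2M; congr mx2; field; by rewrite a0 c0.
Qed.

Lemma phi_six i (a b c d a' b' : C) :
  ph i ((upper a *m lower b *m upper c) *m (upper d *m lower a' *m upper b')) =
  (ph i (upper a) *m ph i (lower b) *m ph i (upper c)) *m
    (ph i (upper d) *m ph i (lower a') *m ph i (upper b')).
Proof.
have [SU SL] := (@SL2_upper R, @SL2_lower R).
have H (x y z : C) : ph i (upper x *m lower y *m upper z) =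
    ph i (upper x) *m ph i (lower y) *m ph i (upper z).
  etransitivity; first exact: (phiM i (SL2M (SU x) (SL y)) (SU z)).
  by congr (_ *m _); exact: (phiM i (SU x) (SL y)).
etransitivity; first exact: (phiM i (SL2M (SL2M (SU a) (SL b)) (SU c)) (SL2M (SL2M (SU d) (SL a')) (SU b'))).
by rewrite !H.
Qed.

Lemma conj_six (t X Y A1 A2 A3 A4 A5 A6 B1 B2 B3 B4 B5 B6 : 'M[C]_n) : t \in unitmx ->
  X = A1 *m A2 *m A3 *m (A4 *m A5 *m A6) -> Y = B1 *m B2 *m B3 *m (B4 *m B5 *m B6) ->
  conjby t A1 = B1 -> conjby t A2 = B2 -> conjby t A3 = B3 ->
  conjby t A4 = B4 -> conjby t A5 = B5 -> conjby t A6 = B6 -> conjby t X = Y.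
Proof. by move=> Ut -> -> <- <- <- <- <- <-; do 5 rewrite (conjbyM _ _ Ut). Qed.

Lemma conj_coroot i t c : T t -> alpha P i t != 0 -> c != 0 ->
  conjby t (ph i (diag2 c)) = ph i (diag2 c).
Proof.
move=> Tt a0 c0; have [Ut1 Hx] : t \in unitmx /\ forall d, conjby t (ph i (upper d)) = ph i (upper (alpha P i t * d)).
  by split=> [|d]; [exact/GGL/TG|have [_ _ _] := phi_upper P i; apply].
have Hy d : conjby t (ph i (lower d)) = ph i (lower ((alpha P i t)^-1 * d)).
  by have [_ _ _] := phi_lower P i; apply.
have E1 := diag2_six (oner_neq0 _) c0; have E2 := diag2_six a0 c0.
have P1 := etrans (congr1 (ph i) E1) (phi_six i _ _ _ _ _ _).
have P2 := etrans (congr1 (ph i) E2) (phi_six i _ _ _ _ _ _).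
apply: (conj_six Ut1 P1 P2).
- by rewrite Hx mul1r.
- by rewrite Hy mul1r mulrN invfM.
- by rewrite Hx mul1r.
- by rewrite Hx mulrN1.
- by rewrite Hy invr1 mulr1.
- by rewrite Hx mulrN1.
Qed.

Lemma pinning_pdata : exists K e f mu q, [/\ pdata T (alpha P) ph K e f mu q,
  exists er, forall i, e i = map_mx (real_complex R) (er i) &
  exists fr, forall i, f i = map_mx (real_complex R) (fr i)].
Proof.
have [d [ep cT]] := split_torus_coords spl; have [sT Tcomm _ _] := cT.
have [rt ind dec] := alpha_simple P.
have char i : character T (alpha P i) by have [] := rt i.
have [q [q0 [mu Hmu]]] := fundamental_cochars cT char ind.
have cmu j : cochar T (mu j) by have [] := Hmu j.
have amu j i c : c != 0 -> alpha P i (mu j c) = c ^+ (if i == j then q else 0).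
  by have [_ H] := Hmu j; apply: H.
have HE i : exists p : nat * 'M[C]_n, [/\ p.2 ^+ p.1 = 0, p.2 != 0,
    forall c, ph i (upper c) = ev (expq p.1 p.2) c
    & forall t, T t -> conjby t p.2 = alpha P i t *: p.2].
  by have [K [e He]] := root_param_expq sG (Bplus_borel P) TB (phi_upper P i); exists (K, e).
have [E {}HE] := boolp.choice HE.
have HF i : exists p : nat * 'M[C]_n, [/\ p.2 ^+ p.1 = 0, p.2 != 0,
    forall c, ph i (lower c) = ev (expq p.1 p.2) c
    & forall t, T t -> conjby t p.2 = (alpha P i t)^-1 *: p.2].
  by have [K [e He]] := root_param_expq sG (Bplus_borel P) TB (phi_lower P i); exists (K, e).
have [F {}HF] := boolp.choice HF.
(* One exponent for all e_i and f_i, and at least 2 so that e_i is the coefficient of order 1 of its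
   exponential. *)
pose K := (2 + \sum_i ((E i).1 + (F i).1))%N.
have K1 : (1 < K)%N by [].
have KE i : ((E i).1 <= K)%N by rewrite /K (bigD1 i) //=; lia.
have KF i : ((F i).1 <= K)%N by rewrite /K (bigD1 i) //=; lia.
pose e i := (E i).2; pose f i := (F i).2.
have eK i : e i ^+ K = 0.
  by have [H _ _ _] := HE i; rewrite -(subnK (KE i)) exprD H mulr0.
have fK i : f i ^+ K = 0.
  by have [H _ _ _] := HF i; rewrite -(subnK (KF i)) exprD H mulr0.
have phe i c : ph i (upper c) = ev (expq K (e i)) c.
  by have [H _ -> _] := HE i; rewrite (expq_le H (KE i)).
have phf i c : ph i (lower c) = ev (expq K (f i)) c.
  by have [H _ -> _] := HF i; rewrite (expq_le H (KF i)).
have Te i t : T t -> conjby t (e i) = alpha P i t *: e i by have [_ _ _] := HE i; apply.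
have Tf i t : T t -> conjby t (f i) = (alpha P i t)^-1 *: f i by have [_ _ _] := HF i; apply.
have phG i A : SL2 A -> G (ph i A) by have [H _ _] := phi_morphism P i; apply: H.
have a0 i t : T t -> alpha P i t != 0.
  have [H _ _] := char i => /H; rewrite /GL /= unitmxE det_scalar1 unitfE.
  by [].
have laur_co i : forall k l, laur (fun c => ph i (diag2 c) k l).
  move=> k l; have [_ _ H] := phi_morphism P i; have [p [N [_ Hp]]] := H k l.
  apply: (@laur_eq _ (fun c => mxeval p (diag2 c))).
    move=> c c0; have S : \det (diag2 c) = 1 := SL2_diag2 c0.
    by rewrite (Hp _ S) S expr1n divr1.
  by apply: laur_mxeval => a b; apply: laur_diag2.
have cco i : cochar G (fun c => ph i (diag2 c)).
  split=> [c c0|c d' c0 d0|k l]; last exact: laur_co.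
    by apply/phG/SL2_diag2.
  by rewrite -diag2M; apply: phiM; apply: SL2_diag2.
have cor i c : c != 0 -> T (ph i (diag2 c)).
  apply: (cochar_in_max_torus sG (T0_max P) (cco i)) => {}c t c0 Tt.
  have := conj_coroot Tt (a0 i t Tt) c0; rewrite /conjby => H.
  by rewrite -{1}H mulmxKV //; exact/GGL/TG.
have er_real i : e i = map_mx (real_complex R) (map_mx (@complex.Re R) (e i)).
  apply: (exp_real K1) => k; rewrite -phe; apply: phi_conj; first exact: SL2_upper.
  exact: conj_upper_nat.
have fr_real i : f i = map_mx (real_complex R) (map_mx (@complex.Re R) (f i)).
  apply: (exp_real K1) => k; rewrite -phf; apply: phi_conj; first exact: SL2_lower.
  exact: conj_lower_nat.
exists K, e, f, mu, q; split; last 2 first.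
- by exists (fun i => map_mx (@complex.Re R) (e i)).
- by exists (fun i => map_mx (@complex.Re R) (f i)).
split=> //.
- by move=> i t t' Tt Tt'; have [_ H _] := char i; have := H t t' Tt Tt';
    rewrite -scalar_mxM => /matrixP /(_ 0 0); rewrite !mxE eqxx !mulr1n.
- by move=> i; have [] := HE i.
- by move=> i; have [] := HF i.
- exact: phi1.
- exact: phiM.
- move=> i j ij; apply: (simple_root_commute Gcl sG (Bplus_borel P) TB spl (alpha_simple P) q0 cmu amu ij (eK i) (fK j) K1).
  + by move=> c; rewrite -phe; apply/phG/SL2_upper.
  + by move=> c; rewrite -phf; apply/phG/SL2_lower.
  + exact: Te.
  + exact: Tf.
- move=> i j; have TGL : T `<=` @GL R n by move=> t /TG /GGL.
  apply: (cochar_char TGL _ (char j)); split; first exact: cor.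
    by have [_ H _] := cco i.
  exact: laur_co.
- by move=> i j c; apply: amu.
Qed.

End PinningData.

Section Pinned.
Variables (R : realType) (n : nat) (G : set 'M[R[i]]_n) (I : finType) (P : pinning G I).
Local Notation C := R[i].
Local Notation ph := (phi P).
Implicit Types (w u : seq I).

Lemma weyl_rep_wd u : weyl_rep P u = wd ph u.
Proof. by rewrite wd.unlock; apply: eq_bigr => i _; rewrite ss.unlock. Qed.

Lemma reduced_longest_word w : reduced_longest P w -> longest_word (T0 P) ph w.
Proof.
have H u v : same_weyl P u v <-> same_class (T0 P) ph u v.
  by rewrite /same_weyl !weyl_rep_wd.
have Hr u : reduced P u <-> minimal_word (T0 P) ph u.
  by split=> red v /H; apply: red.
by move=> [/Hr rw lw]; split=> // v /Hr; apply: lw.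
Qed.

Lemma Uplus_posP w x : Uplus_pos P w x <-> exists a : seq R,
  [/\ size a = size w, all (fun s => 0 < s) a & x = xw ph w a].
Proof.
have E a : xw ph w a = \big[mulmx/1%:M]_(p <- zip w a) xroot P p.1 (p.2)%:C.
  by rewrite xw.unlock; apply: eq_bigr => p _; rewrite xx.unlock.
by split=> -[a [sa pa ->]]; exists a; split=> //; rewrite E.
Qed.

Lemma Uminus_posP w x : Uminus_pos P w x <-> exists a : seq R,
  [/\ size a = size w, all (fun s => 0 < s) a & x = yw ph w a].
Proof.
have E a : yw ph w a = \big[mulmx/1%:M]_(p <- zip w a) yroot P p.1 (p.2)%:C.
  by rewrite yw.unlock; apply: eq_bigr => p _; rewrite yy.unlock.
by split=> -[a [sa pa ->]]; exists a; split=> //; rewrite E.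
Qed.

Lemma T0_pos_Tp : T0_pos P = Tp ph.
Proof. by rewrite /T0_pos /Tp cc.unlock. Qed.

End Pinned.

Theorem theorem7p1 (R : realType) (n : nat) (G : set 'M[R[i]]_n)
    (I : finType) (P : pinning G I)
    (G_alg : alg_group (@realpts R) G)
    (G_ss : semisimple G)
    (G_sc : simply_connected P)
    (w : seq I) (w_longest : reduced_longest P w)
    (T : set 'M[R[i]]_n) (T_pos : Torus_pos P w T)
    (g g1 g2 : 'M[R[i]]_n)
    (Gg : G g)
    (T_conj : T = conjset g (T0 P))
    (gBplus : Borel_pos P w (conjset g (Bplus P)))
    (gBminus : Borel_neg P w (conjset g (Bminus P)))
    (g_fact : g = g1 *m g2)
    (g1_pos : Uminus_pos P w g1)
    (g2_neg : Uplus_neg P w g2) :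
  (T `&` G_pos P w `<=` conjset g (T0_pos_gt P 1)) /\
  (exists p : R, 0 < p /\ conjset g (T0_pos_gt P p) `<=` T `&` G_pos P w).
Proof.
have [K [e [f [mu [q [D [er he] [fr hf]]]]]]] := pinning_pdata P G_alg.
have lw := reduced_longest_word w_longest.
have [d [sd pd Ed]] := (Uminus_posP P w g1).1 g1_pos.
have [h Ph Eh] := g2_neg; have [a [sa pa Ea]] := (Uplus_posP P w h).1 Ph.
have [Ud Ua] := (yw_unit D sd, xw_unit D sa).
have UaV : invmx (xw (phi P) w a) \in unitmx by rewrite unitmx_inv.
have {}g_fact : g = yw (phi P) w d *m invmx (xw (phi P) w a) by rewrite g_fact Ed -Eh Ea.
have conj_g t : conjby g t = yw (phi P) w d *m invmx (xw (phi P) w a) *m t *m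
    xw (phi P) w a *m invmx (yw (phi P) w d).
  by rewrite g_fact /conjby (invmxM Ud UaV) invmxK !mulmxA.
have rchiP t : Tp (phi P) t -> forall i, alpha P i t = (rchi (alpha P) i t)%:C.
  move=> Tt i; exact: (rchiE D i Tt).
rewrite T_conj; split.
  move=> _ [[t Tt <-] [u [t' [v [Uu Tt' Uv]]]]]; rewrite conj_g => E; exists t => //.
  have [b [sb pb Eb]] := (Uminus_posP P w u).1 Uu.
  have [c [sc pc Ec]] := (Uplus_posP P w v).1 Uv.
  rewrite Eb Ec in E; rewrite T0_pos_Tp in Tt'.
  have [Tpt Ht] := torus_expands D lw sa pa sb sc pc sd pd Tt Tt' E.
  by split=> [|i]; rewrite ?T0_pos_Tp // (rchiP t Tpt) ltcR.
have [_ [u Uu <-] Bu] := gBminus; have [b [sb pb Eb]] := (Uminus_posP P w u).1 Uu.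
have TB t : T0 P t -> Bplus P t /\ Bminus P t by rewrite -Bplus_Bminus => -[].
have Ub := yw_unit D sb; have UbV : invmx (yw (phi P) w b) \in unitmx by rewrite unitmx_inv.
have Ug : g \in unitmx by rewrite g_fact; exact: (mulmx_unit Ud UaV).
(* From g.B_- = u^-1.B_+, the torus u g T_0 g^-1 u^-1 lies in B_+, whose elements have limits along
   dominant cocharacters. This is the form in which the hypothesis on g.B_- is used. *)
have HB t : T0 P t -> pol (cm mu predT)
    (conjby (yw (phi P) w b *m yw (phi P) w d *m invmx (xw (phi P) w a)) t).
  move=> Tt; have : conjset g (Bminus P) (conjby g t) by exists t => //; case: (TB t Tt).
  rewrite -Bu Eb => -[A BA EA]; rewrite -mulmxA -g_fact (conjby_comp _ Ub Ug) -EA.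
  rewrite (conjbyVK _ Ub).
  have [spl _ _] := T0_max P.
  have TBp : T0 P `<=` Bplus P by move=> t' /TB [].
  have dom : dominant (T0 P) (alpha P) (cm mu predT).
    by split; [exact: (cm_cochar D)|exists (fun=> q) => i c c0; rewrite (chi_cm D predT i c0)].
  exact: (borel_pol (Bplus_borel P) TBp spl (alpha_simple P) dom BA).
have [p p0 Hp] := torus_positive D he hf lw sa pa sb pb sd pd HB.
exists p; split=> // _ [t [Tt Ht] <-]; rewrite T0_pos_Tp in Tt.
split; first by exists t => //; apply: Tp_T D t Tt.
have [|d2 [t2 [c2 [[sd2 pd2] Tt2 [sc2 pc2] E]]]] := Hp t Tt.
  by move=> i; have := Ht i; rewrite (rchiP t Tt) ltcR.
exists (yw (phi P) w d2), t2, (xw (phi P) w c2); split.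
- by apply/Uminus_posP; exists d2.
- by rewrite T0_pos_Tp.
- by apply/Uplus_posP; exists c2.
by rewrite conj_g E.
Qed.
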